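(* Fix $\theta>0$. For each $n$ it is possible to construct a random vector $C^{(n)}=(c^{(n)}_1,c^{(n)}_2,\ldots)$ distributed as the cycle counts of an ESF$(\theta)$ permutation of $[n]$, together with a standard Brownian motion $W$, on the same probability space, in such a way that \[\mathbb{E}\left\{\sup_{0\le t\le 1}\left|W_n(t)-W(t^3)\right|\right\}=O\!\left(\frac{\log\log n}{\sqrt{\log n}}\right),\] where \[W_n(t)=\frac{\log\mathsf{invol}_{\lfloor n^t\rfloor}(C^{(n)})-\frac{\theta t^2}{2}\log^2 n}{\sqrt{\frac{\theta}{3}\log^3 n}}.\]
   Context: For a sequence $a=(a_1,a_2,\ldots)$ of nonnegative integers and $m\ge1$, define $\mathsf{B}_m(a)=\prod_{k=1}^m k^{a_k}$ and \[\mathsf{invol}_m(a)=\mathsf{B}_m(a)\prod_{k=1}^m\sum_{j=0}^{\lfloor a_k/2\rfloor}\frac{(a_k)_{2j}}{(2k)^j j!},\] where $(x)_r=x(x-1)\cdots(x-r+1)$. ESF$(\theta)$ is the Ewens measure on $\mathfrak{S}_n$, $\mathbb{P}(\sigma=\sigma_0)=\theta^{K(\sigma_0)}/\theta^{(n)}$ with $K$ the number of cycles and $\theta^{(n)}=\theta(\theta+1)\cdots(\theta+n-1)$; its cycle counts are $c_k$ = number of cycles of length $k$ (with $c_k=0$ for $k>n$). *)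

(* Defs.v *)
From HB Require Import structures.
From mathcomp Require Import all_boot all_order all_algebra all_fingroup.
From mathcomp Require Import all_classical all_reals all_analysis.
From mathcomp Require Import measurable_realfun.
Set Implicit Arguments. Unset Strict Implicit. Unset Printing Implicit Defensive.
Import Order.TTheory GRing.Theory Num.Theory.
Import numFieldNormedType.Exports.
Local Open Scope classical_set_scope.
Local Open Scope ring_scope.

Definition ncycles (n : nat) (s : 'S_n) : nat := #|porbits s|.

(* cycle counts: c_k(s) = number of cycles of length k (so c_0 = 0 and
   c_k = 0 for k > n) *)
Definition cycle_counts (n : nat) (s : 'S_n) : nat -> nat :=
  fun k => #|[set X in porbits s | #|X| == k]|.

Definition rising (R : nzRingType) (x : R) (n : nat) : R :=
  \prod_(i < n) (x + i%:R).

Definition esf (R : fieldType) (theta : R) (n : nat) (s : 'S_n) : R :=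
  theta ^+ ncycles s / rising theta n.

Definition ESF_cycle_counts_law d (T : measurableType d) (R : realType)
  (P : probability T R) (theta : R) (n : nat) (C : T -> nat -> nat) : Prop :=
  forall a : nat -> nat,
    measurable [set w | C w = a] /\
    P [set w | C w = a] = (\sum_(s : 'S_n | `[< cycle_counts s = a >]) esf theta s)%:E.

(* W is a standard Brownian motion on [0,oo) under P: W_0 = 0, continuous
   paths, and for every 0 = t_0 < t_1 < ... < t_k the increments
   W(t_{i+1}) - W(t_i) are independent N(0, t_{i+1} - t_i)
   (normal_prob m s has mean m and standard deviation s). *)
Definition standard_BM d (T : measurableType d) (R : realType)
  (P : probability T R) (W : R -> T -> R) : Prop :=
  [/\ (forall t, 0 <= t -> measurable_fun setT (W t)),
      (forall w, W 0 w = 0),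
      (forall w, {within `[0, +oo[, continuous (fun t => W t w)}) &
      (forall (k : nat) (ts : nat -> R), ts 0%N = 0 ->
         (forall i, (i < k)%N -> ts i < ts i.+1) ->
         forall B : nat -> set R, (forall i, measurable (B i)) ->
         P (\bigcap_(i in [set i | (i < k)%N])
              [set w | B i (W (ts i.+1) w - W (ts i) w)])
         = (\prod_(i < k) normal_prob 0 (Num.sqrt (ts i.+1 - ts i)) (B i))%E)].

Definition Bm (R : nzRingType) (m : nat) (a : nat -> nat) : R :=
  \prod_(1 <= k < m.+1) (k%:R ^+ a k).

Definition invol (R : fieldType) (m : nat) (a : nat -> nat) : R :=
  Bm R m a * \prod_(1 <= k < m.+1)
      \sum_(j < (a k)./2.+1)
         ((a k) ^_ (2 * j))%:R / (((2 * k)%:R) ^+ j * (j`!)%:R).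

Definition Wn (R : realType) (theta : R) (n : nat) (c : nat -> nat) (t : R) : R :=
  (ln (invol R (Num.truncn (n%:R `^ t)) c) - theta * t ^+ 2 / 2 * (ln n%:R) ^+ 2)
  / Num.sqrt (theta / 3 * (ln n%:R) ^+ 3).

Definition sup_dev (R : realType) (theta : R) (n : nat) (c : nat -> nat)
  (Wpath : R -> R) : \bar R :=
  ereal_sup [set (`|Wn theta n c t - Wpath (t ^+ 3)|)%:E | t in `[0, 1]].

(* Main.v *)
(* In the Feller coupling the cycles are closed by independent events of probability
   theta / (theta + j), and up to an error of expectation O(log n log log n) the logarithm
   of invol_m is the sum of log j over the events with j <= m. On the scale of the total
   rate, about theta log n, these events are the marks of a Poisson process, which is cut
   into N = 2^m cells of mean mu, a constant multiple of log log n.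
   The cell counts are the first N leaves of a dyadic tree with N^2 leaves: the total number
   of points is a quantile of a normal variable and each node is split by a symmetric
   binomial coupled, again by quantiles, with a normal variable (a weak form of Tusnady's
   lemma). Then the partial sums of the N counts differ from Gaussian sums by O(mu) in
   expectation; using only N of the N^2 leaves makes the error at the root negligible.
   With the normalized increments of W along (l / N)^3 as leaf normals, summation by parts
   gives W(t^3) on the grid, and the modulus of continuity of Levy's construction of W
   handles the times in between. *)
Require Import Defs.
From HB Require Import structures.
From mathcomp Require Import all_boot all_order all_algebra all_fingroup.
From mathcomp Require Import all_classical all_reals all_analysis.
From mathcomp Require Import measurable_realfun.
From mathcomp Require Import ring lra zify.
Set Implicit Arguments. Unset Strict Implicit. Unset Printing Implicit Defensive.
Import Order.TTheory GRing.Theory Num.Theory.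
Import numFieldNormedType.Exports.
Local Open Scope classical_set_scope.
Local Open Scope ring_scope.

(** * Densities, image measures and the standard normal law *)

(** Two demands fix the size of the cells. Partial sums of counts of mean mu are matched within
    O(mu), and summation by parts turns this into O(mu log n) for the weighted sum; division by (log
    n)^(3/2) leaves room for a mean of order log log n and no more. Conversely, the splittings leave
    their controlled range with probability about N^2 exp (- mu / (4 * 2400^2)), which has to beat
    powers of N, so mu must be a large multiple of log log n. Since no node of the tree has a mean
    below mu, a quantile estimate with error O(1 + z^2) and generous constants is enough. The total
    number of points is drawn from a normal that is independent of the tree, so at the root the
    mismatch has order N sqrt mu. It spreads linearly over the N^2 leaves, and the first N of them
    carry at most the fraction 1 / N of it, that is sqrt mu. The probability space is [0, 1) with
    Lebesgue measure: binary digits give independent uniforms, these give normals, these give W, and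
    W is the only source of randomness for the counts. *)

Section density.
Local Open Scope ereal_scope.
Context d (T : measurableType d) (R : realType) (mu : {measure set T -> \bar R}).
Variables (g : T -> R) (g0 : forall x, (0 <= g x)%R) (mg : measurable_fun setT g).

(** The two anonymous arguments are proofs that [g] is nonnegative and measurable; carrying them
    lets the measure structure of this set function be found by inference. *)
Definition dens (_ : forall x, (0 <= g x)%R) (_ : measurable_fun setT g) : set T -> \bar R :=
  fun A => \int[mu]_(x in A) (g x)%:E.

Local Notation nu := (dens g0 mg).

Let dens0 : nu set0 = 0. Proof. by rewrite /dens integral_set0. Qed.
Let dens_ge0 A : 0 <= nu A. Proof. by apply: integral_ge0 => x _; rewrite lee_fin. Qed.
Let dens_sigma_additive : semi_sigma_additive nu.
Proof.
move=> /= A mA tA mUA; rewrite /dens ge0_integral_bigcup//.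
- apply: is_cvg_ereal_nneg_natsum_cond => n _ _.
  by apply: integral_ge0 => x _; rewrite lee_fin g0.
- by apply: measurable_funTS; exact/measurable_EFinP.
- by move=> x _; rewrite lee_fin.
Qed.

HB.instance Definition _ := isMeasure.Build _ _ _ nu dens0 dens_ge0 dens_sigma_additive.

Import HBNNSimple.

Lemma integral_dens (f : T -> \bar R) : (forall x, 0 <= f x) -> measurable_fun setT f ->
  \int[nu]_x f x = \int[mu]_x (f x * (g x)%:E).
Proof.
move=> f0 mf.
have mgE : measurable_fun setT (EFin \o g) by exact/measurable_EFinP.
pose f_ := nnsfun_approx measurableT mf.
have f_f x : (f_ n x)%:E @[n --> \oo] --> f x.
  by apply: (@cvg_nnsfun_approx _ _ _ _ measurableT f mf).
have mf_ n : measurable_fun setT (fun x => (f_ n x)%:E).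
  by apply/measurable_EFinP; exact: measurable_funP.
transitivity (limn (fun n => \int[nu]_x (f_ n x)%:E)).
  rewrite -monotone_convergence//.
  - by apply: eq_integral => x _; apply/esym/cvg_lim.
  - by move=> n x _; rewrite lee_fin.
  - by move=> x _ m n mn; rewrite lee_fin; exact/lefP/nd_nnsfun_approx.
transitivity (limn (fun n => \int[mu]_x ((f_ n x)%:E * (g x)%:E))); last first.
  rewrite -monotone_convergence//.
  - apply: eq_integral => x _; apply/cvg_lim => //.
    by apply: cvgeZr.
  - by move=> n; apply: emeasurable_funM.
  - by move=> n x _; rewrite mule_ge0// lee_fin.
  - by move=> x _ m n mn; apply: lee_wpmul2r; rewrite lee_fin//; exact/lefP/nd_nnsfun_approx.
congr (limn _); apply/funext => n.
transitivity (\sum_(k \in range (f_ n)) \int[nu]_x (k * \1_(f_ n @^-1` [set k]) x)%:E).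
  rewrite -ge0_integral_fsum//.
  - by apply: eq_integral => x _; rewrite [in LHS]fimfunE -fsumEFin.
  - by move=> y; exact/measurable_EFinP/measurable_funM.
  - by move=> y x _; rewrite nnfun_muleindic_ge0.
transitivity (\sum_(k \in range (f_ n)) \int[mu]_x ((k * \1_(f_ n @^-1` [set k]) x)%:E * (g x)%:E)); last first.
  rewrite -ge0_integral_fsum//.
  - apply: eq_integral => x _; rewrite -ge0_mule_fsuml; last first.
      by move=> y; rewrite nnfun_muleindic_ge0.
    by rewrite [in RHS]fimfunE -fsumEFin.
  - by move=> y; apply: emeasurable_funM => //; exact/measurable_EFinP/measurable_funM.
  - by move=> y x _; apply: mule_ge0; [rewrite nnfun_muleindic_ge0|rewrite lee_fin].
apply: eq_fsbigr => k _.
rewrite integralZl_indic_nnsfun// integral_indic// setIT.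
have [k0|k0] := leP 0%R k.
  under [RHS]eq_integral do rewrite EFinM -muleA.
  rewrite ge0_integralZl//; last 2 first.
  - by apply: emeasurable_funM => //; exact/measurable_EFinP.
  - by move=> x _; rewrite mule_ge0// lee_fin.
  congr (_ * _); rewrite /= /dens [LHS]integral_mkcond; apply: eq_integral => x _.
  by rewrite epatch_indic muleC.
rewrite preimage_nnfun0// measure0 mule0.
by under eq_integral do rewrite indic0 mulr0 mul0e; rewrite integral0.
Qed.

End density.

Section push.
Local Open Scope ereal_scope.
Context d d' (T : measurableType d) (S : measurableType d') (R : realType).
Variables (mu : {measure set T -> \bar R}) (h : T -> S) (mh : measurable_fun setT h).

(* [pushforward] with the measurability proof as an explicit argument, so that
   the measure structure can be inferred. *)
Definition push : {measure set S -> \bar R} :=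
  @measure_function_pushforward__canonical__measure_function_Measure _ _ T S R mu h mh.

Lemma pushE A : push A = mu (h @^-1` A). Proof. by []. Qed.

Lemma integral_push (f : S -> \bar R) : measurable_fun setT f -> (forall x, 0 <= f x) ->
  \int[push]_x f x = \int[mu]_x f (h x).
Proof. by move=> mf f0; rewrite ge0_integral_pushforward. Qed.

End push.

Section affine_lebesgue.
Local Open Scope ereal_scope.
Context {R : realType}.
Local Notation mu := (@lebesgue_measure R).
Implicit Types (c e : R) (f : R -> \bar R).

(** Uniqueness of Lebesgue measure: the rescaled image measure gives every half-open interval its
    length. *)
Lemma lebesgue_measure_affine c e (c0 : (0 < c)%R) (A : set R) : measurable A ->
  mu A = c%:E * mu ((fun x => c * x + e)%R @^-1` A).
Proof.
move=> mA.
pose h : measurableTypeR R -> measurableTypeR R := fun x => (c * x + e)%R.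
have mh : measurable_fun setT h by apply: measurable_funD => //; apply: measurable_funM.
pose k : {nonneg R} := NngNum (ltW c0).
have := @lebesgue_measure_unique R (mscale k (pushforward mu h)) _ A mA.
rewrite /= /mscale /= /pushforward => -> //.
move=> _ [[a b]] _ <-.
have -> : h @^-1` `]a, b]%classic = `]((a - e) / c)%R, ((b - e) / c)%R]%classic.
  apply/seteqP; split => x /=; rewrite /h !in_itv /= ltr_pdivrMr// ler_pdivlMr//;
  by rewrite ltrBlDr lerBrDr mulrC.
rewrite !lebesgue_measure_itv /= !lte_fin ltr_pM2r ?invr_gt0// ltrD2r.
case: ifPn => // ab; last by rewrite mule0.
rewrite -!EFinB -EFinM; congr (_%:E); field; lra.
Qed.

(** For negative [c] the substitution is composed with the reflection, which preserves Lebesgue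
    measure. *)
Lemma integral_affine c e f : c != 0%R -> (forall x, 0 <= f x) ->
  measurable_fun setT (f : measurableTypeR R -> _) ->
  \int[mu]_x f x = `|c|%:E * \int[mu]_x f (c * x + e)%R.
Proof.
move=> c0 f0 mf.
have pos c' e' (f' : R -> \bar R) : (0 < c')%R -> (forall x, 0 <= f' x) ->
    measurable_fun setT (f' : measurableTypeR R -> _) ->
    \int[mu]_x f' x = c'%:E * \int[mu]_x f' (c' * x + e')%R.
  move=> cp f'0 mf'.
  pose h : measurableTypeR R -> measurableTypeR R := fun x => (c' * x + e')%R.
  have mh : measurable_fun setT h by apply: measurable_funD => //; apply: measurable_funM.
  pose k : {nonneg R} := NngNum (ltW cp).
  transitivity (\int[mscale k (push mu mh)]_x f' x).
    apply: eq_measure_integral => A mA _.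
    by rewrite /= /mscale /=  /= (lebesgue_measure_affine e' cp).
  by rewrite ge0_integral_mscale// integral_push.
have [cp|cn] := ltP 0%R c; first by rewrite gtr0_norm// (pos c e f).
have cn' : (0 < - c)%R by rewrite oppr_gt0 lt_neqAle c0.
have mN : measurable_fun setT (-%R : measurableTypeR R -> measurableTypeR R) by apply: measurable_funN.
rewrite ler0_norm//.
transitivity (\int[mu]_x f (- x)%R).
  transitivity (\int[push mu mN]_x f x).
    by apply: eq_measure_integral => A mA _; exact/esym/lebesgue_measureN.
  by rewrite integral_push.
rewrite (pos (- c)%R (- e)%R)//.
  by congr (_ * _); apply: eq_integral => x _; congr f; lra.
exact: measurableT_comp.
Qed.

End affine_lebesgue.

Section standard_normal.
Context {R : realType}.
Local Notation mu := (@lebesgue_measure R).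

Definition N01 : probability (measurableTypeR R) R := normal_prob 0 1.

Definition phi (x : R) : R := normal_pdf 0 1 x.

Lemma phi_ge0 x : 0 <= phi x. Proof. exact: normal_pdf_ge0. Qed.

Lemma measurable_phi : measurable_fun setT (phi : measurableTypeR R -> R).
Proof. exact: measurable_normal_pdf. Qed.

Lemma phiE x : phi x = normal_peak 1 * expR (- (x ^+ 2 / 2)).
Proof. by rewrite /phi normal_pdfE ?oner_neq0// /normal_fun subr0 expr1n mulNr. Qed.

Lemma N01T : N01 setT = 1%E.
Proof. exact: probability_setT. Qed.

Lemma integral_N01 (f : R -> \bar R) : (forall x, 0 <= f x)%E ->
  measurable_fun setT (f : measurableTypeR R -> _) ->
  (\int[N01]_x f x = \int[mu]_x (f x * (phi x)%:E))%E.
Proof.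
move=> f0 mf; rewrite -(@integral_dens _ _ _ mu phi phi_ge0 measurable_phi f f0 mf).
by apply: eq_measure_integral.
Qed.

Lemma normal_prob_scale (s : R) (A : set R) : 0 < s -> measurable (A : set (measurableTypeR R)) ->
  normal_prob 0 s A = N01 ((fun x => s * x) @^-1` A).
Proof.
move=> s0 mA; rewrite /N01 /= /normal_prob.
have mh : measurable_fun setT (fun x : measurableTypeR R => s * x : measurableTypeR R).
  exact: measurable_funM.
rewrite integral_mkcond (integral_affine (c := s) 0) ?gt_eqF//; last 2 first.
- by move=> x; rewrite patchE; case: ifP => // _; rewrite lee_fin normal_pdf_ge0.
- apply/(measurable_restrictT _ _).1 => //; apply: measurable_funTS.
  by apply/measurable_EFinP; exact: measurable_normal_pdf.
rewrite [RHS]integral_mkcond -ge0_integralZl//; last 2 first.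
- apply: (@measurableT_comp _ _ _ _ _ _ (fun x : measurableTypeR R => ((fun x => (normal_pdf 0 s x)%:E) \_ A) x) _ (fun x : measurableTypeR R => s * x + 0 : measurableTypeR R)).
    apply/(measurable_restrictT _ _).1 => //; apply: measurable_funTS.
    by apply/measurable_EFinP; exact: measurable_normal_pdf.
  by apply: measurable_funD.
- by move=> x _; rewrite patchE; case: ifP => // _; rewrite lee_fin normal_pdf_ge0.
apply: eq_integral => x _; rewrite !patchE addr0.
have -> : (s * x \in A) = (x \in (fun x => s * x) @^-1` A) by apply/idP/idP; rewrite !inE.
case: ifP => _; last by rewrite mule0.
rewrite -EFinM; congr (_%:E).
rewrite !normal_pdfE ?oner_neq0 ?gt_eqF// /normal_fun !subr0 gtr0_norm//.
have -> : - (s * x) ^+ 2 / (s ^+ 2 *+ 2) = - x ^+ 2 / (1 ^+ 2 *+ 2).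
  by field; rewrite gt_eqF.
rewrite mulrA; congr (_ * _); rewrite /normal_peak.
have -> : s ^+ 2 * pi *+ 2 = s ^+ 2 * (1 ^+ 2 * pi *+ 2) by ring.
by rewrite sqrtrM ?sqr_ge0// sqrtr_sqr gtr0_norm// invfM mulrA divff ?gt_eqF// mul1r.
Qed.

(** The rate 1/4 leaves a Gaussian weight of variance 2, whence the substitution by sqrt 2. The tail
    and moment estimates for normals below rest on this single exponential moment. *)
Lemma N01_exp_moment : (\int[N01]_x (expR (x ^+ 2 / 4))%:E = (Num.sqrt 2)%:E)%E.
Proof.
have m1 : measurable_fun setT (fun x : measurableTypeR R => (expR (x ^+ 2 / 4))%:E).
  apply/measurable_EFinP; apply: measurableT_comp => //.
  by apply: measurable_funM => //; apply: measurable_funX.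
rewrite integral_N01//.
have s2 : 0 < Num.sqrt 2 :> R by rewrite sqrtr_gt0.
rewrite (integral_affine (c := Num.sqrt 2) 0) ?gt_eqF//; last 2 first.
- by move=> x; rewrite mule_ge0 ?lee_fin// phi_ge0.
- apply: emeasurable_funM => //; apply/measurable_EFinP; exact: measurable_phi.
rewrite gtr0_norm//; transitivity ((Num.sqrt 2)%:E * (N01 setT))%E; last by rewrite N01T mule1.
congr (_ * _)%E; rewrite /N01 /= /normal_prob; apply: eq_integral => x _.
rewrite -EFinM -/(phi x) addr0 !phiE mulrCA -expRD; congr (_ * expR _)%:E.
by rewrite exprMn sqr_sqrtr//; field.
Qed.

Section rotation.
Variables (a b : R).
Hypotheses (b0 : b != 0) (ab : a ^+ 2 + b ^+ 2 = 1).

Definition rot (p : measurableTypeR R * measurableTypeR R) : measurableTypeR R * measurableTypeR R :=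
  (a * p.1 + b * p.2, a * p.2 - b * p.1).

Lemma measurable_rot : measurable_fun setT rot.
Proof.
apply/measurable_fun_pairP; split; rewrite /comp /=.
  by apply: measurable_funD; apply: measurable_funM.
by apply: measurable_funB; apply: measurable_funM.
Qed.

Let phi_rot u v : phi (a * u - b * v) * phi ((u - a * (a * u - b * v)) / b) = phi u * phi v.
Proof.
rewrite !phiE mulrACA [RHS]mulrACA -!expRD; congr (_ * expR _).
have -> : (u - a * (a * u - b * v)) / b = b * u + a * v.
  have -> : u - a * (a * u - b * v) = (1 - a ^+ 2) * u + a * b * v by ring.
  by rewrite -ab addrAC subrr add0r; field.
transitivity (- ((a ^+ 2 + b ^+ 2) * (u ^+ 2 + v ^+ 2) / 2)); first by field.
by rewrite ab; field.
Qed.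

(* Two affine substitutions turn [dx dy] into [du dv]: first [y] into
   [u = a x + b y] at fixed [x], then [x] into [v = a y - b x] at fixed [u]. *)
Lemma N01_rotation_rect (A B : set (measurableTypeR R)) : measurable A -> measurable B ->
  (N01 \x N01)%E (rot @^-1` (A `*` B)) = (N01 A * N01 B)%E.
Proof.
move=> mA mB.
have mAB : measurable (rot @^-1` (A `*` B)).
  by rewrite -[X in measurable X]setTI; apply: measurable_rot => //; exact: measurableX.
have mi (d : measure_display) (X : measurableType d) (h : X -> measurableTypeR R) (D : set (measurableTypeR R)) :
    measurable_fun setT h -> measurable D -> measurable_fun setT (fun x => \1_D (h x) : R).
  by move=> mh mD; apply: (measurableT_comp (measurable_indic mD)).
have mp (d : measure_display) (X : measurableType d) (h : X -> measurableTypeR R) :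
    measurable_fun setT h -> measurable_fun setT (fun x => phi (h x)).
  by move=> mh; apply: (measurableT_comp measurable_phi).
pose H (x y : R) : R := (\1_A (a * x + b * y) * \1_B (a * y - b * x)) * (phi x * phi y).
pose K (x u : R) : R := (\1_A u * \1_B (a * ((u - a * x) / b) - b * x)) * (phi x * phi ((u - a * x) / b)).
pose L (u v : R) : R := (\1_A u * \1_B v) * (phi u * phi v).
have H0 x y : 0 <= H x y by rewrite !mulr_ge0// phi_ge0.
have K0 x y : 0 <= K x y by rewrite !mulr_ge0// phi_ge0.
have L0 x y : 0 <= L x y by rewrite !mulr_ge0// phi_ge0.
have mH x : measurable_fun setT (fun y : measurableTypeR R => H x y).
  apply: measurable_funM; apply: measurable_funM.
  - by apply: mi => //; apply: measurable_funD => //; apply: measurable_funM.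
  - by apply: mi => //; apply: measurable_funB => //; apply: measurable_funM.
  - by [].
  - exact: mp.
have mKK : measurable_fun setT (fun p : measurableTypeR R * measurableTypeR R => (K p.1 p.2)%:E).
  apply/measurable_EFinP.
  have m1 : measurable_fun setT (fun p : measurableTypeR R * measurableTypeR R => (p.2 - a * p.1) / b : measurableTypeR R).
    by apply: measurable_funM => //; apply: measurable_funB => //; apply: measurable_funM.
  apply: measurable_funM; apply: measurable_funM.
  - exact: mi.
  - by apply: mi => //; apply: measurable_funB => //; apply: measurable_funM.
  - exact: mp.
  - exact: mp.
have mK2 u : measurable_fun setT (fun x : measurableTypeR R => (K x u)%:E).
  by have := @measurableT_comp _ _ _ _ _ _ _ _ (fun x : measurableTypeR R => (x, u)) mKK; apply.
have mLL : measurable_fun setT (fun p : measurableTypeR R * measurableTypeR R => (L p.1 p.2)%:E).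
  apply/measurable_EFinP; apply: measurable_funM; apply: measurable_funM.
  - exact: mi.
  - exact: mi.
  - exact: mp.
  - exact: mp.
have mL u : measurable_fun setT (fun y : measurableTypeR R => (L u y)%:E).
  apply/measurable_EFinP; apply: measurable_funM; apply: measurable_funM.
  - by [].
  - exact: mi.
  - by [].
  - exact: mp.
transitivity (\int[mu]_x \int[mu]_y (H x y)%:E)%E.
  pose G (z : measurableTypeR R * measurableTypeR R) : R := \1_A (a * z.1 + b * z.2) * \1_B (a * z.2 - b * z.1).
  have G0 z : 0 <= G z by rewrite mulr_ge0.
  have mG : measurable_fun setT (fun z => (G z)%:E).
    apply/measurable_EFinP; apply: measurable_funM; apply: mi => //.
      by apply: measurable_funD; apply: measurable_funM.
    by apply: measurable_funB; apply: measurable_funM.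
  have -> : (N01 \x N01)%E (rot @^-1` (A `*` B)) = (\int[N01 \x N01]_z (G z)%:E)%E.
    have := @integral_indic _ _ _ (N01 \x N01)%E setT measurableT _ mAB; rewrite setIT => <-.
    apply: eq_integral => z _; congr (_%:E); rewrite /G !indicE -natrM mulnb; congr ((_ : bool)%:R).
    by apply/idP/andP; rewrite !inE.
  rewrite fubini_tonelli1//.
  rewrite /fubini_F integral_N01; last 2 first.
  - by move=> x; apply: integral_ge0 => y _; rewrite lee_fin.
  - have := measurable_fun_fubini_tonelli_F (m2 := N01) _ mG; apply.
    by move=> z; rewrite lee_fin.
  apply: eq_integral => x _.
  have mx : measurable_fun setT (fun y : measurableTypeR R => (G (x, y))%:E : \bar R).
    have := measurableT_comp mG (measurable_pair1 x); apply.
  rewrite integral_N01//; last by move=> y; rewrite lee_fin.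
  rewrite -ge0_integralZr//; last 3 first.
  - apply: emeasurable_funM => //; apply/measurable_EFinP; exact: measurable_phi.
  - by move=> y _; rewrite mule_ge0// lee_fin// phi_ge0.
  - by rewrite lee_fin phi_ge0.
  apply: eq_integral => y _; rewrite -!EFinM /H; congr (_%:E).
  by rewrite -mulrA [phi y * _]mulrC.
transitivity (\int[mu]_x (`|b^-1|%:E * \int[mu]_u (K x u)%:E))%E.
  apply: eq_integral => x _.
  have mHE : measurable_fun setT (fun y : measurableTypeR R => (H x y)%:E) by exact/measurable_EFinP.
  rewrite (@integral_affine R b^-1 (- a * x / b) (fun y => (H x y)%:E) (invr_neq0 b0) _ mHE); last first.
    by move=> y; rewrite lee_fin; exact: H0.
  congr (_ * _)%E; apply: eq_integral => u _; congr (_%:E); rewrite /H /K.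
  have -> : b^-1 * u + - a * x / b = (u - a * x) / b by field.
  by congr (\1_A _ * _ * _); field.
have mIK : measurable_fun setT (fun x : measurableTypeR R => \int[mu]_u (K x u)%:E)%E.
  have := measurable_fun_fubini_tonelli_F (m2 := mu) _ mKK; apply.
  by move=> z; rewrite lee_fin; exact: K0.
have mIL : measurable_fun setT (fun x : measurableTypeR R => \int[mu]_u (L x u)%:E)%E.
  have := measurable_fun_fubini_tonelli_F (m2 := mu) _ mLL; apply.
  by move=> z; rewrite lee_fin; exact: L0.
have IK0 x : (setT : set (measurableTypeR R)) x -> (0 <= \int[mu]_u (K x u)%:E)%E.
  by move=> _; apply: integral_ge0 => u _; rewrite lee_fin.
have IL0 x : (setT : set (measurableTypeR R)) x -> (0 <= `|b|%:E * \int[mu]_u (L x u)%:E)%E.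
  by move=> _; apply: mule_ge0; [rewrite lee_fin|apply: integral_ge0 => u _; rewrite lee_fin].
have bE : (0 <= `|b^-1|%:E)%E by rewrite lee_fin.
rewrite (ge0_integralZl mu measurableT mIK IK0 bE).
rewrite (fubini_tonelli _ mKK); last by move=> x; rewrite lee_fin; exact: K0.
transitivity (`|b^-1|%:E * \int[mu]_u (`|b|%:E * \int[mu]_v (L u v)%:E))%E.
  congr (_ * _)%E; apply: eq_integral => u _.
  have nb : - b != 0 by rewrite oppr_eq0.
  rewrite [LHS](@integral_affine R (- b) (a * u) (fun x => (K x u)%:E) nb _ (mK2 u)); last first.
    by move=> x; rewrite lee_fin; exact: K0.
  rewrite normrN; congr (_ * _)%E; apply: eq_integral => v _; congr (_%:E).
  rewrite /K /L mulNr [- _ + _]addrC phi_rot; congr (_ * \1_B _ * _).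
  have -> : (u - a * (a * u - b * v)) / b = b * u + a * v.
    have -> : u - a * (a * u - b * v) = (1 - a ^+ 2) * u + a * b * v by ring.
    by rewrite -ab addrAC subrr add0r; field.
  transitivity ((a ^+ 2 + b ^+ 2) * v); first by ring.
  by rewrite ab mul1r.
have mphi : measurable_fun setT (fun v : measurableTypeR R => (phi v)%:E) by apply/measurable_EFinP; exact: measurable_phi.
have mI (D : set (measurableTypeR R)) : measurable D -> measurable_fun setT (fun v : measurableTypeR R => (\1_D v * phi v)%:E).
  by move=> mD; apply/measurable_EFinP; apply: measurable_funM => //; exact: measurable_phi.
have NE (D : set (measurableTypeR R)) : measurable D -> N01 D = (\int[mu]_v (\1_D v * phi v)%:E)%E.
  move=> mD; have := @integral_indic _ _ _ N01 setT measurableT D mD; rewrite setIT => <-.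
  have h0 x : (0 <= (\1_D x : R)%:E)%E by rewrite lee_fin.
  have h1 : measurable_fun setT (fun x : measurableTypeR R => (\1_D x : R)%:E) by exact/measurable_EFinP.
  by rewrite (integral_N01 h0 h1).
rewrite (NE A)// (NE B)//.
rewrite -ge0_integralZr//; last 2 first.
- by move=> v _; rewrite lee_fin mulr_ge0// phi_ge0.
- by apply: integral_ge0 => v _; rewrite lee_fin mulr_ge0// phi_ge0.
have mbIL : measurable_fun setT (fun x : measurableTypeR R => `|b|%:E * \int[mu]_u (L x u)%:E)%E.
  exact: emeasurable_funM.
rewrite -(ge0_integralZl mu measurableT mbIL IL0 bE).
apply: eq_integral => u _.
rewrite muleA -EFinM -normrM mulVf// normr1 mul1e.
rewrite -ge0_integralZl//; last 3 first.
- exact: mI.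
- by move=> v _; rewrite lee_fin mulr_ge0// phi_ge0.
- by rewrite lee_fin mulr_ge0// phi_ge0.
by apply: eq_integral => v _; rewrite -EFinM /L mulrACA.
exact: mI.
Qed.

End rotation.
End standard_normal.

(** * Independence *)

Lemma bigsetIP (T : Type) (I : eqType) (s : seq I) (E : I -> set T) w :
  (\big[setI/setT]_(i <- s) E i) w <-> (forall i, i \in s -> E i w).
Proof.
elim: s => [|i s IH]; first by rewrite big_nil.
rewrite big_cons; split=> [[Ei Es] j|H].
  by rewrite inE => /predU1P[->//|js]; apply: IH.1 Es _ js.
split; first by apply: H; rewrite mem_head.
by apply: IH.2 => j js; apply: H; rewrite inE js orbT.
Qed.

Lemma bigsetI_preimage_id (T S : Type) (I : eqType) (s : seq I) (X : I -> T -> S) (B : I -> set S) :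
  \big[setI/setT]_(i <- s) (X i @^-1` B i) = [set w | forall i, i \in s -> B i (X i w)].
Proof. by apply/seteqP; split=> w /=; [move/bigsetIP|move=> H; apply/bigsetIP]. Qed.

Section event_law.
Local Open Scope ereal_scope.
Context d d' (T : measurableType d) (S : measurableType d') (R : realType).
Variables (P : {measure set T -> \bar R}) (Y : T -> S) (nu : probability S R).
Hypothesis mY : measurable_fun setT Y.

(** With [A] fixed both sides are finite measures in [B], so a generating pi-system suffices.
    Independence is extended from simple sets to all sets in this way, one variable at a time. *)
Lemma pi_lambda_event (A : set T) (G : set (set S)) : measurable A -> P A \is a fin_num ->
  @measurable _ S = <<s G >> -> setI_closed G -> G setT ->
  (forall B, G B -> P (Y @^-1` B `&` A) = nu B * P A) ->
  forall B, measurable B -> P (Y @^-1` B `&` A) = nu B * P A.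
Proof.
move=> mA PAf mG GI GT H B mB.
have PA : (0 <= fine (P A))%R by apply: fine_ge0.
have e C : mscale (NngNum PA) nu C = nu C * P A by rewrite /mscale /= fineK// muleC.
rewrite -e.
have -> : P (Y @^-1` B `&` A) = push (mrestr P mA) mY B by [].
apply: (@measure_unique _ _ _ G (fun=> setT)) => //.
- by rewrite bigcup_const.
- by move=> C GC; exact: etrans (H _ GC) (esym (e C)).
- by move=> _; rewrite pushE /= /mrestr preimage_setT setTI ltey_eq PAf.
Qed.

(** The image under [Y] of the restriction to [A] is a multiple of [nu], and restricting to [A] is
    taking the indicator of [A] as a density. *)
Lemma integral_event_law (A : set T) (f : S -> R) : measurable A -> P A \is a fin_num ->
  (forall B, measurable B -> P (Y @^-1` B `&` A) = nu B * P A) ->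
  measurable_fun setT f -> (forall x, (0 <= f x)%R) ->
  \int[P]_(w in A) (f (Y w))%:E = (\int[nu]_x (f x)%:E) * P A.
Proof.
move=> mA PAf H mf f0.
have PA : (0 <= fine (P A))%R by apply: fine_ge0.
have mfE : measurable_fun setT (EFin \o f) by exact/measurable_EFinP.
have f0E x : (setT : set S) x -> 0 <= (f x)%:E by rewrite lee_fin.
rewrite -[in RHS](fineK PAf) muleC.
have := @ge0_integral_mscale _ _ _ nu setT measurableT (NngNum PA) (EFin \o f) mfE f0E.
rewrite /= => <-.
transitivity (\int[push (mrestr P mA) mY]_x (f x)%:E); last first.
  apply: eq_measure_integral => B mB _.
  have e : mscale (NngNum PA) nu B = nu B * P A by rewrite /mscale /= fineK// muleC.
  exact: etrans (H _ mB) (esym e).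
rewrite integral_push//.
have md : measurable_fun setT (\1_A : T -> R) by exact: measurable_indic.
have d0 w : (0 <= (\1_A w : R))%R by [].
have mfY : measurable_fun setT (fun w => (f (Y w))%:E) by exact: measurableT_comp mfE mY.
transitivity (\int[dens P d0 md]_w (f (Y w))%:E); last first.
  apply: eq_measure_integral => B mB _.
  by rewrite /= /dens /mrestr integral_indic// setIC.
rewrite integral_dens//; last by move=> w; rewrite lee_fin.
rewrite integral_mkcond; apply: eq_integral => w _.
by rewrite epatch_indic.
Qed.

End event_law.

Section indep.
Local Open Scope ereal_scope.
Context d (T : measurableType d) (R : realType) (P : probability T R).
Local Notation RR := (measurableTypeR R).

Definition indep (I : eqType) (X : I -> T -> RR) (nu : I -> probability RR R) :=
  (forall i, measurable_fun setT (X i)) /\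
  forall (s : seq I) (B : I -> set RR), uniq s -> (forall i, measurable (B i)) ->
    P (\big[setI/setT]_(i <- s) (X i @^-1` B i)) = \prod_(i <- s) nu i (B i).

Lemma indep_measurable (I : eqType) X nu : @indep I X nu -> forall i, measurable_fun setT (X i).
Proof. by case. Qed.

Lemma indepE (I : eqType) X nu s B : @indep I X nu -> uniq s -> (forall i, measurable (B i)) ->
  P (\big[setI/setT]_(i <- s) (X i @^-1` B i)) = \prod_(i <- s) nu i (B i).
Proof. by case=> _; apply. Qed.

Lemma indep_reindex (I J : eqType) (f : J -> I) X nu : injective f ->
  @indep I X nu -> indep (fun j => X (f j)) (fun j => nu (f j)).
Proof.
move=> finj [mX H]; split=> [j|s B us mB]; first exact: mX.
pose B' i : set RR := [set x | forall j, j \in s -> f j = i -> B j x].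
have B'E j : j \in s -> B' (f j) = B j.
  move=> js; apply/seteqP; split=> x /=; first by apply.
  by move=> Bx k ks /finj ->.
have mB' i : measurable (B' i).
  have [[j js <-]|n] := pselect (exists2 j, j \in s & f j = i); first by rewrite B'E.
  have -> : B' i = setT; last exact: measurableT.
  by apply/seteqP; split=> x //= _ j js fj; case: n; exists j.
have := H (map f s) B'; rewrite map_inj_uniq// => /(_ us mB').
rewrite !big_map => e.
rewrite (eq_big_seq (fun j => X (f j) @^-1` B' (f j))); last by move=> j js /=; rewrite B'E.
by rewrite e; apply: eq_big_seq => j js; rewrite B'E.
Qed.

(** Extra indices whose set is the whole space change neither side, so arbitrarily large lists are
    enough. *)
Lemma indep_cofinal (I : eqType) (X : I -> T -> RR) (nu : I -> probability RR R) :
  (forall i, measurable_fun setT (X i)) ->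
  (forall s : seq I, exists S : seq I, [/\ uniq S, {subset s <= S} &
    forall B : I -> set RR, (forall i, measurable (B i)) ->
    P (\big[setI/setT]_(i <- S) (X i @^-1` B i)) = \prod_(i <- S) nu i (B i)]) ->
  indep X nu.
Proof.
move=> mX H; split=> // s B us mB; have [S [uS sS HS]] := H s.
pose B' i := if i \in s then B i else setT.
have mB' i : measurable (B' i) by rewrite /B'; case: ifP.
have pS : perm_eq [seq i <- S | i \in s] s.
  apply: uniq_perm => //; first exact: filter_uniq.
  by move=> i; rewrite mem_filter andb_idr// => /sS.
transitivity (P (\big[setI/setT]_(i <- S) (X i @^-1` B' i))).
  congr (P _); rewrite !bigsetI_preimage_id; apply/seteqP; split=> w /= Hw i.
    by rewrite /B'; case: ifPn => // is_ _; apply: Hw.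
  by move=> is_; have := Hw i (sS _ is_); rewrite /B' is_.
rewrite HS// -(perm_big _ pS) big_filter [RHS]big_mkcond.
by apply: eq_big_seq => i _; rewrite /B'; case: ifP => // _; rewrite probability_setT.
Qed.

(** Stated for a measure [Q] and a constant [c] so that the induction closes: the first factor is
    absorbed into [Q] as a density, which multiplies [c] by the integral of that factor. *)
Let prod_indep (Q : {measure set T -> \bar R}) (c : R) (I : eqType) (X : I -> T -> RR)
    (nu : I -> probability RR R) (f : I -> RR -> R) (s : seq I) : uniq s ->
  (forall i, measurable_fun setT (X i)) ->
  (forall B : I -> set RR, (forall i, measurable (B i)) ->
     Q (\big[setI/setT]_(i <- s) (X i @^-1` B i)) = c%:E * \prod_(i <- s) nu i (B i)) ->
  (forall i, measurable_fun setT (f i)) -> (forall i x, (0 <= f i x)%R) ->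
  (forall i, \int[nu i]_x (f i x)%:E < +oo) ->
  \int[Q]_w (\prod_(i <- s) f i (X i w))%:E = c%:E * \prod_(i <- s) \int[nu i]_x (f i x)%:E.
Proof.
move=> us mX HQ mf f0 foo; elim: s us Q c HQ => [_|i s IH /= /andP[is_ us]] Q c HQ.
  rewrite big_nil mule1; under eq_integral do rewrite big_nil.
  rewrite integral_cst// mul1e.
  by have := HQ (fun=> setT) (fun=> measurableT); rewrite !big_nil mule1.
have foof : \int[nu i]_x (f i x)%:E \is a fin_num.
  by rewrite ge0_fin_numE// integral_ge0// => x _; rewrite lee_fin.
have mg : measurable_fun setT (fun w => f i (X i w)) by exact: measurableT_comp (mf i) (mX i).
have g0 w : (0 <= f i (X i w))%R by [].
have nuf j (B : set RR) : measurable B -> nu j B \is a fin_num by exact: fin_num_measure.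
have QE B : (forall j, measurable (B j)) -> forall D, measurable D ->
    Q (X i @^-1` D `&` \big[setI/setT]_(j <- s) (X j @^-1` B j)) =
    c%:E * (nu i D * \prod_(j <- s) nu j (B j)).
  move=> mB D mD.
  have mD' j : measurable (if j == i then D else B j) by case: ifP.
  have := HQ (fun j => if j == i then D else B j) mD'.
  have e (V : Type) (idx : V) op F G : (forall j, j != i -> F j = G j :> V) ->
      \big[op/idx]_(j <- s) F j = \big[op/idx]_(j <- s) G j.
    by move=> FG; apply: eq_big_seq => j js; apply: FG; apply: contraNneq is_ => <-.
  rewrite !big_cons eqxx.
  rewrite (e _ _ _ _ (fun j => X j @^-1` B j)); last by move=> j /negbTE ->.
  by rewrite (e _ _ _ _ (fun j => nu j (B j))) => [//|j /negbTE ->].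
have QA B : (forall j, measurable (B j)) ->
    Q (\big[setI/setT]_(j <- s) (X j @^-1` B j)) = c%:E * \prod_(j <- s) nu j (B j).
  move=> mB; have := QE B mB setT measurableT.
  by rewrite preimage_setT setTI probability_setT mul1e.
have mA B : (forall j, measurable (B j)) -> measurable (\big[setI/setT]_(j <- s) (X j @^-1` B j)).
  by move=> mB; apply: bigsetI_measurable => j _; rewrite -[X in measurable X]setTI; exact: mX.
have mprod r : measurable_fun setT (fun w => (\prod_(j <- r) f j (X j w))%:E).
  apply/measurable_EFinP; apply: measurable_prod => j _.
  exact: measurableT_comp (mf j) (mX j).
rewrite big_cons; pose Q' : {measure set T -> \bar R} := dens Q g0 mg.
have IH' : forall B : I -> set RR, (forall j, measurable (B j)) ->
    Q' (\big[setI/setT]_(j <- s) (X j @^-1` B j)) =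
    (c * fine (\int[nu i]_x (f i x)%:E))%:E * \prod_(j <- s) nu j (B j).
  move=> B mB; rewrite /= /dens (integral_event_law (nu := nu i))//=; last 3 first.
  - exact: mA.
  - rewrite QA// fin_numM// prode_fin_num// => j _; exact: nuf.
  - by move=> D mD; rewrite QE// QA// muleCA.
  by rewrite QA// EFinM fineK// muleA (muleC c%:E).
have := IH us Q' _ IH'; rewrite integral_dens//; last first.
  by move=> w; rewrite lee_fin prodr_ge0.
rewrite EFinM fineK// => e; rewrite muleA -e; apply: eq_integral => w _.
by rewrite big_cons mulrC EFinM.
Qed.

Lemma integral_prod_indep (I : eqType) X nu (f : I -> RR -> R) s : @indep I X nu -> uniq s ->
  (forall i, measurable_fun setT (f i)) -> (forall i x, (0 <= f i x)%R) ->
  (forall i, \int[nu i]_x (f i x)%:E < +oo) ->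
  \int[P]_w (\prod_(i <- s) f i (X i w))%:E = \prod_(i <- s) \int[nu i]_x (f i x)%:E.
Proof.
move=> [mX HX] us mf f0 foo; rewrite (@prod_indep P 1%R _ _ nu)//.
  by rewrite mul1e.
by move=> B mB; exact: etrans (HX _ _ us mB) (esym (mul1e _)).
Qed.

Definition iid (I : eqType) (X : I -> T -> RR) := indep X (fun=> N01).

Section rotate.
Variables (J L : eqType) (a b : R).
Hypotheses (b0 : (b != 0)%R) (ab : (a ^+ 2 + b ^+ 2 = 1)%R).
Local Notation K := (J * bool + L)%type.

Definition rotate (X : K -> T -> RR) : K -> T -> RR := fun k w =>
  match k with
  | inl (j, true) => (a * X (inl (j, true)) w + b * X (inl (j, false)) w)%R
  | inl (j, false) => (a * X (inl (j, false)) w - b * X (inl (j, true)) w)%R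
  | inr l => X (inr l) w
  end.

Let pr (X : K -> T -> RR) j w : RR * RR := (X (inl (j, true)) w, X (inl (j, false)) w).

Let allk (js : seq J) (ls : seq L) : seq K :=
  [seq inl (j, true) | j <- js] ++ [seq inl (j, false) | j <- js] ++ [seq inr l | l <- ls].

Let rect_case (X : K -> T -> RR) (A B : J -> set RR) (D : L -> set RR) js ls :
  iid X -> uniq js -> uniq ls -> (forall j, measurable (A j)) -> (forall j, measurable (B j)) ->
  (forall l, measurable (D l)) ->
  P (\big[setI/setT]_(j <- js) (pr X j @^-1` (A j `*` B j)) `&`
     \big[setI/setT]_(l <- ls) (X (inr l) @^-1` D l)) =
  \prod_(j <- js) (N01 (A j) * N01 (B j)) * \prod_(l <- ls) N01 (D l).
Proof.
move=> [mX HX] ujs uls mA mB mD.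
pose E (k : K) : set RR := match k with inl (j, true) => A j | inl (j, false) => B j | inr l => D l end.
have mE k : measurable (E k) by case: k => [[j []]|l] /=.
have uk : uniq (allk js ls).
  rewrite !cat_uniq !map_inj_uniq ?ujs ?uls//=; try by move=> ? ? [].
  rewrite andbT; apply/andP; split; apply/hasPn => k.
    by rewrite mem_cat => /orP[] /mapP[x _ ->]; apply/mapP => -[].
  by move=> /mapP[x _ ->]; apply/mapP => -[].
have <- : \prod_(k <- allk js ls) N01 (E k) = \prod_(j <- js) (N01 (A j) * N01 (B j)) * \prod_(l <- ls) N01 (D l).
  by rewrite /allk !big_cat !big_map /= muleA big_split.
rewrite -(HX _ E uk mE) /allk !big_cat !big_map /=.
congr (P _); rewrite setIA; congr (_ `&` _); rewrite -big_split; apply: eq_bigr => j _.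
by apply/seteqP; split.
Qed.

(** Interpolates between rectangles and arbitrary planar sets: pairs in [js1] may carry any
    measurable set, those in [js2] only a rectangle. Each step of the induction frees one pair by a
    pi-lambda argument. *)
Let pair_case (X : K -> T -> RR) (C : J -> set (RR * RR)) (D : L -> set RR) js1 js2 ls :
  iid X -> uniq (js1 ++ js2) -> uniq ls ->
  (forall j, measurable (C j)) -> (forall l, measurable (D l)) ->
  (forall j, j \in js2 -> exists A B, [/\ measurable A, measurable B & C j = A `*` B]) ->
  P (\big[setI/setT]_(j <- js1 ++ js2) (pr X j @^-1` C j) `&`
     \big[setI/setT]_(l <- ls) (X (inr l) @^-1` D l)) =
  \prod_(j <- js1 ++ js2) (N01 \x N01) (C j) * \prod_(l <- ls) N01 (D l).
Proof.
move=> iX + uls; elim: js1 js2 C => [js2 C /= u2 mC mD Crect|j js1 IH js2 C u mC mD Crect].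
  pose A j := if pselect (j \in js2) is left H then sval (cid (Crect j H)) else setT.
  pose B j := if pselect (j \in js2) is left H then sval (cid (svalP (cid (Crect j H)))) else setT.
  have AB j : [/\ measurable (A j), measurable (B j) & (j \in js2 -> C j = A j `*` B j)].
    rewrite /A /B; case: pselect => [H|nH]; last by split=> //; exact: measurableT.
    by case: (svalP (cid (svalP (cid (Crect j H))))).
  rewrite (eq_big_seq (fun j => pr X j @^-1` (A j `*` B j))); last first.
    by move=> j; case: (AB j) => _ _ H /H ->.
  rewrite rect_case//; try by move=> j; case: (AB j).
  congr (_ * _); apply: eq_big_seq => j j2; case: (AB j) => mA mB /(_ j2) ->.
  by rewrite product_measure1E.
have mX := indep_measurable iX.
have mprj k : measurable_fun setT (pr X k) by apply/measurable_fun_pairP; split; exact: mX.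
move: u => /= /andP[jn u].
set A := \big[setI/setT]_(k <- js1 ++ js2) (pr X k @^-1` C k) `&` \big[setI/setT]_(l <- ls) (X (inr l) @^-1` D l).
have mA : measurable A.
  apply: measurableI; apply: bigsetI_measurable => k _; rewrite -[X in measurable X]setTI; first exact: mprj.
  exact: mX.
rewrite !big_cons -setIA -/A -muleA.
have PA : P A = \prod_(k <- js1 ++ js2) (N01 \x N01) (C k) * \prod_(l <- ls) N01 (D l).
  by apply: IH => // k k2; apply: Crect; rewrite ?inE ?k2 ?orbT.
rewrite -PA.
apply: (@pi_lambda_event _ _ _ _ _ P (pr X j) (N01 \x N01) (mprj j) A
  [set A `*` B | A in measurable & B in measurable]) => //.
- exact: fin_num_measure.
- exact: measurable_prod_measurableType.
- move=> _ _ [A1 mA1 [B1 mB1 <-]] [A2 mA2 [B2 mB2 <-]].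
  exists (A1 `&` A2); first exact: measurableI.
  by exists (B1 `&` B2); [exact: measurableI|rewrite setXI].
- by exists setT => //; exists setT => //; rewrite setXTT.
move=> _ [A1 mA1 [B1 mB1 <-]].
pose C' k := if k == j then A1 `*` B1 else C k.
have e (V : Type) (idx : V) op (F G : J -> V) : (forall k, k != j -> F k = G k) ->
    \big[op/idx]_(k <- js1 ++ js2) F k = \big[op/idx]_(k <- js1 ++ js2) G k.
  by move=> FG; apply: eq_big_seq => k kj; apply: FG; apply: contraNneq jn => <-.
have := IH (j :: js2) C'.
have pj : perm_eq (js1 ++ j :: js2) (j :: js1 ++ js2) by rewrite perm_catC /= perm_cons perm_catC.
rewrite !(perm_big _ pj)/= !big_cons (perm_uniq pj) /= jn u /C' eqxx.
rewrite (e _ _ _ _ (fun k => pr X k @^-1` C k)); last by move=> k /negbTE ->.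
rewrite (e _ _ _ _ (fun k => (N01 \x N01) (C k))); last by move=> k /negbTE ->.
rewrite -setIA -/A -muleA -PA; apply=> //.
- by move=> k; case: ifP => // _; exact: measurableX.
- move=> k; rewrite inE; case: ifP => [_ _|nk /= k2]; first by exists A1, B1.
  exact: Crect.
Qed.

(** An event on the rotated family puts each pair into the preimage of a rectangle under [rot]. This
    is no rectangle, hence [pair_case]; its product measure is the planar statement
    [N01_rotation_rect]. *)
Lemma iid_rotate X : iid X -> iid (rotate X).
Proof.
move=> iX; have mX := indep_measurable iX.
have mR k : measurable_fun setT (rotate X k).
  case: k => [[j []]|l] /=; last exact: mX.
    by apply: measurable_funD; apply: measurable_funM => //; exact: mX.
  by apply: measurable_funB; apply: measurable_funM => //; exact: mX.
apply: indep_cofinal => // s.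
pose js := undup (pmap (fun k : K => if k is inl (j, _) then Some j else None) s).
pose ls := undup (pmap (fun k : K => if k is inr l then Some l else None) s).
exists (allk js ls).
have ujs : uniq js by exact: undup_uniq.
have uls : uniq ls by exact: undup_uniq.
split.
- rewrite !cat_uniq !map_inj_uniq ?ujs ?uls//=; try by move=> ? ? [].
  rewrite andbT; apply/andP; split; apply/hasPn => k.
    by rewrite mem_cat => /orP[] /mapP[x _ ->]; apply/mapP => -[].
  by move=> /mapP[x _ ->]; apply/mapP => -[].
- move=> [[j c]|l] ks; rewrite !mem_cat; last first.
    apply/orP; right; apply/orP; right; apply: map_f.
    by rewrite mem_undup mem_pmap; apply/mapP; exists (inr l).
  have jj : j \in js by rewrite mem_undup mem_pmap; apply/mapP; exists (inl (j, c)).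
  by case: c ks => _; rewrite (map_f (fun j => inl (j, _)))// ?orbT.
move=> B mB.
rewrite /allk !big_cat !big_map /= muleA -big_split setIA.
have := @pair_case X (fun j => rot a b @^-1` (B (inl (j, true)) `*` B (inl (j, false))))
  (fun l => B (inr l)) js [::] ls iX; rewrite cats0 => /(_ ujs uls) H.
transitivity (P (\big[setI/setT]_(j <- js) (pr X j @^-1` (rot a b @^-1` (B (inl (j, true)) `*` B (inl (j, false))))) `&`
     \big[setI/setT]_(l <- ls) (X (inr l) @^-1` B (inr l)))).
  congr (P (_ `&` _)); rewrite -big_split; apply: eq_bigr => j _.
  by apply/seteqP; split.
rewrite H//; last first.
  move=> j; rewrite -[X in measurable X]setTI; apply: measurable_rot => //.
  exact: measurableX.
congr (_ * _); apply: eq_bigr => j _; exact: N01_rotation_rect.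
Qed.

End rotate.

End indep.

(** * Independence under pointwise limits *)

Section limits.
Context {R : realType}.
Local Notation RR := (measurableTypeR R).

Lemma probability_lty d (T : measurableType d) (Q : probability T R) : (Q setT < +oo)%E.
Proof. by rewrite probability_setT ltry. Qed.

Lemma bounded_cvg d (T : measurableType d) (mu : {measure set T -> \bar R})
    (f_ : nat -> T -> R) (f : T -> R) :
  (mu setT < +oo)%E -> (forall n, measurable_fun setT (f_ n)) ->
  (forall n x, 0 <= f_ n x <= 1) -> (forall x, f_ n x @[n --> \oo] --> f x) ->
  (\int[mu]_x (f_ n x)%:E)%E @[n --> \oo] --> (\int[mu]_x (f x)%:E)%E.
Proof.
move=> fin mf f01 ff.
apply: (@dominated_cvg _ _ _ mu setT measurableT (fun n x => (f_ n x)%:E) (fun x => (f x)%:E) (fun=> 1%E)) => //.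
- by move=> n; exact/measurable_EFinP.
- by move=> x _; apply: cvg_EFin; [near=> n|exact: ff].
- apply/integrableP; split=> //.
  by under eq_integral do rewrite abse1; rewrite integral_cst// mul1e.
- by move=> n x _; rewrite lee_fin; have /andP[f0 f1] := f01 n x; rewrite ger0_norm.
Unshelve. all: by end_near. Qed.

(* Continuous functions increasing to the indicator of [`]-oo, x[]. *)
Definition ramp (x : R) (m : nat) (y : R) : R := Num.min 1 (Num.max 0 (m%:R * (x - y))).

Lemma ramp01 x m y : 0 <= ramp x m y <= 1.
Proof. by rewrite /ramp ge_min lexx le_min ler01 le_max lexx. Qed.

Lemma continuous_ramp x m : continuous (ramp x m).
Proof.
move=> y; apply: (@continuous_min _ _ (fun=> 1) ((fun=> 0) \max (fun y => m%:R * (x - y)))).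
  exact: cvg_cst.
apply: continuous_max; first exact: cvg_cst.
by apply: cvgM; [exact: cvg_cst|apply: cvgB; [exact: cvg_cst|exact: cvg_id]].
Qed.

Lemma cvg_ramp x y : ramp x m y @[m --> \oo] --> (\1_(`]-oo, x[) y : R).
Proof.
rewrite indicE mem_setE in_itv/=; have [yx|xy] := ltP y x; last first.
  rewrite (_ : (fun m => _) = fun=> 0); first exact: cvg_cst.
  apply/funext => m; rewrite /ramp max_l ?min_r//.
  by rewrite mulr_ge0_le0// subr_le0.
apply: cvg_near_cst; near=> m.
rewrite /ramp min_l// le_max; apply/orP; right.
rewrite -ler_pdivrMr ?subr_gt0//; near: m; exact: nbhs_infty_ger.
Unshelve. all: by end_near. Qed.

End limits.

Section indep_limit.
Context d (T : measurableType d) (R : realType) (P : probability T R).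
Local Notation RR := (measurableTypeR R).

(** The induction moves indices from [s2], where the sets still belong to [G], to [s], where they
    are arbitrary measurable sets. *)
Lemma indep_pi (I : eqType) (X : I -> T -> RR) (nu : I -> probability RR R) (G : set (set RR)) :
  @measurable _ RR = <<s G >> -> setI_closed G -> G setT ->
  (forall i, measurable_fun setT (X i)) ->
  (forall s (B : I -> set RR), uniq s -> (forall i, G (B i)) ->
     P (\big[setI/setT]_(i <- s) (X i @^-1` B i)) = (\prod_(i <- s) nu i (B i))%E) ->
  indep P X nu.
Proof.
move=> mG GI GT mX H; split=> // s B us mB; rewrite -[s]cats0.
have mGG B' : G B' -> measurable B' by rewrite mG => ?; exact: sub_sigma_algebra.
have : forall i, i \in [::] -> G (B i) by [].
have : uniq (s ++ [::]) by rewrite cats0.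
move: {us} [::] => s2; elim: s s2 B mB => [|i s IH] s2 B mB us GB.
  rewrite cat0s in us *.
  pose B' i := if i \in s2 then B i else setT.
  have := H s2 B' us; rewrite /B'.
  rewrite (eq_big_seq (fun i => X i @^-1` B i)); last by move=> i ->.
  rewrite (eq_big_seq (fun i => nu i (B i))); last by move=> i ->.
  by apply => i; case: ifPn => // /GB.
move: us => /= /andP[is_ us].
set A := \big[setI/setT]_(k <- s ++ s2) (X k @^-1` B k).
have mA : measurable A.
  by apply: bigsetI_measurable => k _; rewrite -[X in measurable X]setTI; exact: mX.
have PA : P A = (\prod_(k <- s ++ s2) nu k (B k))%E by apply: IH.
rewrite !big_cons -/A -PA.
apply: (@pi_lambda_event _ _ _ _ _ P (X i) (nu i) (mX i) A G) => //.
  exact: fin_num_measure.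
move=> B1 GB1.
pose B' k := if k == i then B1 else B k.
have e (V : Type) (idx : V) op (F F' : I -> V) : (forall k, k != i -> F k = F' k) ->
    \big[op/idx]_(k <- s ++ s2) F k = \big[op/idx]_(k <- s ++ s2) F' k.
  by move=> FG; apply: eq_big_seq => k kj; apply: FG; apply: contraNneq is_ => <-.
have := IH (i :: s2) B'.
have pj : perm_eq (s ++ i :: s2) (i :: s ++ s2) by rewrite perm_catC /= perm_cons perm_catC.
rewrite !(perm_big _ pj)/= !big_cons (perm_uniq pj) /= is_ us /B' eqxx.
rewrite (e _ _ _ _ (fun k => X k @^-1` B k)); last by move=> k /negbTE ->.
rewrite (e _ _ _ _ (fun k => nu k (B k))); last by move=> k /negbTE ->.
rewrite -/A -PA; apply=> //.
- by move=> k; case: ifP => // _; exact: mGG.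
- move=> k; rewrite inE; case: ifP => [_ _//|nk /= k2]; exact: GB.
Qed.

(** Independence is tested on products of continuous functions with values in [0, 1], for which
    dominated convergence applies on both sides. Ramps then increase to the indicators of open
    half-lines, which form a generating pi-system. *)
Lemma indep_limit (I : eqType) (XJ : nat -> I -> T -> RR) (X : I -> T -> RR)
    (nuJ : nat -> I -> probability RR R) (nu : I -> probability RR R) :
  (forall J, indep P (XJ J) (nuJ J)) ->
  (forall i w, (XJ J i w : R) @[J --> \oo] --> (X i w : R)) ->
  (forall i (f : R -> R), continuous f -> (forall x, 0 <= f x <= 1) ->
     (\int[nuJ J i]_x (f x)%:E)%E @[J --> \oo] --> (\int[nu i]_x (f x)%:E)%E) ->
  indep P X nu.
Proof.
move=> iXJ XJX cnu.
have mX i : measurable_fun setT (X i).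
  apply: (@measurable_fun_cvg _ _ _ setT (fun J => XJ J i)) => [J|w _]; last exact: XJX.
  exact: indep_measurable (iXJ J) i.
have mcf (f : R -> R) : continuous f -> measurable_fun setT (f : RR -> R).
  by move=> cf; exact: continuous_measurable_fun.
have prod01 (s : seq I) (F : I -> R) : (forall i, 0 <= F i <= 1) -> 0 <= \prod_(i <- s) F i <= 1.
  move=> F01; rewrite prodr_ge0 ?prodr_ile1// => i _; first by have /andP[] := F01 i.
have cprod (s : seq I) (F : nat -> I -> R) (l : I -> R) : (forall i, F n i @[n --> \oo] --> l i) ->
    (\prod_(i <- s) F n i) @[n --> \oo] --> \prod_(i <- s) l i.
  move=> Fl; elim: s => [|i s IH].
    by rewrite big_nil; under eq_fun do rewrite big_nil; exact: cvg_cst.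
  by rewrite big_cons; under eq_fun do rewrite big_cons; apply: cvgM.
have int1 (m : probability RR R) (f : R -> R) : measurable_fun setT (f : RR -> R) ->
    (forall x, 0 <= f x <= 1) -> (0 <= \int[m]_x (f x)%:E <= 1)%E.
  move=> mf f01; rewrite integral_ge0/=; last by move=> x _; rewrite lee_fin; case/andP: (f01 x).
  have <- : (\int[m]_x (cst 1%E x))%E = 1%E by rewrite integral_cst// mul1e; exact: probability_setT.
  apply: ge0_le_integral => //.
  - by move=> x _; rewrite lee_fin; case/andP: (f01 x).
  - exact/measurable_EFinP.
  - by move=> x _; rewrite lee_fin; case/andP: (f01 x).
have intfin (m : probability RR R) (f : R -> R) : measurable_fun setT (f : RR -> R) ->
    (forall x, 0 <= f x <= 1) -> (\int[m]_x (f x)%:E)%E \is a fin_num.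
  move=> mf /(int1 m _ mf) /andP[i0 i1].
  by rewrite ge0_fin_numE//; apply: le_lt_trans i1 _; exact: ltry.
have stepA (s : seq I) (f : I -> R -> R) : uniq s -> (forall i, continuous (f i)) ->
    (forall i x, 0 <= f i x <= 1) ->
    (\int[P]_w (\prod_(i <- s) f i (X i w))%:E = \prod_(i <- s) \int[nu i]_x (f i x)%:E)%E.
  move=> us cf f01.
  have mf i : measurable_fun setT (f i : RR -> R) by exact: mcf.
  have L : (\int[P]_w (\prod_(i <- s) f i (XJ J i w))%:E)%E @[J --> \oo] -->
      (\int[P]_w (\prod_(i <- s) f i (X i w))%:E)%E.
    apply: bounded_cvg.
    - exact: probability_lty.
    - move=> J; apply: measurable_prod => i _.
      exact: measurableT_comp (mf i) (indep_measurable (iXJ J) i).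
    - by move=> J w; apply: prod01.
    - move=> w; apply: (cprod s (fun J i => f i (XJ J i w)) (fun i => f i (X i w))) => i.
      exact: cvg_comp (XJX i w) (cf i _).
  have E J : (\int[P]_w (\prod_(i <- s) f i (XJ J i w))%:E = (\prod_(i <- s) fine (\int[nuJ J i]_x (f i x)%:E))%:E)%E.
    rewrite (integral_prod_indep (iXJ J) us mf).
    - by rewrite -prodEFin; apply: eq_bigr => i _; rewrite fineK// intfin.
    - by move=> i x; case/andP: (f01 i x).
    - by move=> i; rewrite -ge0_fin_numE ?intfin//; have /andP[] := int1 (nuJ J i) _ (mf i) (f01 i).
  rewrite (funext E) in L.
  have L' : ((\prod_(i <- s) fine (\int[nuJ J i]_x (f i x)%:E))%:E)%E @[J --> \oo] -->
      ((\prod_(i <- s) fine (\int[nu i]_x (f i x)%:E))%:E)%E.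
    apply: cvg_EFin; first by near=> J.
    apply: (cprod s (fun J i => fine (\int[nuJ J i]_x (f i x)%:E)%E)) => i.
    by apply: fine_cvg; rewrite fineK ?intfin//; exact: cnu.
  rewrite (cvg_unique _ L L')//.
  by rewrite -prodEFin; apply: eq_bigr => i _; rewrite fineK// intfin.
pose G : set (set RR) := [set A | A = setT \/ exists x : R, A = `]-oo, x[%classic].
apply: (@indep_pi I X nu G) => //.
- have -> : @measurable _ RR = <<s RGenInftyO.G (R := R) >> by rewrite RGenInftyO.measurableE.
  apply/seteqP; split.
    by apply: sub_sigma_algebra2 => A [x ->]; right; exists x.
  apply: smallest_sub; first exact: smallest_sigma_algebra.
  move=> A [->|[x ->]]; last by apply: sub_sigma_algebra; exists x.
  by rewrite -[X in _ X](setCK setT) setCT -setTD; apply: sigma_algebraCD; exact: sigma_algebra0.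
- move=> A B [->|[x ->]] [->|[y ->]]; rewrite ?setTI ?setIT; first by left.
  + by right; exists y.
  + by right; exists x.
  + right; exists (Num.min x y); apply/seteqP; split=> z /=; rewrite !in_itv/= lt_min.
      by move=> [-> ->].
    by move/andP.
- by left.
move=> s B us GB.
have [f Hf] : exists f : I -> nat -> R -> R, forall i, [/\ forall m, continuous (f i m),
    forall m x, 0 <= f i m x <= 1 & forall x, f i m x @[m --> \oo] --> (\1_(B i) x : R)].
  suff : forall i, exists f : nat -> R -> R, [/\ forall m, continuous (f m),
    forall m x, 0 <= f m x <= 1 & forall x, f m x @[m --> \oo] --> (\1_(B i) x : R)].
    by move/choice => [f Hf]; exists f.
  move=> i; case: (GB i) => [->|[x ->]].
    exists (fun _ _ => 1); split.
    - by move=> m x; exact: cvg_cst.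
    - by move=> m x; rewrite ler01 lexx.
    - by move=> x; rewrite indicT; exact: cvg_cst.
  exists (ramp x); split; [exact: continuous_ramp|exact: ramp01|exact: cvg_ramp].
have mB i : measurable (B i).
  by case: (GB i) => [->|[x ->]]; [exact: measurableT|exact: measurable_itv].
have mf i m : measurable_fun setT (f i m : RR -> R) by apply: mcf; case: (Hf i).
have L : (\int[P]_w (\prod_(i <- s) f i m (X i w))%:E)%E @[m --> \oo] -->
      (\int[P]_w (\prod_(i <- s) (\1_(B i) (X i w)))%:E)%E.
  apply: bounded_cvg.
  - exact: probability_lty.
  - by move=> m; apply: measurable_prod => i _; exact: measurableT_comp (mf i m) (mX i).
  - by move=> m w; apply: prod01 => i; case: (Hf i).
  - by move=> w; apply: (cprod s (fun m i => f i m (X i w))) => i; case: (Hf i).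
have E m : (\int[P]_w (\prod_(i <- s) f i m (X i w))%:E = (\prod_(i <- s) fine (\int[nu i]_x (f i m x)%:E))%:E)%E.
  rewrite (stepA s (fun i => f i m))//; try by move=> i; case: (Hf i).
  rewrite -prodEFin; apply: eq_bigr => i _; rewrite fineK// intfin//.
  by case: (Hf i).
rewrite (funext E) in L.
have L' : ((\prod_(i <- s) fine (\int[nu i]_x (f i m x)%:E))%:E)%E @[m --> \oo] -->
      ((\prod_(i <- s) fine (nu i (B i)))%:E)%E.
  apply: cvg_EFin; first by near=> m.
  apply: (cprod s (fun m i => fine (\int[nu i]_x (f i m x)%:E)%E)) => i.
  apply: fine_cvg; rewrite fineK ?fin_num_measure//.
  have -> : nu i (B i) = (\int[nu i]_x (\1_(B i) x)%:E)%E by rewrite integral_indic// setIT.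
  apply: bounded_cvg; first exact: probability_lty.
  - by move=> m; exact: mf.
  - by case: (Hf i).
  - by case: (Hf i).
have := cvg_unique _ L L'; rewrite -prodEFin => e.
transitivity (\int[P]_w (\prod_(i <- s) \1_(B i) (X i w))%:E)%E; last first.
  by rewrite e//; apply: eq_bigr => i _; rewrite fineK// fin_num_measure.
have mA : measurable (\big[setI/setT]_(i <- s) (X i @^-1` B i)).
  by apply: bigsetI_measurable => k _; rewrite -[X in measurable X]setTI; exact: mX.
have := @integral_indic _ _ _ P setT measurableT _ mA; rewrite setIT => <-.
apply: eq_integral => w _; congr (_%:E).
elim: s {us mA L E L' e} => [|i s IH]; first by rewrite !big_nil indicT.
by rewrite !big_cons indicI /= IH.
Unshelve. all: by end_near. Qed.

End indep_limit.

Section law.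
Context d d' (T : measurableType d) (S : measurableType d') (R : realType).
Variables (P : probability T R) (h : T -> S) (mh : measurable_fun setT h).

Let h_mixin := isMeasurableFun.Build _ _ _ _ _ mh.
Let h_pack : {mfun T >-> S} := HB.pack h h_mixin.

Definition law : probability S R := distribution P h_pack.

Lemma lawE B : law B = P (h @^-1` B). Proof. by []. Qed.

Lemma integral_law (f : S -> \bar R) : measurable_fun setT f -> (forall x, 0 <= f x)%E ->
  (\int[law]_x f x = \int[P]_w f (h w))%E.
Proof. by move=> mf f0; rewrite -(integral_push P mh). Qed.

End law.

Lemma indep_comp d (T : measurableType d) (R : realType) (P : probability T R) (I : eqType)
    (X : I -> T -> measurableTypeR R) nu (g : I -> measurableTypeR R -> measurableTypeR R)
    (nu' : I -> probability (measurableTypeR R) R) : indep P X nu ->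
  (forall i, measurable_fun setT (g i)) ->
  (forall i B, measurable B -> nu i (g i @^-1` B) = nu' i B) ->
  indep P (fun i w => g i (X i w)) nu'.
Proof.
move=> [mX HX] mg gnu; split=> [i|s B us mB]; first exact: measurableT_comp (mg i) (mX i).
have mgB i : measurable (g i @^-1` B i) by rewrite -[X in measurable X]setTI; exact: mg.
by have := HX s (fun i => g i @^-1` B i) us mgB => ->; apply: eq_bigr => i _; rewrite gnu.
Qed.

(** * Independent uniforms from the binary digits of one uniform *)

Section uniform_splitting.
Context {R : realType}.
Local Notation RR := (measurableTypeR R).
Local Notation mu := (@lebesgue_measure R).

Definition U01 : set RR -> \bar R := mrestr mu (measurable_itv `[0%R, 1%R[).

HB.instance Definition _ := Measure.copy U01 (mrestr mu (measurable_itv `[0%R, 1%R[)).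

Let U01T : U01 setT = 1%E.
Proof. by rewrite /U01 /mrestr setTI lebesgue_measure_itv/= lte_fin ltr01 oppr0 adde0. Qed.

HB.instance Definition _ := @Measure_isProbability.Build _ _ _ U01 U01T.

Let half (w : RR) : bool := 2^-1 <= w.
Let dbl (w : RR) : RR := 2 * w - (half w)%:R.

Let mhalf : measurable_fun setT half.
Proof. by apply: measurable_fun_ler. Qed.

Let mhalfc (c : bool) : measurable [set w | half w = c].
Proof. by have := mhalf measurableT (Y := [set c]); rewrite setTI; apply. Qed.

Let mhalfR : measurable_fun setT (fun w => (half w)%:R : RR).
Proof.
have -> : (fun w => (half w)%:R : RR) = \1_(half @^-1` [set true]).
  by apply/funext => w; rewrite indicE; congr ((_ : bool)%:R); apply/idP/idP; rewrite inE.
by apply: measurable_indic; rewrite -[X in measurable X]setTI; apply: mhalf.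
Qed.

Let mdbl : measurable_fun setT dbl.
Proof. by apply: measurable_funB; [exact: measurable_funM|exact: mhalfR]. Qed.

Let pre (S : RR -> RR) (A : set RR) : measurable_fun setT S -> measurable A -> measurable (S @^-1` A).
Proof. by move=> mS mA; rewrite -[X in measurable X]setTI; exact: mS. Qed.

(** The first binary digit is a fair coin, and given its value the remaining digits, read by [dbl],
    are again uniform. *)
Let U01_half (c : bool) (A : set RR) : measurable A ->
  (2%:E * U01 ([set w | half w = c] `&` dbl @^-1` A) = U01 A)%E.
Proof.
move=> mA; rewrite /U01 /mrestr.
have c2 : 0 < 2 :> R by [].
rewrite [RHS](lebesgue_measure_affine (- c%:R) c2); last exact: measurableI.
congr (_ * mu _)%E; apply/seteqP; split=> w /=; rewrite !in_itv/=.
  move=> [[hc Aw] /andP[w0 w1]]; rewrite /dbl hc in Aw; split=> //.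
  move: hc; rewrite /half; case: c {Aw} => /= hc; first by apply/andP; split; lra.
  by move/negbT: hc; rewrite -ltNge => hc; apply/andP; split; lra.
move=> [Aw /andP[w0 w1]].
have hc : half w = c.
  by rewrite /half; case: c w0 w1 {Aw} => /= w0 w1; apply/idP; [lra|apply/negP; rewrite -ltNge; lra].
split; last by case: c w0 w1 {Aw hc} => /= w0 w1; apply/andP; split; lra.
by split=> //; rewrite /dbl hc.
Qed.

Let m (A : set RR) : R := fine (U01 A).

Let mE A : measurable A -> U01 A = (m A)%:E.
Proof. by move=> mA; rewrite /m fineK// fin_num_measure. Qed.

Let msplit (A : bool -> set RR) : (forall c, measurable (A c)) ->
  m [set w | A (half w) (dbl w)] = (m (A true) + m (A false)) / 2.
Proof.
move=> mA.
have mS c : measurable ([set w | half w = c] `&` dbl @^-1` A c).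
  apply: measurableI; last exact: (pre mdbl (mA c)).
  exact: mhalfc.
have -> : [set w | A (half w) (dbl w)] =
    ([set w | half w = true] `&` dbl @^-1` A true) `|` ([set w | half w = false] `&` dbl @^-1` A false).
  apply/seteqP; split=> w /=; first by case: (half w); [left|right].
  by move=> [[-> ?]|[-> ?]].
have mh c : m ([set w | half w = c] `&` dbl @^-1` A c) = m (A c) / 2.
  by rewrite /m -[U01 (A c)](U01_half c)// mE// -EFinM /= mulrC mulKf.
set S1 := _ `&` _; set S2 := _ `&` _.
have e : U01 (S1 `|` S2) = (U01 S1 + U01 S2)%E.
  rewrite measureU//; try exact: mS.
  by apply/seteqP; split=> w //= [[/= e1 _] [/= e2 _]]; rewrite e1 in e2.
by rewrite {1}/m e !mE ?/S1 ?/S2//= !mh mulrDl.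
Qed.

Fixpoint digits (J : nat) (w : RR) : RR :=
  if J is J'.+1 then ((half w)%:R + digits J' (dbl w)) / 2 else 0.

(** Reads every other binary digit, starting with the first; precomposed with [dbl] it reads the
    complementary ones. *)
Fixpoint even_digits (J : nat) (w : RR) : RR :=
  if J is J'.+1 then ((half w)%:R + even_digits J' (dbl (dbl w))) / 2 else 0.

Let mdigits J : measurable_fun setT (digits J).
Proof.
elim: J => [|J IH] /=; first exact: measurable_cst.
apply: measurable_funM => //; apply: measurable_funD; first exact: mhalfR.
exact: measurableT_comp IH mdbl.
Qed.

Let meven J : measurable_fun setT (even_digits J).
Proof.
elim: J => [|J IH] /=; first exact: measurable_cst.
apply: measurable_funM => //; apply: measurable_funD; first exact: mhalfR.
exact: measurableT_comp IH (measurableT_comp mdbl mdbl).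
Qed.

(** Exact at every finite depth: one more level consumes one digit for either reading, and both
    sides are averages over the four values of this pair of digits. *)
Let even_odd_law J A B : measurable A -> measurable B ->
  m (even_digits J @^-1` A `&` (even_digits J \o dbl) @^-1` B) =
  m (digits J @^-1` A) * m (digits J @^-1` B).
Proof.
elim: J A B => [|J IH] A B mA mB.
  have m1 C : m ((fun=> 0) @^-1` C) = (0 \in C)%:R.
    rewrite preimage_cst; case: ifPn => h; rewrite /m ?U01T//.
    by rewrite (measure0 U01).
  by rewrite -preimage_setI /= !m1 in_setI -natrM mulnb.
pose sh (c : bool) (C : set RR) : set RR := [set y | C ((c%:R + y) / 2)].
have msh c C : measurable C -> measurable (sh c C).
  move=> mC; apply: (pre (S := fun y => (c%:R + y) / 2)) => //.
  by apply: measurable_funM => //; apply: measurable_funD.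
have dE C : measurable C -> m (digits J.+1 @^-1` C) =
    (m (digits J @^-1` sh true C) + m (digits J @^-1` sh false C)) / 2.
  by move=> mC; rewrite -(msplit (A := fun c => digits J @^-1` sh c C))// => c; exact: (pre (mdigits J) (msh c _ mC)).
pose BB c c' : set RR := even_digits J @^-1` sh c A `&` (even_digits J \o dbl) @^-1` sh c' B.
have mBB c c' : measurable (BB c c').
  apply: measurableI; first exact: (pre (meven J) (msh _ _ mA)).
  exact: (pre (measurableT_comp (meven J) mdbl) (msh _ _ mB)).
have mBB2 c : measurable [set w | BB c (half w) (dbl w)].
  have -> : [set w | BB c (half w) (dbl w)] =
    ([set w | half w = true] `&` dbl @^-1` BB c true) `|` ([set w | half w = false] `&` dbl @^-1` BB c false).
    apply/seteqP; split=> w /=; first by case: (half w); [left|right].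
    by move=> [[-> ?]|[-> ?]].
  apply: measurableU; apply: measurableI; try exact: (pre mdbl (mBB _ _));
    exact: mhalfc.
transitivity (m [set w | [set v | BB (half w) (half v) (dbl v)] (dbl w)]).
  by congr m; apply/seteqP; split.
rewrite (msplit (A := fun c => [set v | BB c (half v) (dbl v)]))//.
rewrite !(msplit (A := BB _))// !IH ?dE//; try exact: msh.
by field.
Qed.

(** Sends the points outside [0, 1) to 0, so that the digit expansions converge for every [w]; [U01]
    does not see the change. *)
Let clip (w : RR) : RR := if 0 <= w < 1 then w else 0.

Let mclip : measurable_fun setT clip.
Proof.
apply: measurable_fun_ifT => //; apply: measurable_and; first exact: measurable_fun_ler.
exact: measurable_fun_ltr.
Qed.

Let U01_clip (f : RR -> RR) A : U01 ((f \o clip) @^-1` A) = U01 (f @^-1` A).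
Proof.
rewrite /U01 /mrestr; congr (mu _); apply/seteqP; split=> w /=; rewrite in_itv/= => -[+ w01];
  by rewrite /clip w01.
Qed.

Let cvg_digits w : (digits J (clip w) : R) @[J --> \oo] --> (clip w : R).
Proof.
have [c0 c1] : 0 <= clip w /\ clip w < 1.
  by rewrite /clip; case: ifPn => [/andP[]//|_]; rewrite ltr01.
move: (clip w) c0 c1 => {}w w0 w1.
have dB J v : 0 <= v -> v < 1 -> `|digits J v - v| <= 2^-1 ^+ J.
  elim: J v => [|J IH] v v0 v1; first by rewrite /= sub0r normrN ger0_norm// expr0 ltW.
  have [d0 d1] : 0 <= dbl v /\ dbl v < 1.
    by rewrite /dbl /half; case: (lerP 2^-1 v) => h /=; split; lra.
  have -> : digits J.+1 v - v = (digits J (dbl v) - dbl v) / 2.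
    have dv : 2 * v = (half v)%:R + dbl v by rewrite /dbl; ring.
    by rewrite /=; lra.
  by rewrite normrM exprS mulrC (ger0_norm (_ : 0 <= 2^-1))// ler_wpM2l// IH.
have H : (2^-1 : R) ^+ J @[J --> \oo] --> (0 : R) by apply: cvg_expr; rewrite ger0_norm//; lra.
have H0 : (digits J w - w : R) @[J --> \oo] --> (0 : R).
  apply: norm_cvg0; apply: (squeeze_cvgr _ (cvg_cst 0) H).
  by near=> J; rewrite normr_ge0 dB.
rewrite (_ : (fun J => digits J w : R) = (fun J => digits J w - w + w)); last first.
  by apply/funext => J; rewrite subrK.
by rewrite -[X in _ --> X]add0r; apply: cvgD => //; exact: cvg_cst.
Unshelve. all: by end_near. Qed.

Let even01 J w : 0 <= even_digits J w <= 1.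
Proof.
elim: J w => [|J IH] w /=; first by rewrite lexx ler01.
by have := IH (dbl (dbl w)); case: (half w) => /= /andP[? ?]; apply/andP; split; lra.
Qed.

Let even_incr J w : even_digits J w <= even_digits J.+1 w.
Proof.
elim: J w => [|J IH] w; first by have := even01 1 w => /andP[].
by rewrite /=; have := IH (dbl (dbl w)); rewrite /=; lra.
Qed.

Let E (w : RR) : RR := limn (fun J => even_digits J w : R).

Let cvgE w : (even_digits J w : R) @[J --> \oo] --> (E w : R).
Proof.
apply: nondecreasing_is_cvgn; first by apply/nondecreasing_seqP => J; exact: even_incr.
by exists 1 => _ [J _ <-]; case/andP: (even01 J w).
Qed.

Let indep_EO : indep U01 (fun b : bool => if b then E else E \o dbl) (fun=> U01).
Proof.
have mDc J : measurable_fun setT (digits J \o clip) := measurableT_comp (mdigits J) mclip.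
apply: (@indep_limit _ _ _ _ _ (fun J b => if b then even_digits J else even_digits J \o dbl) _
  (fun J _ => law U01 (mDc J))).
- move=> J; apply: indep_cofinal => [[]|s]; [exact: meven|exact: measurableT_comp (meven J) mdbl|].
  exists [:: true; false]; split=> // [[]//|B mB].
  rewrite !big_cons !big_nil setIT mule1 !lawE /= !(U01_clip (digits J)).
  have mm := mE (pre (mdigits J) (mB _)).
  rewrite !mm -EFinM -even_odd_law// mE//; apply: measurableI.
    exact: (pre (meven J) (mB _)).
  exact: (pre (measurableT_comp (meven J) mdbl) (mB _)).
- by move=> [] w /=; exact: cvgE.
move=> _ f cf f01.
have mf : measurable_fun setT (f : RR -> R) by exact: continuous_measurable_fun.
have mfE : measurable_fun setT (fun x : RR => (f x)%:E) by exact/measurable_EFinP.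
have f0 x : (0 <= (f x)%:E)%E by rewrite lee_fin; case/andP: (f01 x).
have -> : (\int[U01]_x (f x)%:E = \int[U01]_x (f (clip x))%:E)%E.
  rewrite -(integral_law U01 mclip mfE f0); apply: eq_measure_integral => A mA _.
  exact: esym (U01_clip id A).
rewrite (_ : (fun J => _) = (fun J => \int[U01]_x (f (digits J (clip x)))%:E)%E); last first.
  by apply/funext => J; rewrite (integral_law U01 (mDc J) mfE f0).
apply: bounded_cvg => //; first exact: probability_lty.
- by move=> J; exact: measurableT_comp mf (mDc J).
- by move=> w; exact: cvg_comp (@cvg_digits w) (cf _).
Qed.

Lemma exists_iid_uniform : exists X : nat -> RR -> RR, indep U01 X (fun=> U01).
Proof.
have mE_ : measurable_fun setT E by exact: (indep_measurable indep_EO true).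
have mO : measurable_fun setT (E \o dbl) by exact: (indep_measurable indep_EO false).
pose O := E \o dbl.
(* Variable [i] is the even half of what is left after [i] passages to the odd half; every remainder
   is uniform again and independent of the part taken off. *)
exists (fun i => E \o iter i O).
have mi i : measurable_fun setT (iter i O).
  by elim: i => [|i IH] //=; [exact: measurable_id|exact: measurableT_comp].
have mX i : measurable_fun setT (E \o iter i O) by exact: measurableT_comp.
apply: indep_cofinal => // s; exists (iota 0 (\max_(i <- s) i).+1); split; first exact: iota_uniq.
  by move=> i is_; rewrite mem_iota /= add0n ltnS; exact: (@leq_bigmax_seq _ s xpredT id).
move: (_.+1) => k; elim: k => [|k IH] B mB.
  by rewrite !big_nil; exact: probability_setT.
rewrite /= !big_cons.
set A := \big[setI/setT]_(j <- iota 0 k) ((E \o iter j O) @^-1` B j.+1).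
have mA : measurable A by apply: bigsetI_measurable => j _; exact: pre.
have -> : \big[setI/setT]_(j <- iota 1 k) ((E \o iter j O) @^-1` B j) = O @^-1` A.
  rewrite /A (iotaDl 1 0) big_map !bigsetI_preimage_id.
  by apply/seteqP; split=> w /= H j /H; rewrite -iterSr.
have mB2 (b : bool) : measurable (if b then B 0%N else A) by case: b.
have := indepE (s := [:: true; false]) indep_EO isT mB2.
rewrite !big_cons !big_nil setIT mule1 => ->; congr (_ * _)%E.
by rewrite /A IH// (iotaDl 1 0) big_map.
Qed.

End uniform_splitting.

(** * The normal distribution function *)

Section normal_cdf.
Context {R : realType}.
Local Notation RR := (measurableTypeR R).
Local Notation mu := (@lebesgue_measure R).

Definition Phi (x : R) : R := fine (@N01 R `]-oo, x]%classic).

Lemma PhiE x : @N01 R `]-oo, x]%classic = (Phi x)%:E.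
Proof. by rewrite /Phi fineK// fin_num_measure. Qed.

Lemma Phi_ge0 x : 0 <= Phi x. Proof. exact: fine_ge0. Qed.

Lemma N01_itv x y : x <= y -> @N01 R `]x, y]%classic = (Phi y - Phi x)%:E.
Proof.
move=> xy; have -> : `]x, y]%classic = `]-oo, y]%classic `\` `]-oo, x]%classic :> set R.
  apply/seteqP; split=> z /=; rewrite !in_itv/=.
    by move=> /andP[xz zy]; split=> //; apply/negP; rewrite -ltNge.
  by move=> [zy /negP]; rewrite -ltNge => xz; apply/andP.
rewrite measureD//=; last by rewrite -ge0_fin_numE// fin_num_measure.
rewrite (_ : _ `&` _ = `]-oo, x]%classic); last first.
  apply/seteqP; split=> z /=; rewrite !in_itv/=; first by case.
  by move=> zx; split=> //; exact: le_trans xy.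
rewrite -!/(@N01 R _).
by have := PhiE x; have := PhiE y; rewrite /= => -> ->; rewrite EFinB.
Qed.

Let pk : R := normal_peak 1.
Let pk0 : 0 < pk. Proof. by rewrite normal_peak_gt0// oner_neq0. Qed.
Lemma phi_le_peak x : phi x <= pk.
Proof. by apply: normal_pdf_ub; rewrite oner_neq0. Qed.

Lemma Phi_lipschitz x y : x <= y -> Phi y - Phi x <= pk * (y - x).
Proof.
move=> xy; rewrite -lee_fin -N01_itv// /N01 /= /normal_prob.
apply: (@le_trans _ _ (\int[mu]_(z in `]x, y]) pk%:E)%E); last first.
  rewrite integral_cst//= lebesgue_measure_itv/= lte_fin.
  case: ifPn => [_|_]; first by rewrite -EFinD -EFinM lexx.
  by rewrite mule0 lee_fin mulr_ge0 ?subr_ge0// ltW.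
apply: ge0_le_integral => //=.
- by move=> z _; rewrite lee_fin phi_ge0.
- by apply: measurable_funTS; apply/measurable_EFinP; exact: measurable_phi.
- by move=> z _; rewrite lee_fin; exact: phi_le_peak.
Qed.

Lemma Phi_incr_ge (c x y : R) : x <= y -> (forall z, x <= z <= y -> c <= phi z) -> 0 <= c ->
  c * (y - x) <= Phi y - Phi x.
Proof.
move=> xy cz c0; rewrite -[leRHS]/(_) -lee_fin -N01_itv// /N01 /= /normal_prob.
apply: (@le_trans _ _ (\int[mu]_(z in `]x, y]) c%:E)%E).
  rewrite integral_cst//= lebesgue_measure_itv/= lte_fin.
  case: ifPn => [//|]; rewrite -leNgt => yx.
  by rewrite mule0 lee_fin; have -> : y = x; [apply/eqP; rewrite eq_le xy yx|rewrite subrr mulr0].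
apply: ge0_le_integral => //=.
- by apply: measurable_funTS; apply/measurable_EFinP; exact: measurable_phi.
- by move=> z; rewrite in_itv/= => /andP[xz zy]; rewrite lee_fin; apply: cz; rewrite zy ltW.
Qed.

Lemma Phi_lt x y : x < y -> Phi x < Phi y.
Proof.
move=> xy; rewrite -subr_gt0.
pose c := pk * expR (- (x ^+ 2 + y ^+ 2)).
have c0 : 0 < c by rewrite mulr_gt0// expR_gt0.
apply: (lt_le_trans (_ : 0 < c * (y - x))); first by rewrite mulr_gt0// subr_gt0.
apply: Phi_incr_ge; rewrite ?ltW// => z /andP[xz zy].
rewrite phiE /c ler_pM2l// ler_expR lerN2.
have : 0 <= (z - x) * (y - z) by rewrite mulr_ge0// subr_ge0.
by have := sqr_ge0 (x - y); nra.
Qed.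

Lemma Phi_le x y : (Phi x <= Phi y) = (x <= y).
Proof.
apply/idP/idP => [|]; last by rewrite le_eqVlt => /predU1P[->//|/Phi_lt /ltW].
by apply: contraTT; rewrite -!ltNge => /Phi_lt.
Qed.

Lemma Phi_lt1 x : Phi x < 1.
Proof.
apply: (lt_le_trans (Phi_lt (_ : x < x + 1))); first by rewrite ltrDl.
by rewrite -lee_fin -PhiE; exact: probability_le1.
Qed.

Lemma Phi_gt0 x : 0 < Phi x.
Proof. by apply: le_lt_trans (Phi_ge0 (x - 1)) (Phi_lt _); rewrite ltrBlDr ltrDl. Qed.

Lemma continuous_Phi : continuous Phi.
Proof.
move=> x; apply/cvgrPdist_lt => e e0; near=> y.
have H a b : a <= b -> `|Phi a - Phi b| <= pk * `|a - b|.
  move=> ab; rewrite distrC ger0_norm ?subr_ge0 ?Phi_le// distrC ger0_norm ?subr_ge0//.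
  exact: Phi_lipschitz.
have H2 : `|Phi x - Phi y| <= pk * `|x - y|.
  have [xy|/ltW xy] := leP x y; first exact: H.
  by rewrite distrC [`|x - y|]distrC; exact: H.
apply: le_lt_trans H2 _; rewrite mulrC -ltr_pdivlMr//.
by near: y; apply: cvgr_dist_lt; rewrite ?divr_gt0//; exact: cvg_id.
Unshelve. all: by end_near. Qed.

Lemma Phi_opp x : Phi (- x) = 1 - Phi x.
Proof.
have mI (A : set RR) : measurable A -> measurable_fun setT (fun z : RR => (\1_A z * phi z)%:E).
  by move=> mA; apply/measurable_EFinP; apply: measurable_funM => //; exact: measurable_phi.
have NE (A : set RR) : measurable A -> @N01 R A = (\int[mu]_z (\1_A z * phi z)%:E)%E.
  move=> mA; have := @integral_indic _ _ _ (@N01 R) setT measurableT A mA; rewrite setIT => <-.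
  have h0 z : (0 <= (\1_A z : R)%:E)%E by rewrite lee_fin.
  have h1 : measurable_fun setT (fun z : RR => (\1_A z : R)%:E) by exact/measurable_EFinP.
  by rewrite (integral_N01 h0 h1).
have e : @N01 R `]-oo, - x]%classic = @N01 R `[x, +oo[%classic.
  rewrite !NE// (integral_affine (c := -1) 0) ?oppr_eq0 ?oner_eq0//; last 2 first.
  - by move=> z; rewrite lee_fin mulr_ge0// phi_ge0.
  - exact: mI.
  rewrite normrN1 mul1e; apply: eq_integral => z _; congr (_%:E).
  rewrite addr0 mulN1r !phiE sqrrN !indicE; congr ((_ : bool)%:R * _).
  by apply/idP/idP; rewrite !inE/= !in_itv/= lerN2 ?andbT.
have := PhiE (- x); rewrite e (_ : `[x, +oo[%classic = ~` `]-oo, x[%classic); last first.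
  by apply/seteqP; split=> z /=; rewrite !in_itv/= andbT leNgt => /negP.
have lt : @N01 R `]-oo, x[%classic = (Phi x)%:E.
  rewrite -PhiE /N01 /= /normal_prob integral_itv_bndo_bndc//.
  by apply: measurable_funTS; apply/measurable_EFinP; exact: measurable_phi.
rewrite probability_setC// lt -EFinB => h.
by have := congr1 fine h.
Qed.

Lemma Phi_surj p : 0 < p < 1 -> exists x, Phi x = p.
Proof.
have ub q : q < 1 -> exists b, q <= Phi b.
  move=> q1; apply: contrapT => /forallNP H.
  have L : ((@N01 R) `]-oo, k%:R]%classic @[k --> \oo] --> (@N01 R) setT)%E.
    have -> : [set: RR] = \bigcup_k `]-oo, k%:R]%classic.
      apply/esym/seteqP; split=> // x _; exists (Num.truncn `|x|).+1 => //=; rewrite in_itv/=.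
      by rewrite (le_trans (ler_norm x))// ltW// truncnS_gt.
    apply: nondecreasing_cvg_mu => //; first by apply: bigcup_measurable.
    apply/nondecreasing_seqP => k; apply/subsetPset => x /=; rewrite !in_itv/= => /le_trans; apply.
    by rewrite ler_nat.
  have : ((@N01 R) setT <= q%:E)%E.
    rewrite -(cvg_lim _ L)//; apply: lime_le; first by apply/cvg_ex; exists ((@N01 R) setT).
    by apply: nearW => k; rewrite PhiE lee_fin ltW// ltNge; exact/negP/H.
  by rewrite N01T lee_fin leNgt q1.
move=> /andP[p0 p1].
have [b pb] := ub p p1.
have [a' pa'] : exists b, 1 - p <= Phi b by apply: ub; rewrite gtrBl.
pose a := - a'.
have pa : Phi a <= p by rewrite Phi_opp lerBlDr -lerBlDl.
have ab : a <= b by rewrite -Phi_le (le_trans pa).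
have pm : Num.min (Phi a) (Phi b) <= p <= Num.max (Phi a) (Phi b) by rewrite min_l ?max_r ?Phi_le// pa.
have [c _ <-] := @IVT R Phi a b p ab (continuous_subspaceT continuous_Phi) pm.
by exists c.
Qed.

Lemma N01_Phi_le p : 0 <= p <= 1 -> @N01 R [set z | Phi z <= p] = p%:E.
Proof.
move=> /andP[]; rewrite le_eqVlt => /predU1P[<- _|p0].
  rewrite (_ : [set _ | _] = set0) ?measure0//.
  by apply/seteqP; split=> z //=; rewrite leNgt Phi_gt0.
rewrite le_eqVlt => /predU1P[->|p1].
  rewrite (_ : [set _ | _] = setT); first exact: probability_setT.
  by apply/seteqP; split=> z //= _; rewrite ltW// Phi_lt1.
have [c cp] := Phi_surj (introT andP (conj p0 p1)).
rewrite -cp (_ : [set _ | _] = `]-oo, c]%classic) ?PhiE//.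
by apply/seteqP; split=> z /=; rewrite in_itv/= Phi_le.
Qed.

(** The value 0 outside ]0, 1[ is arbitrary; within [0, 1) it concerns only the point 0, of measure
    zero. *)
Definition invPhi (u : R) : R := if pselect (0 < u < 1) is left H then sval (cid (Phi_surj H)) else 0.

Lemma invPhiK u : 0 < u < 1 -> Phi (invPhi u) = u.
Proof. by rewrite /invPhi; case: pselect => // H _; exact: (svalP (cid (Phi_surj H))). Qed.

Lemma invPhi_lt u x : 0 < u < 1 -> (invPhi u < x) = (u < Phi x).
Proof. by move=> u01; rewrite !ltNge -Phi_le invPhiK. Qed.

Lemma measurable_invPhi : measurable_fun setT (invPhi : RR -> RR).
Proof.
apply: (measurability _ (RGenInftyO.measurableE R)) => _ [_ [x ->] <-].
rewrite setTI.
have -> : invPhi @^-1` `]-oo, x[%classic = (`]0, 1[%classic `&` `]-oo, Phi x[%classic) `|`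
    (~` `]0, 1[%classic `&` [set u | 0 < x]) :> set RR.
  apply/seteqP; split=> u /=; rewrite !in_itv/=; have [u01|u01] := boolP (0 < u < 1).
  - by rewrite invPhi_lt// => h; left.
  - by rewrite /invPhi; case: pselect => [h|_ h]; [rewrite h in u01|right].
  - by rewrite invPhi_lt// => -[[]|[]].
  - by rewrite /invPhi; case: pselect => [h|_]; [rewrite h in u01|move=> [[]|[]]].
apply: measurableU; apply: measurableI => //; first exact: measurableC.
by have [x0|x0] := boolP (0 < x); [rewrite (_ : [set _ | _] = setT)//|rewrite (_ : [set _ | _] = set0)//];
  apply/seteqP; split=> // u /= h; rewrite h in x0.
Qed.

Lemma U01_lt (p : R) : 0 <= p <= 1 -> @U01 R [set u | u < p] = p%:E.
Proof.
move=> /andP[p0 p1]; rewrite /U01 /mrestr.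
rewrite (_ : _ `&` _ = `[0, p[%classic); last first.
  apply/seteqP; split=> u /=; rewrite !in_itv/=; first by move=> [-> /andP[-> _]].
  by move=> /andP[-> up]; rewrite up; split=> //=; apply: lt_le_trans up _.
rewrite lebesgue_measure_itv/= lte_fin; case: ifPn => [_|]; rewrite ?oppr0 ?adde0// -leNgt => ?.
by congr (_%:E); apply/eqP; rewrite eq_le p0.
Qed.

Lemma N01_lt x : @N01 R `]-oo, x[%classic = (Phi x)%:E.
Proof.
rewrite -PhiE /N01 /= /normal_prob integral_itv_bndo_bndc//.
by apply: measurable_funTS; apply/measurable_EFinP; exact: measurable_phi.
Qed.

(** By [invPhi_lt] the preimage of a half-line is, within ]0, 1[, an interval of length [Phi x];
    half-lines determine the law. *)
Lemma U01_invPhi (B : set RR) : measurable B -> (@U01 R) (invPhi @^-1` B) = @N01 R B.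
Proof.
move=> mB.
have mG : @measurable _ RR = <<s RGenInftyO.G (R := R) >> by rewrite RGenInftyO.measurableE.
pose g k : set RR := `]-oo, k%:R[%classic.
have HI : setI_closed (RGenInftyO.G (R := R)).
  move=> _ _ [x ->] [y ->]; exists (Num.min x y); apply/seteqP; split=> z /=; rewrite !in_itv/= lt_min.
    by move=> [-> ->].
  by move/andP.
have Hg k : RGenInftyO.G (g k) by exists k%:R.
have Hc : \bigcup_k g k = setT.
  apply/seteqP; split=> // x _; exists (Num.truncn `|x|).+1 => //=; rewrite /g /= in_itv/=.
  by rewrite (le_lt_trans (ler_norm x))// truncnS_gt.
have HE A : RGenInftyO.G A -> push (@U01 R) measurable_invPhi A = @N01 R A.
  move=> [x ->].
  have -> : push (@U01 R) measurable_invPhi `]-oo, x[%classic = (@U01 R) (invPhi @^-1` `]-oo, x[%classic) by [].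
  rewrite N01_lt -(U01_lt (p := Phi x)); last by rewrite Phi_ge0 ltW// Phi_lt1.
  (* the two sets only differ at 0 *)
  have P01 : 0 < Phi x < 1 by rewrite Phi_gt0 Phi_lt1.
  have e0 : (@U01 R) [set 0] = 0%E.
    rewrite /U01 /mrestr (_ : _ `&` _ = [set 0]) ?lebesgue_measure_set1//.
    by apply/seteqP; split=> u /=; [case|move=> ->; rewrite in_itv/= lexx ltr01].
  pose D := `]0, Phi x[%classic : set RR.
  have mD : measurable D by exact: measurable_itv.
  have m0 : measurable ([set 0] : set RR) by exact: measurable_set1.
  have D0 : (@U01 R) D = (@U01 R) [set u | u < Phi x].
    have -> : (@U01 R) [set u | u < Phi x] = (@U01 R) (D `|` [set 0]).
      rewrite /U01 /mrestr; congr (lebesgue_measure _); apply/seteqP; split=> u /=; rewrite !in_itv/=.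
        move=> [ux /andP[u0 u1]]; split; last by rewrite u0.
        by move: u0; rewrite le_eqVlt => /predU1P[<-|u0]; [right|left; rewrite /D /= in_itv/= u0].
      by rewrite /D /= in_itv/= => -[[/andP[_ ->]//|->] ->]; rewrite Phi_gt0.
    by rewrite measureU0.
  rewrite -D0; transitivity ((@U01 R) (D `|` ((invPhi @^-1` `]-oo, x[%classic) `&` [set 0]))).
    rewrite /U01 /mrestr; congr (lebesgue_measure _); apply/seteqP; split=> u /=; rewrite !in_itv/=.
      move=> [ux /andP[u0 u1]]; split; last by rewrite u0.
      move: u0; rewrite le_eqVlt => /predU1P[u0|u0]; first by right; rewrite -u0 in ux *.
      by left; rewrite /D /= in_itv/= u0 -invPhi_lt ?u0.
    move=> [[uD|[]//] u01]; split=> //; move: uD; rewrite /D /= in_itv/= => /andP[u0 uP].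
    by rewrite invPhi_lt// u0; case/andP: u01.
  have mI : measurable ((invPhi @^-1` `]-oo, x[%classic) `&` [set 0] : set RR).
    by apply: measurableI => //; rewrite -[X in measurable X]setTI; exact: measurable_invPhi.
  rewrite measureU0//; apply/eqP; rewrite eq_le measure_ge0 andbT -e0.
  by apply: le_measure; rewrite ?inE.
have Hf k : (push (@U01 R) measurable_invPhi (g k) < +oo)%E.
  apply: (@le_lt_trans _ _ 1%E); last exact: ltry.
  by apply: (@probability_le1 _ _ _ (law (@U01 R) measurable_invPhi)); exact: measurable_itv.
have := @measure_unique _ R RR (RGenInftyO.G (R := R)) g mG HI Hg Hc.
move=> /(_ (push (@U01 R) measurable_invPhi)) H1.
have H2 := H1 (@N01 R).
exact: (H2 HE Hf B mB).
Qed.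

Lemma exists_iid_normal : exists X : nat -> RR -> RR, iid (@U01 R) X.
Proof.
have [U HU] := @exists_iid_uniform R.
exists (fun i w => invPhi (U i w)).
apply: (indep_comp HU (g := fun=> invPhi)) => [_|_ B mB]; first exact: measurable_invPhi.
exact: U01_invPhi.
Qed.

End normal_cdf.

(** * Sums of independent normals over consecutive blocks *)

Section block_sums.
Context d (T : measurableType d) (R : realType) (P : probability T R).
Local Notation RR := (measurableTypeR R).

Let merged (L : eqType) (X : L + nat -> T -> RR) (m : nat) : option L + nat -> T -> RR := fun k w =>
  match k with
  | inl None => (\sum_(c < m) X (inr (c : nat)) w) / Num.sqrt m%:R
  | inl (Some l) => X (inl l) w
  | inr c => X (inr (m + c)%N) w
  end.

(** Adding one variable to a normalized sum of m + 1 normals is a plane rotation with coefficients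
    sqrt ((m + 1) / (m + 2)) and sqrt (1 / (m + 2)); the second rotated coordinate is discarded. *)
Let iid_merged (L : eqType) (X : L + nat -> T -> RR) (m : nat) : iid P X -> iid P (merged X m.+1).
Proof.
move=> iX; elim: m => [|m IH].
  pose f (k : option L + nat) : L + nat := match k with
    inl None => inr 0%N | inl (Some l) => inl l | inr c => inr c.+1 end.
  have finj : injective f.
    by move=> [[l|]|c] [[l'|]|c'] //= [] => [->|->].
  have := indep_reindex finj iX; congr (iid P _); apply/funext => -[[l|]|c] //=.
  by apply/funext => w; rewrite /merged big_ord1 sqrtr1 divr1.
pose a : R := Num.sqrt (m.+1%:R / m.+2%:R); pose b : R := Num.sqrt (m.+2%:R^-1).
have b0 : b != 0 by rewrite gt_eqF// sqrtr_gt0 invr_gt0.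
have ab : a ^+ 2 + b ^+ 2 = 1.
  rewrite !sqr_sqrtr ?divr_ge0 ?invr_ge0// -[X in _ + X]mul1r -mulrDl natr1 divff//.
pose f (k : unit * bool + (L + nat)) : option L + nat := match k with
  inl (_, true) => inl None | inl (_, false) => inr 0%N | inr (inl l) => inl (Some l) | inr (inr c) => inr c.+1 end.
have finj : injective f.
  by move=> [[[] []]|[l|c]] [[[] []]|[l'|c']] //= [] => [->|->].
pose g (k : option L + nat) : unit * bool + (L + nat) := match k with
  inl None => inl (tt, true) | inl (Some l) => inr (inl l) | inr c => inr (inr c) end.
have ginj : injective g by move=> [[l|]|c] [[l'|]|c'] //= [] => [->|->].
have := indep_reindex ginj (iid_rotate b0 ab (indep_reindex finj IH)).
congr (iid P _); apply/funext => -[[l|]|c] //=; apply/funext => w /=.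
  rewrite [in RHS]big_ord_recr /= addn0 mulrDl; congr (_ + _).
    rewrite mulrCA; congr (_ * _); rewrite /a sqrtrM// mulrAC sqrtrV// mulfV ?mul1r//.
  by rewrite mulrC /b sqrtrV.
by rewrite [in RHS]addSnnS.
Qed.

Lemma measurable_scale (s : R) : measurable_fun setT (fun x : RR => s * x : RR).
Proof. exact: measurable_funM. Qed.

(** As an image of [N01] this makes sense at s = 0 too, where it is the point mass at 0, the law of
    an empty block sum. *)
Definition scaled_normal (s : R) : probability RR R := law (@N01 R) (measurable_scale s).

Lemma scaled_normalE s B : scaled_normal s B = N01 ((fun x => s * x) @^-1` B).
Proof. by []. Qed.

Let block (X : nat -> T -> RR) (b m : nat) w : RR := \sum_(c < m) X (b + c)%N w.

Fixpoint offset (ms : seq nat) (i : nat) : nat :=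
  if i is i'.+1 then (head 0 ms + offset (behead ms) i')%N else 0%N.

(** Blocks are merged one by one: a finished block becomes an additional spectator, an index of
    [option L], and the induction goes on with the variables that remain. *)
Let block_law (N : set RR -> \bar R) (nu : nat -> set RR -> \bar R) (ms : seq nat) (L : eqType) (X : L + nat -> T -> RR) (s : seq L) (C : L -> set RR)
    (B : nat -> set RR) : (forall A, N01 A = N A) -> (forall m A, scaled_normal (Num.sqrt m%:R) A = nu m A) ->
  iid P X -> uniq s -> (forall l, measurable (C l)) -> (forall i, measurable (B i)) ->
  P (\big[setI/setT]_(l <- s) (X (inl l) @^-1` C l) `&`
     \big[setI/setT]_(i < size ms) (block (fun c => X (inr c)) (offset ms i) (nth 0%N ms i) @^-1` B i)) =
  (\prod_(l <- s) N (C l) * \prod_(i < size ms) nu (nth 0%N ms i) (B i))%E.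
Proof.
move=> NE nuE; elim: ms L X s C B => [|m ms IH] L X s C B iX us mC mB.
  rewrite !big_ord0 setIT mule1.
  have linj : injective (@inl L nat) by move=> l l' [].
  by rewrite (indepE (indep_reindex linj iX))//; apply: eq_bigr => l _; exact: NE.
rewrite /= !big_ord_recl.
have e3 : (\prod_(i < size ms) nu (nth 0%N (m :: ms) (lift ord0 i)) (B (lift ord0 i)) =
   \prod_(i < size ms) nu (nth 0%N ms i) (B i.+1))%E.
  by apply: eq_bigr => i _; rewrite lift0.
rewrite e3 {e3}; case: m => [|m].
  have -> : nu (nth 0%N (0%N :: ms) (ord0 : 'I_(size ms).+1)) (B (ord0 : 'I_(size ms).+1)) = (((0 : R) \in B 0%N)%:R)%:E.
    rewrite -nuE scaled_normalE /= sqrtr0; under [X in X @^-1` _]eq_fun do rewrite mul0r.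
    rewrite preimage_cst; case: ifPn => _; first exact: probability_setT.
    exact: measure0.
  have -> : block (fun c => X (inr c)) (offset (0%N :: ms) (ord0 : 'I_(size ms).+1)) (nth 0%N (0%N :: ms) (ord0 : 'I_(size ms).+1)) = fun=> 0.
    by apply/funext => w; rewrite /block big_ord0.
  rewrite preimage_cst.
  have -> : \big[setI/setT]_(i < size ms) (block (fun c => X (inr c)) (offset (0%N :: ms) (lift ord0 i)) (nth 0%N (0%N :: ms) (lift ord0 i)) @^-1` B (lift ord0 i)) =
     \big[setI/setT]_(i < size ms) (block (fun c => X (inr c)) (offset ms i) (nth 0%N ms i) @^-1` B i.+1).
    by apply: eq_bigr => i _; rewrite lift0.
  have := IH L X s C (fun i => B i.+1) iX us mC (fun i => mB i.+1).
  case: ifPn => _ /=; first by rewrite setTI mul1e => <-.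
  by rewrite set0I setI0 measure0 mul0e mule0.
pose C' (l : option L) : set RR := if l is Some l then C l else (fun x => Num.sqrt m.+1%:R * x) @^-1` B 0%N.
have mC' l : measurable (C' l).
  case: l => [l|] /=; first exact: mC.
  by rewrite -[X in measurable X]setTI; apply: measurable_scale.
have := IH _ _ (None :: map Some s) C' (fun i => B i.+1) (iid_merged m iX) _ mC' (fun i => mB i.+1).
rewrite /= map_inj_uniq ?us; last by move=> ? ? [].
rewrite andbT (_ : None \notin map Some s); last by apply/mapP => -[].
move=> /(_ isT); rewrite !big_cons !big_map (_ : N (C' None) = nu m.+1 (B 0%N)); last by rewrite -NE -nuE.
move=> H.
have e1 : block (fun c => X (inr c)) (offset (m.+1 :: ms) (ord0 : 'I_(size ms).+1)) (nth 0%N (m.+1 :: ms) (ord0 : 'I_(size ms).+1)) @^-1` B 0%N =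
    merged X m.+1 (inl None) @^-1` C' None.
  apply/seteqP; split=> w /=; rewrite /block/= mulrCA divff ?mulr1 ?gt_eqF ?sqrtr_gt0//;
  by under eq_bigr do rewrite add0n.
have e2 : \big[setI/setT]_(i < size ms) (block (fun c => X (inr c)) (offset (m.+1 :: ms) (lift ord0 i)) (nth 0%N (m.+1 :: ms) (lift ord0 i)) @^-1` B (lift ord0 i)) =
   \big[setI/setT]_(i < size ms) (block (fun c => merged X m.+1 (inr c)) (offset ms i) (nth 0%N ms i) @^-1` B i.+1).
  apply: eq_bigr => i _; rewrite lift0.
  have -> // : block (fun c => X (inr c)) (offset (m.+1 :: ms) i.+1) (nth 0%N (m.+1 :: ms) i.+1) =
      block (fun c => merged X m.+1 (inr c)) (offset ms i) (nth 0%N ms i).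
  by apply/funext => w; apply: eq_bigr => c _ /=; rewrite addnA.
rewrite [RHS]muleCA [RHS]muleA -H; congr (P _).
by rewrite e1 e2 setICA setIA.
Qed.

Lemma indep_block_sums (X : nat -> T -> RR) (ms : seq nat) (B : nat -> set RR) :
  iid P X -> (forall i, measurable (B i)) ->
  P (\big[setI/setT]_(i < size ms)
       ((fun w => \sum_(c < nth 0%N ms i) X (offset ms i + c)%N w) @^-1` B i)) =
  (\prod_(i < size ms) scaled_normal (Num.sqrt (nth 0%N ms i)%:R) (B i))%E.
Proof.
move=> iX mB; pose f (k : void + nat) : nat := if k is inr c then c else 0%N.
have finj : injective f by move=> [[]|c] [[]|c'] //= ->.
have := @block_law N01 (fun m => scaled_normal (Num.sqrt m%:R)) ms void _ [::] (fun=> setT) B (fun=> erefl) (fun _ _ => erefl) (indep_reindex finj iX) isT (fun=> measurableT) mB.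
by rewrite !big_nil setTI mul1e.
Qed.

End block_sums.

(** * Levy's construction of Brownian motion *)

Section summable_increments.
Context {R : realType}.

Lemma cvg_summable_increments (u y : nat -> R) (V : R) (k : nat) :
  (forall j, 0 <= y j) -> (forall j, `|u j.+1 - u j| <= y j.+1) ->
  (forall m, \sum_(k.+1 <= j < m) y j <= V) ->
  cvgn u /\ `|limn u - u k| <= V.
Proof.
move=> y0 uy yV.
have uk m : (k <= m)%N -> `|u m - u k| <= \sum_(k.+1 <= j < m.+1) y j.
  move=> km; rewrite big_add1 /= -telescope_sumr//.
  by apply: le_trans (ler_norm_sum _ _ _) _; apply: ler_sum => j _; exact: uy.
have cu : cvgn u.
  have : cvgn (series (fun j => u j.+1 - u j)).
    apply: normed_cvg; apply: nondecreasing_is_cvgn.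
      by apply: nondecreasing_series => j _ _; exact: normr_ge0.
    exists (\sum_(0 <= j < k.+1) y j.+1 + V) => _ [m _ <-].
    rewrite /series /=; apply: (@le_trans _ _ (\sum_(0 <= j < m) y j.+1)).
      by apply: ler_sum => j _; exact: uy.
    have [mk|km] := leqP m k.+1.
      rewrite (big_cat_nat (n := m) (p := k.+1))//= -addrA lerDl addr_ge0 ?sumr_ge0//.
      by apply: le_trans (yV 0%N); rewrite big_geq.
    rewrite (big_cat_nat (n := k.+1))//= 1?ltnW// lerD2l.
    apply: le_trans (yV m.+1); rewrite [leRHS]big_add1 /= [leRHS](big_cat_nat (n := k.+1))//= 1?ltnW//.
    by rewrite lerDr sumr_ge0.
  move=> /cvg_ex[l Hl]; apply/cvg_ex; exists (u 0%N + l).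
  have e : (fun m => u 0%N + series (fun j => u j.+1 - u j) m) = u.
    by apply/funext => m; rewrite /series /= telescope_sumr// addrC subrK.
  have H2 : (fun m => u 0%N + series (fun j => u j.+1 - u j) m) @ \oo --> u 0%N + l.
    by apply: cvgD => //; exact: cvg_cst.
  by rewrite e in H2.
split=> //.
have L : `|u m - u k| @[m --> \oo] --> `|limn u - u k|.
  by apply: cvg_norm; apply: cvgB => //; exact: cvg_cst.
rewrite -(cvg_lim _ L)//; apply: limr_le; first by apply/cvg_ex; exists `|limn u - u k|.
near=> m.
by apply: le_trans (uk m _) (yV _); near: m; exists k.
Unshelve. all: by end_near. Qed.

(** Replaces a maximum of many normals by a sum: a level [a] plus an excess of mean at most sqrt 2
    exp (- a^2 / 4). Beyond [a] it follows from (|z| - a) (|z| + a - 4) >= 0. *)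
Lemma le_add_expR (a z : R) : 2 <= a -> `|z| <= a + expR (z ^+ 2 / 4 - a ^+ 2 / 4).
Proof.
move=> a2; have [za|az] := leP `|z| a.
  by apply: le_trans za _; rewrite lerDl expR_ge0.
rewrite -lerBlDl; apply: le_trans (expR_ge1Dx _).
rewrite -[z ^+ 2]real_normK ?num_real//.
have : 0 <= (`|z| - a) * (`|z| + a - 4) by rewrite mulr_ge0; lra.
nra.
Qed.

End summable_increments.

Lemma indep_integral d (T : measurableType d) (R : realType) (P : probability T R) (I : eqType)
    (X : I -> T -> measurableTypeR R) nu (i : I) (f : R -> \bar R) : indep P X nu ->
  measurable_fun setT (f : measurableTypeR R -> _) -> (forall x, 0 <= f x)%E ->
  (\int[P]_w f (X i w) = \int[nu i]_x f x)%E.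
Proof.
move=> iX mf f0; rewrite -(integral_push P (indep_measurable iX i))//.
apply: eq_measure_integral => B mB _; rewrite pushE.
have := indepE (s := [:: i]) (B := fun=> B) iX isT (fun=> mB).
by rewrite !big_cons !big_nil setIT mule1.
Qed.

Section levy.
Context d (T : measurableType d) (R : realType) (P : probability T R).
Local Notation RR := (measurableTypeR R).
Variables (Z : nat + nat * nat -> T -> RR) (iZ : iid P Z).

Let q : R := (Num.sqrt 2)^-1.

Let q0 : 0 < q. Proof. by rewrite invr_gt0 sqrtr_gt0. Qed.

Let qge0 : 0 <= q. Proof. exact: ltW. Qed.

Let qq : q * q = 2^-1.
Proof. by rewrite /q -invfM -expr2 sqr_sqrtr. Qed.

(* Normalized increments of the path over the intervals [[i/2^j, (i+1)/2^j]]: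
   the midpoint rule splits an increment with a fresh independent normal. *)
Fixpoint lev (j i : nat) (w : T) : RR :=
  if j is j'.+1 then
    if odd i then q * lev j' i./2 w - q * Z (inr (j', i./2)) w
    else q * Z (inr (j', i./2)) w + q * lev j' i./2 w
  else Z (inl i) w.

Let fam (j : nat) (k : nat + nat * nat) : T -> RR :=
  match k with inl i => lev j i | inr (j', i) => Z (inr ((j + j')%N, i)) end.

Let iid_fam j : iid P (fam j).
Proof.
elim: j => [|j IH].
  have -> : fam 0 = Z by apply/funext => -[i|[j i]].
  exact: iZ.
pose f (k : nat * bool + nat * nat) : nat + nat * nat := match k with
  inl (i, true) => inr (0%N, i) | inl (i, false) => inl i | inr (j', i) => inr (j'.+1, i) end.
have finj : injective f by move=> [[i []]|[j1 i]] [[i' []]|[j2 i']] //= [] => [->|->|-> ->].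
pose g (k : nat + nat * nat) : nat * bool + nat * nat := match k with
  inl i => inl (i./2, ~~ odd i) | inr x => inr x end.
have ginj : injective g.
  move=> [i|x] [i'|x'] //= [].
    by move=> h /negb_inj o; rewrite -[i]odd_double_half -[i']odd_double_half o h.
  by move=> ->.
have qq1 : q ^+ 2 + q ^+ 2 = 1 by rewrite expr2 qq; lra.
have := indep_reindex ginj (iid_rotate (lt0r_neq0 q0) qq1 (indep_reindex finj IH)).
congr (iid P _); apply/funext => -[i|[j' i]] /=; last by rewrite addSnnS.
by apply/funext => w /=; case: (odd i); rewrite /= addn0.
Qed.

Lemma iid_lev j : iid P (lev j).
Proof.
have linj : injective (@inl nat (nat * nat)) by move=> ? ? [].
exact: (indep_reindex linj (iid_fam j)).
Qed.

Let mlev j i : measurable_fun setT (lev j i).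
Proof. exact: indep_measurable (iid_lev j) i. Qed.

(** Value of the approximate path at time k / 2^j; an increment over a time 2^-j has standard
    deviation q^j. *)
Let pos (j k : nat) (w : T) : R := q ^+ j * \sum_(c < k) lev j c w.

Let pos_double j k w : pos j.+1 k.*2 w = pos j k w.
Proof.
rewrite /pos exprSr -mulrA; congr (_ * _).
elim: k => [|k IH]; first by rewrite !big_ord0 mulr0.
rewrite doubleS !big_ord_recr /= -addrA mulrDr IH; congr (_ + _).
rewrite odd_double /= uphalf_double doubleK.
transitivity (2 * (q * q) * lev j k w); first by ring.
by rewrite qq mulfV// mul1r.
Qed.

Let fl (j : nat) (t : R) : nat := Num.truncn (t * 2 ^+ j).

Let flP j t : 0 <= t -> (fl j t)%:R <= t * 2 ^+ j < (fl j t).+1%:R.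
Proof. by move=> t0; apply: truncn_itv; rewrite mulr_ge0 ?exprn_ge0. Qed.

Let flS j t : 0 <= t -> fl j.+1 t = (fl j t).*2 \/ fl j.+1 t = (fl j t).*2.+1.
Proof.
move=> t0; have /andP[l u] := flP j t0.
have /andP[l' u'] := flP j.+1 t0.
have e : t * 2 ^+ j.+1 = 2 * (t * 2 ^+ j) by rewrite exprS mulrCA.
have h1 : ((fl j t).*2 <= fl j.+1 t)%N.
  by rewrite -ltnS -(ltr_nat R); apply: le_lt_trans u'; rewrite e -muln2 natrM mulrC ler_pM2l.
have h2 : (fl j.+1 t < (fl j t).*2.+2)%N.
  by rewrite -(ltr_nat R); apply: le_lt_trans l' _; rewrite e -doubleS -mul2n natrM ltr_pM2l.
lia.
Qed.

Let fl_lt j n t : 0 <= t < n%:R -> (fl j t < n * 2 ^ j)%N.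
Proof.
move=> /andP[t0 tn]; have /andP[l u] := flP j t0.
by rewrite -(ltr_nat R); apply: le_lt_trans l _; rewrite natrM natrX ltr_pM2r ?exprn_gt0.
Qed.

(** Bounds all increments of level [j] on [0, n) at once, by [le_add_expR] with a = 2 sqrt (j + n).
    The factor exp (- (j + n)) outweighs the number n 2^j of summands, so the mean is at most q^j (2
    sqrt (j + n) + 2). *)
Let Y (n j : nat) (w : T) : R :=
  q ^+ j * (2 * Num.sqrt (j + n)%:R + \sum_(c < n * 2 ^ j) expR (lev j c w ^+ 2 / 4 - (j + n)%:R)).

Let Y0 n j w : 0 <= Y n j w.
Proof.
apply: mulr_ge0; first by rewrite exprn_ge0.
apply: addr_ge0; first by rewrite mulr_ge0 ?sqrtr_ge0.
by rewrite sumr_ge0// => c _; exact: expR_ge0.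
Qed.

Let mY n j : measurable_fun setT (Y n j).
Proof.
apply: measurable_funM => //; apply: measurable_funD => //; apply: measurable_sum => c.
apply: measurableT_comp => //; apply: measurable_funB => //; apply: measurable_funM => //.
by apply: measurable_funX; exact: mlev.
Qed.

Let lev_le n j c w : (0 < n)%N -> (c < n * 2 ^ j)%N -> q ^+ j * `|lev j c w : R| <= Y n j w.
Proof.
move=> n0 cn; rewrite /Y ler_wpM2l ?exprn_ge0//.
have a2 : 2 <= 2 * Num.sqrt (j + n)%:R :> R.
  rewrite ler_peMr// -[leLHS]sqrtr1 ler_sqrt// ler1n; lia.
apply: le_trans (le_add_expR (lev j c w : R) a2) _; rewrite lerD2l.
rewrite exprMn sqr_sqrtr// (_ : 2 ^+ 2 * (j + n)%:R / 4 = (j + n)%:R); last by field.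
rewrite (bigD1 (Ordinal cn))//= lerDl sumr_ge0// => i _; exact: expR_ge0.
Qed.

Let EY n j : (0 < n)%N ->
  (\int[P]_w (Y n j w)%:E <= (q ^+ j * (2 * Num.sqrt (j + n)%:R + 2))%:E)%E.
Proof.
move=> n0.
have mexpR c : measurable_fun setT (fun w => expR (lev j c w ^+ 2 / 4 - (j + n)%:R)).
  apply: measurableT_comp => //; apply: measurable_funB => //.
  by apply: measurable_funM => //; apply: measurable_funX; exact: mlev.
have mexp c : measurable_fun setT (fun w => (expR (lev j c w ^+ 2 / 4 - (j + n)%:R))%:E).
  by apply/measurable_EFinP; exact: mexpR.
have msum : measurable_fun setT (fun w => (\sum_(c < n * 2 ^ j) expR (lev j c w ^+ 2 / 4 - (j + n)%:R))%:E).
  by apply/measurable_EFinP; apply: measurable_sum => c; exact: mexpR.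
under eq_integral do rewrite EFinM EFinD.
rewrite ge0_integralZl//; last 3 first.
- by apply: emeasurable_funD.
- by move=> w _; rewrite -EFinD lee_fin addr_ge0 ?mulr_ge0 ?sqrtr_ge0// sumr_ge0// => c _; exact: expR_ge0.
- by rewrite lee_fin exprn_ge0.
rewrite [leRHS]EFinM; apply: lee_wpmul2l; first by rewrite lee_fin exprn_ge0.
have c0 : (forall w : T, [set: T] w -> 0 <= (2 * Num.sqrt (j + n)%:R : R)%:E)%E.
  by move=> w _; rewrite lee_fin mulr_ge0 ?sqrtr_ge0.
have s0 : (forall w : T, [set: T] w -> 0 <= (\sum_(c < n * 2 ^ j) expR (lev j c w ^+ 2 / 4 - (j + n)%:R))%:E)%E.
  by move=> w _; rewrite lee_fin sumr_ge0// => c _; exact: expR_ge0.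
have mc : measurable_fun setT (fun _ : T => (2 * Num.sqrt (j + n)%:R : R)%:E) by [].
rewrite (ge0_integralD P measurableT c0 mc s0 msum).
rewrite integral_cst// EFinD.
have -> : (((2 * Num.sqrt (j + n)%:R)%:E * P setT)%E = (2 * Num.sqrt (j + n)%:R)%:E :> \bar R)%E.
  by rewrite [P _]probability_setT mule1.
rewrite leeD2l//.
under eq_integral do rewrite -sumEFin.
have me0 (c : 'I_(n * 2 ^ j)) (w : T) : setT w -> (0 <= (expR (lev j c w ^+ 2 / 4 - (j + n)%:R))%:E)%E.
  by rewrite lee_fin expR_ge0.
rewrite (ge0_integral_sum P measurableT (fun c : 'I_(n * 2 ^ j) => mexp c) me0).
have E c : (\int[P]_w (expR (lev j c w ^+ 2 / 4 - (j + n)%:R))%:E = (expR (- (j + n)%:R) * Num.sqrt 2)%:E)%E.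
  rewrite (indep_integral c (iid_lev j) (f := fun x => (expR (x ^+ 2 / 4 - (j + n)%:R))%:E)); last 2 first.
  - apply/measurable_EFinP; apply: measurableT_comp => //; apply: measurable_funB => //.
    by apply: measurable_funM => //; apply: measurable_funX.
  - by move=> x; rewrite lee_fin expR_ge0.
  have me : measurable_fun setT (fun x : RR => (expR (x ^+ 2 / 4))%:E).
    apply/measurable_EFinP; apply: measurableT_comp => //; apply: measurable_funM => //.
  have e0 (x : RR) : setT x -> (0 <= (expR (x ^+ 2 / 4))%:E)%E by rewrite lee_fin expR_ge0.
  rewrite EFinM -N01_exp_moment -(ge0_integralZl N01 measurableT me e0) ?lee_fin ?expR_ge0//.
  by apply: eq_integral => x _; rewrite -EFinM -expRD addrC.
under eq_bigr do rewrite E.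
rewrite sumEFin lee_fin sumr_const card_ord -[leLHS]mulr_natr.
have s2 : Num.sqrt 2 <= 2 :> R by rewrite -[leRHS]ger0_norm// -sqrtr_sqr ler_sqrt// expr2; lra.
have e1 : (n * 2 ^ j)%:R <= expR (j + n)%:R :> R.
  rewrite natrD addrC expRD natrM ler_pM//.
    by apply: le_trans (expR_ge1Dx _); rewrite lerDr.
  rewrite natrX -[j%:R]mulr1 expRM_natl lerXn2r ?nnegrE ?expR_ge0//.
  by apply: le_trans (expR_ge1Dx _); rewrite -natr1; lra.
rewrite -mulrA mulrC -mulrA; apply: (@le_trans _ _ (Num.sqrt 2 * 1)); last by rewrite mulr1.
rewrite ler_wpM2l ?sqrtr_ge0// expRN ler_pdivrMr ?expR_gt0// mul1r//.
Qed.

Let tail (n k : nat) (w : T) : \bar R := (\sum_(k <= j <oo) (Y n j w)%:E)%E.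

Let tailS n k w : tail n k w = ((Y n k w)%:E + tail n k.+1 w)%E.
Proof.
rewrite /tail (nneseries_split _ 1) ?addn1; last by move=> j _; rewrite lee_fin.
by rewrite big_nat1.
Qed.

Let tail_ge0 n k w : (0 <= tail n k w)%E.
Proof. by apply: nneseries_ge0 => j _ _; rewrite lee_fin. Qed.

Let good (w : T) : Prop := forall n, (tail n.+1 0 w < +oo)%E.

Let good_tail n k w : good w -> (tail n.+1 k w < +oo)%E.
Proof.
move=> g; elim: k => [|k IH]; first exact: g.
by apply: le_lt_trans IH; rewrite [leRHS]tailS leeDr// lee_fin.
Qed.

Let sum_le_tail n k w m : good w -> \sum_(k <= j < m) Y n.+1 j w <= fine (tail n.+1 k w).
Proof.
move=> g; rewrite -lee_fin fineK; last by rewrite ge0_fin_numE// good_tail.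
rewrite -sumEFin; apply: nneseries_lim_ge => j _; by rewrite lee_fin.
Qed.

(** Off the null set where the bounds fail to be summable the path is set to 0, so that it is
    continuous and starts at 0 for every [w]. *)
Definition levy (t : R) (w : T) : R :=
  if `[< good w >] then limn (fun j => pos j (fl j t) w) else 0.

Let pos_step n j t w : 0 <= t < n.+1%:R ->
  `|pos j.+1 (fl j.+1 t) w - pos j (fl j t) w| <= Y n.+1 j.+1 w.
Proof.
move=> /[dup] t01 /andP[t0 _]; rewrite -[pos j (fl j t) w]pos_double.
have [->|e] := flS j t0; first by rewrite subrr normr0 Y0.
rewrite e /pos big_ord_recr /= -mulrBr addrAC subrr add0r normrM ger0_norm ?exprn_ge0//.
by apply: lev_le => //; have := fl_lt j.+1 t01; rewrite e; lia.
Qed.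

Let levy_pos n j t w : good w -> 0 <= t < n.+1%:R ->
  (pos i (fl i t) w @[i --> \oo] --> levy t w) /\
  `|levy t w - pos j (fl j t) w| <= fine (tail n.+1 j.+1 w).
Proof.
move=> g t01; rewrite /levy asboolT//.
have [c b] := @cvg_summable_increments R (fun i => pos i (fl i t) w) (fun i => Y n.+1 i w)
  (fine (tail n.+1 j.+1 w)) j (fun i => Y0 _ _ _) (fun i => @pos_step n i t w t01)
  (fun m => @sum_le_tail n j.+1 w m g).
by split.
Qed.

(** At level [k] the two times round down to equal or neighbouring grid points. The factor 3 counts
    one increment of level [k] and the two errors of replacing the path by its level-[k] value. *)
Lemma levy_modulus n k s t w : 0 <= s < n.+1%:R -> 0 <= t < n.+1%:R -> `|s - t| <= 2^-1 ^+ k ->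
  (`|levy s w - levy t w|%:E <= 3%:E * tail n.+1 k w)%E.
Proof.
move=> s01 t01 st.
have [g|g] := pselect (good w); last first.
  by rewrite /levy asboolF// subr0 normr0 mule_ge0// tail_ge0.
wlog le_st : s t s01 t01 st / s <= t.
  by move=> H; have [h|/ltW h] := leP s t; [exact: H|rewrite distrC; apply: H => //; rewrite distrC].
have [_ ws] := levy_pos k g s01; have [_ wt] := levy_pos k g t01.
have /andP[s0 _] := s01; have /andP[t0 _] := t01.
have dif : `|pos k (fl k t) w - pos k (fl k s) w| <= Y n.+1 k w.
  have /andP[ls us] := flP k s0; have /andP[lt ut] := flP k t0.
  have le1 : (fl k s <= fl k t)%N.
    by apply: le_truncn; rewrite ler_wpM2r// exprn_ge0.
  have le2 : (fl k t <= (fl k s).+1)%N.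
    rewrite -ltnS -(ltr_nat R); apply: le_lt_trans lt _.
    have : (t - s) * 2 ^+ k <= 1.
      rewrite distrC ger0_norm ?subr_ge0// in st.
      by rewrite -ler_pdivlMr ?exprn_gt0// div1r -exprVn.
    by rewrite mulrBl -[(_).+2]addn1 natrD; lra.
  have [->|e] : fl k t = fl k s \/ fl k t = (fl k s).+1 by move: le1 le2; clear; lia.
    by rewrite subrr normr0 Y0.
  rewrite e /pos big_ord_recr /= -mulrBr addrAC subrr add0r normrM ger0_norm ?exprn_ge0//.
  by apply: lev_le => //; exact: fl_lt.
rewrite -[tail _ _ _]fineK; last by rewrite ge0_fin_numE// good_tail.
rewrite -EFinM lee_fin tailS.
have f1 : tail n.+1 k.+1 w \is a fin_num by rewrite ge0_fin_numE// good_tail.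
rewrite fineD//=.
have T0 : 0 <= fine (tail n.+1 k.+1 w) by exact: fine_ge0.
move: ws wt dif; rewrite !ler_norml => /andP[? ?] /andP[? ?] /andP[? ?].
have yy := Y0 n.+1 k w.
apply/andP; split; lra.
Qed.



Let levy_bad t w : ~ good w -> levy t w = 0.
Proof. by move=> g; rewrite /levy asboolF. Qed.


Let mtail n k : measurable_fun setT (tail n k).
Proof.
have -> : tail n k = fun w => (\sum_(0 <= j <oo) (Y n (j + k) w)%:E)%E.
  apply/funext => w; rewrite (nneseries_addn (f := fun j => (Y n j w)%:E))// => i.
  by rewrite lee_fin.
apply: (@ge0_emeasurable_sum _ _ _ _ (fun j w => (Y n (j + k) w)%:E) xpredT) => [j w _ _|j _].
  by rewrite lee_fin.
by apply/measurable_EFinP; exact: mY.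
Qed.

Let mgood : measurable [set w | good w].
Proof.
have -> : [set w | good w] = \bigcap_n [set w | tail n.+1 0 w < +oo]%E.
  by apply/seteqP; split => w /= H; [move=> n _; exact: H|move=> n; exact: (H n I)].
apply: bigcapT_measurable => n.
rewrite -[X in measurable X]setTI; exact: emeasurable_fun_infty_o.
Qed.

Let pos_cvg t w : good w -> 0 <= t -> pos j (fl j t) w @[j --> \oo] --> levy t w.
Proof.
move=> g t0; have t1 : 0 <= t < (Num.truncn t).+1%:R by rewrite t0 truncnS_gt.
by have [] := levy_pos 0 g t1.
Qed.

Let mpos j k : measurable_fun setT (pos j k).
Proof. by apply: measurable_funM => //; apply: measurable_sum => c; exact: mlev. Qed.

Lemma measurable_levy t : 0 <= t -> measurable_fun setT (levy t : T -> RR).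
Proof.
move=> t0; apply: (@measurable_fun_cvg _ _ _ _ (fun j w => pos j (fl j t) w * \1_[set w | good w] w)).
  by move=> j; apply: measurable_funM; [exact: mpos|exact: measurable_indic].
move=> w _; rewrite indicE; have [g|g] := pselect (good w).
  rewrite (_ : (fun j => _) = fun j => pos j (fl j t) w); first exact: pos_cvg.
  by apply/funext => j; rewrite mem_set// mulr1.
rewrite levy_bad// (_ : (fun j => _) = cst 0); first exact: cvg_cst.
by apply/funext => j; rewrite memNset// mulr0.
Qed.

Lemma levy0 w : levy 0 w = 0.
Proof.
rewrite /levy; case: asboolP => // _; rewrite (_ : (fun j => _) = cst 0) ?lim_cst//.
apply/funext => j; rewrite /pos (_ : fl j 0 = 0%N) ?big_ord0 ?mulr0//.
by rewrite /fl mul0r truncn0.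
Qed.

(** The full series is (1 - q)^-2, about 11.7; [E] is the closed form of the partial sums. *)
Let sum_geometric m : \sum_(i < m) q ^+ i * i.+1%:R <= 12 :> R.
Proof.
have E : (\sum_(i < m) q ^+ i * i.+1%:R) * (1 - q) ^+ 2 = 1 - m.+1%:R * q ^+ m + m%:R * q ^+ m.+1.
  elim: m => [|m IH]; first by rewrite big_ord0; ring.
  by rewrite big_ord_recr /= mulrDl IH !exprS -!natr1; ring.
have q1 : q <= 17 / 24.
  by rewrite leNgt; apply/negP => h; have := qq; nra.
have le1 : 1 - m.+1%:R * q ^+ m + m%:R * q ^+ m.+1 <= 1.
  rewrite -natr1 exprS; have Q0 := exprn_ge0 m qge0; have m0 : 0 <= m%:R :> R by [].
  have := mulr_ge0 m0 Q0; have : 0 <= m%:R * q ^+ m * (1 - q) by rewrite !mulr_ge0//; lra.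
  lra.
have s0 : 0 <= \sum_(i < m) q ^+ i * i.+1%:R by apply: sumr_ge0 => i _; rewrite mulr_ge0 ?exprn_ge0.
have : 1 / 12 <= (1 - q) ^+ 2 by rewrite expr2; nra.
nra.
Qed.

Lemma integral_tail n k :
  (\int[P]_w tail n.+1 k w <= (48 * Num.sqrt n.+1%:R * (q ^+ k * Num.sqrt k.+1%:R))%:E)%E.
Proof.
have -> : tail n.+1 k = fun w => (\sum_(0 <= j <oo) (Y n.+1 (j + k) w)%:E)%E.
  apply/funext => w; rewrite (nneseries_addn (f := fun j => (Y n.+1 j w)%:E))// => i.
  by rewrite lee_fin.
rewrite (integral_nneseries P measurableT (f := fun j w => (Y n.+1 (j + k) w)%:E)); last 2 first.
- by move=> j; apply/measurable_EFinP; exact: mY.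
- by move=> j w _; rewrite lee_fin.
apply: lime_le.
  apply: is_cvg_nneseries => j _ _; apply: integral_ge0 => w _; by rewrite lee_fin.
apply: nearW => m; set S := Num.sqrt n.+1%:R; set K := Num.sqrt k.+1%:R.
have S1 : 1 <= S by rewrite -[leLHS]sqrtr1 ler_sqrt// ler1n.
have K1 : 1 <= K by rewrite -[leLHS]sqrtr1 ler_sqrt// ler1n.
apply: (@le_trans _ _ (\sum_(0 <= j < m) (4 * S * (q ^+ k * K) * (q ^+ j * j.+1%:R))%:E)%E).
  apply: lee_sum => j _; apply: le_trans (EY _ _) _ => //; rewrite lee_fin exprD.
  have le1 : Num.sqrt (j + k + n.+1)%:R <= S * K * j.+1%:R :> R.
    rewrite -[j.+1%:R]ger0_norm// -sqrtr_sqr -!sqrtrM// ler_sqrt//.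
    rewrite -natrX -!natrM ler_nat; nia.
  have j1 : 1 <= j.+1%:R :> R by rewrite ler1n.
  have SK : 1 <= S * K by nra.
  have SKj : 1 <= S * K * j.+1%:R by nra.
  rewrite (_ : 4 * _ * _ * _ = q ^+ j * q ^+ k * (4 * (S * K * j.+1%:R))); last by ring.
  rewrite ler_wpM2l ?mulr_ge0 ?exprn_ge0//; lra.
rewrite sumEFin lee_fin -mulr_sumr big_mkord.
have : 0 <= 4 * S * (q ^+ k * K) by rewrite !mulr_ge0 ?exprn_ge0 ?sqrtr_ge0.
by have := sum_geometric m; nra.
Qed.

Let good_ae : P (~` [set w | good w]) = 0%E.
Proof.
apply: measure_negligible; first exact: measurableC mgood.
suff : \forall w \ae P, good w by [].
apply: ae_foralln => n.
have : P.-integrable setT (tail n.+1 0).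
  apply/integrableP; split; first exact: mtail.
  apply: (@le_lt_trans _ _ (\int[P]_w tail n.+1 0 w)%E).
    by rewrite le_eqVlt; apply/orP; left; apply/eqP/eq_integral => w _; rewrite gee0_abs// tail_ge0.
  by apply: le_lt_trans (integral_tail _ _) _; rewrite ltry.
move=> /(integrable_ae measurableT); apply: filterS => w /(_ I).
by rewrite ge0_fin_numE// tail_ge0.
Qed.

Lemma continuous_levy w : {within `[0, +oo[%classic, continuous (fun t => levy t w)}.
Proof.
have [g|g] := pselect (good w); last first.
  rewrite (_ : (fun t => levy t w) = cst 0); first exact: cst_continuous.
  by apply/funext => t; rewrite levy_bad.
apply/subspace_continuousP => t /=; rewrite in_itv/= andbT => t0.
apply/cvgrPdist_le => e e0.
pose n := (Num.truncn t).+1; have tn : t + 1 < n.+1%:R.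
  by rewrite -natr1 ltrD2r truncnS_gt.
have YE k : xpredT k -> (0 <= (Y n.+1 k w)%:E)%E by rewrite lee_fin.
have /fine_cvgP[_ tl] := nneseries_tail_cvg (g n) YE.
move/cvgrPdist_lt : tl => /(_ (e / 3)).
rewrite divr_gt0// => /(_ isT)[k _ /(_ k (leqnn k))] /=.
rewrite sub0r normrN -/(tail n.+1 k w) ger0_norm; last by apply: fine_ge0; exact: tail_ge0.
move=> ke; near=> s.
have s0 : 0 <= s.
  have : s \in `[0, +oo[%classic by apply/mem_set; near: s; exact: withinT.
  by rewrite inE/= in_itv/= andbT.
have st : `|t - s| < 2^-1 ^+ k.
  near: s; apply: cvg_within; apply/nbhs_ballP; exists (2^-1 ^+ k); first by rewrite /= exprn_gt0.
  by move=> y.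
rewrite -lee_fin; apply: le_trans (@levy_modulus n k t s w _ _ (ltW st)) _.
- by rewrite t0/=; lra.
- rewrite s0/=; have : 2^-1 ^+ k <= 1 :> R by apply: exprn_ile1; lra.
  by move: st; rewrite ltr_norml => /andP[]; lra.
rewrite -[tail _ _ _]fineK; last by rewrite ge0_fin_numE ?tail_ge0// good_tail.
by rewrite -EFinM lee_fin; lra.
Unshelve. all: by end_near. Qed.

Let offset_telescope (u : nat -> nat) (k i : nat) : u 0%N = 0%N ->
  (forall j, (j < k)%N -> (u j <= u j.+1)%N) -> (i <= k)%N ->
  offset (mkseq (fun j => u j.+1 - u j)%N k) i = u i.
Proof.
move=> u0 um ik; suff H : forall k i (u : nat -> nat), (forall j, (j < k)%N -> (u j <= u j.+1)%N) ->
    (i <= k)%N -> (u 0 + offset (mkseq (fun j => u j.+1 - u j) k) i = u i)%N.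
  by have := H k i u um ik; rewrite u0.
move=> {u u0 um k i ik} k; elim: k => [|k IH] [|i] u um // ik; rewrite ?addn0//.
have -> : mkseq (fun j => u j.+1 - u j)%N k.+1 = (u 1 - u 0)%N :: mkseq (fun j => u j.+2 - u j.+1)%N k.
  by rewrite /mkseq -[k.+1]add1n iotaD map_cat/= (iotaDl 1 0) -map_comp.
rewrite /= addnA subnKC ?um//; apply: (IH i (fun j => u j.+1)) => // j jk.
exact: um.
Qed.

Let indep_ae (I : eqType) (X X' : I -> T -> RR) nu A : measurable A -> P (~` A) = 0%E ->
  (forall i w, A w -> X i w = X' i w) -> (forall i, measurable_fun setT (X' i)) ->
  indep P X nu -> indep P X' nu.
Proof.
move=> mA PA XX mX' iX; split=> // s B us mB; rewrite -(indepE iX us mB).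
have mX i := indep_measurable iX i.
have mI (Z' : I -> T -> RR) : (forall i, measurable_fun setT (Z' i)) ->
    measurable (\big[setI/[set: T]]_(i <- s) (Z' i @^-1` B i)).
  move=> mZ; apply: bigsetI_measurable => i _; rewrite -[X in measurable X]setTI; exact: mZ.
have E (Z' : I -> T -> RR) : (forall i, measurable_fun setT (Z' i)) ->
    P (\big[setI/[set: T]]_(i <- s) (Z' i @^-1` B i)) =
    P ((\big[setI/[set: T]]_(i <- s) (Z' i @^-1` B i)) `&` A).
  move=> mZ; rewrite (measureDI P (mI _ mZ) mA) [X in (X + _)%E](@subset_measure0 _ _ _ P _ (~` A)) ?add0e//.
  - by apply: measurableD => //; exact: mI.
  - exact: measurableC.
rewrite E// [RHS]E//; congr (P _); apply/seteqP; split => w [] /bigsetIP H Aw; split => //;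
  by apply/bigsetIP => i; move: (H i); rewrite /= XX.
Qed.

Let incr (J : nat) (s t : R) (w : T) : R :=
  (pos J (fl J t) w - pos J (fl J s) w) * \1_[set w | good w] w.

Let fl_cvg t : 0 <= t -> (fl J t)%:R * (2 ^- J) @[J --> \oo] --> t.
Proof.
move=> t0.
have h : (2^-1 : R) ^+ J @[J --> \oo] --> 0.
  by apply: cvg_expr; rewrite ger0_norm ?invr_ge0//; lra.
apply: (@squeeze_cvgr _ _ _ _ (fun J => t - 2^-1 ^+ J) (fun=> t)).
- near=> J; have /andP[a b] := flP J t0.
  rewrite exprVn; apply/andP; split.
    rewrite lerBlDr -[X in _ <= _ + X]mul1r -mulrDl natr1 ler_pdivlMr ?exprn_gt0//; exact: ltW.
  by rewrite ler_pdivrMr ?exprn_gt0.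
- rewrite -[X in _ --> X]subr0; apply: cvgB => //; exact: cvg_cst.
- exact: cvg_cst.
Unshelve. all: by end_near. Qed.

(** Increments between times rounded down to the level-[J] grid are sums over disjoint blocks of
    [lev J]. The indicator of [good] makes them converge to the increments of [levy] at every
    point. *)
Let indep_incr (k : nat) (ts : nat -> R) (J : nat) : ts 0%N = 0 ->
  (forall i, (i < k)%N -> ts i < ts i.+1) ->
  indep P (fun i : 'I_k => incr J (ts i) (ts i.+1) : T -> RR)
    (fun i : 'I_k => scaled_normal (q ^+ J * Num.sqrt (fl J (ts i.+1) - fl J (ts i))%:R)).
Proof.
move=> ts0 tsi.
pose u i := fl J (ts i).
have u0 : u 0%N = 0%N by rewrite /u ts0 /fl mul0r truncn0.
have um i : (i < k)%N -> (u i <= u i.+1)%N.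
  by move=> ik; apply: le_truncn; rewrite ler_wpM2r ?exprn_ge0// ltW// tsi.
pose X (i : 'I_k) w : RR := q ^+ J * \sum_(c < u i.+1 - u i) lev J (u i + c)%N w.
have XE (i : 'I_k) w : X i w = pos J (u i.+1) w - pos J (u i) w.
  rewrite /X /pos -mulrBr; congr (_ * _); apply/eqP; rewrite eq_sym subr_eq addrC; apply/eqP.
  rewrite -!(big_mkord xpredT (fun c => lev J c w)) -(big_mkord xpredT (fun c => lev J (u i + c)%N w)).
  rewrite (big_cat_nat (n := u i))//=; last exact: um.
  congr (_ + _); rewrite -{1}[u i]add0n big_addn; apply: eq_bigr => c _; by rewrite addnC.
have mX i : measurable_fun setT (X i).
  by apply: measurable_funM => //; apply: measurable_sum => c; exact: mlev.
apply: (@indep_ae _ X _ _ _ mgood good_ae).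
- by move=> i w g; rewrite XE /incr indicE mem_set// mulr1.
- by move=> i; apply: measurable_funM; [apply: measurable_funB; exact: mpos|exact: measurable_indic].
apply: indep_cofinal => // s; exists (enum 'I_k); split; first exact: enum_uniq.
  by move=> i _; rewrite mem_enum.
move=> B mB; pose ms := mkseq (fun j => u j.+1 - u j)%N k.
pose B' (i : nat) : set RR := if insub i is Some i' then [set x : RR | B (i' : 'I_k) (q ^+ J * x)] else setT.
have mB' i : measurable (B' i).
  rewrite /B'; case: insubP => // i' _ _; rewrite -[X in measurable X]setTI.
  exact: measurable_scale.
have := indep_block_sums ms (iid_lev J) mB'.
have sz : size ms = k by rewrite size_mkseq.
rewrite sz => H; rewrite big_enum/= big_enum/=.
have BE (i : 'I_k) : B' i = [set x | B i (q ^+ J * x)].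
  by rewrite /B'; case: insubP => [i' _ e|]; [rewrite (_ : i' = i)//; apply/val_inj|rewrite ltn_ord].
transitivity (P (\big[setI/[set: T]]_(i < k)
    (fun w => \sum_(c < nth 0%N ms i) lev J (offset ms i + c)%N w) @^-1` B' i)).
  congr (P _); apply: eq_bigr => i _; rewrite BE; apply/funext => w /=.
  by rewrite nth_mkseq// offset_telescope// 1?ltnW.
rewrite H; apply: eq_bigr => i _; rewrite BE nth_mkseq// !scaled_normalE; congr (N01 _).
by apply/funext => x /=; rewrite mulrA.
Qed.

Let scaled_normal_cvg (s_ : nat -> R) (s : R) (f : R -> R) : s_ @ \oo --> s -> continuous f ->
  (forall x, 0 <= f x <= 1) ->
  (\int[scaled_normal (s_ J)]_x (f x)%:E)%E @[J --> \oo] --> (\int[scaled_normal s]_x (f x)%:E)%E.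
Proof.
move=> ss cf f01.
have mf : measurable_fun setT (f : RR -> RR) by exact: continuous_measurable_fun.
have E (r : R) : (\int[scaled_normal r]_x (f x)%:E = \int[N01]_x (f (r * x))%:E)%E.
  rewrite /scaled_normal (integral_law N01 (measurable_scale r) (f := fun x => (f x)%:E))//.
    exact/measurable_EFinP.
  by move=> x; rewrite lee_fin; have /andP[] := f01 x.
rewrite E (funext (fun J => E (s_ J))).
apply: bounded_cvg.
- exact: probability_lty.
- by move=> n; apply: (measurableT_comp mf (measurable_scale (s_ n))).
- by move=> n x; exact: f01.
- move=> x; apply: continuous_cvg; first exact: cf.
  by apply: cvgM => //; exact: cvg_cst.
Qed.

(** Independence is exact at every level [J]; the rounded increments and their variances both
    converge, so [indep_limit] applies. *)
Lemma levy_increments (k : nat) (ts : nat -> R) : ts 0%N = 0 ->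
  (forall i, (i < k)%N -> ts i < ts i.+1) ->
  indep P (fun (i : 'I_k) w => levy (ts i.+1) w - levy (ts i) w : RR)
    (fun i : 'I_k => scaled_normal (Num.sqrt (ts i.+1 - ts i))).
Proof.
move=> ts0 tsi.
have ts_ge0 i : (i <= k)%N -> 0 <= ts i.
  elim: i => [|i IH] ik; first by rewrite ts0.
  by apply: le_trans (IH (ltnW ik)) _; rewrite ltW// tsi.
apply: (@indep_limit _ _ _ P _ _ _ _ _ (fun J => indep_incr J ts0 tsi)).
  move=> i w; rewrite /incr indicE; have [g|g] := pselect (good w).
    rewrite (_ : (fun J => _) = fun J => pos J (fl J (ts i.+1)) w - pos J (fl J (ts i)) w); last first.
      by apply/funext => J; rewrite mem_set// mulr1.
    by apply: cvgB; apply: pos_cvg => //; apply: ts_ge0 => //; exact: ltnW.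
  rewrite !levy_bad// subr0 (_ : (fun j => _) = cst 0); first exact: cvg_cst.
  by apply/funext => J; rewrite memNset// mulr0.
move=> i f cf f01; apply: scaled_normal_cvg => //.
have E J : q ^+ J * Num.sqrt (fl J (ts i.+1) - fl J (ts i))%:R =
    Num.sqrt ((fl J (ts i.+1))%:R * 2 ^- J - (fl J (ts i))%:R * 2 ^- J).
  rewrite -mulrBl natrB; last first.
    by apply: le_truncn; rewrite ler_wpM2r ?exprn_ge0// ltW// tsi.
  rewrite sqrtrM ?subr_ge0 ?ler_nat; last first.
    by apply: le_truncn; rewrite ler_wpM2r ?exprn_ge0// ltW// tsi.
  rewrite mulrC; congr (_ * _); rewrite -[LHS]ger0_norm ?exprn_ge0// -sqrtr_sqr.
  by congr Num.sqrt; rewrite -exprM mulnC exprM expr2 qq exprVn.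
rewrite (funext E); apply: (continuous_cvg _ (@sqrt_continuous R _)).
by apply: cvgB; apply: fl_cvg; apply: ts_ge0 => //; exact: ltnW.
Qed.

Theorem levy_standard_BM : standard_BM P (fun t w => levy t w).
Proof.
split.
- exact: measurable_levy.
- exact: levy0.
- exact: continuous_levy.
move=> k ts ts0 tsi B mB.
have -> : \bigcap_(i in [set i | (i < k)%N]) [set w | B i (levy (ts i.+1) w - levy (ts i) w)] =
    \big[setI/[set: T]]_(i <- enum 'I_k) ((fun w => levy (ts i.+1) w - levy (ts i) w : RR) @^-1` (B i : set RR)).
  by rewrite big_enum/= (bigcap_mkord k (fun i => [set w | B i (levy (ts i.+1) w - levy (ts i) w)])).
rewrite (indepE (B := fun i : 'I_k => B i : set RR) (levy_increments ts0 tsi) (enum_uniq _))//.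
rewrite big_enum/=; apply: eq_bigr => i _.
apply/esym/normal_prob_scale; [by rewrite sqrtr_gt0 subr_gt0 tsi|exact: mB].
by move=> i; exact: mB.
Qed.

Lemma levy_oscillation : exists Osc : nat -> T -> \bar R,
  [/\ forall k, measurable_fun setT (Osc k) /\ (forall w, 0 <= Osc k w)%E,
      forall k s t w, 0 <= s <= 1 -> 0 <= t <= 1 -> `|s - t| <= 2^-1 ^+ k ->
        (`|levy s w - levy t w|%:E <= Osc k w)%E &
      forall k, (\int[P]_w Osc k w <= (288 * ((Num.sqrt 2)^-1 ^+ k * Num.sqrt k.+1%:R))%:E)%E].
Proof.
(* [0, 1] lies in [0, 2), the range controlled by [tail 2]; 288 bounds 3 * 48 * sqrt 2. *)
exists (fun k w => 3%:E * tail 2 k w)%E; split.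
- move=> k; split; first by apply: measurable_funeM; exact: mtail.
  by move=> w; rewrite mule_ge0// tail_ge0.
- move=> k s t w /andP[s0 s1] /andP[t0 t1] st; apply: (levy_modulus _ _ _ st).
    by rewrite s0/=; lra.
  by rewrite t0/=; lra.
move=> k; have t0 (w : T) : setT w -> (0 <= tail 2 k w)%E by move=> _; exact: tail_ge0.
rewrite (ge0_integralZl P measurableT (mtail 2 k) t0 (_ : 0 <= 3%:E)%E)//.
apply: (@le_trans _ _ (3 * (48 * Num.sqrt 2 * (q ^+ k * Num.sqrt k.+1%:R))%:E)%E).
  by apply: lee_wpmul2l => //; exact: integral_tail.
rewrite -EFinM lee_fin -/q.
have s2 : Num.sqrt 2 <= 2 :> R by rewrite -[leRHS]ger0_norm// -sqrtr_sqr ler_sqrt// expr2; lra.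
have : 0 <= q ^+ k * Num.sqrt k.+1%:R :> R by rewrite mulr_ge0 ?sqrtr_ge0// exprn_ge0.
nra.
Qed.

End levy.

Theorem exists_BM_modulus (R : realType) :
  exists (W : R -> measurableTypeR R -> R) (Osc : nat -> measurableTypeR R -> \bar R),
  [/\ standard_BM U01 W,
      forall k, measurable_fun setT (Osc k) /\ (forall w, 0 <= Osc k w)%E,
      forall k s t w, 0 <= s <= 1 -> 0 <= t <= 1 -> `|s - t| <= 2^-1 ^+ k ->
        (`|W s w - W t w|%:E <= Osc k w)%E &
      forall k, (\int[U01]_w Osc k w <= (288 * ((Num.sqrt 2)^-1 ^+ k * Num.sqrt k.+1%:R))%:E)%E].
Proof.
have [X iX] := @exists_iid_normal R.
have iZ := indep_reindex (pcan_inj (@pickleK (nat + nat * nat)%type)) iX.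
have [Osc [h1 h2 h3]] := levy_oscillation iZ.
by exists (levy (fun j : nat + nat * nat => X (pickle j))), Osc; split => //; exact: levy_standard_BM.
Qed.

(** * Quantile coupling of symmetric binomial and normal laws *)

Section real_integral.
Context d (T : measurableType d) (R : realType) (mu : {measure set T -> \bar R}).
Implicit Types f g : T -> R.

Lemma integral_le (f g : T -> \bar R) : (forall x, 0 <= f x)%E -> measurable_fun setT f ->
  measurable_fun setT g -> (forall x, f x <= g x)%E ->
  (\int[mu]_x f x <= \int[mu]_x g x)%E.
Proof.
move=> f0 mf mg fg; exact: ge0_le_integral.
Qed.

Lemma integral_EFin_le f g : (forall x, 0 <= f x) -> measurable_fun setT f ->
  measurable_fun setT g -> (forall x, f x <= g x) ->
  (\int[mu]_x (f x)%:E <= \int[mu]_x (g x)%:E)%E.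
Proof.
by move=> f0 mf mg fg; apply: integral_le => [x|||x]; rewrite ?lee_fin//; exact/measurable_EFinP.
Qed.

Lemma integral_EFinZ (c : R) f : 0 <= c -> (forall x, 0 <= f x) -> measurable_fun setT f ->
  (\int[mu]_x (c * f x)%:E = c%:E * \int[mu]_x (f x)%:E)%E.
Proof.
move=> c0 f0 mf.
have f0' x : setT x -> (0 <= (f x)%:E)%E by rewrite lee_fin.
have mf' : measurable_fun setT (fun x => (f x)%:E) by exact/measurable_EFinP.
by rewrite -(ge0_integralZl mu measurableT mf' f0') ?lee_fin//.
Qed.

Lemma integral_EFinD f g : (forall x, 0 <= f x) -> measurable_fun setT f ->
  (forall x, 0 <= g x) -> measurable_fun setT g ->
  (\int[mu]_x (f x + g x)%:E = \int[mu]_x (f x)%:E + \int[mu]_x (g x)%:E)%E.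
Proof.
move=> f0 mf g0 mg.
have f0' x : setT x -> (0 <= (f x)%:E)%E by rewrite lee_fin.
have mf' : measurable_fun setT (fun x => (f x)%:E) by exact/measurable_EFinP.
have g0' x : setT x -> (0 <= (g x)%:E)%E by rewrite lee_fin.
have mg' : measurable_fun setT (fun x => (g x)%:E) by exact/measurable_EFinP.
by rewrite -(ge0_integralD mu measurableT f0' mf' g0' mg').
Qed.

Lemma integral_EFin_sum (I : Type) (s : seq I) (F : I -> T -> R) :
  (forall i x, 0 <= F i x) -> (forall i, measurable_fun setT (F i)) ->
  (\int[mu]_x (\sum_(i <- s) F i x)%:E = \sum_(i <- s) \int[mu]_x (F i x)%:E)%E.
Proof.
move=> F0 mF; elim: s => [|i s IH].
  by rewrite big_nil; under eq_integral do rewrite big_nil; rewrite integral0.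
rewrite big_cons -IH; under eq_integral do rewrite big_cons.
rewrite integral_EFinD//; first by move=> x; exact: sumr_ge0.
exact: measurable_sum.
Qed.

Lemma integral_indicT (A : set T) : measurable A -> (\int[mu]_x (\1_A x)%:E = mu A)%E.
Proof. by move=> mA; rewrite (integral_indic mu measurableT mA) setIT. Qed.

End real_integral.

Section gaussian_tail.
Context {R : realType}.
Local Notation RR := (measurableTypeR R).
Implicit Types a b x y : R.

(** An affine change of variable maps one Gaussian cell onto the other, so a pointwise comparison of
    densities bounds the ratio of their masses. *)
Lemma Phi_affine_le (c e K a b : R) : 0 < c -> 0 <= K -> a <= b ->
  (forall x, a <= x <= b -> c * phi (c * x + e) <= K * phi x) ->
  Phi (c * b + e) - Phi (c * a + e) <= K * (Phi b - Phi a).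
Proof.
move=> c0 K0 ab H; rewrite -lee_fin EFinM -!N01_itv//; last by rewrite lerD2r ler_pM2l.
have m1 : measurable (`]c * a + e, c * b + e]%classic : set RR) by exact: measurable_itv.
have m2 : measurable (`]a, b]%classic : set RR) by exact: measurable_itv.
have EE (A : set RR) : measurable A ->
    (N01 A = \int[lebesgue_measure]_x ((\1_A x)%:E * (phi x)%:E))%E.
  move=> mA; rewrite -(integral_indicT (@N01 R) mA) (integral_N01 (f := fun x => (\1_A x)%:E))//.
  by apply/measurable_EFinP; exact: measurable_indic.
have f0 (A : set RR) x : (0 <= (\1_A x)%:E * (phi x)%:E)%E.
  by rewrite mule_ge0// lee_fin ?phi_ge0.
have mf (A : set RR) : measurable A -> measurable_fun setT (fun x : RR => (\1_A x)%:E * (phi x)%:E)%E.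
  move=> mA; apply: emeasurable_funM; apply/measurable_EFinP; first exact: measurable_indic.
  exact: measurable_phi.
rewrite !EE// (integral_affine e (lt0r_neq0 c0) (f0 _) (mf _ m1)).
have mg : measurable_fun setT (fun x : RR => (\1_(`]c * a + e, c * b + e]%classic : set RR) (c * x + e))%:E * (phi (c * x + e))%:E)%E.
  by apply: (measurableT_comp (mf _ m1)); apply: measurable_funD.
have g0 (x : RR) : setT x -> (0 <= (\1_(`]c * a + e, c * b + e]%classic : set RR) (c * x + e))%:E * (phi (c * x + e))%:E)%E.
  by move=> _; exact: f0.
have h0 (x : RR) : setT x -> (0 <= (\1_(`]a, b]%classic : set RR) x)%:E * (phi x)%:E)%E.
  by move=> _; exact: f0.
have K0e : (0 <= K%:E)%E by rewrite lee_fin.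
have c0e : (0 <= `|c|%:E)%E by rewrite lee_fin.
rewrite -(ge0_integralZl _ measurableT mg g0 c0e) -(ge0_integralZl _ measurableT (mf _ m2) h0 K0e).
apply: integral_le => [x|||].
- by apply: mule_ge0; [exact: c0e|exact: g0].
- exact: measurable_funeM.
- by apply: measurable_funeM; exact: mf.
move=> x; rewrite !indicE gtr0_norm//.
have -> : (c * x + e \in `]c * a + e, c * b + e]%classic) = (x \in `]a, b]%classic).
  by apply/idP/idP; rewrite !inE/= !in_itv/= ltrD2r lerD2r ltr_pM2l// ler_pM2l.
case: (boolP (x \in _)) => [|_]; last by rewrite !mul0e !mule0.
rewrite inE/= in_itv/= => /andP[/ltW ax xb]; rewrite !mul1e -!EFinM lee_fin.
by apply: H; rewrite ax.
Qed.

Lemma phi_le_mul (K x y : R) : phi x <= expR K * phi y <-> y ^+ 2 - x ^+ 2 <= 2 * K.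
Proof.
rewrite !phiE mulrCA ler_pM2l ?normal_peak_gt0// -expRD ler_expR.
by split; lra.
Qed.

Lemma Phi_tail x : 0 <= x -> Phi (- x) <= 2 * expR (- (x ^+ 2 / 4)).
Proof.
move=> x0; rewrite -lee_fin -PhiE.
have m1 : measurable (`]-oo, (- x)]%classic : set RR) by exact: measurable_itv.
rewrite -(integral_indicT (@N01 R) m1).
have mexp : measurable_fun setT (fun z : RR => expR (z ^+ 2 / 4)).
  by apply: measurableT_comp => //; apply: measurable_funM => //.
apply: (@le_trans _ _ (\int[N01]_z (expR (- (x ^+ 2 / 4)) * expR (z ^+ 2 / 4))%:E)%E).
  apply: integral_EFin_le.
  - by move=> z; rewrite indicE.
  - exact: measurable_indic.
  - by apply: measurable_funM.
  move=> z; rewrite indicE -expRD.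
  case: (boolP (z \in _)) => [|_]; last exact: expR_ge0.
  rewrite inE/= in_itv/= => zx; apply: le_trans (expR_ge1Dx _); rewrite lerDl.
  have : 0 <= (- x - z) * (x - z) by apply: mulr_ge0; lra.
  by nra.
rewrite integral_EFinZ ?expR_ge0//.
rewrite N01_exp_moment -EFinM lee_fin mulrC.
rewrite ler_wpM2r ?expR_ge0// -[leRHS]ger0_norm// -sqrtr_sqr ler_sqrt// expr2; lra.
Qed.

End gaussian_tail.

(** By [ratio] the quotient of the decrements of [T] and [S] is nondecreasing. Hence T - S first
    rises and then falls, and it is nonnegative as soon as it is so at both ends. Comparing two
    tails is thus reduced to comparing consecutive cells. *)
Lemma single_crossing (R : realDomainType) (T S : nat -> R) (k0 k1 k : nat) :
  (k0 <= k <= k1)%N -> S k0 <= T k0 -> S k1 <= T k1 ->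
  (forall i, (k0 <= i < k1)%N -> S i.+1 < S i) ->
  (forall i, (k0 <= i)%N -> (i.+1 < k1)%N ->
     (S i.+1 - S i.+2) * (T i - T i.+1) <= (S i - S i.+1) * (T i.+1 - T i.+2)) ->
  S k <= T k.
Proof.
move=> /andP[k0k kk1] le0 le1 Sd ratio.
have [c|/ltW c] := leP (S k - S k.+1) (T k - T k.+1).
- have up i : (k <= i)%N -> (i < k1)%N -> S i - S i.+1 <= T i - T i.+1.
    elim: i => [|i IH] ki ik; first by move: ki c; rewrite leqn0 => /eqP->.
    move: ki; rewrite leq_eqVlt => /orP[/eqP <-//|]; rewrite ltnS => ki.
    have h1 := IH ki (ltnW ik).
    have h2 := ratio i (leq_trans k0k ki) ik.
    have d1 : 0 < S i - S i.+1 by rewrite subr_gt0 Sd// (leq_trans k0k ki) ltnW.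
    have d2 : 0 < S i.+1 - S i.+2 by rewrite subr_gt0 Sd// ik andbT (leq_trans k0k)// ltnW.
    rewrite -(ler_pM2l d1); apply: le_trans h2; rewrite mulrC; apply: ler_wpM2l => //; exact: ltW.
  have sum m : (m <= k1 - k)%N -> S (k1 - m)%N <= T (k1 - m)%N.
    elim: m => [|m IH] mk; first by rewrite subn0.
    have := IH (ltnW mk); have e : (k1 - m = (k1 - m.+1).+1)%N by move: mk; clear; lia.
    rewrite e; have := up (k1 - m.+1)%N.
    have -> : (k <= k1 - m.+1)%N by move: mk kk1; clear; lia.
    have -> : (k1 - m.+1 < k1)%N by move: mk kk1; clear; lia.
    move=> /(_ isT isT); lra.
  by have := sum (k1 - k)%N (leqnn _); rewrite subKn.
have [kk|kk] := ltnP k k1; last first.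
  by have -> : k = k1 by move: kk kk1; clear; lia.
have dn m : (m <= k - k0)%N -> T (k - m)%N - T (k - m).+1 <= S (k - m)%N - S (k - m).+1.
  elim: m => [|m IH] mk; first by rewrite subn0.
  have e : (k - m = (k - m.+1).+1)%N by move: mk; clear; lia.
  have h1 := IH (ltnW mk).
  have h2 : (S (k - m.+1).+1 - S (k - m.+1).+2) * (T (k - m.+1)%N - T (k - m.+1).+1) <=
     (S (k - m.+1)%N - S (k - m.+1).+1) * (T (k - m.+1).+1 - T (k - m.+1).+2).
    by apply: ratio; move: mk kk; clear; lia.
  rewrite -e in h2 *.
  have d1 : 0 < S (k - m)%N - S (k - m).+1.
    by rewrite subr_gt0 Sd//; move: mk kk; clear; lia.
  have d2 : 0 < S (k - m.+1)%N - S (k - m)%N.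
    by rewrite subr_gt0 e Sd//; move: mk kk; clear; lia.
  rewrite -(ler_pM2l d1); apply: le_trans h2 _; rewrite [leRHS]mulrC; apply: ler_wpM2l => //; exact: ltW.
have sum m : (m <= k - k0)%N -> S (k0 + m)%N <= T (k0 + m)%N.
  elim: m => [|m IH] mk; first by rewrite addn0.
  have := IH (ltnW mk); have := dn (k - (k0 + m))%N.
  have -> : (k - (k - (k0 + m)) = k0 + m)%N by move: mk k0k; clear; lia.
  have -> : (k - (k0 + m) <= k - k0)%N by move: mk k0k; clear; lia.
  rewrite addnS => /(_ isT); lra.
by have := sum (k - k0)%N (leqnn _); rewrite subnKC.
Qed.

Section binomial_tail.
Context {R : realType}.

Definition binp (n k : nat) : R := 'C(n, k)%:R / 2 ^+ n.

Definition binT (n k : nat) : R := \sum_(k <= i < n.+1) binp n i.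

Lemma binp_ge0 n k : 0 <= binp n k.
Proof. by rewrite divr_ge0 ?exprn_ge0. Qed.

Lemma binp_gt0 n k : (k <= n)%N -> 0 < binp n k.
Proof. by move=> kn; rewrite divr_gt0 ?exprn_gt0// ltr0n bin_gt0. Qed.

Lemma binpS n k : binp n k.+1 * k.+1%:R = binp n k * (n%:R - k%:R).
Proof.
rewrite /binp mulrAC [RHS]mulrAC; congr (_ / _).
have [kn|nk] := leqP k n; last first.
  by rewrite !bin_small ?mul0r// ltnW.
by rewrite -natrB// -!natrM mulnC mul_bin_left mulnC.
Qed.

Lemma binTS n k : (k <= n)%N -> binT n k - binT n k.+1 = binp n k.
Proof. by move=> kn; rewrite /binT big_ltn// addrK. Qed.

Lemma binT0 n : binT n 0 = 1.
Proof.
rewrite /binT -mulr_suml -natr_sum big_mkord.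
have := Pascal 1 1 n; rewrite -[2%R]/(1 + 1)%:R.
under eq_bigr do rewrite !exp1n !muln1.
by move=> <-; rewrite natrX divff// expf_neq0// pnatr_eq0.
Qed.

Lemma binT_gt n k : (n < k)%N -> binT n k = 0.
Proof. by move=> nk; rewrite /binT big_geq. Qed.

Lemma binT_sym n k : (k <= n.+1)%N -> binT n k = 1 - binT n (n.+1 - k).
Proof.
move=> kn; apply/eqP; rewrite eq_sym subr_eq -[in eqbLHS](binT0 n) /binT.
rewrite (big_cat_nat (n := (n.+1 - k)%N))//= ?leq_subr//; apply/eqP; congr (_ + _).
rewrite big_nat_rev /= add0n.
rewrite -[X in _ = \sum_(X <= _ < _) _]add0n [RHS]big_addn.
rewrite !big_mkord; apply: eq_bigr => i _ /=.
rewrite /binp; congr (_%:R / _); rewrite -bin_sub; last by have := ltn_ord i; clear; lia.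
by congr ('C(_, _)); have := ltn_ord i; clear; lia.
Qed.

Lemma binT_le n i j : (i <= j)%N -> binT n j <= binT n i.
Proof.
move=> ij; have [jn|nj] := leqP j n.+1; last first.
  by rewrite binT_gt 1?ltnW// /binT sumr_ge0// => c _; exact: binp_ge0.
rewrite /binT [leRHS](big_cat_nat (n := j))//= lerDr sumr_ge0// => c _; exact: binp_ge0.
Qed.

Lemma binT_half_le n k : (n.+1 <= 2 * k)%N -> binT n k <= 2^-1.
Proof.
move=> nk; have [kn|nk'] := leqP k n.+1; last by rewrite binT_gt 1?ltnW// invr_ge0.
have h : (n.+1 - k <= k)%N by move: nk; clear; lia.
by have := binT_le n h; have := binT_sym kn; lra.
Qed.

Lemma binT_half_ge n k : (2 * k <= n.+1)%N -> 2^-1 <= binT n k.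
Proof.
move=> nk; have kn : (k <= n.+1)%N by move: nk; clear; lia.
have h : (k <= n.+1 - k)%N by move: nk; clear; lia.
by have := binT_le n h; have := binT_sym kn; lra.
Qed.

Lemma binT_half_gt n k : (2 * k <= n)%N -> 2^-1 < binT n k.
Proof.
move=> nk; have kn : (k <= n)%N by move: nk; clear; lia.
have h : (k.+1 <= n.+1 - k)%N by move: nk; clear; lia.
have := binT_le n h; have := binT_sym (leqW kn); have := binTS kn; have := binp_gt0 kn.
lra.
Qed.

(** Consecutive symmetric binomial weights have a ratio of the form (1 - x) / (1 + x), here bounded
    by exp (- 2 x). The auxiliary [f] has derivative t (e^t - e^-t). *)
Lemma exp2_le_ratio (x : R) : 0 <= x -> (1 - x) * expR (2 * x) <= 1 + x.
Proof.
move=> x0; pose f (t : R) := (1 + t) * expR (- t) - (1 - t) * expR t.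
have df (t : R) : is_derive t 1 f (t * expR t - t * expR (- t)).
  rewrite /f; apply: is_derive_eq; rewrite /GRing.scale/=; ring.
have : f 0 <= f x.
  apply: (@ger0_derive1_ndecry _ f 0) => //.
  - move=> t; rewrite in_itv/= andbT => t0; rewrite derive1E derive_val.
    by rewrite -mulrBr; apply: mulr_ge0; [exact: ltW|rewrite subr_ge0 ler_expR; lra].
  - apply: derivable_within_continuous => t _; exact: ex_derive.
have -> : f 0 = 0 by rewrite /f oppr0 expR0; ring.
rewrite /f subr_ge0 => h.
rewrite mulr_natl mulr2n expRD mulrA; apply: (@le_trans _ _ ((1 + x) * expR (- x) * expR x)).
  by rewrite ler_wpM2r ?expR_ge0.
by rewrite -mulrA -expRD addNr expR0 mulr1.
Qed.


Let Phi0 : Phi 0 = 2^-1 :> R.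
Proof. by have := @Phi_opp R 0; rewrite oppr0; lra. Qed.

(** With cells of width 2 / sqrt (n + 1) the Gaussian masses shrink at each step by at most the
    factor exp (- kap), the binomial weights by at least this factor. At the ends of the range
    [single_crossing] needs only the values 1/2 and 0. *)
Lemma binT_upper (n k : nat) : (n < 2 * k)%N -> (k <= n.+1)%N ->
  binT n k <= Phi (- (2 * (k%:R - n%:R / 2 - 1) / Num.sqrt n.+1%:R)).
Proof.
move=> nk kn; set r : R := Num.sqrt n.+1%:R.
have r0 : 0 < r by rewrite sqrtr_gt0.
have rr : r ^+ 2 = n%:R + 1 by rewrite sqr_sqrtr// -natr1.
pose u (i : nat) : R := 2 * (i%:R - n%:R / 2 - 1) / r.
have n0 : 0 <= n%:R :> R by [].
apply: (@single_crossing _ (fun i => Phi (- u i)) (binT n) (n./2).+1 n.+1 k).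
- by rewrite kn andbT; move: nk; clear; lia.
- apply: (@le_trans _ _ 2^-1); first by apply: binT_half_le; clear; lia.
  rewrite -Phi0 Phi_le oppr_ge0 /u pmulr_lle0 ?invr_gt0//.
  have : ((2 * (n./2).+1)%:R <= (n + 2)%:R :> R) by rewrite ler_nat; clear; lia.
  by rewrite natrM natrD; lra.
- by rewrite binT_gt// Phi_ge0.
- move=> i /andP[_ ik]; rewrite -subr_gt0 binTS//; exact: binp_gt0.
move=> i ki; rewrite ltnS => ik; rewrite !binTS ?(ltnW ik)// !Phi_opp.
set kap : R := (4 * i%:R + 2 - 2 * n%:R) / (n%:R + 1).
have G : Phi (u i.+1) - Phi (u i) <= expR kap * (Phi (u i.+2) - Phi (u i.+1)).
  have E j : u j = 1 * u j.+1 + - (2 / r) by rewrite /u -natr1; field; rewrite gt_eqF.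
  have ujj j : u j <= u j.+1 by rewrite [u j]E mul1r gerDl oppr_le0 divr_ge0// ltW.
  have := @Phi_affine_le R 1 (- (2 / r)) (expR kap) (u i.+1) (u i.+2) ltr01 (expR_ge0 _) (ujj _).
  rewrite -!E; apply => x /andP[_ xu]; rewrite !mul1r; apply/phi_le_mul.
  have -> : x ^+ 2 - (x - 2 / r) ^+ 2 = 4 * (x / r - (r ^+ 2)^-1) by field; rewrite gt_eqF.
  have h : x / r <= (2 * (i%:R + 2 - n%:R / 2 - 1)) / r ^+ 2.
    rewrite expr2 invfM mulrA ler_pM2r ?invr_gt0//; apply: le_trans xu _.
    rewrite /u -!natr1 ler_pM2r ?invr_gt0//; lra.
  have -> : 2 * kap = 4 * ((2 * (i%:R + 2 - n%:R / 2 - 1)) / r ^+ 2 - (r ^+ 2)^-1).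
    by rewrite /kap rr; field; rewrite gt_eqF// ltr_wpDl.
  by rewrite ler_pM2l// lerD2r.
have B : binp n i.+1 * expR kap <= binp n i :> R.
  have := @exp2_le_ratio ((2 * i%:R + 1 - n%:R) / (n%:R + 1)).
  have -> : 2 * ((2 * i%:R + 1 - n%:R) / (n%:R + 1)) = kap by rewrite /kap; field; rewrite gt_eqF// ltr_wpDl.
  have : (n%:R <= (2 * i + 1)%:R :> R) by rewrite ler_nat; move: ki; clear; lia.
  rewrite natrD natrM => ni.
  have p0 : 0 < n%:R + 1 :> R by rewrite ltr_wpDl.
  rewrite divr_ge0; [|lra|exact: ltW].
  have -> : 1 - (2 * i%:R + 1 - n%:R) / (n%:R + 1) = (n%:R - i%:R) * (2 / (n%:R + 1)) :> R.
    by field; rewrite gt_eqF.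
  have -> : 1 + (2 * i%:R + 1 - n%:R) / (n%:R + 1) = i.+1%:R * (2 / (n%:R + 1)) :> R.
    by rewrite -natr1; field; rewrite gt_eqF.
  rewrite mulrAC ler_pM2r ?divr_gt0// => /(_ isT) h.
  rewrite -(@ler_pM2r _ i.+1%:R)// mulrAC binpS -mulrA ler_wpM2l//; exact: binp_ge0.
have -> : 1 - Phi (u i) - (1 - Phi (u i.+1)) = Phi (u i.+1) - Phi (u i) by ring.
have -> : 1 - Phi (u i.+1) - (1 - Phi (u i.+2)) = Phi (u i.+2) - Phi (u i.+1) by ring.
apply: (@le_trans _ _ (binp n i.+1 * (expR kap * (Phi (u i.+2) - Phi (u i.+1))))).
  by rewrite ler_wpM2l ?binp_ge0.
rewrite mulrA ler_wpM2r// subr_ge0 Phi_le /u ler_pM2r ?invr_gt0// -!natr1; lra.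
Qed.

(** Hidden behind a sigma type so that arithmetic treats the constant as a symbol. As 128 = 2 * 8^2,
    the term C x^2 / n reaches 2 n at distance x = n / 8 from the mean. *)
Let Cdef : {c : R | c = 128}. Proof. by exists 128. Qed.

Let C := sval Cdef.

Let CE : C = 128. Proof. exact: svalP Cdef. Qed.

Let C2 : 2 <= C. Proof. by rewrite CE; lra. Qed.

Let C0 : 0 <= C. Proof. exact: le_trans C2. Qed.

(* The quadratic correction makes the Gaussian cells shrink faster than the binomial
   weights, up to a distance proportional to [n] of the mean. *)
Let g (n k : nat) : R :=
  let x := k%:R - n%:R / 2 in (x + C + C * x ^+ 2 / n%:R) * (2 / Num.sqrt n%:R).

Let rho_rate (n m : R) : 0 < n -> 0 <= m ->
  1 <= 1 + ((2 * C) / n) / (1 + C * m / n) <= expR ((2 * C) / n).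
Proof.
move=> n0 m0; have a0 : 0 <= (2 * C) / n by apply: divr_ge0; [exact: mulr_ge0|exact: ltW].
have b0 : 1 <= 1 + C * m / n by rewrite lerDl; apply: divr_ge0; [exact: mulr_ge0|exact: ltW].
have b1 : 0 < 1 + C * m / n by exact: lt_le_trans b0.
apply/andP; split; first by rewrite lerDl; apply: divr_ge0; [exact: a0|exact: ltW].
by apply: le_trans (expR_ge1Dx _); rewrite lerD2l ler_pdivrMr// ler_peMr.
Qed.

(** With m = 2 i + 1 - n, the pivot of the comparison is E = 2 m / n + 2 C m^2 / n^2: consecutive
    Gaussian cells have ratio at most exp (- E) by this lemma, and consecutive binomial weights have
    ratio at least 1 / (1 + E) by [weight_rate]. *)
Let cell_rate (n m Q : R) : 0 < n -> 0 <= m -> 0 <= Q ->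
  (2 * C) / n - 4 / n * ((1 + C * m / n) * (m + 2 * C + Q)) / 2 <= - (2 * m / n + (2 * C) * m ^+ 2 / n ^+ 2).
Proof.
move=> n0 m0 Q0; set a := n^-1; have a0 : 0 <= a by rewrite invr_ge0 ltW.
have -> : n ^- 2 = a ^+ 2 by rewrite exprVn.
have am : 0 <= a * m by exact: mulr_ge0.
have Ca : 0 <= C * a by exact: mulr_ge0.
have h1 : 0 <= a * m * C * (C * a) by apply: mulr_ge0 => //; exact: mulr_ge0.
have Cam : 0 <= C * (a * m) by exact: mulr_ge0.
have h2 : 0 <= a * Q * (1 + C * (a * m)).
  by apply: mulr_ge0; [exact: mulr_ge0|exact: addr_ge0].
have e : 4 * a * ((1 + C * m * a) * (m + 2 * C + Q)) / 2 =
  2 * m * a + 2 * C * m ^+ 2 * a ^+ 2 + 4 * (C * a) + 4 * (a * m * C * (C * a)) + 2 * (a * Q * (1 + C * (a * m))).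
  by field.
rewrite e; clear e; rewrite -[2 * C * a]mulrA; clear -Ca h1 h2; lra.
Qed.

Let weight_rate (n m : R) : 1 <= m -> 2 * m <= n ->
  (n + 1 + m) / 2 <= (n + 1 - m) / 2 * (1 + (2 * m / n + (2 * C) * m ^+ 2 / n ^+ 2)).
Proof.
move=> m1 mn; have n0 : 0 < n by lra.
pose z := m / n; have mz : m = z * n by rewrite /z divfK// gt_eqF.
have -> : 2 * m / n + (2 * C) * m ^+ 2 / n ^+ 2 = 2 * z + 2 * C * z ^+ 2 by rewrite /z; field; rewrite gt_eqF.
have z0 : 0 <= z by apply: divr_ge0; lra.
have z2 : z <= 2^-1 by rewrite /z ler_pdivrMr//; lra.
have h0 : 0 <= n * z ^+ 2 * (2^-1 - z) by apply: mulr_ge0; [rewrite mulr_ge0 ?sqr_ge0// ltW|lra].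
have h1 : 0 <= z * (1 + 2 * z) by apply: mulr_ge0; lra.
have h2 : 0 <= (n + 1 - m) * ((C - 2) * z ^+ 2).
  by apply: mulr_ge0; [lra|apply: mulr_ge0; [rewrite subr_ge0|exact: sqr_ge0]].
clearbody z; clear z0 z2; move: mz h0 h1 h2 => -> h0 h1 h2; clear m1 mn n0.
rewrite !expr2 in h0 h2 *; nra.
Qed.

Lemma binT_lower (n k : nat) : (10 <= n)%N -> (n <= 2 * k)%N ->
  k%:R - n%:R / 2 <= n%:R / 8 :> R -> Phi (- g n k) <= binT n k.
Proof.
move=> n10 nk kn; set r : R := Num.sqrt n%:R.
have n0 : 10 <= n%:R :> R by rewrite ler_nat.
have np : 0 < n%:R :> R by lra.
have r0 : 0 < r by rewrite sqrtr_gt0.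
have rr : r ^+ 2 = n%:R by rewrite sqr_sqrtr// ltW.
(* At [k0] the two tails lie on either side of 1/2. At [k1], just beyond distance n / 8, [g] is at
   least 4 sqrt n, so the Gaussian tail is at most 2 exp (- 4 n), below the last binomial weight
   2^-n. *)
pose k0 := uphalf n; pose k1 := (n./2 + n %/ 8 + 2)%N.
have k10 (i : nat) : (k0 <= i)%N -> n%:R <= 2 * i%:R :> R.
  by move=> h; rewrite -natrM ler_nat; move: h; rewrite /k0; clear; lia.
have k1n : (k1 <= n)%N by rewrite /k1; move: n10; clear; lia.
have gE i : g n i.+1 - g n i = (1 + C * (2 * i%:R + 1 - n%:R) / n%:R) * (2 / r).
  by rewrite /g -/r -natr1; field; rewrite !gt_eqF.
have gincr i : (k0 <= i)%N -> 0 < g n i.+1 - g n i.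
  move=> /k10 h; rewrite gE; apply: mulr_gt0; [apply: ltr_pwDl => //; apply: divr_ge0 => //; apply: mulr_ge0 => //; clear gE k10; lra|exact: divr_gt0].
have gpos i : (k0 <= i)%N -> 0 <= g n i.
  move=> /k10 h; rewrite /g -/r; apply: mulr_ge0; last by apply: divr_ge0 => //; exact: ltW.
  have : 0 <= C * (i%:R - n%:R / 2) ^+ 2 / n%:R :> R by apply: divr_ge0 => //; apply: mulr_ge0 => //; exact: sqr_ge0.
  have := C0; lra.
apply: (@single_crossing _ (binT n) (fun i => Phi (- g n i)) k0 k1 k).
- apply/andP; split; first by rewrite /k0; move: nk; clear; lia.
  have : ((8 * k)%:R <= (5 * n)%:R :> R) by rewrite !natrM; lra.
  by rewrite ler_nat /k1; clear; lia.
- apply: (@le_trans _ _ 2^-1); last by apply: binT_half_ge; rewrite /k0; clear; lia.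
  by rewrite -Phi0 Phi_le oppr_le0 gpos.
- have k01 : (k0 <= k1)%N by rewrite /k0 /k1; clear; lia.
  apply: le_trans (Phi_tail (gpos _ k01)) _; apply: (@le_trans _ _ (binp n n)); last first.
    by rewrite -[leLHS](binTS (leqnn n)) (binT_gt (ltnSn n)) subr0 binT_le.
  have x8 : n%:R / 8 <= k1%:R - n%:R / 2 :> R.
    have : ((5 * n)%:R <= (8 * k1)%:R :> R) by rewrite ler_nat /k1; clear; lia.
    by rewrite !natrM; lra.
  have g4 : 4 * r <= g n k1.
    rewrite /g -/r; set x := k1%:R - _ in x8 *.
    have : 2 * n%:R <= C * x ^+ 2 / n%:R.
      rewrite CE.
      have : (n%:R / 8) ^+ 2 <= x ^+ 2 by rewrite lerXn2r ?nnegrE//; lra.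
      by rewrite ler_pdivlMr// expr_div_n expr2; lra.
    move=> h; have -> : 4 * r = 2 * n%:R * (2 / r) by rewrite -rr; field; rewrite gt_eqF.
    have := C0; rewrite ler_pM2r ?divr_gt0//; clear gE gincr gpos k10; lra.
  have g16 : 4 * n%:R <= g n k1 ^+ 2 / 4.
    have : (4 * r) ^+ 2 <= g n k1 ^+ 2 by rewrite lerXn2r ?nnegrE// ?gpos// mulr_ge0// ltW.
    by rewrite exprMn rr; lra.
  apply: (@le_trans _ _ (2 * expR (- (4 * n%:R)))); first by rewrite ler_pM2l// ler_expR lerN2.
  rewrite /binp binn mul1r expRN ler_pdivrMr ?expR_gt0// ler_pdivlMl ?exprn_gt0//.
  rewrite mulrC expRM_natr.
  have e4 : 4 <= expR 4 :> R by apply: le_trans (expR_ge1Dx _); lra.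
  apply: (@le_trans _ _ (4 ^+ n)); last by rewrite lerXn2r ?nnegrE// ?expR_ge0.
  rewrite (_ : 4 = 2 * 2); last by ring.
  rewrite exprMn ler_wpM2r ?exprn_ge0//.
  by rewrite -[leLHS]expr1 ler_weXn2l//; [lra|move: n10; clear; lia].
- by move=> i /andP[ki _]; apply: Phi_lt; rewrite ltrN2 -subr_gt0 gincr.
move=> i ki ik; rewrite !Phi_opp.
have i_n : (i.+1 <= n)%N by move: ik k1n; clear; lia.
pose m : R := 2 * i%:R + 1 - n%:R.
have m1 : 1 <= m by have := k10 i ki; rewrite /m; lra.
have mn : 2 * m <= n%:R.
  have : ((8 * i)%:R <= (5 * n)%:R :> R) by rewrite ler_nat; move: ik; rewrite /k1; clear; lia.
  by rewrite !natrM /m; clear gE; lra.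
rewrite !binTS ?(ltnW i_n)//.
have -> : 1 - Phi (g n i) - (1 - Phi (g n i.+1)) = Phi (g n i.+1) - Phi (g n i) by ring.
have -> : 1 - Phi (g n i.+1) - (1 - Phi (g n i.+2)) = Phi (g n i.+2) - Phi (g n i.+1) by ring.
have d0 := gincr i ki; have d1 := gincr i.+1 (leqW ki).
have [p0 p1] := (gpos i ki, gpos i.+1 (leqW ki)).
have E0 := gE i; have E1 := gE i.+1.
set g0 := g n i in d0 p0 E0 *; set g1 := g n i.+1 in d0 d1 p1 E0 E1 *; set g2 := g n i.+2 in d1 E1 *.
(* [rho] is the ratio of the widths of consecutive cells, and [K] below bounds the ratio of
   densities at corresponding points. *)
pose rho := (g2 - g1) / (g1 - g0).
have rho0 : 0 < rho by rewrite divr_gt0.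
have m0 : 0 <= m by exact: le_trans m1.
have den : 0 < 1 + C * m / n%:R by apply: ltr_pwDl => //; apply: divr_ge0 => //; exact: mulr_ge0.
have rhoE : rho = 1 + ((2 * C) / n%:R) / (1 + C * m / n%:R).
  have e2 : 2 * i.+1%:R + 1 - n%:R = m + 2 by rewrite -natr1 /m; ring.
  rewrite /rho E0 E1 e2 -/m; field.
  by rewrite !gt_eqF//= [X in 0 < X](_ : _ = n%:R * (1 + C * m / n%:R)) ?mulr_gt0//; field; rewrite gt_eqF.
have /andP[rho1 rho2] := rho_rate np m0; rewrite -rhoE in rho1 rho2.
pose Q := C * ((i%:R + 1 - n%:R / 2) ^+ 2 + (i%:R - n%:R / 2) ^+ 2) / n%:R : R.
have Q0 : 0 <= Q by apply: divr_ge0 => //; apply: mulr_ge0 => //; apply: addr_ge0; exact: sqr_ge0.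
have sqE : g1 ^+ 2 - g0 ^+ 2 = 4 / n%:R * ((1 + C * m / n%:R) * (m + 2 * C + Q)).
  have -> : g1 ^+ 2 - g0 ^+ 2 = (g1 - g0) * (g1 + g0) by ring.
  have -> : g1 + g0 = (m + 2 * C + Q) * (2 / r).
    by rewrite /g1 /g0 /g -/r -natr1 /m /Q; field; rewrite !gt_eqF.
  by rewrite E0 -/m -rr; field; rewrite !gt_eqF.
clear gE gincr gpos E0 E1 rhoE.
pose K := expR (- ((g1 ^+ 2 - g0 ^+ 2) / 2)).
have G : Phi g2 - Phi g1 <= rho * K * (Phi g1 - Phi g0).
  have rd : rho * (g1 - g0) = g2 - g1 by rewrite /rho divfK// gt_eqF.
  have -> : g2 = rho * g1 + (g1 - rho * g0) by move: rd; lra.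
  rewrite [X in _ - Phi X <= _](_ : g1 = rho * g0 + (g1 - rho * g0)); last by ring.
  apply: Phi_affine_le => //.
  - by rewrite mulr_ge0 ?expR_ge0// ltW.
  - by rewrite -subr_ge0 ltW.
  move=> x /andP[gx xg]; rewrite -mulrA ler_pM2l//; apply/phi_le_mul.
  set y := rho * x + _; clearbody g0 g1; clear sqE.
  have yx : g1 - g0 <= y - x.
    have : 0 <= (rho - 1) * (x - g0) by apply: mulr_ge0; lra.
    by rewrite /y; lra.
  have yx2 : g1 + g0 <= y + x by lra.
  have : (g1 - g0) * (g1 + g0) <= (y - x) * (y + x) by apply: ler_pM => //; lra.
  by rewrite -!subr_sqr; lra.
have B : rho * K * binp n i <= binp n i.+1.
  rewrite -(@ler_pM2r _ i.+1%:R)// binpS [leLHS]mulrAC mulrC ler_wpM2l ?binp_ge0//.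
  pose E := 2 * m / n%:R + (2 * C) * m ^+ 2 / n%:R ^+ 2.
  have KE : rho * K <= expR (- E).
    apply: (@le_trans _ _ (expR ((2 * C) / n%:R) * K)); first by rewrite ler_wpM2r ?expR_ge0.
    by rewrite -expRD ler_expR sqE cell_rate.
  apply: (@le_trans _ _ (expR (- E) * i.+1%:R)); first by rewrite ler_wpM2r.
  have ni : n%:R - i%:R = (n%:R + 1 - m) / 2 :> R by rewrite /m; field.
  have i1 : 0 < n%:R - i%:R :> R by rewrite ni divr_gt0//; clear sqE; lra.
  rewrite mulrC expRN ler_pdivrMr ?expR_gt0//.
  apply: (@le_trans _ _ ((n%:R - i%:R) * (1 + E))); last by rewrite ler_pM2l// expR_ge1Dx.
  rewrite ni (_ : i.+1%:R = (n%:R + 1 + m) / 2 :> R); last by rewrite -natr1 /m; field.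
  exact: weight_rate.
apply: (@le_trans _ _ (rho * K * (Phi g1 - Phi g0) * binp n i)).
  by rewrite ler_wpM2r ?binp_ge0.
by rewrite mulrAC mulrC ler_wpM2l// subr_ge0 Phi_le -subr_ge0 ltW.
Qed.

(** The bound y <= sqrt n / 16 keeps the quantile within distance n / 8 of the mean, where
    [binT_lower] is available. The constant 1200 has to cover 128 + 128 (8 + 2 y^2), the corrections
    in [g]. *)
Lemma binT_quantile (n b : nat) (y : R) : 0 <= y -> y <= Num.sqrt n%:R / 16 ->
  Phi (- y) <= binT n b -> binT n b.+1 <= Phi (- y) ->
  `|b%:R - n%:R / 2 - Num.sqrt n%:R / 2 * y| <= 1200 * (1 + y ^+ 2).
Proof.
move=> y0; set r := Num.sqrt n%:R => yr h1 h2.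
have n0 : 0 <= n%:R :> R by [].
have r0 : 0 <= r by exact: sqrtr_ge0.
have rr : r ^+ 2 = n%:R by rewrite sqr_sqrtr.
have yle : y <= 1 + y ^+ 2 by have := sqr_ge0 (y - 2^-1); rewrite expr2; lra.
have y20 : 0 <= y ^+ 2 by exact: sqr_ge0.
have bn : (b <= n)%N.
  by rewrite leqNgt; apply/negP => /binT_gt e; move: h1; rewrite e leNgt Phi_gt0.
have yhalf : Phi (- y) <= 2^-1 :> R by rewrite -Phi0 Phi_le oppr_le0.
have b1 : (n.+1 <= 2 * b.+1)%N.
  rewrite ltnNge; apply/negP => /binT_half_gt h; lra.
have up : b%:R - n%:R / 2 <= 1 + r * y / 2 + y / 2.
  have [nb|nb] := ltnP n (2 * b); last first.
    have : ((2 * b)%:R <= n%:R :> R) by rewrite ler_nat.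
    rewrite natrM; have : 0 <= r * y by exact: mulr_ge0.
    lra.
  have := le_trans h1 (binT_upper nb (leqW bn)); rewrite Phi_le lerN2.
  have s0 : 0 < Num.sqrt n.+1%:R :> R by rewrite sqrtr_gt0.
  rewrite ler_pdivrMr// => h3.
  have : Num.sqrt n.+1%:R <= r + 1.
    rewrite -[leRHS]ger0_norm ?addr_ge0// -sqrtr_sqr ler_sqrt ?sqr_ge0//.
    by rewrite -natr1 sqrrD rr; lra.
  move=> h4; have : y * Num.sqrt n.+1%:R <= y * (r + 1) by rewrite ler_wpM2l.
  lra.
have ry : r * y <= n%:R / 16.
  by rewrite -rr expr2 -mulrA; exact: ler_wpM2l.
(* For small [n] the constant alone exceeds the left side. *)
have [n32|n32] := ltnP n 32.
  have nR : n%:R <= 32 :> R by rewrite ler_nat ltnW.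
  have : b%:R <= n%:R :> R by rewrite ler_nat.
  have : 0 <= b%:R :> R by [].
  have : 0 <= r * y by exact: mulr_ge0.
  move=> *; rewrite ler_norml; apply/andP; split; lra.
have nR : 32 <= n%:R :> R by rewrite ler_nat.
have r1 : 1 <= r by rewrite -[leLHS]sqrtr1 ler_sqrt//; lra.
have ny : y <= n%:R / 16.
  apply: le_trans yr _; rewrite ler_pM2r//; rewrite -rr expr2; nra.
have lo := @binT_lower n b.+1 (_ : 10 <= n)%N (_ : n <= 2 * b.+1)%N (_ : _).
have : y <= g n b.+1.
  rewrite -[leLHS]opprK lerNl -Phi_le; apply: le_trans h2; apply: binT_lower.
  - by move: n32; clear; lia.
  - exact: ltnW.
  - by rewrite -natr1; lra.
rewrite /g -/r -natr1 CE; set x := b%:R + 1 - n%:R / 2.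
have x1 : 0 <= x.
  have : ((n.+1)%:R <= (2 * b.+1)%:R :> R) by rewrite ler_nat.
  by rewrite natrM -!natr1 /x; lra.
have x2 : x <= 2 + r * y.
  have : y <= r * y by rewrite ler_peMl.
  rewrite /x; lra.
have rp : 0 < r by lra.
rewrite mulrA ler_pdivlMr// => h.
have xn : x ^+ 2 / n%:R <= 8 + 2 * y ^+ 2.
  rewrite ler_pdivrMr; last by lra.
  have : x ^+ 2 <= (2 + r * y) ^+ 2 by rewrite lerXn2r ?nnegrE//; have := mulr_ge0 r0 y0; lra.
  have : 0 <= (2 - r * y) ^+ 2 by exact: sqr_ge0.
  have : (r * y) ^+ 2 = y ^+ 2 * n%:R by rewrite exprMn rr mulrC.
  by rewrite !expr2; nra.
rewrite ler_norml; apply/andP; split; last by lra.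
have : 128 * x ^+ 2 / n%:R <= 128 * (8 + 2 * y ^+ 2) by rewrite -mulrA ler_pM2l.
by rewrite /x in h *; lra.
Qed.

End binomial_tail.

(** * Quantile functions of discrete laws *)

Section quantile.
Context {R : realType}.
Local Notation RR := (measurableTypeR R).
Implicit Types p : nat -> R.

Definition pmf p := (forall k, 0 <= p k) /\ (series p @ \oo --> (1 : R)).

Lemma pmf_sum_le1 p m : pmf p -> \sum_(i < m) p i <= 1.
Proof.
move=> [p0 p1]; rewrite -(cvg_lim _ p1)// -(big_mkord xpredT p).
apply: (@nondecreasing_cvgn_le _ (series p)).
  by apply: nondecreasing_series => k _ _; exact: p0.
by apply/cvg_ex; exists 1.
Qed.

Lemma finite_pmf p m : (forall k, 0 <= p k) -> (forall k, (m <= k)%N -> p k = 0) ->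
  \sum_(i < m) p i = 1 -> pmf p.
Proof.
move=> p0 pm p1; split=> //; apply: cvg_near_cst; exists m => // k /= mk.
rewrite /series /= (big_cat_nat (n := m))//= big_mkord p1 big1_seq ?addr0// => i.
by rewrite mem_index_iota => /andP[_ /andP[mi _]]; rewrite pm.
Qed.

Let quant_ex p z : pmf p -> exists k, Phi z <= \sum_(i < k.+1) p i.
Proof.
move=> [p0 p1]; have := cvgr_ge _ p1 _ (Phi_lt1 z) => -[k _ /(_ k.+1 (leqnSn k))] /= h.
by exists k; rewrite -(big_mkord xpredT).
Qed.

(** The quantile function of the law [p] composed with [Phi]: it turns a standard normal into a
    variable of law [p], monotonically. The value 0 is a default for sequences that are not
    probability mass functions. *)
Definition quant p (z : R) : nat :=
  if pselect (pmf p) is left H then ex_minn (quant_ex z H) else 0%N.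

Lemma quant_leE p z k : pmf p -> (quant p z <= k)%N = (Phi z <= \sum_(i < k.+1) p i).
Proof.
move=> Hp; rewrite /quant; case: pselect => // H; case: ex_minnP => m Pm mmin.
apply/idP/idP => [mk|]; last exact: mmin.
apply: le_trans Pm _; rewrite -!(big_mkord xpredT p) [leRHS](big_cat_nat (n := m.+1))//= lerDl.
by apply: sumr_ge0 => i _; apply: Hp.1.
Qed.

Lemma quant_gtE p z k : pmf p -> (k <= quant p z)%N = (k == 0%N) || (\sum_(i < k) p i < Phi z).
Proof.
by move=> Hp; case: k => [//|k]; rewrite ltnNge quant_leE// ltNge.
Qed.

Lemma measurable_Phi : measurable_fun setT (Phi : RR -> RR).
Proof. by apply: continuous_measurable_fun; exact: continuous_Phi. Qed.

Let mquant_le p k : pmf p -> measurable [set z : RR | (quant p z <= k)%N].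
Proof.
move=> Hp; rewrite (_ : [set z | _] = Phi @^-1` `]-oo, \sum_(i < k.+1) p i]%classic); last first.
  by apply/seteqP; split => z /=; rewrite quant_leE// in_itv.
rewrite -[X in measurable X]setTI; apply: measurable_Phi => //; exact: measurable_itv.
Qed.

Let quant_eq_le p k : [set z : RR | quant p z = k] =
  [set z : RR | (quant p z <= k)%N] `\` (if k is k'.+1 then [set z : RR | (quant p z <= k')%N] else set0).
Proof.
apply/seteqP; split => z /=.
  move=> e; split; first by rewrite e.
  by case: k e => [|k] e //=; apply/negP; rewrite e -ltnNge.
case: k => [|k] [h1 h2]; first by move: h1; rewrite leqn0 => /eqP.
by apply/eqP; rewrite eqn_leq h1 ltnNge; apply/negP.
Qed.

Lemma measurable_quant_eq p k : pmf p -> measurable [set z : RR | quant p z = k].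
Proof.
move=> Hp; rewrite quant_eq_le; apply: measurableD; first exact: mquant_le.
by case: k => [|k] //; exact: mquant_le.
Qed.

Lemma measurable_quant p (A : set nat) : pmf p -> measurable [set z : RR | A (quant p z)].
Proof.
move=> Hp; rewrite (_ : [set z | _] = \bigcup_(k in A) [set z : RR | quant p z = k]); last first.
  by apply/seteqP; split => z /= => [Az|[k Ak e]]; [exists (quant p z)|rewrite e].
by apply: bigcup_measurable => k _; exact: measurable_quant_eq.
Qed.

Lemma measurable_fun_quant p (f : nat -> R) : pmf p -> measurable_fun setT (fun z : RR => f (quant p z) : RR).
Proof.
move=> Hp _ B mB; rewrite setTI.
exact: (@measurable_quant p (f @^-1` B)).
Qed.

Let N01_quant_le p k : pmf p -> N01 [set z : RR | (quant p z <= k)%N] = (\sum_(i < k.+1) p i)%:E.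
Proof.
move=> Hp; rewrite -N01_Phi_le; last by rewrite pmf_sum_le1// sumr_ge0// => i _; apply: Hp.1.
by congr (N01 _); apply/seteqP; split => z /=; rewrite quant_leE.
Qed.

Lemma N01_quant p k : pmf p -> N01 [set z : RR | quant p z = k] = (p k)%:E.
Proof.
move=> Hp; rewrite quant_eq_le measureD; last 3 first.
- exact: mquant_le.
- by case: k => [|k]//; exact: mquant_le.
- by rewrite (le_lt_trans (probability_le1 _ _))// ?ltry//; exact: mquant_le.
case: k => [|k].
  rewrite setI0 measure0 sube0; have := N01_quant_le 0 Hp; rewrite big_ord1.
  by move=> <-.
rewrite (_ : _ `&` _ = [set z : RR | (quant p z <= k)%N]); last first.
  by apply/seteqP; split => z /= => [[]//|h]; split => //; exact: leqW.
have h1 := N01_quant_le k.+1 Hp; have h2 := N01_quant_le k Hp.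
transitivity (N01 [set z : RR | (quant p z <= k.+1)%N] - N01 [set z : RR | (quant p z <= k)%N])%E => //.
by rewrite h1 h2 big_ord_recr /= -EFinB addrAC subrr add0r.
Qed.

Lemma integral_quant p (f : nat -> R) : pmf p -> (forall k, 0 <= f k) ->
  (\int[N01]_z (f (quant p z))%:E = \sum_(0 <= k <oo) (f k * p k)%:E)%E.
Proof.
move=> Hp f0; pose F k := [set z : RR | quant p z = k].
have mF k : measurable (F k) by exact: measurable_quant_eq.
have cover : \bigcup_k F k = setT by apply/seteqP; split => // z _; exists (quant p z).
rewrite -cover ge0_integral_bigcup//; last 3 first.
- by rewrite cover; apply/measurable_EFinP; exact: measurable_fun_quant.
- by move=> z _; rewrite lee_fin.
- by apply/trivIsetP => i j _ _ ij; apply/seteqP; split => z // [] /= h1 h2; move: ij; rewrite -h1 h2 eqxx.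
apply: eq_eseriesr => k _.
rewrite (eq_integral (fun=> (f k)%:E)); last by move=> z; rewrite inE /F/= => ->.
have h : N01 (F k) = (p k)%:E by exact: N01_quant.
by rewrite integral_cst// [X in (_ * X)%E]h.
Qed.

Lemma integral_quant_cvg p (f : nat -> R) l : pmf p -> (forall k, 0 <= f k) ->
  (fun m => \sum_(k < m) f k * p k) @ \oo --> l ->
  (\int[N01]_z (f (quant p z))%:E = l%:E)%E.
Proof.
move=> Hp f0 cl; rewrite integral_quant// -(cvg_lim _ cl)// -EFin_lim; last by apply/cvg_ex; exists l.
by congr (limn _); apply/funext => m /=; rewrite sumEFin big_mkord.
Qed.

End quantile.

Section poisson.
Context {R : realType}.
Local Notation RR := (measurableTypeR R).

Definition poisson (lam : R) (k : nat) : R := expR (- lam) * (lam ^+ k / k`!%:R).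

Lemma poisson_ge0 lam k : 0 <= lam -> 0 <= poisson lam k.
Proof. by move=> l0; rewrite mulr_ge0 ?expR_ge0// divr_ge0 ?exprn_ge0. Qed.

Lemma pmf_poisson lam : 0 <= lam -> pmf (poisson lam).
Proof.
move=> l0; split=> [k|]; first exact: poisson_ge0.
have -> : series (poisson lam) = fun n => expR (- lam) * series (exp_coeff lam) n.
  by apply/funext => n; rewrite /series /= mulr_sumr; apply: eq_bigr => k _.
rewrite -[X in _ --> X](_ : expR (- lam) * expR lam = 1); last by rewrite -expRD addNr expR0.
by apply: cvgM; [exact: cvg_cst|exact: is_cvg_series_exp_coeff].
Qed.

(** Fair thinning: splitting a Poisson number of points by fair coins produces two independent
    Poisson numbers of half the mean. This is what makes the leaf counts of the tree independent. *)
Lemma poisson_split lam a b : poisson lam (a + b) * binp (a + b) a = poisson (lam / 2) a * poisson (lam / 2) b.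
Proof.
rewrite /poisson /binp.
have -> : expR (- lam) = expR (- (lam / 2)) * expR (- (lam / 2)) by rewrite -expRD; congr expR; field.
have := bin_fact (leq_addr b a); rewrite addKn => /(congr1 (fun n : nat => n%:R : R)).
rewrite !natrM => <-.
have fa k : k`!%:R != 0 :> R by rewrite pnatr_eq0 -lt0n fact_gt0.
rewrite !expr_div_n exprD [2 ^+ (a + b)]exprD; field.
rewrite !fa !expf_neq0 ?pnatr_eq0//=.
by rewrite -lt0n bin_gt0 leq_addr.
Qed.

Lemma poissonS lam k : k.+1%:R * poisson lam k.+1 = lam * poisson lam k.
Proof.
rewrite /poisson factS natrM exprS; field.
by rewrite pnatr_eq0 -lt0n fact_gt0 /= gt_eqF// ltr_pwDl.
Qed.

Let partial1 lam m : \sum_(k < m.+1) k%:R * poisson lam k = lam * \sum_(k < m) poisson lam k.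
Proof.
rewrite big_ord_recl mul0r add0r mulr_sumr; apply: eq_bigr => k _.
by rewrite lift0 poissonS.
Qed.

Let partial2 lam m : \sum_(k < m.+2) (k%:R * (k%:R - 1)) * poisson lam k = lam ^+ 2 * \sum_(k < m) poisson lam k.
Proof.
rewrite !big_ord_recl /= /bump/= mul0r mul0r add0r subrr mulr0 mul0r add0r mulr_sumr; apply: eq_bigr => k _.
rewrite /bump /= !add1n (_ : k.+2%:R - 1 = k.+1%:R :> R); last by rewrite -[k.+2%:R]natr1 addrK.
by rewrite [X in X * _]mulrC -mulrA poissonS mulrCA poissonS mulrA expr2.
Qed.

Let cvg_sum_poisson lam : 0 <= lam -> (fun m => \sum_(k < m) poisson lam k) @ \oo --> (1 : R).
Proof.
move=> /pmf_poisson [_]; rewrite (_ : series _ = fun m => \sum_(k < m) poisson lam k)//.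
by apply/funext => m; rewrite /series /= big_mkord.
Qed.

Let cvg_partial1 lam : 0 <= lam -> (fun m => \sum_(k < m) k%:R * poisson lam k) @ \oo --> lam.
Proof.
move=> l0; rewrite -cvg_shiftS.
rewrite (_ : (fun n => _) = fun m => lam * \sum_(k < m) poisson lam k); last exact/funext/partial1.
have H : (fun m => lam * \sum_(k < m) poisson lam k) @ \oo --> lam * 1.
  by apply: cvgM; [exact: cvg_cst|exact: cvg_sum_poisson].
by rewrite mulr1 in H.
Qed.

Let cvg_partial2 lam : 0 <= lam ->
  (fun m => \sum_(k < m) (k%:R * (k%:R - 1)) * poisson lam k) @ \oo --> lam ^+ 2.
Proof.
move=> l0; rewrite -cvg_shiftS -(cvg_shiftS (fun n => \sum_(k < n.+1) _)).
rewrite (_ : (fun n => _) = fun m => lam ^+ 2 * \sum_(k < m) poisson lam k); last exact/funext/partial2.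
have H : (fun m => lam ^+ 2 * \sum_(k < m) poisson lam k) @ \oo --> lam ^+ 2 * 1.
  by apply: cvgM; [exact: cvg_cst|exact: cvg_sum_poisson].
by rewrite mulr1 in H.
Qed.

Lemma integral_poisson_id lam : 0 <= lam ->
  (\int[N01]_z ((quant (poisson lam) z)%:R)%:E = lam%:E)%E.
Proof.
move=> l0; apply: (integral_quant_cvg (f := fun k => k%:R)) => //; first exact: pmf_poisson.
exact: cvg_partial1.
Qed.

Lemma integral_poisson_var lam : 0 <= lam ->
  (\int[N01]_z (((quant (poisson lam) z)%:R - lam) ^+ 2)%:E = lam%:E)%E.
Proof.
move=> l0; apply: (integral_quant_cvg (f := fun k => (k%:R - lam) ^+ 2)) => [|k|].
- exact: pmf_poisson.
- exact: sqr_ge0.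
have -> : (fun m => \sum_(k < m) (k%:R - lam) ^+ 2 * poisson lam k) =
    fun m => \sum_(k < m) (k%:R * (k%:R - 1)) * poisson lam k +
      (1 - 2 * lam) * \sum_(k < m) k%:R * poisson lam k + lam ^+ 2 * \sum_(k < m) poisson lam k.
  apply/funext => m; rewrite !mulr_sumr -!big_split /=; apply: eq_bigr => k _; ring.
rewrite -[X in _ --> X](_ : lam ^+ 2 + (1 - 2 * lam) * lam + lam ^+ 2 * 1 = lam); last by ring.
apply: cvgD; first apply: cvgD; first exact: cvg_partial2.
- by apply: cvgM; [exact: cvg_cst|exact: cvg_partial1].
- by apply: cvgM; [exact: cvg_cst|exact: cvg_sum_poisson].
Qed.

End poisson.

Section binomial_quantile.
Context {R : realType}.

Lemma pmf_binp n : pmf (@binp R n).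
Proof.
apply: (@finite_pmf _ _ n.+1) => [k|k nk|]; first exact: binp_ge0.
  by rewrite /binp bin_small// mul0r.
by rewrite -(big_mkord xpredT) -/(binT n 0) binT0.
Qed.

Definition binQ (n : nat) (z : R) : nat := quant (binp n) z.

Lemma binQ_le n z : (binQ n z <= n)%N.
Proof.
rewrite /binQ (quant_leE _ _ (pmf_binp n)) -(big_mkord xpredT) -/(binT n 0) binT0.
by rewrite ltW// Phi_lt1.
Qed.

Lemma binQ_approx (n : nat) (z : R) : `|z| <= Num.sqrt n%:R / 16 ->
  `|(binQ n z)%:R - n%:R / 2 - Num.sqrt n%:R / 2 * z| <= 1200 * (1 + z ^+ 2).
Proof.
set b := binQ n z => zn; have bn : (b <= n)%N := binQ_le n z.
have F k : \sum_(i < k) binp n i = 1 - binT n k :> R.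
  rewrite -(big_mkord xpredT); apply/eqP; rewrite eq_sym subr_eq -(binT0 n) /binT.
  have [kn|nk] := leqP k n.+1; first by rewrite (big_cat_nat (n := k)).
  rewrite [X in _ == _ + X]big_geq 1?ltnW// addr0 (big_cat_nat (p := k) (n := n.+1))//= 1?ltnW//.
  rewrite [X in _ == _ + X]big1_seq ?addr0// => i.
  by rewrite mem_index_iota => /andP[_ /andP[ni _]]; rewrite /binp bin_small// mul0r.
have h1 : 1 - binT n b < Phi z \/ b = 0%N.
  have := leqnn b; rewrite {2}/b /binQ (quant_gtE _ _ (pmf_binp n)) F.
  by move=> /orP[/eqP|]; [right|left].
have h2 : Phi z <= 1 - binT n b.+1.
  by have := leqnn b; rewrite {1}/b /binQ (quant_leE _ _ (pmf_binp n)) F.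
have [z0|/ltW z0] := leP 0 z.
  rewrite ger0_norm// in zn; apply: binT_quantile => //; rewrite Phi_opp; last by lra.
  by case: h1 => [|->]; [lra|rewrite binT0; have := Phi_ge0 z; lra].
(* For negative [z] symmetry is used: [n - b] takes the role of the quantile at [- z]. *)
have y0 : 0 <= - z by rewrite oppr_ge0.
rewrite ler0_norm// in zn.
have := @binT_quantile R n (n - b) (- z) y0 zn; rewrite opprK sqrrN natrB//.
have e1 : binT n (n - b) = 1 - binT n b.+1 :> R by rewrite (binT_sym (leqW (leq_subr b n))) subSn ?leq_subr// subKn.
have e2 : binT n (n - b).+1 = 1 - binT n b :> R.
  by rewrite (@binT_sym _ n (n - b).+1) ?ltnS ?leq_subr// subSS subKn.
rewrite e1 e2 => /(_ h2) H.
have : 1 - binT n b <= Phi z by case: h1 => [/ltW//|->]; rewrite binT0 subrr Phi_ge0.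
move=> /H; rewrite -normrN => h3; apply: le_trans h3; rewrite le_eqVlt; apply/orP; left; apply/eqP.
by congr `|_|; field.
Qed.

End binomial_quantile.

(** * Dyadic splitting trees *)

Section countable_valued.
Context d (T : measurableType d).

(** Measurability by fibres, so that no sigma-algebra has to be chosen on [I]; it serves counts,
    booleans and finite sequences alike. *)
Definition cmeas (I : countType) (f : T -> I) := forall i, measurable [set w | f w = i].

Lemma measurable_bigcup_countType (I : countType) (A : I -> set T) :
  (forall i, measurable (A i)) -> measurable (\bigcup_i A i).
Proof.
move=> mA; rewrite (_ : \bigcup_i A i =
    \bigcup_n (if unpickle n is Some i then A i else set0)); last first.
  apply/seteqP; split => w [].
    by move=> i _ Ai; exists (pickle i) => //; rewrite pickleK.
  by move=> n _; case: (unpickle n) => // i Ai; exists i.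
by apply: bigcup_measurable => n _; case: unpickle.
Qed.

Lemma measurable_fun_bind d' (S : measurableType d') (I : countType) (f : T -> I) (g : I -> T -> S) :
  cmeas f -> (forall i, measurable_fun setT (g i)) -> measurable_fun setT (fun w => g (f w) w).
Proof.
move=> mf mg _ B mB; rewrite setTI (_ : _ @^-1` B = \bigcup_i ([set w | f w = i] `&` g i @^-1` B)); last first.
  apply/seteqP; split => w /=; first by move=> Bw; exists (f w).
  by move=> [i _ [/= <-]].
apply: measurable_bigcup_countType => i; apply: measurableI; first exact: mf.
by rewrite -[X in measurable X]setTI; exact: mg.
Qed.

Lemma cmeas_bind (I J : countType) (f : T -> I) (g : I -> T -> J) :
  cmeas f -> (forall i, cmeas (g i)) -> cmeas (fun w => g (f w) w).
Proof.
move=> mf mg j; rewrite (_ : [set w | g (f w) w = j] = \bigcup_i ([set w | f w = i] `&` [set w | g i w = j])); last first.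
  apply/seteqP; split => w /=; first by move=> e; exists (f w).
  by move=> [i _ [/= <-]].
by apply: measurable_bigcup_countType => i; apply: measurableI; [exact: mf|exact: mg].
Qed.

Lemma cmeas_cst (I : countType) (i : I) : cmeas (fun=> i).
Proof.
move=> j; have [->|ij] := eqVneq i j; first by rewrite (_ : [set _ | _] = setT)//; exact/seteqP.
by rewrite (_ : [set _ | _] = set0)//; apply/seteqP; split => // w /= e; move: ij; rewrite e eqxx.
Qed.

Lemma cmeas_comp (I J : countType) (f : T -> I) (h : I -> J) : cmeas f -> cmeas (h \o f).
Proof. by move=> mf; apply: (cmeas_bind (g := fun i _ => h i)) => // i; exact: cmeas_cst. Qed.

Lemma cmeas_mkseq (I : countType) (f : nat -> T -> I) n :
  (forall i, cmeas (f i)) -> cmeas (fun w => mkseq (fun i => f i w) n).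
Proof.
move=> mf; elim: n => [|n IH]; first exact: cmeas_cst.
rewrite (_ : (fun w => _) = fun w => rcons (mkseq (fun i => f i w) n) (f n w)); last first.
  by apply/funext => w; rewrite mkseqS.
apply: (cmeas_bind (g := fun s w => rcons s (f n w))) => // s.
exact: (cmeas_comp (rcons s) (mf n)).
Qed.

End countable_valued.

Section split_arith.
Context {R : realFieldType}.
Implicit Types q c b D s r t : R.

(** 7 is the least integer with 7 / sqrt 2 + 2 <= 7. This lets the slack 7 t sqrt mu reproduce
    itself: from parent to child it becomes 7 q t s, and the splitting adds at most 2 t s. *)
Let half_le q : q * q = 2^-1 -> 0 < q -> 7 * q + 2 <= 7 /\ 1 <= 2 * q.
Proof.
move=> qq q0; have h : q <= 5 / 7 by rewrite leNgt; apply/negP => h; nra.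
have h' : 2^-1 <= q by rewrite leNgt; apply/negP => h'; nra.
by split; lra.
Qed.

(** 2400 is twice the constant of [binQ_approx]: 1200 (1 + t^2) <= 2400 t^2 <= t s. *)
Let t_le s t q : 0 < q -> 7 * q + 2 <= 7 -> 1 <= t -> 2400 * t <= s ->
  [/\ 7 * t * (2 * q * s) <= s ^+ 2 / 100, 1200 * (1 + t ^+ 2) <= t * s &
      7 * t * (2 * q * s) / 2 + 2 * (t * s) <= 7 * t * s].
Proof.
move=> q0 q7 t1 ts.
have ts0 : 0 <= t * s by apply: mulr_ge0; lra.
have h1 : t * s <= s * s / 2400 by rewrite -mulrAC ler_wpM2r; lra.
have h2 : 0 <= (t * s) * (5 / 7 - q) by apply: mulr_ge0; lra.
have h3 : 2400 * t * t <= t * s by rewrite [leRHS]mulrC ler_wpM2r; lra.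
have h4 : 0 <= (t - 1) * (t + 1) by apply: mulr_ge0; lra.
move: h1 h2 h3 h4 t1; rewrite !expr2; clear; split; lra.
Qed.

(** One splitting: [c] is the parent count of mean 2 s^2, [b] the left child, [D] the splitting
    normal and [A] the normalized squared deviation of the parent. A child inherits half of the
    deviation of its parent, which alone would halve [A]; the factor 3/4 leaves room for the
    fluctuation of order s (1 + |D|). The error of using s q in place of sqrt c / 2 is paid by A / 2
    and D^2 / 2, so the drop of 4 A to 3 A covers it. *)
Lemma split_arith q c b D s r t : q * q = 2^-1 -> 0 < q -> 1 <= t -> 2400 * t <= s -> `|D| <= t ->
  `|c - 2 * s ^+ 2| <= 2 * s ^+ 2 / 4 + 7 * t * (2 * q * s) -> 0 <= r -> r ^+ 2 = c ->
  (`|D| <= r / 16 -> `|b - c / 2 - r / 2 * D| <= 1200 * (1 + D ^+ 2)) ->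
  let A := (c - 2 * s ^+ 2) ^+ 2 / (2 * s ^+ 2) in
  `|b - c / 2 - s * q * D| + 4 * A * (3 / 4) <= 4 * A + 1201 * (1 + D ^+ 2) /\
  forall b', b' = b \/ b' = c - b ->
    `|b' - s ^+ 2| <= s ^+ 2 / 4 + 7 * t * s /\
    (b' - s ^+ 2) ^+ 2 / s ^+ 2 <= A * (3 / 4) + 24 * (1 + D ^+ 2).
Proof.
move=> qq q0 t1 ts Dt cA r0 rr hb A.
have [q7 q12] := half_le qq q0; have [t_1 t_2 t_3] := t_le q0 q7 t1 ts.
have s0 : 0 < s by lra.
have ss0 : 0 < s ^+ 2 by rewrite exprn_gt0.
have D0 := normr_ge0 D.
have DD : `|D| ^+ 2 = D ^+ 2 by rewrite real_normK ?num_real.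
have sr : s <= r.
  rewrite -(ler_pXn2r (n := 2))// ?nnegrE// ?ltW// rr.
  move: cA t_1 ss0; rewrite ler_norml => /andP[]; clear; lra.
have r2s : r <= 2 * s.
  rewrite -(ler_pXn2r (n := 2))// ?nnegrE// ?mulr_ge0// ?ltW// rr exprMn.
  move: cA t_1 ss0; rewrite ler_norml => /andP[]; clear; lra.
have {}hb : `|b - c / 2 - r / 2 * D| <= 1200 * (1 + D ^+ 2).
  by apply: hb; move: Dt t1 ts sr; clear; lra.
have A0 : 0 <= A by rewrite divr_ge0 ?sqr_ge0// mulr_ge0// ltW.
pose y := `|c - 2 * s ^+ 2|.
have yA : y ^+ 2 = A * (2 * s ^+ 2) by rewrite /A divfK ?real_normK ?num_real// mulf_neq0// gt_eqF.
have y0 : 0 <= y by exact: normr_ge0.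
have sD : 0 <= s * `|D| by rewrite mulr_ge0// ltW.
have key : `|b - c / 2| <= s * `|D| + 1200 * (1 + D ^+ 2).
  rewrite -[X in `|X|](subrK (r / 2 * D)); apply: le_trans (ler_normD _ _) _.
  rewrite addrC lerD// normrM ger0_norm ?divr_ge0// ler_wpM2r//; move: r2s; clear; lra.
have Dmu : D ^+ 2 <= s * `|D| / 2400.
  rewrite -DD expr2; have : `|D| * `|D| <= (s / 2400) * `|D|.
    by apply: ler_wpM2r => //; move: Dt ts; clear; lra.
  clear; lra.
have close : `|b - c / 2| <= s * (2 * `|D| + 1).
  apply: le_trans key _; move: Dmu sD t1 ts; clear; lra.
have both b' : b' = b \/ b' = c - b -> `|b' - s ^+ 2| <= y / 2 + `|b - c / 2|.
  have -> : y / 2 = `|c / 2 - s ^+ 2|.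
    by rewrite -[2 in LHS]ger0_norm// -normrV ?unitfE// -normrM; congr `|_|; field.
  move=> [->|->].
    by rewrite (_ : b - s ^+ 2 = (c / 2 - s ^+ 2) + (b - c / 2)) ?ler_normD//; ring.
  rewrite -[X in _ <= _ + X]normrN.
  by rewrite (_ : c - b - s ^+ 2 = (c / 2 - s ^+ 2) + - (b - c / 2)) ?ler_normD//; field.
split.
- have h1 : `|b - c / 2 - s * q * D| <= 1200 * (1 + D ^+ 2) + `|r / 2 - s * q| * `|D|.
    rewrite -normrM (_ : b - c / 2 - s * q * D = (b - c / 2 - r / 2 * D) + (r / 2 - s * q) * D); last by ring.
    by apply: le_trans (ler_normD _ _) _; rewrite lerD2r.
  have u0 := normr_ge0 (r / 2 - s * q).
  have sq0 : 0 <= s * q by rewrite mulr_ge0// ltW.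
  have h2 : `|r / 2 - s * q| * (2 * s) <= y.
    have e : `|r / 2 - s * q| * (r / 2 + s * q) = y / 4.
      rewrite -[r / 2 + s * q]ger0_norm; last by rewrite addr_ge0// divr_ge0.
      rewrite -normrM -[4 in RHS]ger0_norm// -normrV ?unitfE// -normrM; congr `|_|.
      by rewrite -subr_sqr !exprMn rr (expr2 q) qq; field.
    have h : s / 2 <= r / 2 + s * q.
      have : s / 2 <= s * q by rewrite ler_pM2l//; move: q12; clear; lra.
      move: r0; clear; lra.
    have : `|r / 2 - s * q| * (s / 2) <= y / 4 by rewrite -e ler_wpM2l.
    clear; lra.
  have h3 : (`|r / 2 - s * q| * 2) ^+ 2 <= 2 * A.
    have : (`|r / 2 - s * q| * (2 * s)) ^+ 2 <= y ^+ 2.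
      by rewrite lerXn2r ?nnegrE// ?mulr_ge0// ltW.
    rewrite yA (_ : (`|r / 2 - s * q| * (2 * s)) ^+ 2 = (`|r / 2 - s * q| * 2) ^+ 2 * s ^+ 2); last by ring.
    by rewrite (_ : A * (2 * s ^+ 2) = 2 * A * s ^+ 2) ?ler_pM2r//; ring.
  have h4 : `|r / 2 - s * q| * `|D| <= A / 2 + D ^+ 2 / 2.
    have : 0 <= (`|r / 2 - s * q| * 2 - `|D|) ^+ 2 by exact: sqr_ge0.
    rewrite sqrrB DD; move: h3 (sqr_ge0 D); clear.
    rewrite -mulr_natr; lra.
  move: h1 h4 A0 (sqr_ge0 D); clear; lra.
move=> b' /both hb'; split.
- apply: le_trans hb' _; apply: (@le_trans _ _ (y / 2 + (s * t + 1200 * (1 + t ^+ 2)))).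
    rewrite lerD2l; apply: le_trans key _.
    have h1 : D ^+ 2 <= t ^+ 2 by rewrite -DD lerXn2r ?nnegrE//; apply: le_trans Dt.
    have h2 : s * `|D| <= s * t by rewrite ler_wpM2l// ltW.
    move: h1 h2; clear; lra.
  move: t_2 t_3 cA; rewrite -/y; clear; lra.
- rewrite ler_pdivrMr//.
  pose z := s * (2 * `|D| + 1).
  have z0 : 0 <= z by rewrite mulr_ge0 ?ltW// addr_ge0// mulr_ge0.
  have h : (`|b' - s ^+ 2|) ^+ 2 <= (y / 2 + z) ^+ 2.
    rewrite lerXn2r ?nnegrE// ?addr_ge0// ?divr_ge0//.
    by apply: le_trans hb' _; rewrite lerD2l.
  rewrite real_normK ?num_real// in h; apply: le_trans h _.
  have zz : z ^+ 2 <= s ^+ 2 * (8 * (1 + D ^+ 2)).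
    rewrite /z exprMn ler_wpM2l ?ltW// -DD.
    have := sqr_ge0 (2 * `|D| - 1); rewrite !expr2; clear; lra.
  have yz : (y / 2 + z) ^+ 2 <= 3 / 2 * (y / 2) ^+ 2 + 3 * z ^+ 2.
    have := sqr_ge0 (y / 2 - 2 * z); rewrite !expr2; clear; lra.
  rewrite expr_div_n yA in yz; apply: le_trans yz _.
  move: zz; clear; lra.
Qed.

Lemma potential_step (m1 D2 dd ee aa A rt hh ps : R) :
  ee <= m1 + dd -> dd + 4 * A * (3 / 4) <= 4 * A + 1201 * (1 + D2) ->
  aa <= A * (3 / 4) + 24 * (1 + D2) -> m1 + 4 * A <= rt + 1300 * (hh + ps) -> 0 <= D2 ->
  ee + 4 * aa <= rt + 1300 * (hh + 1 + (ps + D2)).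
Proof. lra. Qed.

End split_arith.

Lemma big_ord_double (V : Type) (idx : V) (op : Monoid.law idx) (F : nat -> V) m :
  \big[op/idx]_(j < m.*2) F j = \big[op/idx]_(j < m) op (F j.*2) (F j.*2.+1).
Proof.
elim: m => [|m IH]; first by rewrite !big_ord0.
by rewrite doubleS !big_ord_recr /= IH Monoid.mulmA.
Qed.

Section dyadic_tree.
Context {R : realType}.
Implicit Types (x : nat -> R) (mu t : R).

Let q : R := (Num.sqrt 2)^-1.

Let q0 : 0 < q. Proof. by rewrite invr_gt0 sqrtr_gt0. Qed.

Let qq : q * q = 2^-1.
Proof. by rewrite /q -invfM -expr2 sqr_sqrtr. Qed.

Definition up x (i : nat) : R := q * x i.*2 + q * x i.*2.+1.

Definition df x (i : nat) : R := q * x i.*2 - q * x i.*2.+1.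

(* Top-down splitting of [n] points along a dyadic tree of height [h] whose leaves carry
   the normals [x]: the children of a node are obtained by quantile-coupling a
   symmetric binomial with the normalized difference of the two half sums. *)
Fixpoint cnt (h : nat) x (n : nat) (i : nat) : nat :=
  if h is h'.+1 then
    let c := cnt h' (up x) n i./2 in
    let b := binQ c (df x i./2) in if odd i then (c - b)%N else b
  else n.

Fixpoint troot (h : nat) x : R := if h is h'.+1 then troot h' (up x) else x 0%N.

Fixpoint tgood (h : nat) x t : Prop :=
  if h is h'.+1 then (forall i, (i < 2 ^ h')%N -> `|df x i| <= t) /\ tgood h' (up x) t else True.

(** What the splitting errors O(1 + D^2) add up to on the way from the root to leaf [i]. *)
Fixpoint pathsum (h : nat) x (i : nat) : R :=
  if h is h'.+1 then pathsum h' (up x) i./2 + df x i./2 ^+ 2 else 0.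

Let split_step (c : nat) mu t D : 1 <= t -> 2400 * t <= Num.sqrt mu -> 0 < mu -> `|D| <= t ->
  `|c%:R - 2 * mu| <= 2 * mu / 4 + 7 * t * (Num.sqrt 2 * Num.sqrt mu) ->
  let A := (c%:R - 2 * mu) ^+ 2 / (2 * mu) in let b := binQ c D in
  `|b%:R - c%:R / 2 - Num.sqrt mu * q * D| + 4 * A * (3 / 4) <= 4 * A + 1201 * (1 + D ^+ 2) /\
  forall b' : nat, b' = b \/ b' = (c - b)%N ->
    `|b'%:R - mu| <= mu / 4 + 7 * t * Num.sqrt mu /\
    (b'%:R - mu) ^+ 2 / mu <= A * (3 / 4) + 24 * (1 + D ^+ 2).
Proof.
move=> t1 ts mu0 Dt cA A b.
have ss : Num.sqrt mu ^+ 2 = mu by rewrite sqr_sqrtr// ltW.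
have s0 := sqrtr_ge0 mu.
have r2 : Num.sqrt 2 = 2 * q :> R.
  by apply: (mulIf (lt0r_neq0 q0)); rewrite -mulrA qq divff// mulfV// sqrtr_eq0; lra.
rewrite r2 -{1 2}ss in cA.
have rr : Num.sqrt c%:R ^+ 2 = c%:R :> R by rewrite sqr_sqrtr.
have := @split_arith R q c%:R b%:R D (Num.sqrt mu) (Num.sqrt c%:R) t qq q0 t1 ts Dt cA (sqrtr_ge0 _) rr (@binQ_approx R c D).
rewrite ss => -[h1 h2]; split; first exact: h1.
move=> b' [->|->]; first by apply: h2; left.
by apply: h2; right; rewrite natrB// binQ_le.
Qed.

Let cnt_pair h x n i : (cnt h.+1 x n i.*2 + cnt h.+1 x n i.*2.+1 = cnt h (up x) n i)%N.
Proof. by rewrite /= odd_double /= uphalf_double doubleK subnKC// binQ_le. Qed.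

(* The deviation of a count from its mean shrinks down the tree: the potential
   [4 (c - mu)^2 / mu] pays for the splitting errors along the path to the leaf. *)
Theorem cnt_deviation h x mu n t : 1 <= t -> 2400 * t <= Num.sqrt mu -> 0 < mu ->
  `|n%:R - 2 ^+ h * mu| <= 2 ^+ h * mu / 4 -> tgood h x t ->
  forall i, (i < 2 ^ h)%N ->
  `|(cnt h x n i)%:R - mu| <= mu / 4 + 7 * t * Num.sqrt mu /\
  forall k, k = i \/ k = i.+1 ->
    `|\sum_(j < k) ((cnt h x n j)%:R - mu - Num.sqrt mu * x j)
       - (n%:R - 2 ^+ h * mu - Num.sqrt (2 ^+ h * mu) * troot h x) * (k%:R / 2 ^+ h)|
      + 4 * (((cnt h x n i)%:R - mu) ^+ 2 / mu)
    <= 4 * ((n%:R - 2 ^+ h * mu) ^+ 2 / (2 ^+ h * mu)) + 1300 * (h%:R + pathsum h x i).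
Proof.
elim: h x mu => [|h IH] x mu t1 ts mu0 nmu good i i2.
  move: i2 nmu; rewrite expn0 ltnS leqn0 => /eqP ->; rewrite expr0 mul1r => nmu; split.
    apply: le_trans nmu _; rewrite lerDl mulr_ge0 ?sqrtr_ge0// mulr_ge0//; lra.
  move=> k [->|->] /=.
    by rewrite big_ord0 mul0r mulr0 subrr normr0 add0r addr0 mulr0 addr0.
  by rewrite big_ord1 !divr1 mulr1 subrr normr0 add0r addr0 mulr0 addr0.
have mu2 : 0 < 2 * mu by rewrite mulr_gt0.
have s2 : Num.sqrt (2 * mu) = Num.sqrt 2 * Num.sqrt mu by rewrite sqrtrM.
have r2 : Num.sqrt 2 = 2 * q :> R.
  by apply: (mulIf (lt0r_neq0 q0)); rewrite -mulrA qq divff// mulfV// sqrtr_eq0; lra.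
have s0 := sqrtr_ge0 mu.
have s21 : 1 <= Num.sqrt 2 :> R by rewrite -[leLHS]sqrtr1 ler_sqrt//; lra.
have e2 : 2 ^+ h * (2 * mu) = 2 ^+ h.+1 * mu by rewrite exprSr mulrA.
case: good => gd gu.
have i2' : (i./2 < 2 ^ h)%N by move: i2; rewrite expnS; clear; lia.
have := IH (up x) (2 * mu) t1 _ mu2 _ gu i./2 i2'; rewrite s2 e2.
case => [||hi hk] //.
  by apply: le_trans ts _; rewrite ler_peMl.
set er := n%:R - 2 ^+ h.+1 * mu - Num.sqrt (2 ^+ h.+1 * mu) * troot h (up x) in hk *.
set c := cnt h (up x) n i./2 in hi hk.
have := @split_step c mu t (df x i./2) t1 ts mu0 (gd _ i2') hi.
set A := (c%:R - 2 * mu) ^+ 2 / (2 * mu) => /=; set b := binQ c _ => -[dlt ch].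
have ci : cnt h.+1 x n i = b \/ cnt h.+1 x n i = (c - b)%N.
  by rewrite /= -/c -/b; case: (odd i); [right|left].
have [c1 c2] := ch _ ci; split=> // k kE.
pose E (m : nat) := \sum_(j < m) ((cnt h.+1 x n j)%:R - mu - Num.sqrt mu * x j).
pose E' (m : nat) := \sum_(j < m) ((cnt h (up x) n j)%:R - 2 * mu - Num.sqrt 2 * Num.sqrt mu * up x j).
have EE m : E m.*2 = E' m.
  rewrite [LHS](big_ord_double _ (fun j => (cnt h.+1 x n j)%:R - mu - Num.sqrt mu * x j)).
  apply: eq_bigr => i' _; move: (nat_of_ord i') => {i'} j.
  change ((cnt h.+1 x n j.*2)%:R - mu - Num.sqrt mu * x j.*2 + ((cnt h.+1 x n j.*2.+1)%:R - mu - Num.sqrt mu * x j.*2.+1)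
    = (cnt h (up x) n j)%:R - 2 * mu - Num.sqrt 2 * Num.sqrt mu * up x j :> R).
  rewrite -cnt_pair natrD /up r2.
  have -> : 2 * q * Num.sqrt mu * (q * x j.*2 + q * x j.*2.+1) = 2 * (q * q) * Num.sqrt mu * (x j.*2 + x j.*2.+1) by ring.
  by rewrite qq mulfV// mul1r; ring.
have EO : E (i./2.*2).+1 = (E' i./2 + E' i./2.+1) / 2 + (b%:R - c%:R / 2 - Num.sqrt mu * q * df x i./2).
  rewrite /E big_ord_recr -/(E _) EE /E' big_ord_recr -/(E' _) /=.
  rewrite odd_double /= doubleK -/c -/b r2 /up /df.
  have -> : Num.sqrt mu * q * (q * x i./2.*2 - q * x i./2.*2.+1) = (q * q) * Num.sqrt mu * (x i./2.*2 - x i./2.*2.+1) by ring.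
  have -> : 2 * q * Num.sqrt mu * (q * x i./2.*2 + q * x i./2.*2.+1) = 2 * (q * q) * Num.sqrt mu * (x i./2.*2 + x i./2.*2.+1) by ring.
  by rewrite qq; field.
have H0 := hk i./2 (or_introl erefl); have H1 := hk i./2.+1 (or_intror erefl).
rewrite -/(E' _) -/A in H0; rewrite -/(E' _) -/A in H1.
have P0 : 0 <= 2 ^+ h.+1 :> R by rewrite exprn_ge0.
have lin m : er * (m%:R / 2 ^+ h) = er * (m.*2%:R / 2 ^+ h.+1).
  by rewrite exprS -mul2n natrM; congr (_ * _); field; rewrite expf_neq0.
rewrite !lin in H0 H1.
set Z0 := E' i./2 - er * ((i./2).*2%:R / 2 ^+ h.+1) in H0 *.
set Z1 := E' i./2.+1 - er * ((i./2.+1).*2%:R / 2 ^+ h.+1) in H1 *.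
set dl := b%:R - c%:R / 2 - _ in dlt EO.
have kk : k = i./2.*2 \/ k = (i./2.*2).+1 \/ k = (i./2.+1).*2.
  by move: kE; clear; lia.
(* A cut at an even position is a cut of the parent level; at an odd position it halves a parent,
   and the error there is the mean of the two neighbouring parent errors plus the error [dl] of the
   splitting. *)
have bnd : `|E k - er * (k%:R / 2 ^+ h.+1)| <= Num.max `|Z0| `|Z1| + `|dl|.
  have d0 := normr_ge0 dl.
  case: kk => [->|[->|->]].
  - by rewrite EE -/Z0; apply: ler_wpDr => //; rewrite le_max lexx.
  - have -> : E (i./2.*2).+1 - er * ((i./2.*2).+1%:R / 2 ^+ h.+1) = (Z0 + Z1) / 2 + dl.
      by rewrite EO /Z0 /Z1 doubleS -!natr1; field; rewrite expf_neq0.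
    apply: le_trans (ler_normD _ _) _; rewrite lerD2r normrM [`|2^-1|]ger0_norm// ler_pdivrMr//.
    apply: le_trans (ler_normD _ _) _; rewrite mulr_natr mulr2n lerD// le_max lexx ?orbT//.
  - by rewrite EE -/Z1; apply: ler_wpDr => //; rewrite le_max lexx orbT.
change (`|E k - er * (k%:R / 2 ^+ h.+1)| + 4 * (((cnt h.+1 x n i)%:R - mu) ^+ 2 / mu)
  <= 4 * ((n%:R - 2 ^+ h.+1 * mu) ^+ 2 / (2 ^+ h.+1 * mu)) +
     1300 * (h.+1%:R + (pathsum h (up x) i./2 + df x i./2 ^+ 2))).
have M : Num.max `|Z0| `|Z1| + 4 * A <= 4 * ((n%:R - 2 ^+ h.+1 * mu) ^+ 2 / (2 ^+ h.+1 * mu)) + 1300 * (h%:R + pathsum h (up x) i./2).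
  by case: (leP `|Z0| `|Z1|) => _; [exact: H1|exact: H0].
rewrite (_ : h.+1%:R = h%:R + 1); last by rewrite natr1.
exact: potential_step bnd dlt c2 M (sqr_ge0 _).
Qed.

End dyadic_tree.

Section mixture.
Context d (T : measurableType d) (R : realType) (P : {measure set T -> \bar R}).

(** Passes from events that prescribe all counts to events that sum over them. The coordinates are
    released one at a time, [U m] being the stage where the first [m] are free, so no series over
    vectors occurs. *)
Lemma measure_bigsetI_bigcup (M : nat) (H : nat -> nat -> set T) (eta : nat -> nat -> R) :
  (forall i k, measurable (H i k)) -> (forall i, trivIset setT (H i)) ->
  (forall i k, 0 <= eta i k) ->
  (forall i, (\sum_(0 <= k <oo) (eta i k)%:E < +oo)%E) ->
  (forall a : nat -> nat, P (\big[setI/setT]_(i < M) H i (a i)) = (\prod_(i < M) eta i (a i))%:E) ->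
  P (\big[setI/setT]_(i < M) \bigcup_k H i k) =
    (\prod_(i < M) (\sum_(0 <= k <oo) (eta i k)%:E))%E.
Proof.
move=> mH tH eta0 etay Hyp.
pose g i := fine (\sum_(0 <= k <oo) (eta i k)%:E)%E.
have gE i : ((g i)%:E = \sum_(0 <= k <oo) (eta i k)%:E)%E.
  by rewrite /g fineK// ge0_fin_numE// nneseries_ge0// => k _ _; rewrite lee_fin.
have g0 i : 0 <= g i by apply: fine_ge0; apply: nneseries_ge0 => k _ _; rewrite lee_fin.
pose U m (a : nat -> nat) i := if (i < m)%N then \bigcup_k H i k else H i (a i).
have mU m a i : measurable (U m a i) by rewrite /U; case: ifP => // _; exact: bigcup_measurable.
suff main m a : (m <= M)%N -> P (\big[setI/setT]_(i < M) U m a i) =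
    (\prod_(i < M) (if (i < m)%N then g i else eta i (a i)))%:E.
  have := main M (fun=> 0%N) (leqnn M).
  have e1 : \big[setI/setT]_(i < M) U M (fun=> 0%N) i = \big[setI/setT]_(i < M) \bigcup_k H i k.
    by apply: eq_bigr => i _; rewrite /U ltn_ord.
  rewrite e1 => ->; rewrite -prodEFin.
  by apply: eq_bigr => i _; rewrite ltn_ord gE.
elim: m a => [|m IH] a mM; first exact: Hyp.
have IH' k := IH (fun i => if i == m then k else a i) (ltnW mM).
pose S := \big[setI/setT]_(i < M | i != m :> nat) U m.+1 a i.
pose c := \prod_(i < M | i != m :> nat) (if (i < m.+1)%N then g i else eta i (a i)).
have c0 : 0 <= c by apply: prodr_ge0 => i _; case: ifP.
have E1 : \big[setI/setT]_(i < M) U m.+1 a i = \bigcup_k (H m k `&` S).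
  by rewrite (bigD1 (Ordinal mM))//= -/S /U ltnSn setI_bigcupl.
have E2 k : H m k `&` S = \big[setI/setT]_(i < M) U m (fun i => if i == m then k else a i) i.
  rewrite [RHS](bigD1 (Ordinal mM))//= {1}/U ltnn eqxx; congr (_ `&` _).
  apply: eq_bigr => i im; rewrite /U (negbTE im) ltnS leq_eqVlt.
  by rewrite (negbTE im).
have E3 k : P (H m k `&` S) = (c * eta m k)%:E.
  rewrite E2 IH' (bigD1 (Ordinal mM))//= ltnn eqxx mulrC; congr ((_ * _)%:E).
  apply: eq_bigr => i im; have im' : (i == m :> nat) = false by exact: negbTE im.
  have -> : (i < m.+1)%N = (i < m)%N by rewrite ltnS leq_eqVlt im'.
  by rewrite im'.
have mS : measurable S by apply: bigsetI_measurable => i _; exact: mU.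
rewrite E1 measure_bigcup//; last 2 first.
- by move=> k _; exact: measurableI.
- by apply: trivIset_setIr; exact: tH.
rewrite (eq_eseriesl (Q := xpredT)); last by move=> k; rewrite in_setT.
rewrite (eq_eseriesr (g := fun k => c%:E * (eta m k)%:E)%E); last by move=> k _; rewrite E3 EFinM.
rewrite nneseriesZl//; last by move=> k _; rewrite lee_fin.
by rewrite -gE -EFinM mulrC (bigD1 (Ordinal mM))//= ltnSn.
Qed.

End mixture.

Section tree_measurability.
Context d (T : measurableType d) (R : realType).
Local Notation RR := (measurableTypeR R).

Lemma measurable_up (x : nat -> T -> RR) : (forall i, measurable_fun setT (x i)) ->
  forall i, measurable_fun setT (fun w => up (x^~ w) i : RR).
Proof. by move=> mx i; apply: measurable_funD; apply: measurable_funM => //; exact: mx. Qed.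

Lemma measurable_df (x : nat -> T -> RR) : (forall i, measurable_fun setT (x i)) ->
  forall i, measurable_fun setT (fun w => df (x^~ w) i : RR).
Proof. by move=> mx i; apply: measurable_funB; apply: measurable_funM => //; exact: mx. Qed.

Lemma cmeas_cnt h (x : nat -> T -> RR) (M : T -> nat) i :
  (forall i, measurable_fun setT (x i)) -> cmeas M -> cmeas (fun w => cnt h (x^~ w) (M w) i).
Proof.
elim: h x i => [//|h IH] x i mx mM /=.
apply: (cmeas_bind (f := fun w => cnt h (up (x^~ w)) (M w) i./2)
  (g := fun c w => if odd i then (c - binQ c (df (x^~ w) i./2))%N else binQ c (df (x^~ w) i./2))).
  exact: (IH (fun i w => up (x^~ w) i) _ (measurable_up mx)).
move=> c; have mb : cmeas (fun w => binQ c (df (x^~ w) i./2)).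
  move=> k; rewrite -[X in measurable X]setTI.
  exact: (measurable_df mx i./2 measurableT (measurable_quant_eq k (pmf_binp c))).
by case: (odd i) => //; exact: (cmeas_comp (fun b => c - b)%N mb).
Qed.

Lemma measurable_troot h (x : nat -> T -> RR) :
  (forall i, measurable_fun setT (x i)) -> measurable_fun setT (fun w => troot h (x^~ w) : RR).
Proof.
elim: h x => [|h IH] x mx /=; first exact: mx.
exact: (IH (fun i w => up (x^~ w) i) (measurable_up mx)).
Qed.

Lemma measurable_pathsum h (x : nat -> T -> RR) i :
  (forall i, measurable_fun setT (x i)) -> measurable_fun setT (fun w => pathsum h (x^~ w) i : RR).
Proof.
elim: h x i => [//|h IH] x i mx /=.
apply: measurable_funD; first exact: (IH (fun i w => up (x^~ w) i) _ (measurable_up mx)).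
by apply: measurable_funX; exact: measurable_df.
Qed.

Lemma measurable_tgood h (x : nat -> T -> RR) t :
  (forall i, measurable_fun setT (x i)) -> measurable [set w | tgood h (x^~ w) t].
Proof.
elim: h x => [|h IH] x mx; first by rewrite (_ : [set _ | _] = setT)//; exact/seteqP.
rewrite (_ : [set w | _] = (\bigcap_(i < 2 ^ h) [set w | `|df (x^~ w) i| <= t]) `&`
  [set w | tgood h (up (x^~ w)) t]); last by apply/seteqP; split => w.
apply: measurableI; last exact: (IH (fun i w => up (x^~ w) i) (measurable_up mx)).
rewrite (bigcap_mkord _ (fun i => [set w | `|df (x^~ w) i| <= t])); apply: bigsetI_measurable => i _.
rewrite (_ : [set w | _] = (fun w => `|df (x^~ w) i|) @^-1` `]-oo, t]%classic); last first.
  by apply/seteqP; split => w /=; rewrite in_itv.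
rewrite -[X in measurable X]setTI; apply: measurableT_comp => //; first exact: measurable_df.
Qed.

End tree_measurability.

(** * Exact law of the leaf counts and moments along the tree *)

Section tree_law.
Context d (T : measurableType d) (R : realType) (P : probability T R).
Local Notation RR := (measurableTypeR R).

Let q : R := (Num.sqrt 2)^-1.

Let qq : q * q = 2^-1.
Proof. by rewrite /q -invfM -expr2 sqr_sqrtr. Qed.

(** One level up: normalized sums of siblings become the leaves of the smaller tree, and the
    differences join the spectators. *)
Definition tree_step (L : eqType) (X : nat + L -> T -> RR) (k : nat + (nat + L)) : T -> RR :=
  match k with
  | inl i => fun w => up (fun j => X (inl j) w) i
  | inr (inl i) => fun w => df (fun j => X (inl j) w) i
  | inr (inr l) => X (inr l)
  end.

Lemma iid_tree_step (L : eqType) (X : nat + L -> T -> RR) : iid P X -> iid P (tree_step X).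
Proof.
move=> iX; pose f (k : nat * bool + L) : nat + L := match k with
  inl (i, b) => inl (b + i.*2)%N | inr l => inr l end.
have finj : injective f.
  move=> [[i b]|l] [[i' b']|l'] //= [].
    by case: b; case: b' => h; congr (inl (_, _)); move: h; lia.
  by move=> ->.
pose g (k : nat + (nat + L)) : nat * bool + L := match k with
  inl i => inl (i, true) | inr (inl i) => inl (i, false) | inr (inr l) => inr l end.
have ginj : injective g by move=> [i|[i|l]] [i'|[i'|l']] //= [] => ->.
have q0 : q != 0 by rewrite invr_eq0 sqrtr_eq0 -ltNge.
have q1 : q ^+ 2 + q ^+ 2 = 1 by rewrite expr2 qq; lra.
have := indep_reindex ginj (iid_rotate q0 q1 (indep_reindex finj iX)).
congr (iid P _); apply/funext => -[i|[i|l]] //=; apply/funext => w.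
by rewrite /up addrC.
Qed.

(** Prescribing the counts at the leaves amounts to prescribing the sums [a'] one level up together
    with a binomial quantile event for each difference. These differences are spectators of the
    smaller tree, which is why arbitrary spectator events are part of the statement; [poisson_split]
    recombines the factors. *)
Theorem tree_law h (L : eqType) (X : nat + L -> T -> RR) (l0 : L) (lam : R) (a : nat -> nat)
    (s : seq L) (B : L -> set RR) :
  iid P X -> 0 <= lam -> uniq s -> l0 \notin s -> (forall l, measurable (B l)) ->
  P ([set w | forall i, (i < 2 ^ h)%N ->
        cnt h (fun j => X (inl j) w) (quant (poisson lam) (X (inr l0) w)) i = a i] `&`
     \big[setI/setT]_(l <- s) (X (inr l) @^-1` B l)) =
  ((\prod_(i < 2 ^ h) poisson (lam / 2 ^+ h) (a i))%:E * \prod_(l <- s) N01 (B l))%E.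
Proof.
elim: h L X l0 a s B => [|h IH] L X l0 a s B iX lam0 us ls mB.
  have Hp := pmf_poisson lam0.
  pose B' (k : nat + L) : set RR := match k with
    inr l => if l == l0 then [set z : RR | quant (poisson lam) z = a 0%N] else B l
    | inl _ => setT end.
  have mB' k : measurable (B' k).
    case: k => [i|l]; rewrite /B'; first exact: measurableT.
    by case: (l == l0) => //; exact: measurable_quant_eq.
  have := indepE (s := [seq inr l | l <- l0 :: s]) iX _ mB'.
  rewrite map_inj_uniq/= ?us ?ls//; last by move=> ? ? [].
  have B0 : B' (inr l0) = [set z : RR | quant (poisson lam) z = a 0%N] by rewrite /B' eqxx.
  move=> /(_ isT); rewrite !big_cons !big_map B0 => H.
  have eB : \big[setI/setT]_(j <- s) (X (inr j) @^-1` B' (inr j)) = \big[setI/setT]_(l <- s) (X (inr l) @^-1` B l).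
    apply: eq_big_seq => l sl /=; case: eqP => // e; move: ls; by rewrite -e sl.
  rewrite eB in H.
  rewrite expr0 divr1 expn0 big_ord1.
  transitivity (P ((X (inr l0) @^-1` [set z : RR | quant (poisson lam) z = a 0%N]) `&` 
      \big[setI/setT]_(l <- s) (X (inr l) @^-1` B l))).
    congr (P (_ `&` _)); apply/seteqP; split => w /= Hw; first exact: (Hw 0%N).
    by move=> [|i].
  rewrite H; congr (_ * _)%E; first exact: N01_quant.
  by apply: eq_big_seq => l sl /=; case: eqP => // e; move: ls; rewrite -e sl.
pose a' i := (a i.*2 + a i.*2.+1)%N.
pose s' : seq (nat + L) := [seq inl i | i <- iota 0 (2 ^ h)] ++ [seq inr l | l <- s].
pose B' (k : nat + L) : set RR := match k with
  inl i => [set z : RR | binQ (a' i) z = a i.*2] | inr l => B l end.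
have mB' k : measurable (B' k) by case: k => [i|l] //=; exact: (measurable_quant_eq _ (pmf_binp _)).
have us' : uniq s'.
  rewrite cat_uniq !map_inj_uniq ?iota_uniq ?us//=; try by move=> ? ? [].
  by rewrite andbT; apply/hasPn => _ /mapP[l _ ->]; apply/mapP => -[].
have ls' : inr l0 \notin s'.
  rewrite mem_cat negb_or; apply/andP; split; first by apply/mapP => -[].
  by rewrite mem_map//; move=> ? ? [].
have := IH _ (tree_step X) (inr l0) a' s' B' (iid_tree_step iX) lam0 us' ls' mB'.
rewrite /s' !big_cat !big_map /= => H.
transitivity (P ([set w | forall i, (i < 2 ^ h)%N ->
    cnt h (fun j => up (fun j => X (inl j) w) j) (quant (poisson lam) (X (inr l0) w)) i = a' i] `&`
  (\big[setI/setT]_(i <- iota 0 (2 ^ h)) (fun w => df (fun j => X (inl j) w) i) @^-1` [set z : RR | binQ (a' i) z = a i.*2] `&`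
   \big[setI/setT]_(l <- s) X (inr l) @^-1` B l))).
  congr (P _); rewrite setIA; congr (_ `&` _); apply/seteqP; split => w /=.
    move=> Hw; have H1 i : (i < 2 ^ h)%N -> cnt h (up (fun j => X (inl j) w)) (quant (poisson lam) (X (inr l0) w)) i = a' i.
      move=> ih; rewrite /a' -Hw; last by rewrite expnS; move: ih; clear; lia.
      rewrite -(Hw i.*2.+1); last by rewrite expnS; move: ih; clear; lia.
      by rewrite /= odd_double /= uphalf_double doubleK subnKC// binQ_le.
    split=> //; apply/bigsetIP => i; rewrite mem_iota /= add0n => ih.
    rewrite /= -(H1 i ih) -(Hw i.*2); last by rewrite expnS; move: ih; clear; lia.
    by rewrite odd_double doubleK.
  move=> [H1 /bigsetIP H2] i ih.
  have i2 : (i./2 < 2 ^ h)%N by move: ih; rewrite expnS; clear; lia.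
  have := H2 i./2; rewrite mem_iota /= add0n => /(_ i2) e.
  rewrite (H1 _ i2) e /a' -[in RHS](odd_double_half i).
  by case: (odd i); rewrite ?add0n// add1n addKn.
rewrite H muleA; congr (_ * _)%E.
rewrite -[X in (_ * X)%E](_ : ((\prod_(i <- iota 0 (2 ^ h)) binp (a' i) (a i.*2))%:E = _)%E); last first.
  rewrite -prodEFin; apply: eq_bigr => i _; apply/esym; exact: (N01_quant _ (pmf_binp _)).
rewrite -EFinM; congr (_%:E).
have -> : \prod_(i <- iota 0 (2 ^ h)) binp (a' i) (a i.*2) = \prod_(i < 2 ^ h) binp (a' i) (a i.*2) :> R.
  by rewrite -(big_mkord xpredT (fun i => binp (a' i) (a i.*2))) /index_iota subn0.
rewrite -big_split /=.
rewrite expnS mul2n (big_ord_double _ (fun i => poisson (lam / 2 ^+ h.+1) (a i))).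
have e : lam / 2 ^+ h / 2 = lam / 2 ^+ h.+1 by rewrite exprSr invfM mulrA.
by apply: eq_bigr => i _; rewrite poisson_split e.
Qed.

Let expsq : (\int[@N01 R]_x (expR (x ^+ 2 / 4))%:E < +oo)%E.
Proof. by rewrite N01_exp_moment ltry. Qed.

Let mexpsq : measurable_fun setT (fun x : RR => expR (x ^+ 2 / 4) : RR).
Proof. by apply: measurableT_comp => //; apply: measurable_funM => //. Qed.

(** The path collects [h] squares of independent normals, each contributing a factor sqrt 2. The
    product over [s] is there for the induction: it stores the differences of the levels already
    removed. *)
Lemma integral_exp_pathsum h (L : eqType) (X : nat + L -> T -> RR) (s : seq L) i : iid P X -> uniq s ->
  (\int[P]_w (expR (pathsum h (fun j => X (inl j) w) i / 4) * \prod_(l <- s) expR (X (inr l) w ^+ 2 / 4))%:E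
    = (Num.sqrt 2 ^+ (h + size s))%:E)%E.
Proof.
elim: h L X s i => [|h IH] L X s i iX us.
  have := @integral_prod_indep _ _ _ P _ X (fun=> N01) (fun _ x => expR (x ^+ 2 / 4)) [seq inr l | l <- s] iX.
  rewrite map_inj_uniq ?us; last by move=> ? ? [].
  move=> /(_ isT (fun=> mexpsq) (fun _ x => expR_ge0 _) (fun=> expsq)); rewrite big_map => H.
  rewrite -[RHS](_ : \prod_(j <- s) \int[N01]_x (expR (x ^+ 2 / 4))%:E = _)%E; last first.
    rewrite N01_exp_moment prodEFin; congr (_%:E); rewrite add0n.
    by elim: (s) => [|l s' IHs]; [rewrite big_nil|rewrite big_cons IHs -exprS].
  by rewrite -H; apply: eq_integral => w _; rewrite /= mul0r expR0 mul1r big_map.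
have := IH _ (tree_step X) (inl i./2 :: [seq inr l | l <- s]) i./2 (iid_tree_step iX).
rewrite /= map_inj_uniq ?us; last by move=> ? ? [].
have -> : inl i./2 \notin [seq inr l | l <- s] by apply/mapP => -[].
rewrite size_map addnS => /(_ isT) <-; apply: eq_integral => w _.
rewrite big_cons big_map /= mulrDl expRD mulrA; congr (_%:E); by [].
Qed.

(** Union bound over the splitting normals, fewer than 2^h in number. *)
Lemma tgood_prob h (L : eqType) (X : nat + L -> T -> RR) (t : R) : iid P X -> 0 <= t ->
  (P (~` [set w | tgood h (fun j => X (inl j) w) t]) <= (2 ^+ h * (2 * expR (- (t ^+ 2 / 4))))%:E)%E.
Proof.
move=> + t0; set e := 2 * _; have e0 : 0 <= e by rewrite mulr_ge0 ?expR_ge0.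
elim: h L X => [|h IH] L X iX.
  rewrite (_ : ~` _ = set0); last by apply/seteqP; split => w //=; apply.
  by rewrite measure0 lee_fin mulr_ge0.
have mX k := indep_measurable iX k.
have iY := iid_tree_step iX; have mY k := indep_measurable iY k.
pose A i := [set w | t < `|tree_step X (inr (inl i)) w|].
have mA i : measurable (A i).
  rewrite (_ : A i = (fun w => `|tree_step X (inr (inl i)) w : R|) @^-1` `]t, +oo[%classic); last first.
    by apply/seteqP; split => w /=; rewrite in_itv/= andbT.
  rewrite -[X in measurable X]setTI; apply: measurableT_comp => //; exact: mY.
have PA i : (P (A i) <= e%:E)%E.
  have mN : measurable [set x : RR | t < `|x|].
    rewrite (_ : [set x : RR | t < `|x|] = (fun x : RR => `|x|) @^-1` `]t, +oo[%classic); last first.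
      by apply/seteqP; split => w /=; rewrite in_itv/= andbT.
    by rewrite -[X in measurable X]setTI; apply: measurableT_comp.
  have := indepE (s := [:: inr (inl i)]) (B := fun=> [set x : RR | t < `|x|]) iY isT (fun=> mN).
  rewrite !big_cons !big_nil setIT mule1 => ->.
  rewrite -(integral_indicT (@N01 R) mN).
  apply: (@le_trans _ _ (\int[N01]_z (expR (- (t ^+ 2 / 4)) * expR (z ^+ 2 / 4))%:E)%E).
    apply: integral_EFin_le.
    - by move=> z; rewrite indicE.
    - exact: measurable_indic.
    - by apply: measurable_funM => //; exact: mexpsq.
    - move=> z; rewrite indicE -expRD; case: (boolP (z \in _)) => [|_]; last exact: expR_ge0.
      rewrite inE/= => tz; apply: le_trans (expR_ge1Dx _); rewrite lerDl.
      have : t ^+ 2 <= `|z : R| ^+ 2 by rewrite lerXn2r ?nnegrE// ltW.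
      by rewrite real_normK ?num_real//; lra.
  rewrite (integral_EFinZ (@N01 R) (expR_ge0 _) _ mexpsq); last by move=> z; exact: expR_ge0.
  rewrite N01_exp_moment -EFinM lee_fin mulrC ler_wpM2r ?expR_ge0//.
  by rewrite -[leRHS]ger0_norm// -sqrtr_sqr ler_sqrt// expr2; lra.
have sub : ~` [set w | tgood h.+1 (fun j => X (inl j) w) t] `<=`
    (\bigcup_(i in `I_(2 ^ h)) A i) `|` ~` [set w | tgood h (fun j => tree_step X (inl j) w) t].
  move=> w /= /not_andP[|]; last by right.
  move=> /existsNP[i /not_implyP[ih /negP]]; rewrite -ltNge => H.
  by left; exists i.
have mG : measurable (~` [set w | tgood h (fun j => tree_step X (inl j) w) t]).
  by apply: measurableC; apply: (measurable_tgood h t (x := fun j => tree_step X (inl j))) => j; exact: mY.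
have mG' : measurable (~` [set w | tgood h.+1 (fun j => X (inl j) w) t]).
  by apply: measurableC; apply: (measurable_tgood h.+1 t (x := fun j => X (inl j))) => j; exact: mX.
have mU : measurable (\bigcup_(i in `I_(2 ^ h)) A i) by exact: bigcup_measurable.
apply: le_trans (le_measure _ _ _ sub) _; rewrite ?inE//; first exact: measurableU.
apply: le_trans (measureU2 _ _ _) _ => //.
rewrite exprS mulrDl mul1r mulrDl EFinD; apply: leeD; last exact: IH.
rewrite bigcup_mkord; apply: le_trans (Boole_inequality _ _) _; first by move=> i _; exact: mA.
apply: (@le_trans _ _ (\sum_(i < 2 ^ h) e%:E)%E); first by apply: lee_sum => i _; exact: PA.
by rewrite sumEFin lee_fin sumr_const card_ord -[leLHS]mulr_natl natrX.
Qed.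

End tree_law.

(** * The Feller coupling *)

Section orbits.
Import fintype.
Local Open Scope group_scope.
Local Open Scope set_scope.

Lemma porbit_subset (T : finType) (s : {perm T}) (A : {set T}) x :
  x \in A -> (forall y, y \in A -> s y \in A) -> porbit s x \subset A.
Proof.
move=> xA sA; apply/subsetP => y /porbitP[i ->].
by elim: i => [|i IH]; rewrite ?perm1// expgSr permM sA.
Qed.

Lemma porbit_equivariant (T T' : finType) (s : {perm T}) (s' : {perm T'}) (h : T -> T') x :
  (forall y, y \in porbit s x -> s' (h y) = h (s y)) -> porbit s' (h x) = h @: porbit s x.
Proof.
move=> H; have E i : (s' ^+ i) (h x) = h ((s ^+ i) x).
  elim: i => [|i IH]; first by rewrite !perm1.
  by rewrite !expgSr !permM IH H// mem_porbit.
apply/setP => y; apply/porbitP/imsetP => [[i ->]|[z /porbitP[i ->] ->]].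
  by exists ((s ^+ i) x); rewrite ?mem_porbit.
by exists i.
Qed.

Lemma porbit_next (T : finType) (s : {perm T}) x y : y \in porbit s x -> s y \in porbit s x.
Proof. by rewrite -!eq_porbit_mem -(porbit_perm s 1 y) expg1. Qed.

Variable n : nat.
Implicit Types (s : 'S_n.+1) (i : 'I_n.+2).

(* Inserts the new element [ord_max] right before the image of [i] in its cycle
   (as a fixed point if [i = ord_max]). *)
Definition perm_insert (si : 'S_n.+1 * 'I_n.+2) : 'S_n.+2 :=
  tperm si.2 ord_max * lift_perm ord_max ord_max si.1.

Lemma perm_insert_bij : bijective perm_insert.
Proof.
apply: inj_card_bij.
  move=> [s i] [s' i'] e.
  have ei : i = i'.
    have h j (t : 'S_n.+1) : perm_insert (t, j) j = ord_max.
      by rewrite /perm_insert permM tpermL lift_perm_id.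
    by apply: (@perm_inj _ (perm_insert (s, i))); rewrite h e h.
  subst i'; congr (_, _); move: e; rewrite /perm_insert /= => /mulgI e.
  apply/permP => x; have := congr1 (fun p : 'S_n.+2 => p (lift ord_max x)) e.
  by rewrite !lift_perm_lift => /lift_inj.
by rewrite card_prod !card_Sn card_ord /= [in leqRHS]factS mulnC.
Qed.

Let ins_lift s i x : i != lift ord_max x -> perm_insert (s, i) (lift ord_max x) = lift ord_max (s x).
Proof.
move=> ix; rewrite /perm_insert permM tpermD ?lift_perm_lift//.
by rewrite eq_sym -(inj_eq val_inj) /= /bump leqNgt ltn_ord /= neq_ltn ltn_ord.
Qed.

Let lmax_neq (x : 'I_n.+1) : ord_max != lift ord_max x.
Proof. exact: neq_lift. Qed.

Lemma porbits_insert_new s : let s' := perm_insert (s, ord_max) in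
  porbit s' ord_max = [set ord_max] /\
  porbits s' = [set ord_max] |: [set lift ord_max @: (X : {set 'I_n.+1}) | X in porbits s].
Proof.
move=> s'.
have H1 : porbit s' ord_max = [set ord_max].
  apply/eqP; rewrite finset.eqEsubset finset.sub1set porbit_id andbT.
  apply: porbit_subset; first by rewrite inE.
  by move=> y; rewrite !inE => /eqP ->; rewrite /s' /perm_insert permM tpermL lift_perm_id.
have H2 x : porbit s' (lift ord_max x) = lift ord_max @: porbit s x.
  by apply: porbit_equivariant => y _; exact: ins_lift.
split=> //; apply/setP => Y; apply/imsetP/setU1P => [[y _ ->]|].
  case: (unliftP ord_max y) => [x|] ->; last by left.
  by right; apply/imsetP; exists (porbit s x); rewrite ?H2// imset_f.
move=> [->|/imsetP[X /imsetP[x _ ->] ->]]; first by exists ord_max.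
by exists (lift ord_max x).
Qed.

Lemma porbits_insert_old s (i : 'I_n.+1) : let s' := perm_insert (s, lift ord_max i) in
  porbit s' ord_max = ord_max |: lift ord_max @: porbit s i /\
  porbits s' = (ord_max |: lift ord_max @: porbit s i)
    |: [set lift ord_max @: (X : {set 'I_n.+1}) | X in porbits s :\ porbit s i].
Proof.
move=> s'; set L := lift ord_max; set B := ord_max |: _.
have smax : s' ord_max = L (s i) by rewrite /s' /perm_insert permM tpermR lift_perm_lift.
have si : s' (L i) = ord_max by rewrite /s' /perm_insert permM tpermL lift_perm_id.
have sL x : x != i -> s' (L x) = L (s x).
  by move=> xi; apply: ins_lift; rewrite (inj_eq lift_inj) eq_sym.
have s_orb x : x \in porbit s i -> s x \in porbit s i.
  exact: porbit_next.
have H1 : porbit s' ord_max = B.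
  apply/eqP; rewrite finset.eqEsubset; apply/andP; split.
    apply: porbit_subset; first by rewrite setU11.
    move=> y /setU1P[->|/imsetP[x xi ->]].
      by rewrite smax setU1r// imset_f// s_orb// porbit_id.
    by have [->|xi'] := eqVneq x i; rewrite ?si ?setU11// sL// setU1r// imset_f// s_orb.
  have Lsi : L (s i) \in porbit s' ord_max by rewrite -smax; have := mem_porbit s' 1 ord_max; rewrite expg1.
  have so y : y \in porbit s' ord_max -> s' y \in porbit s' ord_max.
    exact: porbit_next.
  rewrite finset.subUset finset.sub1set porbit_id /=.
  have : porbit s (s i) \subset [set x | L x \in porbit s' ord_max].
    apply: porbit_subset; first by rewrite inE.
    move=> y; rewrite !inE => yi; have [->//|yi'] := eqVneq y i.
    by rewrite -sL// so.
  have -> : porbit s (s i) = porbit s i by apply/eqP; rewrite eq_porbit_mem s_orb// porbit_id.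
  move=> /subsetP sub; apply/subsetP => _ /imsetP[x xi ->].
  by have := sub x xi; rewrite inE.
have H2 x : x \in porbit s i -> porbit s' (L x) = B.
  by move=> xi; rewrite -H1; apply/eqP; rewrite eq_porbit_mem H1 setU1r// imset_f.
have H3 x : x \notin porbit s i -> porbit s' (L x) = L @: porbit s x.
  move=> xi; apply: porbit_equivariant => y yx; apply: sL; apply: contraNneq xi => yi.
  by rewrite -eq_porbit_mem eq_sym eq_porbit_mem -yi.
split=> //; apply/setP => Y; apply/imsetP/setU1P => [[y _ ->]|].
  case: (unliftP ord_max y) => [x|] ->; last by left.
  have [xi|xi] := boolP (x \in porbit s i); first by left; exact: H2.
  right; apply/imsetP; exists (porbit s x); rewrite -/L ?H3// !inE imset_f// andbT.
  by rewrite eq_porbit_mem.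
move=> [->|/imsetP[X /setD1P[Xi /imsetP[x _ Xx]] ->]]; first by exists ord_max.
by exists (L x) => //; rewrite H3 ?Xx// -eq_porbit_mem -Xx.
Qed.

Let imL_inj : injective (fun X : {set 'I_n.+1} => lift ord_max @: X).
Proof. by apply: imset_inj; exact: lift_inj. Qed.

Let count_card (B : {set 'I_n.+2}) (S : {set {set 'I_n.+1}}) (k : nat) : ord_max \in B ->
  #|[set X in B |: [set lift ord_max @: (X : {set 'I_n.+1}) | X in S] | #|X| == k]| =
  ((#|B| == k) + #|[set X in S | #|X| == k]|)%N.
Proof.
move=> mB; have nB : B \notin [set lift ord_max @: (X : {set 'I_n.+1}) | X in S].
  apply/imsetP => -[X _ e]; move: mB; rewrite e => /imsetP[x _ h].
  by have := lmax_neq x; rewrite -h eqxx.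
rewrite -[X in (_ + X)%N](card_imset _ imL_inj).
have -> : [set X in B |: [set lift ord_max @: (X : {set 'I_n.+1}) | X in S] | #|X| == k] =
    (if #|B| == k then [set B] else finset.set0) :|: [set lift ord_max @: (X : {set 'I_n.+1}) | X in [set X in S | #|X| == k]].
  apply/setP => Y; rewrite !inE; apply/andP/orP.
    move=> [/predU1P[->|/imsetP[X XS ->]]].
      by move=> ->; left; rewrite inE.
    by rewrite card_imset; [move=> h; right; apply/imsetP; exists X; rewrite ?inE ?XS|exact: lift_inj].
  move=> [|/imsetP[X]].
    by case: ifP => //; rewrite ?inE// => h /eqP ->; rewrite eqxx.
  rewrite inE => /andP[XS h] ->; rewrite card_imset; last exact: lift_inj.
  by split=> //; apply/orP; right; apply/imsetP; exists X.
case: ifP => _; last by rewrite finset.set0U.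
rewrite cardsU1 (_ : B \notin _)//.
apply: contra nB => /imsetP[X]; rewrite inE => /andP[XS _] ->; exact: imset_f.
Qed.

Definition cyc_new (c : nat -> nat) : nat -> nat := fun k => ((k == 1) + c k)%N.

(** The truncated subtraction is exact in use, since there is a cycle of length [l] whenever one of
    that length grows. *)
Definition cyc_grow (c : nat -> nat) (l : nat) : nat -> nat :=
  fun k => ((k == l.+1) + (c k - (k == l)))%N.

Lemma cycle_counts_insert_new s :
  cycle_counts (perm_insert (s, ord_max)) = cyc_new (cycle_counts s) /\
  ncycles (perm_insert (s, ord_max)) = (ncycles s).+1.
Proof.
have [_ e] := porbits_insert_new s; split.
  apply/funext => k; rewrite /cycle_counts e count_card ?set11// cards1.
  by rewrite /cyc_new eq_sym.
rewrite /ncycles e cardsU1 card_imset; last exact: imL_inj.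
rewrite (_ : _ \notin _)//; apply/imsetP => -[X _ h].
have : ord_max \in [set ord_max : 'I_n.+2] by rewrite inE.
by rewrite h => /imsetP[x _ h']; have := lmax_neq x; rewrite -h' eqxx.
Qed.

Lemma cycle_counts_insert_old s (i : 'I_n.+1) :
  [/\ cycle_counts (perm_insert (s, lift ord_max i)) = cyc_grow (cycle_counts s) #|porbit s i|,
      ncycles (perm_insert (s, lift ord_max i)) = ncycles s &
      #|porbit (perm_insert (s, lift ord_max i)) ord_max| = #|porbit s i|.+1].
Proof.
have [e1 e2] := porbits_insert_old s i.
have nB : ord_max \notin [set lift ord_max x | x in porbit s i].
  by apply/imsetP => -[x _ h]; have := lmax_neq x; rewrite -h eqxx.
have cB : #|ord_max |: [set lift ord_max x | x in porbit s i]| = #|porbit s i|.+1.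
  by rewrite cardsU1 nB card_imset//; exact: lift_inj.
have Os : porbit s i \in porbits s by exact: imset_f.
split; last by rewrite e1.
- apply/funext => k; rewrite /cycle_counts e2 count_card ?setU11// cB /cyc_grow eq_sym; congr (_ + _)%N.
  rewrite [in RHS](cardsD1 (porbit s i)) inE Os /= eq_sym addKn; apply: eq_card => X.
  by rewrite !inE andbA.
- rewrite /ncycles e2 cardsU1 card_imset; last exact: imL_inj.
  rewrite [RHS](cardsD1 (porbit s i)) Os (_ : _ \notin _)//.
  apply/imsetP => -[X _ h]; have := setU11 ord_max [set lift ord_max x | x in porbit s i].
  by rewrite h => /imsetP[x _ h']; have := lmax_neq x; rewrite -h' eqxx.
Qed.

Lemma cycle_counts_conj s t :
  [/\ cycle_counts (s ^ t) = cycle_counts s, ncycles (s ^ t) = ncycles s &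
      forall x, #|porbit (s ^ t) (t x)| = #|porbit s x|].
Proof.
have H x : porbit (s ^ t) (t x) = t @: porbit s x.
  by apply: porbit_equivariant => y _; rewrite /conjg !permM permK.
have E : porbits (s ^ t) = [set t @: (X : {set _}) | X in porbits s].
  apply/setP => Y; apply/imsetP/imsetP => [[y _ ->]|[_ /imsetP[x _ ->] ->]].
    by exists (porbit s (t^-1 y)); rewrite ?imset_f// -H permKV.
  by exists (t x).
have tinj : injective (fun X : {set 'I_n.+1} => t @: X) by apply: imset_inj; exact: perm_inj.
split.
- apply/funext => k; rewrite /cycle_counts E -[RHS](card_imset _ tinj); apply: eq_card => Y.
  rewrite !inE; apply/andP/imsetP => [[/imsetP[X XS ->]]|[X]].
    by rewrite card_imset; [exists X; rewrite ?inE ?XS|exact: perm_inj].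
  rewrite inE => /andP[XS h] ->; rewrite card_imset; last exact: perm_inj.
  by split=> //; apply/imsetP; exists X.
- by rewrite /ncycles E card_imset.
- by move=> x; rewrite H card_imset//; exact: perm_inj.
Qed.

End orbits.

Section feller.
Import fintype.
Context {R : realType}.
Variable theta : R.
Hypothesis theta0 : 0 < theta.

Definition fprob (j : nat) : R := theta / (theta + j.+1%:R).

(* Law of (cycle counts, length of the cycle of the last element) after [n] insertions. *)
Fixpoint feller (n : nat) (F : (nat -> nat) -> nat -> R) : R :=
  if n is n'.+1 then
    fprob n' * feller n' (fun c _ => F (cyc_new c) 1%N) +
    (1 - fprob n') * feller n' (fun c l => F (cyc_grow c l) l.+1)
  else F (fun k => (k == 1%N) : nat) 1%N.

(** The new element either forms a cycle of its own or is inserted next to one of the n + 1 old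
    elements. Conjugation by the transposition of [i] and [ord_max] preserves Ewens weights and
    cycle counts, so every position [i] contributes as much as [ord_max]: the cycle that grows may
    be taken to be that of the last element. *)
Lemma esf_feller n F :
  \sum_(s : 'S_n.+1) esf theta s * F (cycle_counts s) #|porbit s ord_max| = feller n F.
Proof.
elim: n F => [|n IH] F.
  have S1 (s : 'S_1) : s = 1%g by apply/permP => x; rewrite !ord1.
  have P1 : porbits (1%g : 'S_1) = [set [set ord0]]%SET.
    apply/setP => Y; rewrite inE; apply/imsetP/eqP => [[x _ ->]|->].
      by apply/setP => y; rewrite !ord1 inE eqxx porbit_id.
    by exists ord0 => //; apply/setP => y; rewrite !ord1 inE eqxx porbit_id.
  rewrite (bigD1 1%g)//= big1 ?addr0; last by move=> s; rewrite (S1 s) eqxx.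
  have -> : cycle_counts (1%g : 'S_1) = fun k => (k == 1%N) : nat.
    apply/funext => k; rewrite /cycle_counts P1.
    have [->|k1] := eqVneq k 1%N.
      rewrite (_ : [set X in _ | _]%SET = [set [set ord0]]%SET) ?cards1//.
      by apply/setP => Y; rewrite !inE; have [->|//] := eqVneq Y [set ord0]%SET; rewrite cards1.
    apply/eqP; rewrite cards_eq0; apply/eqP/setP => Y; rewrite !inE.
    by have [->|//] := eqVneq Y [set ord0]%SET; rewrite cards1 eq_sym (negbTE k1).
  have -> : porbit (1%g : 'S_1) ord_max = [set ord0]%SET.
    by apply/setP => y; rewrite !ord1 inE eqxx porbit_id.
  by rewrite cards1 /esf /ncycles P1 cards1 /rising big_ord1 addr0 divff ?gt_eqF// mul1r.
have ris : rising theta n.+2 = rising theta n.+1 * (theta + n.+1%:R) by rewrite /rising big_ord_recr.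
have tn0 : theta + n.+1%:R != 0 by rewrite gt_eqF// ltr_wpDr.
have rn0 m : rising theta m != 0.
  by rewrite gt_eqF//; apply: prodr_gt0 => i _; rewrite ltr_wpDr.
rewrite (reindex _ (onW_bij _ (perm_insert_bij n))) /=.
rewrite -(pair_bigA _ (fun s i => esf theta (perm_insert (s, i)) *
  F (cycle_counts (perm_insert (s, i))) #|porbit (perm_insert (s, i)) ord_max|)) /=.
under eq_bigr => s _ do rewrite (bigD1 ord_max)//=.
rewrite big_split /=; congr (_ + _).
  rewrite -IH mulr_sumr; apply: eq_bigr => s _.
  have [-> nc] := cycle_counts_insert_new s; have [-> _] := porbits_insert_new s.
  rewrite finset.cards1 mulrA; congr (_ * _); rewrite /esf nc ris exprS /fprob.
  move: (theta ^+ ncycles s) (rising theta n.+1) (rn0 n.+1) (theta + n.+1%:R) tn0 => x y y0 z z0.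
  by field; rewrite z0 y0.
rewrite -IH mulr_sumr exchange_big /=.
have step (i : 'I_n.+1) : \sum_(s : 'S_n.+1) esf theta (perm_insert (s, lift ord_max i)) *
     F (cycle_counts (perm_insert (s, lift ord_max i))) #|porbit (perm_insert (s, lift ord_max i)) ord_max| =
   (theta + n.+1%:R)^-1 * \sum_(s : 'S_n.+1) esf theta s * F (cyc_grow (cycle_counts s) #|porbit s ord_max|) #|porbit s ord_max|.+1.
  rewrite mulr_sumr (reindex (fun s => (s ^ tperm i ord_max)%g)); last first.
    by apply: onW_bij; exists (fun s => (s ^ (tperm i ord_max)^-1)%g) => s; rewrite ?conjgK ?conjgKV.
  apply: eq_bigr => s _; have [-> nc ->] := cycle_counts_insert_old (s ^ tperm i ord_max)%g i.
  have [-> nc' po] := cycle_counts_conj s (tperm i ord_max).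
  have -> : porbit (s ^ tperm i ord_max)%g i = porbit (s ^ tperm i ord_max)%g (tperm i ord_max ord_max) by rewrite tpermR.
  rewrite po mulrA; congr (_ * _); rewrite /esf nc nc' ris.
  move: (theta ^+ ncycles s) (rising theta n.+1) (rn0 n.+1) (theta + n.+1%:R) tn0 => x y y0 z z0.
  by field; rewrite z0 y0.
transitivity (\sum_(i < n.+1) (theta + n.+1%:R)^-1 * \sum_(s : 'S_n.+1) esf theta s * F (cyc_grow (cycle_counts s) #|porbit s ord_max|) #|porbit s ord_max|.+1).
  rewrite (reindex_onto (lift ord_max) (fun j => odflt ord0 (unlift ord_max j))) /=; last first.
    by move=> j jm; case: unliftP => [k ->|e]; rewrite ?liftK//; move: jm; rewrite e eqxx.
  by apply: eq_big => [i|i _]; [rewrite liftK /= eqxx andbT eq_sym neq_lift|exact: step].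
rewrite -mulr_suml sumr_const card_ord -[X in X * _]mulr_natl -mulr_sumr; congr (_ * _).
rewrite /fprob; move: (n.+1%:R) tn0 => z z0; by field.
Qed.

End feller.

(* Pathwise Feller coupling: the state is (cycle counts, length of the current cycle), and
   [b j] tells whether the insertion of element [j.+2] opens a new cycle. *)
Fixpoint feller_run (b : nat -> bool) (n : nat) : (nat -> nat) * nat :=
  if n is n'.+1 then
    let st := feller_run b n' in
    if b n' then (cyc_new st.1, 1%N) else (cyc_grow st.1 st.2, st.2.+1)
  else (fun k => (k == 1%N) : nat, 1%N).

Lemma feller_run2S b n : (feller_run b n.+1).2 = if b n then 1%N else (feller_run b n).2.+1.
Proof. by rewrite /=; case: (b n). Qed.

Lemma feller_run2_gt0 b n : (0 < (feller_run b n).2)%N.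
Proof. by case: n => //= n; case: (b n). Qed.

Lemma feller_run2_le b n : ((feller_run b n).2 <= n.+1)%N.
Proof. by elim: n => //= n IH; case: (b n). Qed.

(** Each true [b j] closes a cycle whose length is that of the current one at time [j]; the last
    summand is the cycle still open at time [n]. *)
Lemma feller_run1E b n k : (feller_run b n).1 k =
  (\sum_(j < n) (b j && ((feller_run b j).2 == k)) + ((feller_run b n).2 == k))%N.
Proof.
elim: n => [|n IH]; first by rewrite big_ord0 add0n eq_sym.
rewrite big_ord_recr /= /cyc_new /cyc_grow; case: (b n) => /=.
  by rewrite IH /= -addnA addnC [(_ == 1%N)]eq_sym addnA.
by rewrite IH addn0 [(k == (feller_run b n).2)]eq_sym addnK addnC [(k == _)]eq_sym.
Qed.

Lemma sum_feller_run1 (R : pzRingType) b n m (f : nat -> R) :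
  \sum_(1 <= k < m.+1) ((feller_run b n).1 k)%:R * f k =
  \sum_(j < n | b j && ((feller_run b j).2 <= m)%N) f (feller_run b j).2
   + (if ((feller_run b n).2 <= m)%N then f (feller_run b n).2 else 0).
Proof.
have single (l : nat) : (0 < l)%N ->
    \sum_(1 <= k < m.+1) (l == k)%:R * f k = (if (l <= m)%N then f l else 0).
  move=> l0; have [lm|ml] := leqP l m.
    rewrite (bigD1_seq l) ?mem_index_iota ?iota_uniq ?l0//= eqxx mul1r big1 ?addr0//.
    by move=> k kl; rewrite eq_sym (negbTE kl) mul0r.
  rewrite big1_seq// => k; rewrite mem_index_iota => /andP[_ /andP[_ km]].
  by rewrite (_ : l == k = false) ?mul0r//; apply/eqP => e; move: km ml; rewrite e; clear; lia.
under eq_bigr do rewrite feller_run1E natrD mulrDl natr_sum mulr_suml.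
rewrite big_split /= single ?feller_run2_gt0//; congr (_ + _).
rewrite exchange_big /= [RHS]big_mkcond; apply: eq_bigr => j _.
case: (b j) => /=; first exact/single/feller_run2_gt0.
by rewrite big1// => k _; rewrite mul0r.
Qed.

Section feller_run_law.
Context d (T : measurableType d) (R : realType) (P : probability T R).
Variables (theta : R) (b : nat -> T -> bool).
Hypothesis mb : forall j v, measurable [set w | b j w = v].

Let wt (j : nat) (v : bool) : R := if v then fprob theta j else 1 - fprob theta j.

Lemma measurable_feller_run n (A : (nat -> nat) * nat -> Prop) : measurable [set w | A (feller_run (b^~ w) n)].
Proof.
elim: n A => [|n IH] A /=.
  case: (pselect (A (fun k => (k == 1%N) : nat, 1%N))) => h.
    by rewrite (_ : [set _ | _] = setT)//; apply/seteqP; split.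
  by rewrite (_ : [set _ | _] = set0)//; apply/seteqP; split => // w /= /h.
rewrite (_ : [set _ | _] =
   ([set w | b n w = true] `&` [set w | A (cyc_new (feller_run (b^~ w) n).1, 1%N)]) `|`
   ([set w | b n w = false] `&` [set w | A (cyc_grow (feller_run (b^~ w) n).1 (feller_run (b^~ w) n).2, (feller_run (b^~ w) n).2.+1)])).
  apply: measurableU; apply: measurableI => //.
    exact: (IH (fun st => A (cyc_new st.1, 1%N))).
  exact: (IH (fun st => A (cyc_grow st.1 st.2, st.2.+1))).
apply/seteqP; split => w /=; first by case: (b n w); [left|right].
by move=> [[->]|[->]].
Qed.

Variable m : nat.
Hypothesis law_b : forall v : nat -> bool,
  P (\big[setI/setT]_(j < m) [set w | b j w = v j]) = (\prod_(j < m) wt j (v j))%:E.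

Lemma feller_run_law (A : (nat -> nat) -> nat -> Prop) :
  P [set w | A (feller_run (b^~ w) m).1 (feller_run (b^~ w) m).2] = (feller theta m (fun c l => (`[< A c l >])%:R))%:E.
Proof.
(* The event that fixes the later values b_j with n <= j < m is carried along, so that each step can
   use the joint law. *)
suff main n v : (n <= m)%N ->
    P ([set w | A (feller_run (b^~ w) n).1 (feller_run (b^~ w) n).2] `&` \big[setI/setT]_(n <= j < m) [set w | b j w = v j]) =
    (feller theta n (fun c l => (`[< A c l >])%:R) * \prod_(n <= j < m) wt j (v j))%:E.
  by have := main m (fun=> true) (leqnn m); rewrite !big_geq// setIT mulr1.
elim: n A v => [|n IH] A v nm.
  rewrite /= !big_mkord; case: asboolP => h.
    by rewrite (_ : [set _ | _] = setT) ?setTI ?mul1r ?law_b//; apply/seteqP; split.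
  by rewrite (_ : [set _ | _] = set0) ?set0I ?mul0r ?measure0//; apply/seteqP; split => // w /= /h.
have mE : measurable (\big[setI/setT]_(n.+1 <= j < m) [set w | b j w = v j]).
  by apply: bigsetI_measurable => j _; exact: mb.
pose u (x : bool) (j : nat) := if j == n then x else v j.
have E (x : bool) : \big[setI/setT]_(n <= j < m) [set w | b j w = u x j] =
    [set w | b n w = x] `&` \big[setI/setT]_(n.+1 <= j < m) [set w | b j w = v j].
  rewrite big_ltn// /u eqxx; congr (_ `&` _); apply: eq_big_nat => j /andP[nj _].
  by rewrite gtn_eqF.
have W (x : bool) : \prod_(n <= j < m) wt j (u x j) = wt n x * \prod_(n.+1 <= j < m) wt j (v j).
  rewrite big_ltn// /u eqxx; congr (_ * _); apply: eq_big_nat => j /andP[nj _].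
  by rewrite gtn_eqF.
have H1 := IH (fun c _ => A (cyc_new c) 1%N) (u true) (ltnW nm).
have H0 := IH (fun c l => A (cyc_grow c l) l.+1) (u false) (ltnW nm).
rewrite E W in H1; rewrite E W in H0.
have S : [set w | A (feller_run (b^~ w) n.+1).1 (feller_run (b^~ w) n.+1).2] `&`
     \big[setI/setT]_(n.+1 <= j < m) [set w | b j w = v j] =
   ([set w | A (cyc_new (feller_run (b^~ w) n).1) 1%N] `&`
     ([set w | b n w = true] `&` \big[setI/setT]_(n.+1 <= j < m) [set w | b j w = v j])) `|`
   ([set w | A (cyc_grow (feller_run (b^~ w) n).1 (feller_run (b^~ w) n).2) (feller_run (b^~ w) n).2.+1] `&`
     ([set w | b n w = false] `&` \big[setI/setT]_(n.+1 <= j < m) [set w | b j w = v j])).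
  apply/seteqP; split => w /=; first by case: (b n w) => -[? ?]; [left|right].
  by move=> [[? [-> ?]]|[? [-> ?]]].
rewrite S measureU//; last first.
- by apply/seteqP; split => w // -[[_ [/= -> _]] [_ []]].
- apply: measurableI; last exact: measurableI.
  exact: (measurable_feller_run n (fun st => A (cyc_grow st.1 st.2) st.2.+1)).
- apply: measurableI; last exact: measurableI.
  exact: (measurable_feller_run n (fun st => A (cyc_new st.1) 1%N)).
rewrite [X in (X + _)%E]H1 [X in (_ + X)%E]H0 -EFinD; congr (_%:E).
by rewrite /= /wt; ring.
Qed.

Lemma feller_run_ESF : 0 < theta -> ESF_cycle_counts_law P theta m.+1 (fun w => (feller_run (b^~ w) m).1).
Proof.
move=> theta0 a; split; first exact: (measurable_feller_run m (fun st => st.1 = a)).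
rewrite (feller_run_law (fun c _ => c = a)) -(esf_feller theta0); congr (_%:E).
rewrite [RHS]big_mkcond; apply: eq_bigr => s _.
by case: asboolP => _; rewrite ?mulr1 ?mulr0.
Qed.

End feller_run_law.

(** Inclusion and exclusion, one index at a time: the event that [b k] is true is obtained by
    subtracting from the unconstrained event the one where it is false. Avoidance probabilities are
    what the marked Poisson tree delivers directly. *)
Lemma avoidance_law d (T : measurableType d) (R : realType) (P : probability T R)
    (b : nat -> T -> bool) (p : nat -> R) (m : nat) :
  (forall j v, measurable [set w | b j w = v]) ->
  (forall z : nat -> bool,
     P (\big[setI/setT]_(j < m) (if z j then [set w | b j w = false] else setT))
     = (\prod_(j < m) (if z j then 1 - p j else 1))%:E) ->
  forall v : nat -> bool, P (\big[setI/setT]_(j < m) [set w | b j w = v j]) =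
    (\prod_(j < m) (if v j then p j else 1 - p j))%:E.
Proof.
move=> mb av v.
pose G k (z : nat -> bool) j := if (j < k)%N then [set w | b j w = v j]
  else if z j then [set w | b j w = false] else setT.
pose g k (z : nat -> bool) j := if (j < k)%N then (if v j then p j else 1 - p j) else if z j then 1 - p j else 1.
have mG k z j : measurable (G k z j) by rewrite /G; case: ifP => // _; case: ifP.
suff main k z : (k <= m)%N -> P (\big[setI/setT]_(j < m) G k z j) = (\prod_(j < m) g k z j)%:E.
  have := main m (fun=> false) (leqnn m); rewrite /G /g.
  under eq_bigr do rewrite ltn_ord.
  by under [X in _ = X%:E]eq_bigr do rewrite ltn_ord.
elim: k z => [|k IH] z km; first exact: av.
pose zz (x : bool) j := if j == k then x else z j.
pose S := \big[setI/setT]_(j < m | j != Ordinal km) G k.+1 z j.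
pose c := \prod_(j < m | j != Ordinal km) g k.+1 z j.
have rest x (j : 'I_m) : j != Ordinal km -> G k (zz x) j = G k.+1 z j /\ g k (zz x) j = g k.+1 z j.
  move=> jk; have jk' : (j == k :> nat) = false by exact: negbTE jk.
  rewrite /G /g /zz jk'; have -> : (j < k.+1)%N = (j < k)%N by rewrite ltnS leq_eqVlt jk'.
  by [].
have E x : P ((if x then [set w | b k w = false] else setT) `&` S) = ((if x then 1 - p k else 1) * c)%:E.
  have := IH (zz x) (ltnW km); rewrite (bigD1 (Ordinal km))//= [in RHS](bigD1 (Ordinal km))//=.
  rewrite (eq_bigr (fun j : 'I_m => G k.+1 z j)); last by move=> j /(rest x)[].
  rewrite [in RHS](eq_bigr (fun j : 'I_m => g k.+1 z j)); last by move=> j /(rest x)[].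
  by rewrite /G /g /zz ltnn eqxx.
have mS : measurable S by apply: bigsetI_measurable => j _; exact: mG.
rewrite (bigD1 (Ordinal km))//= -/S [in RHS](bigD1 (Ordinal km))//= -/c {1}/G {1}/g ltnSn.
have E1 := E true; have E0 := E false; rewrite /= setTI mul1r in E0; rewrite /= in E1.
case: (v k); last exact: E1.
have -> : [set w | b k w = true] `&` S = S `\` ([set w | b k w = false] `&` S).
  apply/seteqP; split => w /= [].
    by move=> bt Sw; split => // -[]; rewrite bt.
  by move=> Sw h; split => //; case: (b k w) h => // h; exfalso; apply: h.
rewrite measureD//; last 2 first.
- by apply: measurableI.
- by rewrite [X in (X < _)%E]E0 ltry.
rewrite setIA [S `&` _]setIC -setIA setIid.
transitivity (c%:E - ((1 - p k) * c)%:E)%E; first by congr (_ - _)%E.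
by rewrite -EFinB; congr (_%:E); ring.
Qed.

(** * Marked Poisson trees *)

Lemma integral_natval d (T : measurableType d) (R : realType) (mu : {measure set T -> \bar R})
    (f : T -> nat) (F : nat -> R) : cmeas f -> (forall k, 0 <= F k) ->
  (\int[mu]_w (F (f w))%:E = \sum_(0 <= k <oo) ((F k)%:E * mu [set w | f w = k]))%E.
Proof.
move=> mf F0; have cover : \bigcup_k [set w | f w = k] = setT by apply/seteqP; split => // w _; exists (f w).
rewrite -cover ge0_integral_bigcup//; last 3 first.
- by rewrite cover; apply/measurable_EFinP; apply: (measurable_fun_bind (g := fun k _ => F k)).
- by move=> z _; rewrite lee_fin.
- by apply/trivIsetP => i j _ _ ij; apply/seteqP; split => z // [] /= h1 h2; move: ij; rewrite -h1 h2 eqxx.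
apply: eq_eseriesr => k _.
rewrite (eq_integral (fun=> (F k)%:E)); last by move=> z; rewrite inE /= => ->.
by rewrite integral_cst//; exact: mf.
Qed.

(** Values of mass zero are avoided at every point and not merely almost surely; hence marks lie in
    their cell for every [w], and the error bounds can be pathwise. *)
Lemma quant_gt0 (R : realType) (p : nat -> R) z : pmf p -> 0 < p (quant p z).
Proof.
move=> Hp; set k := quant p z.
have h1 : Phi z <= \sum_(i < k.+1) p i by rewrite -quant_leE.
have h2 : (k == 0%N) || (\sum_(i < k) p i < Phi z) by rewrite -quant_gtE.
move: h1 h2; rewrite big_ord_recr /=; case: k => [|k] /=.
  by rewrite big_ord0 add0r => h _; apply: lt_le_trans h; exact: Phi_gt0.
by move=> h1 h2; move: (lt_le_trans h2 h1); rewrite ltrDl.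
Qed.

Section marked_tree.
Context d (T : measurableType d) (R : realType) (P : probability T R).
Local Notation RR := (measurableTypeR R).
Variables (X : nat + option (nat * nat) -> T -> RR) (h : nat) (mu : R).
Hypotheses (iX : iid P X) (mu0 : 0 < mu).

Let lam : R := 2 ^+ h * mu.

Let lam0 : 0 <= lam. Proof. by rewrite mulr_ge0 ?exprn_ge0// ltW. Qed.

Let mX k : measurable_fun setT (X k). Proof. exact: indep_measurable iX k. Qed.

(** Roles of the indices of [X]: [inl j] are the leaf normals, [inr None] gives the total number of
    points, and [inr (Some (l, r))] gives the mark of point [r] in cell [l]. The total is thus not
    coupled with the root normal [troot]. *)
Definition root_count (w : T) : nat := quant (poisson lam) (X (inr None) w).

Definition leaf_count (i : nat) (w : T) : nat := cnt h (fun j => X (inl j) w) (root_count w) i.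

Lemma cmeas_root_count : cmeas root_count.
Proof.
move=> k; rewrite -[X in measurable X]setTI.
exact: (mX (inr None) measurableT (measurable_quant_eq k (pmf_poisson lam0))).
Qed.

Lemma cmeas_leaf_count i : cmeas (leaf_count i).
Proof. by apply: (cmeas_cnt h i (x := fun j => X (inl j))) => //; exact: cmeas_root_count. Qed.

(** [A] restricts the counts and [D] the marks. The two uses are the law of one count, with trivial
    [D], and avoidance of a set of marks, with trivial [A]. *)
Lemma marked_tree_law (A : nat -> nat -> bool) (D : nat -> set RR) (dd : nat -> R) :
  (forall i, measurable (D i)) -> (forall i, N01 (D i) = (dd i)%:E) ->
  (forall i, 0 <= dd i <= 1) ->
  P (\big[setI/setT]_(i < 2 ^ h) \bigcup_k (if A i k then [set w | leaf_count i w = k] `&`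
        \big[setI/setT]_(r < k) (X (inr (Some (i : nat, r : nat))) @^-1` D i) else set0))
  = (\prod_(i < 2 ^ h) (\sum_(0 <= k <oo) (if A i k then poisson mu k * dd i ^+ k else 0)%:E))%E.
Proof.
move=> mD ND d01.
have d0 i : 0 <= dd i by case/andP: (d01 i).
pose H i k := if A i k then [set w | leaf_count i w = k] `&`
        \big[setI/setT]_(r < k) (X (inr (Some (i, r : nat))) @^-1` D i) else set0.
pose eta i k := if A i k then poisson mu k * dd i ^+ k else 0.
have pm := pmf_poisson (ltW mu0).
apply: (@measure_bigsetI_bigcup _ _ _ P (2 ^ h) H eta).
- move=> i k; rewrite /H; case: (A i k) => //; apply: measurableI; first exact: cmeas_leaf_count.
  by apply: bigsetI_measurable => r _; rewrite -[X in measurable X]setTI; exact: mX.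
- move=> i; apply/trivIsetP => k k' _ _ kk; rewrite /H; case: (A i k); last by rewrite set0I.
  case: (A i k'); last by rewrite setI0.
  by apply/seteqP; split => w // -[[/= h1 _] [h2 _]]; move: kk; rewrite -h1 h2 eqxx.
- by move=> i k; rewrite /eta; case: (A i k) => //; rewrite mulr_ge0 ?exprn_ge0// pm.1.
- move=> i; apply: (@le_lt_trans _ _ (\sum_(0 <= k <oo) (1 * poisson mu k)%:E)%E); last first.
    rewrite -(integral_quant (f := fun=> 1) pm)// integral_cst// [X in (_ * X)%E]probability_setT.
    by rewrite mule1 ltry.
  apply: lee_nneseries => [k *|k *]; rewrite /eta lee_fin; case: (A i k); rewrite ?mul1r ?pm.1//.
    by rewrite mulr_ge0 ?exprn_ge0// pm.1.
  by rewrite ler_piMr ?pm.1// exprn_ile1//; case/andP: (d01 i).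
move=> a; have [Aa|] := boolP [forall i : 'I_(2 ^ h), A i (a i)]; last first.
  rewrite negb_forall => /existsP[i nA].
  by rewrite (bigD1 i)//= /H (negbTE nA) set0I measure0 (bigD1 i)//= /eta (negbTE nA) mul0r.
have {}Aa i : (i < 2 ^ h)%N -> A i (a i) by move=> ih; exact: (forallP Aa (Ordinal ih)).
pose s : seq (option (nat * nat)) := [seq Some (i, r) | i <- iota 0 (2 ^ h), r <- iota 0 (a i)].
pose B (l : option (nat * nat)) : set RR := if l is Some (i, _) then D i else setT.
have us : uniq s.
  apply: allpairs_uniq_dep; rewrite ?iota_uniq//; first by move=> i _; exact: iota_uniq.
  by move=> [i r] [i' r'] _ _ /= [-> ->].
have ns : None \notin s by apply/allpairsPdep => -[i [r []]].
have mB l : measurable (B l) by case: l => [[i r]|] //=; exact: mD.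
have := tree_law h a iX lam0 us ns mB; rewrite -/(root_count _).
have -> : lam / 2 ^+ h = mu by rewrite /lam mulrAC divff ?mul1r// expf_neq0.
move=> HH; transitivity (P ([set w | forall i, (i < 2 ^ h)%N -> leaf_count i w = a i] `&`
     \big[setI/[set: T]]_(l <- s) X (inr l) @^-1` B l)).
  congr (P _); apply/seteqP; split => w /=.
    move=> Hw; have Hi i : (i < 2 ^ h)%N -> H i (a i) w.
      move=> ih; have := proj1 (bigsetIP _ _ _) Hw (Ordinal ih); apply.
      by rewrite mem_index_enum.
    split; first by move=> i ih; have := Hi i ih; rewrite /H Aa// => -[].
    apply/bigsetIP => l /allpairsPdep[i [r [+ + ->]]]; rewrite !mem_iota /= !add0n => ih ra.
    have := Hi i ih; rewrite /H Aa// => -[_ /bigsetIP] /(_ (Ordinal ra)).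
    by rewrite mem_index_enum; apply.
  move=> [H1 /bigsetIP H2]; apply/bigsetIP => i _; rewrite /H Aa//; split; first exact: H1.
  apply/bigsetIP => r _; apply: (H2 (Some (i : nat, r : nat))).
  by apply/allpairsPdep; exists (i : nat), (r : nat); rewrite !mem_iota /= !add0n !ltn_ord.
rewrite HH big_allpairs_dep /= (_ : \prod_(i <- iota 0 (2 ^ h)) _ = (\prod_(i < 2 ^ h) dd i ^+ a i)%:E)%E.
  rewrite -EFinM -big_split /=; congr (_%:E); apply: eq_bigr => i _.
  by rewrite /eta Aa.
rewrite -prodEFin -(big_mkord xpredT (fun i => (dd i ^+ a i)%:E)) /index_iota subn0.
apply: eq_bigr => i _; rewrite (eq_bigr (fun=> (dd i)%:E)); last by move=> r _; exact: ND.
rewrite prodEFin; congr (_%:E).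
by rewrite big_const_seq count_predT size_iota; elim: (a i) => //= k ->; rewrite exprS.
Qed.

Lemma leaf_count_law (i k : nat) : (i < 2 ^ h)%N -> P [set w | leaf_count i w = k] = (poisson mu k)%:E.
Proof.
move=> ih; have pm := pmf_poisson (ltW mu0).
have := @marked_tree_law (fun i' k' => (i' != i) || (k' == k)) (fun=> setT) (fun=> 1)
  (fun=> measurableT) (fun=> @probability_setT _ _ _ (@N01 R)) (fun=> _).
rewrite lexx ler01 => /(_ (fun=> isT)) H.
transitivity (P (\big[setI/[set: T]]_(i0 < 2 ^ h)
         \bigcup_k0 (if ((i0 : nat) != i) || (k0 == k) then
            [set w | leaf_count i0 w = k0] `&` \big[setI/[set: T]]_(r < k0)
             (X (inr (Some (i0 : nat, r : nat))) @^-1` setT) else set0))).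
  congr (P _); apply/seteqP; split => w /=.
    move=> e; apply/bigsetIP => i' _; exists (leaf_count i' w) => //.
    have -> : ((i' : nat) != i) || (leaf_count i' w == k).
      by have [->|//] := eqVneq (i' : nat) i; rewrite e eqxx.
    by split => //; apply/bigsetIP => r _.
  move=> /bigsetIP /(_ (Ordinal ih)); rewrite mem_index_enum => /(_ isT) [k' _] /=.
  by rewrite eqxx /=; case: eqP => // -> [].
rewrite H (bigD1 (Ordinal ih))//= big1 ?mule1; last first.
  move=> i' ii; have -> : ((i' : nat) != i) = true by exact: ii.
  rewrite (eq_eseriesr (g := fun k => (1 * poisson mu k)%:E)); last first.
    by move=> k' _; rewrite expr1n mulr1 mul1r.
  by rewrite -(integral_quant (f := fun=> 1) pm)// integral_cst// [X in (_ * X)%E]probability_setT mule1.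
rewrite eqxx /= (nneseries_split _ k.+1); last first.
  by move=> k' _; rewrite lee_fin; case: eqP => // _; rewrite mulr_ge0 ?pm.1 ?exprn_ge0.
rewrite add0n big_mkord big_ord_recr /= eqxx expr1n mulr1 big1 ?add0e; last first.
  by move=> k' _; rewrite (ltn_eqF (ltn_ord k')).
rewrite eseries0 ?adde0// => k' kk _.
by rewrite gtn_eqF.
Qed.

Lemma integral_leaf_count (F : nat -> R) i : (i < 2 ^ h)%N -> (forall k, 0 <= F k) ->
  (\int[P]_w (F (leaf_count i w))%:E = \int[N01]_z (F (quant (poisson mu) z))%:E)%E.
Proof.
move=> ih F0; rewrite (integral_natval P (cmeas_leaf_count i) F0).
rewrite (integral_quant (pmf_poisson (ltW mu0)) F0); apply: eq_eseriesr => k _.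
by rewrite EFinM; congr (_ * _)%E; exact: leaf_count_law.
Qed.

Lemma integral_root_count (F : nat -> R) : (forall k, 0 <= F k) ->
  (\int[P]_w (F (root_count w))%:E = \int[N01]_z (F (quant (poisson lam) z))%:E)%E.
Proof.
move=> F0; have pl := pmf_poisson lam0.
have mF : measurable_fun setT (fun x : RR => (F (quant (poisson lam) x))%:E).
  by apply/measurable_EFinP; exact: measurable_fun_quant.
by rewrite -(indep_integral (inr None) iX (f := fun x => (F (quant (poisson lam) x))%:E))// => x; rewrite lee_fin.
Qed.

Section marks.
Variables (N J : nat) (nu : nat -> nat -> R).
Hypotheses (hN : (N <= 2 ^ h)%N) (nu0 : forall l j, 0 <= nu l j)
  (nuJ : forall l j, (J <= j)%N -> nu l j = 0) (nu1 : forall l, \sum_(j < J) nu l j = 1).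

Let pnu l : pmf (nu l).
Proof. by apply: (finite_pmf (m := J)); [exact: nu0|exact: nuJ|exact: nu1]. Qed.

Definition mark (l r : nat) (w : T) : nat := quant (nu l) (X (inr (Some (l, r))) w).

Definition hit (j : nat) (w : T) : bool :=
  has (fun l => has (fun r => mark l r w == j) (iota 0 (leaf_count l w))) (iota 0 N).

Lemma mark_lt l r w : (mark l r w < J)%N.
Proof.
rewrite ltnNge; apply/negP => Jm; have := quant_gt0 (X (inr (Some (l, r))) w) (pnu l).
by rewrite -/(mark l r w) nuJ// ltxx.
Qed.

Lemma cmeas_mark l r : cmeas (mark l r).
Proof.
move=> k; rewrite -[X in measurable X]setTI.
exact: (mX (inr (Some (l, r))) measurableT (measurable_quant_eq k (pnu l))).
Qed.

Let cmeas_has (I : Type) (f : I -> T -> bool) (s : seq I) :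
  (forall i, cmeas (f i)) -> cmeas (fun w => has (f^~ w) s).
Proof.
move=> mf; elim: s => [|i s IH]; first exact: cmeas_cst.
apply: (cmeas_bind (f := f i) (g := fun v w => v || has (f^~ w) s)) => // v.
exact: (cmeas_comp (orb v) IH).
Qed.

Lemma cmeas_hit j : cmeas (hit j).
Proof.
apply: cmeas_has => l.
apply: (cmeas_bind (f := leaf_count l) (g := fun k w => has (fun r => mark l r w == j) (iota 0 k))).
  exact: cmeas_leaf_count.
move=> k; apply: cmeas_has => r; exact: (cmeas_comp (fun i => i == j) (cmeas_mark l r)).
Qed.

Let N01_avoid (z : nat -> bool) l : N01 [set x : RR | ~~ z (quant (nu l) x)] =
  (1 - \sum_(j < J | z j) nu l j)%:E.
Proof.
have mD : measurable [set x : RR | ~~ z (quant (nu l) x)].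
  exact: (measurable_quant (fun k => ~~ z k) (pnu l)).
rewrite -(integral_indicT (@N01 R) mD).
transitivity (\int[@N01 R]_x (((~~ z (quant (nu l) x)) : bool)%:R)%:E)%E.
  by apply: eq_integral => x _; rewrite indicE (_ : (x \in _) = ~~ z (quant (nu l) x))//; apply/idP/idP; rewrite inE.
apply: (integral_quant_cvg (f := fun k => (~~ z k)%:R)) => //.
have -> : 1 - \sum_(j < J | z j) nu l j = \sum_(j < J) (~~ z j)%:R * nu l j.
  rewrite -{1}(nu1 l) (bigID (fun j : 'I_J => z j)) /= addrC addrK [RHS](bigID (fun j : 'I_J => z j)) /=.
  rewrite [X in _ = X + _]big1 ?add0r; last by move=> j zj; rewrite zj mul0r.
  by apply: eq_bigr => j zj; rewrite zj mul1r.
apply: cvg_near_cst; exists J => // k /= Jk.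
rewrite -!(big_mkord xpredT (fun j => (~~ z j)%:R * nu l j)) (big_cat_nat (n := J))//= [X in _ + X]big1_seq ?addr0//.
by move=> j; rewrite mem_index_iota => /andP[_ /andP[Jj _]]; rewrite nuJ// mulr0.
Qed.

Let mass_le1 (z : nat -> bool) l : \sum_(j < J | z j) nu l j <= 1.
Proof. by rewrite -(nu1 l) [leRHS](bigID (fun j : 'I_J => z j)) /= lerDl sumr_ge0. Qed.

(** If a single mark of a cell avoids the forbidden set with probability d, then [k] marks do so
    with probability d^k, and the Poisson generating function gives exp (- mu (1 - d)). The exponent
    is additive in the forbidden marks, so the probabilities factorize. *)
Lemma hit_avoid (z : nat -> bool) :
  P (\big[setI/setT]_(j < J) (if z j then [set w | hit j w = false] else setT)) =
  (\prod_(j < J) (if z j then 1 - (1 - expR (- \sum_(l < N) mu * nu l j)) else 1))%:E.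
Proof.
pose D i : set RR := if (i < N)%N then [set x : RR | ~~ z (quant (nu i) x)] else setT.
pose dd i : R := if (i < N)%N then 1 - \sum_(j < J | z j) nu i j else 1.
have mD i : measurable (D i).
  by rewrite /D; case: ifP => // _; exact: (measurable_quant (fun k => ~~ z k) (pnu i)).
have ND i : N01 (D i) = (dd i)%:E.
  by rewrite /D /dd; case: ifP => _; [exact: N01_avoid|exact: probability_setT].
have d01 i : 0 <= dd i <= 1.
  rewrite /dd; case: ifP => _; last by rewrite ler01 lexx.
  by rewrite subr_ge0 mass_le1 gerBl sumr_ge0.
have HH := marked_tree_law (fun _ _ => true) mD ND d01.
transitivity (P (\big[setI/[set: T]]_(i < 2 ^ h) \bigcup_k ([set w | leaf_count i w = k] `&`
    \big[setI/[set: T]]_(r < k) X (inr (Some (i : nat, r : nat))) @^-1` D i))).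
  congr (P _); apply/seteqP; split => w /bigsetIP Hw; apply/bigsetIP.
    move=> i _; exists (leaf_count i w) => //; split => //; apply/bigsetIP => r _.
    rewrite /D /=; case: ifP => iN //=; apply/negP => zm.
    have := Hw (Ordinal (mark_lt i r w)); rewrite mem_index_enum => /(_ isT) /=.
    rewrite /mark zm /= => /negP; apply; rewrite /hit; apply/hasP; exists (i : nat).
      by rewrite mem_iota add0n.
    by apply/hasP; exists (r : nat); rewrite ?mem_iota ?add0n ?ltn_ord//= /mark eqxx.
  move=> j _; case: ifP => // zj /=; apply/negP => /hasP[l]; rewrite mem_iota add0n /= => lN /hasP[r].
  rewrite mem_iota add0n /= => rl /eqP mj.
  have lh : (l < 2 ^ h)%N by exact: leq_trans hN.
  have := Hw (Ordinal lh); rewrite mem_index_enum => /(_ isT) [k _] [/= kE].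
  rewrite -kE => /bigsetIP /(_ (Ordinal rl)); rewrite mem_index_enum => /(_ isT) /=.
  by rewrite /D lN /= -/(mark l r w) mj zj.
rewrite HH.
have gen (c : R) : (\sum_(0 <= k <oo) (poisson mu k * c ^+ k)%:E = (expR (- (mu * (1 - c))))%:E)%E.
  transitivity (limn (EFin \o (fun n => expR (- mu) * series (exp_coeff (mu * c)) n))).
    congr (limn _); apply/funext => n /=; rewrite sumEFin; congr (_%:E).
    rewrite /series /= mulr_sumr; apply: eq_bigr => k _.
    by rewrite /poisson /exp_coeff /= exprMn; ring.
  have C := is_cvg_series_exp_coeff (mu * c).
  rewrite EFin_lim; last by apply: is_cvgM => //; exact: is_cvg_cst.
  rewrite limM//; last exact: is_cvg_cst.
  rewrite lim_cst// -[limn _]/(expR (mu * c)) -expRD; congr (expR _)%:E; ring.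
under eq_bigr do rewrite gen.
rewrite prodEFin; congr (_%:E).
rewrite -expR_sum [in RHS]/=; under [RHS]eq_bigr => j _ do rewrite opprB addrCA subrr addr0.
transitivity (expR (- \sum_(j < J | z j) \sum_(l < N) mu * nu l j)).
  congr expR; rewrite exchange_big /= -sumrN.
  rewrite -!(big_mkord xpredT (fun i => - (mu * (1 - dd i)))) -(big_mkord xpredT (fun i => - \sum_(j < J | z j) mu * nu i j)).
  rewrite (big_cat_nat (n := N))//= [X in _ + X]big1_seq ?addr0; last first.
    move=> i; rewrite mem_index_iota => /andP[_ /andP[Ni _]].
    by rewrite /dd ltnNge Ni /= subrr mulr0 oppr0.
  apply: eq_big_nat => i /andP[_ iN]; rewrite /dd iN opprB addrCA subrr addr0 mulr_sumr//.
rewrite -sumrN expR_sum [RHS]big_mkcond [LHS]big_mkcond; apply: eq_bigr => j _.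
by case: (z j).
Qed.

Lemma hit_law (v : nat -> bool) :
  P (\big[setI/setT]_(j < J) [set w | hit j w = v j]) =
  (\prod_(j < J) (if v j then 1 - expR (- \sum_(l < N) mu * nu l j)
                  else 1 - (1 - expR (- \sum_(l < N) mu * nu l j))))%:E.
Proof. apply: (@avoidance_law _ _ _ P hit (fun j => 1 - expR (- \sum_(l < N) mu * nu l j))) => [j v'|].
  exact: cmeas_hit.
exact: hit_avoid. Qed.

Let mhit1 j : measurable [set w | hit j w = false]. Proof. exact: cmeas_hit. Qed.

Let p j := 1 - expR (- \sum_(l < N) mu * nu l j).

Let hit_avoid1 (j : nat) : (j < J)%N -> P [set w | hit j w = false] = (1 - p j)%:E.
Proof.
move=> jJ; have := hit_avoid (fun i => i == j).
rewrite (bigD1 (Ordinal jJ))//= eqxx big1 ?setIT => [->|i ij]; last by rewrite (negbTE ij : (i == j :> nat) = false).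
rewrite (bigD1 (Ordinal jJ))//= eqxx [X in _ * X]big1 ?mulr1// => i ij.
by rewrite (negbTE ij : (i == j :> nat) = false).
Qed.

Let hit_avoid2 (i j : nat) : (i < j)%N -> (j < J)%N ->
  P ([set w | hit i w = false] `&` [set w | hit j w = false]) = ((1 - p i) * (1 - p j))%:E.
Proof.
move=> ij jJ; have iJ := ltn_trans ij jJ; have := hit_avoid (fun k => (k == i) || (k == j)).
have ne : Ordinal jJ != Ordinal iJ by rewrite -(inj_eq val_inj) /= gtn_eqF.
rewrite (bigD1 (Ordinal iJ))//= eqxx (bigD1 (Ordinal jJ))//= eqxx orbT big1 ?setIT => [->|k /andP[ki kj]]; last first.
  by rewrite (negbTE ki : (k == i :> nat) = false) (negbTE kj : (k == j :> nat) = false).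
rewrite (bigD1 (Ordinal iJ))//= eqxx (bigD1 (Ordinal jJ))//= eqxx orbT [X in _ * (_ * X)]big1 ?mulr1// => k /andP[ki kj].
by rewrite (negbTE ki : (k == i :> nat) = false) (negbTE kj : (k == j :> nat) = false).
Qed.

Let mhitR j : measurable_fun setT (fun w => (hit j w)%:R : RR).
Proof. exact: (measurable_fun_bind (cmeas_hit j) (fun v => measurable_cst (v%:R : RR))). Qed.
Lemma integral_hit j : (j < J)%N -> (\int[P]_w ((hit j w)%:R)%:E = (p j)%:E)%E.
Proof.
move=> jJ; transitivity (\int[P]_w (\1_(~` [set w | hit j w = false]) w)%:E)%E.
  apply: eq_integral => w _; rewrite indicE (_ : (w \in _) = hit j w)//.
  by apply/idP/idP; rewrite inE /=; case: (hit j w).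
rewrite integral_indicT; last exact: measurableC (mhit1 j).
transitivity (1 - P [set w | hit j w = false])%E; first exact: (probability_setC P (mhit1 j)).
by rewrite hit_avoid1// -EFinB opprB addrCA subrr addr0.
Qed.

Lemma integral_hit2 i j : (i < j)%N -> (j < J)%N ->
  (\int[P]_w ((hit i w)%:R * (hit j w)%:R)%:E = (p i * p j)%:E)%E.
Proof.
move=> ij jJ; have iJ := ltn_trans ij jJ.
pose A k := [set w | hit k w = false].
transitivity (P (~` A i `\` A j)).
  rewrite -integral_indicT; last by apply: measurableD; [exact: measurableC (mhit1 i)|exact: mhit1].
  apply: eq_integral => w _; rewrite indicE; congr (_%:E).
  rewrite (_ : (w \in ~` A i `\` A j) = hit i w && hit j w) ?mulnb -?natrM ?mulnb//.
  apply/idP/andP; rewrite inE /A /=.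
    by move=> []; case: (hit i w); case: (hit j w).
  by move=> [-> ->].
have fin A' : measurable A' -> (P A' < +oo)%E.
  by move=> mA'; apply: le_lt_trans (probability_le1 _ mA') _; exact: ltry.
rewrite (measureD (measurableC (mhit1 i)) (mhit1 j) (fin _ (measurableC (mhit1 i)))).
rewrite (_ : ~` A i `&` A j = A j `\` A i); last by rewrite setDE setIC.
rewrite (measureD (mhit1 j) (mhit1 i) (fin _ (mhit1 j))) [X in (X - _)%E](probability_setC P (mhit1 i)).
transitivity (1 - (1 - p i)%:E - ((1 - p j)%:E - ((1 - p i) * (1 - p j))%:E))%E; last first.
  by rewrite -!EFinB; congr (_%:E); ring.
by congr (1 - _ - (_ - _))%E; [exact: hit_avoid1|exact: hit_avoid1|rewrite setIC; exact: hit_avoid2].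
Qed.

End marks.

End marked_tree.

Lemma integral_troot d (T : measurableType d) (R : realType) (P : probability T R) h (L : eqType)
    (X : nat + L -> T -> measurableTypeR R) (f : R -> \bar R) : iid P X ->
  measurable_fun setT (f : measurableTypeR R -> _) -> (forall x, 0 <= f x)%E ->
  (\int[P]_w f (troot h (fun j => X (inl j) w)) = \int[N01]_x f x)%E.
Proof.
move=> + mf f0; elim: h L X => [|h IH] L X iX; first exact: (indep_integral (inl 0%N) iX).
exact: (IH _ _ (iid_tree_step iX)).
Qed.

Lemma expected_error_le (R : realType) (s mu m e z : R) : s <= mu -> e <= 1 -> 1 <= mu ->
  s / 2 + 4 + s + s / 2 * 6 + 11700 * (2 * m) + 5200 * e + (33 * mu + 16 + z)
    <= 40 * mu + 23400 * m + 5220 + z.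
Proof. lra. Qed.

(** * Expected Gaussian approximation error of the first leaf counts *)

Section tree_coupling.
Context d (T : measurableType d) (R : realType) (P : probability T R).
Local Notation RR := (measurableTypeR R).
Variables (X : nat + option (nat * nat) -> T -> RR) (m : nat) (mu : R).
Hypotheses (iX : iid P X) (mu_ge : 2400 <= Num.sqrt mu).

Let N := (2 ^ m)%N.
Let h := (m + m)%N.
Let lam : R := 2 ^+ h * mu.
Let s := Num.sqrt mu.
(** The largest threshold allowed by [cnt_deviation]; it gives the exponent t^2 / 4 = mu / (4 *
    2400^2) in the failure probability. *)
Let t : R := s / 2400.

Let c0 : 0 < 2400 :> R. Proof. by rewrite ltr0n. Qed.

Let ct : 2400 * t = s. Proof. by rewrite /t mulrC (divfK (lt0r_neq0 c0)). Qed.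

Let s_ge1 : 1 <= s. Proof. by apply: le_trans mu_ge; rewrite ler1n. Qed.

Let s_gt0 : 0 < s. Proof. exact: lt_le_trans s_ge1. Qed.

Let mu0 : 0 < mu. Proof. by rewrite -sqrtr_gt0. Qed.

Let s0 : 0 <= s. Proof. exact: sqrtr_ge0. Qed.

Let ss : s ^+ 2 = mu. Proof. by rewrite sqr_sqrtr// ltW. Qed.

Let mu1 : 1 <= mu. Proof. by rewrite -ss exprn_ege1. Qed.

Let t1 : 1 <= t. Proof. by rewrite (ler_pdivlMr _ _ c0) mul1r. Qed.

Let N0 : 0 < N%:R :> R. Proof. by rewrite ltr0n expn_gt0. Qed.

Let NN : 2 ^+ h = N%:R ^+ 2 :> R. Proof. by rewrite /h exprD /N natrX expr2. Qed.

Let lamE : lam = N%:R ^+ 2 * mu. Proof. by rewrite /lam NN. Qed.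

Let lam0 : 0 < lam. Proof. by rewrite mulr_gt0 ?exprn_gt0. Qed.

Let hN : (N <= 2 ^ h)%N. Proof. by rewrite leq_exp2l// /h leq_addr. Qed.

Let mX k : measurable_fun setT (X k). Proof. exact: indep_measurable iX k. Qed.

Let x (w : T) (j : nat) : R := X (inl j) w.
Let M (w : T) : R := (root_count X h mu w)%:R.
Let n (l : nat) (w : T) : R := (leaf_count X h mu l w)%:R.

Let mn l : measurable_fun setT (n l : T -> RR).
Proof.
exact: (measurable_fun_bind (cmeas_leaf_count h iX mu0 l) (fun k => measurable_cst (k%:R : RR))).
Qed.

Let mM : measurable_fun setT (M : T -> RR).
Proof.
exact: (measurable_fun_bind (cmeas_root_count h iX mu0) (fun k => measurable_cst (k%:R : RR))).
Qed.

Let good := [set w | tgood h (x w) t] `&` [set w | `|M w - lam| <= lam / 4].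

Let mgood : measurable good.
Proof.
apply: measurableI; first exact: (measurable_tgood h t (fun j => mX (inl j))).
rewrite (_ : [set w | _] = (fun w => `|M w - lam|) @^-1` `]-oo, lam / 4]%classic); last first.
  by apply/seteqP; split => w /=; rewrite in_itv.
rewrite -[X in measurable X]setTI; apply: measurableT_comp => //.
by apply: measurable_funB => //; exact: mM.
Qed.

Let D w := (M w - lam) ^+ 2.
Let bad w : R := \1_(~` [set w | tgood h (x w) t]) w.
Let u l w := n l w + mu + s * `|x w l|.
Let V w := \sum_(l < N) (3 * (2 * (n l w - mu) ^+ 2 + 3 * mu ^+ 2 + mu * (x w l) ^+ 2)).
(** Pays for the bad event, where a splitting normal exceeds [t] or the total is off by more than
    lam / 4. There the trivial bound is at most (N / lam) V + lam, and lam is charged to the factor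
    bad + 16 D / lam^2, which is at least 1 on that event. *)
Let BY w := N%:R / lam * V w + lam * bad w + 16 / lam * D w.
(** Stands in for the maximum of the path sums over all leaves, by x <= 2 h + exp (x - 2 h) with x a
    quarter of a path sum. *)
Let Z w := \sum_(i < 2 ^ h) expR (pathsum h (x w) i / 4).

Let Dev k w := \sum_(j < k) (n j w - mu - s * x w j).

Let u0 l w : 0 <= u l w.
Proof. by rewrite /u !addr_ge0 ?ler0n ?(ltW mu0)// mulr_ge0. Qed.

Let bad0 w : 0 <= bad w. Proof. by rewrite /bad indicE. Qed.

Let D0 w : 0 <= D w. Proof. exact: sqr_ge0. Qed.

Let Nlam0 : 0 <= N%:R / lam. Proof. by apply: divr_ge0; [exact: ltW|exact: ltW]. Qed.

Let V_ge0 w l : 0 <= 3 * (2 * (n l w - mu) ^+ 2 + 3 * mu ^+ 2 + mu * (x w l) ^+ 2).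
Proof. rewrite mulr_ge0// addr_ge0//; last by rewrite mulr_ge0 ?sqr_ge0// ltW.
by rewrite addr_ge0// mulr_ge0// sqr_ge0. Qed.

Let V0 w : 0 <= V w.
Proof. by apply: sumr_ge0 => l _; exact: V_ge0. Qed.

Let BY0 w : 0 <= BY w.
Proof.
rewrite addr_ge0 ?addr_ge0//; first exact: mulr_ge0.
  by rewrite mulr_ge0// ltW.
by rewrite mulr_ge0// divr_ge0// ltW.
Qed.

Let u_sqr l w : u l w ^+ 2 <= 3 * (2 * (n l w - mu) ^+ 2 + 3 * mu ^+ 2 + mu * (x w l) ^+ 2).
Proof.
rewrite /u -ss -(real_normK (num_real (x w l))); move: (n l w) (`|x w l|) s => a b c.
have -> : 3 * (2 * (a - c ^+ 2) ^+ 2 + 3 * (c ^+ 2) ^+ 2 + c ^+ 2 * b ^+ 2) =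
  (a + c ^+ 2 + c * b) ^+ 2 + (a - c ^+ 2) ^+ 2 + (a - c * b) ^+ 2 + (c ^+ 2 - c * b) ^+ 2
  + 3 * (a - 2 * c ^+ 2) ^+ 2 by ring.
rewrite -!addrA lerDl; do 3 (apply: addr_ge0; first exact: sqr_ge0).
by rewrite mulr_ge0// sqr_ge0.
Qed.

(* [sum u <= sum (u^2 / z + z) / 2] with [z = lam / N] *)
Let bad_le k w : (k <= N)%N -> ~ good w -> \sum_(l < k) u l w <= BY w.
Proof.
move=> kN ng.
have B1 : 1 <= bad w + 16 / lam ^+ 2 * D w.
  have [tg|tg] := pselect (tgood h (x w) t); last first.
    rewrite /bad indicE mem_set// lerDl mulr_ge0// divr_ge0// sqr_ge0//.
  have /negP : ~ (`|M w - lam| <= lam / 4) by move=> ?; apply: ng; split.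
  rewrite -ltNge => /ltW H.
  have H2 : (lam / 4) ^+ 2 <= D w.
    rewrite /D -(real_normK (num_real (M w - lam))); apply: lerXn2r => //; rewrite ?nnegrE ?normr_ge0//.
    by apply: divr_ge0 => //; exact: ltW.
  apply: (@le_trans _ _ (16 / lam ^+ 2 * D w)); last by rewrite lerDr.
  rewrite mulrAC ler_pdivlMr ?exprn_gt0// mul1r; move: H2; rewrite exprMn exprVn -natrX; lra.
have -> : BY w = N%:R / lam * V w + lam * (bad w + 16 / lam ^+ 2 * D w).
  by rewrite /BY; field; rewrite gt_eqF.
have L0 := ltW lam0.
apply: (@le_trans _ _ (\sum_(l < N) (N%:R / lam * u l w ^+ 2 + lam / N%:R))).
  apply: (@le_trans _ _ (\sum_(l < k) (N%:R / lam * u l w ^+ 2 + lam / N%:R))).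
    apply: ler_sum => l _; rewrite -subr_ge0.
    have -> : N%:R / lam * u l w ^+ 2 + lam / N%:R - u l w =
      (N%:R / lam) * ((u l w - lam / (2 * N%:R)) ^+ 2 + 3 / 4 * (lam / N%:R) ^+ 2).
      by field; rewrite !gt_eqF.
    by rewrite mulr_ge0// addr_ge0 ?sqr_ge0// mulr_ge0 ?sqr_ge0// divr_ge0.
  rewrite -!(big_mkord xpredT (fun l => N%:R / lam * u l w ^+ 2 + lam / N%:R)).
  rewrite [leRHS](big_cat_nat (n := k))//= lerDl; apply: sumr_ge0 => l _.
  by rewrite addr_ge0//; [rewrite mulr_ge0// sqr_ge0|apply: divr_ge0 => //; exact: ltW].
rewrite big_split/= -mulr_sumr sumr_const card_ord -[lam / N%:R *+ N]mulr_natr divfK ?gt_eqF//.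
apply: lerD; last by rewrite ler_peMr.
by apply: ler_wpM2l => //; apply: ler_sum => l _; exact: u_sqr.
Qed.

Let dev_le_Y k w : `|Dev k w| <= \sum_(l < k) u l w.
Proof.
apply: le_trans (ler_norm_sum _ _ _) _; apply: ler_sum => j _.
rewrite /u -addrA; apply: le_trans (ler_normD _ _) _.
rewrite -opprD normrN -addrA; apply: lerD; first by rewrite ger0_norm// ler0n.
by apply: le_trans (ler_normD _ _) _; rewrite normrM (ger0_norm s0) (ger0_norm (ltW mu0)).
Qed.

(** The terms in order: the root mismatch scaled by 1 / N, split by the inequality of means,
    together with the initial potential 4 D / lam; then the path sums, with 11700 = 1300 * (1 + 8)
    and 5200 = 1300 * 4; then the bad event. *)
Let ME w := ((2 * N%:R ^+ 2 * s)^-1 + 4 / lam) * D w + s + s / 2 * troot h (x w) ^+ 2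
   + 11700 * h%:R + 5200 * (expR (- (2 * h%:R)) * Z w) + BY w.

Let tree w : good w -> forall i, (i < 2 ^ h)%N ->
  `|n i w - mu| <= mu / 4 + 7 * t * s /\
  forall k, k = i \/ k = i.+1 ->
    `|Dev k w - (M w - lam - Num.sqrt lam * troot h (x w)) * (k%:R / 2 ^+ h)|
      + 4 * ((n i w - mu) ^+ 2 / mu)
    <= 4 * ((M w - lam) ^+ 2 / lam) + 1300 * (h%:R + pathsum h (x w) i).
Proof.
move=> [g1 g2]; apply: cnt_deviation => //.
by rewrite ct.
Qed.

Let Z0 w : 0 <= Z w. Proof. by apply: sumr_ge0 => i _; exact: expR_ge0. Qed.

Let path_le w i : (i < 2 ^ h)%N -> pathsum h (x w) i <= 4 * (2 * h%:R + expR (- (2 * h%:R)) * Z w).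
Proof.
move=> ih; rewrite mulrC -ler_pdivrMr//.
have e1 : pathsum h (x w) i / 4 - 2 * h%:R <= expR (pathsum h (x w) i / 4 - 2 * h%:R).
  by apply: le_trans (expR_ge1Dx _); rewrite lerDr.
have e2 : expR (pathsum h (x w) i / 4 - 2 * h%:R) <= expR (- (2 * h%:R)) * Z w.
  rewrite addrC expRD ler_wpM2l ?expR_ge0// /Z (bigD1 (Ordinal ih))//= lerDl.
  by apply: sumr_ge0 => j _; exact: expR_ge0.
by rewrite -lerBlDl; exact: le_trans e1 e2.
Qed.

Let sqlam : Num.sqrt lam = N%:R * s.
Proof. by rewrite lamE sqrtrM ?sqr_ge0// sqrtr_sqr ger0_norm// ltW. Qed.

Let dev_le k w : (k <= N)%N -> `|Dev k w| <= ME w.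
Proof.
move=> kN.
have P1 : 0 <= (2 * N%:R ^+ 2 * s)^-1 * D w.
  by rewrite mulr_ge0// invr_ge0 mulr_ge0// mulr_ge0// sqr_ge0.
have P2 : 0 <= 4 / lam * D w by rewrite mulr_ge0// divr_ge0// ltW.
have P3 : 0 <= expR (- (2 * h%:R)) * Z w by rewrite mulr_ge0// expR_ge0.
have P4 : 0 <= s / 2 * troot h (x w) ^+ 2 by rewrite mulr_ge0 ?sqr_ge0// divr_ge0.
have P5 : 0 <= h%:R :> R by exact: ler0n.
have [g|g] := pselect (good w); last first.
  apply: le_trans (dev_le_Y k w) _; apply: le_trans (bad_le kN g) _.
  rewrite /ME mulrDl; move: P1 P2 P3 P4 P5 s0.
  lra.
have P6 := BY0 w.
case: k kN => [|k] kN.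
  rewrite /Dev big_ord0 normr0 /ME mulrDl; move: P1 P2 P3 P4 P5 P6 s0.
  lra.
have kh : (k < 2 ^ h)%N by exact: leq_trans hN.
have [_ /(_ k.+1 (or_intror erefl)) H] := tree g kh.
have pq := path_le w kh.
have H4 : 0 <= 4 * ((n k w - mu) ^+ 2 / mu) by rewrite mulr_ge0// divr_ge0 ?sqr_ge0// ltW.
set E := (M w - lam - Num.sqrt lam * troot h (x w)) in H *.
have HE : `|E * (k.+1%:R / 2 ^+ h)| <= (2 * N%:R ^+ 2 * s)^-1 * D w + s + s / 2 * troot h (x w) ^+ 2.
  have e1 : `|E| <= N%:R * ((2 * N%:R ^+ 2 * s)^-1 * D w + s + s / 2 * troot h (x w) ^+ 2).
    apply: le_trans (ler_normD _ _) _; rewrite normrN normrM (ger0_norm (sqrtr_ge0 _)) sqlam.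
    rewrite /D -(real_normK (num_real (M w - lam))) -(real_normK (num_real (troot h (x w)))).
    move: (`|M w - lam|) (`|troot h (x w)|) => p q; rewrite -subr_ge0.
    have -> : N%:R * ((2 * N%:R ^+ 2 * s)^-1 * p ^+ 2 + s + s / 2 * q ^+ 2) - (p + N%:R * s * q)
      = (p - N%:R * s) ^+ 2 / (2 * N%:R * s) + N%:R * s / 2 * (q - 1) ^+ 2.
      by field; rewrite !gt_eqF.
    apply: addr_ge0; first by apply: divr_ge0; [exact: sqr_ge0|rewrite mulr_ge0// mulr_ge0// ltW].
    by rewrite mulr_ge0 ?sqr_ge0// divr_ge0// mulr_ge0// ltW.
  rewrite normrM NN -[leRHS](mulKf (lt0r_neq0 N0)) mulrC ler_pM//.
  rewrite ger0_norm ?divr_ge0 ?exprn_ge0 ?ler0n// ler_pdivrMr ?exprn_gt0//.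
  by rewrite expr2 mulKf ?gt_eqF// ler_nat.
have := ler_normD (Dev k.+1 w - E * (k.+1%:R / 2 ^+ h)) (E * (k.+1%:R / 2 ^+ h)); rewrite subrK.
rewrite /ME [(_ + 4 / lam) * _]mulrDl; move: P1 P2 P3 P4 P5 P6 H H4 HE pq s0.
rewrite -/(D w) (_ : 4 * (D w / lam) = 4 / lam * D w); last by rewrite mulrA mulrAC.
move: (`|Dev k.+1 w|) (`|Dev k.+1 w - _|) (`|E * _|) (_^-1 * D w) (4 / lam * D w) (4 * ((n k w - mu) ^+ 2 / mu)) (BY w) (pathsum _ _ _) (expR _ * _) => *.
lra.
Qed.

Let MX w := 2 * mu + BY w.

Let n_le l w : (l < N)%N -> n l w <= MX w.
Proof.
move=> lN; have [g|g] := pselect (good w); last first.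
  apply: (@le_trans _ _ (BY w)); last by rewrite lerDr mulr_ge0// ltW.
  apply: le_trans (bad_le (leqnn N) g).
  rewrite (bigD1 (Ordinal lN))//= {1}/u -addrA -addrA lerDl.
  apply: addr_ge0; first exact: ltW.
  by apply: addr_ge0; [exact: mulr_ge0|apply: sumr_ge0 => j _; exact: u0].
have [+ _] := tree g (leq_trans lN hN); rewrite ler_norml => /andP[_ H].
have P4 := BY0 w.
have ts : 7 * t * s <= mu / 4.
  have : 2400 * t * s <= mu by rewrite ct -ss expr2.
  have : 0 <= t * s by rewrite mulr_ge0// (le_trans ler01).
  rewrite -!mulrA; move: (t * s) => p; lra.
rewrite /MX; move: H P4 ts mu0; move: (n l w) (BY w) (7 * t * s) => *; lra.
Qed.

Let mx l : measurable_fun setT (x^~ l : T -> RR). Proof. exact: mX. Qed.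

Let mabs (f : T -> RR) : measurable_fun setT f -> measurable_fun setT (fun w => `|f w| : RR).
Proof. by move=> mf; apply: measurableT_comp => //. Qed.

Let mroot : measurable_fun setT ((fun w => troot h (x w)) : T -> RR).
Proof. exact: (measurable_troot h (fun j => mX (inl j))). Qed.

Let mbad : measurable_fun setT (bad : T -> RR).
Proof.
by apply: measurable_indic; apply: measurableC; exact: (measurable_tgood h t (fun j => mX (inl j))).
Qed.

Let mZ : measurable_fun setT (Z : T -> RR).
Proof.
apply: measurable_sum => i; apply: measurableT_comp => //; apply: measurable_funM => //.
exact: (measurable_pathsum h i (fun j => mX (inl j))).
Qed.

Let mnl l : measurable_fun setT (fun w => (n l w - mu) ^+ 2 : RR).
Proof. by apply: measurable_funX; apply: measurable_funB => //; exact: mn. Qed.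

Let mxl l : measurable_fun setT (fun w => x w l ^+ 2 : RR).
Proof. by apply: measurable_funX; exact: mx. Qed.

Let mVl l : measurable_fun setT
  (fun w => 3 * (2 * (n l w - mu) ^+ 2 + 3 * mu ^+ 2 + mu * (x w l) ^+ 2) : RR).
Proof.
apply: measurable_funM => //; apply: measurable_funD; last by apply: measurable_funM => //; exact: mxl.
by apply: measurable_funD => //; apply: measurable_funM => //; exact: mnl.
Qed.

Let mV : measurable_fun setT (V : T -> RR).
Proof. by apply: measurable_sum => l; exact: mVl. Qed.

Let mD : measurable_fun setT (D : T -> RR).
Proof. by apply: measurable_funX; apply: measurable_funB => //; exact: mM. Qed.

Let mBY : measurable_fun setT (BY : T -> RR).
Proof.
apply: measurable_funD; last by apply: measurable_funM => //; exact: mD.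
by apply: measurable_funD; apply: measurable_funM.
Qed.

Let ED : (\int[P]_w (D w)%:E = lam%:E)%E.
Proof.
rewrite (integral_root_count h iX mu0 (F := fun k => (k%:R - lam) ^+ 2)); last by move=> k; exact: sqr_ge0.
by rewrite integral_poisson_var// ltW.
Qed.

Let sq_le_exp (z : R) : z ^+ 2 <= 4 * expR (z ^+ 2 / 4).
Proof. have := expR_ge1Dx (z ^+ 2 / 4); lra. Qed.

Let mexp : measurable_fun setT (fun z : RR => expR (z ^+ 2 / 4) : RR).
Proof. by apply: measurableT_comp => //; apply: measurable_funM => //. Qed.

Let s2 : Num.sqrt 2 <= 3 / 2 :> R.
Proof. rewrite -[leRHS]ger0_norm// -sqrtr_sqr ler_sqrt// expr2; lra. Qed.

Let mz2 : measurable_fun setT (fun z : RR => z ^+ 2 : RR).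
Proof. by apply: measurable_funX. Qed.

Let E_sq : (\int[@N01 R]_z (z ^+ 2)%:E <= 6%:E)%E.
Proof.
apply: (@le_trans _ _ (\int[@N01 R]_z (4 * expR (z ^+ 2 / 4))%:E)%E).
  apply: (@integral_EFin_le _ RR R (@N01 R) (fun z => z ^+ 2) (fun z => 4 * expR (z ^+ 2 / 4))) => //.
  - by move=> z; exact: sqr_ge0.
  - by apply: measurable_funM => //; exact: mexp.
rewrite integral_EFinZ//.
by rewrite N01_exp_moment -EFinM lee_fin; have := s2; lra.
Qed.

Let Ecst (c : R) : (\int[P]_w c%:E = c%:E)%E.
Proof. by rewrite integral_cst// [X in (_ * X)%E]probability_setT mule1. Qed.

Let EZ : (\int[P]_w (Z w)%:E = (2 ^+ h * Num.sqrt 2 ^+ h)%:E)%E.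
Proof.
have g (i : 'I_(2 ^ h)) w : 0 <= expR (pathsum h (x w) i / 4) by exact: expR_ge0.
have mz (i : 'I_(2 ^ h)) : measurable_fun setT ((fun w => expR (pathsum h (x w) i / 4)) : T -> RR).
  apply: measurableT_comp => //; apply: measurable_funM => //.
  exact: (measurable_pathsum h i (fun j => mX (inl j))).
rewrite (integral_EFin_sum P _ g mz).
rewrite (eq_bigr (fun=> (Num.sqrt 2 ^+ h)%:E)); last first.
  move=> i _; have := integral_exp_pathsum h (s := [::]) i iX isT; rewrite addn0 => <-.
  by apply: eq_integral => w _; rewrite big_nil mulr1.
by rewrite sumEFin sumr_const card_ord -[in RHS]natrX mulr_natl.
Qed.

Let Ebad : (\int[P]_w (bad w)%:E <= (2 ^+ h * (2 * expR (- (t ^+ 2 / 4))))%:E)%E.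
Proof.
rewrite integral_indicT; last by apply: measurableC; exact: (measurable_tgood h t (fun j => mX (inl j))).
by apply: (tgood_prob h iX); exact: le_trans t1.
Qed.

Let Ex (l : nat) : (\int[P]_w (x w l ^+ 2)%:E <= 6%:E)%E.
Proof.
apply: le_trans E_sq; rewrite le_eqVlt; apply/orP; left; apply/eqP.
apply: (indep_integral (inl l) iX (f := fun z => (z ^+ 2)%:E)); last by move=> z; rewrite lee_fin sqr_ge0.
by apply/measurable_EFinP; exact: mz2.
Qed.

Let Eroot : (\int[P]_w (troot h (x w) ^+ 2)%:E <= 6%:E)%E.
Proof.
apply: le_trans E_sq; rewrite le_eqVlt; apply/orP; left; apply/eqP.
apply: (integral_troot h iX (f := fun z => (z ^+ 2)%:E)); last by move=> z; rewrite lee_fin sqr_ge0.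
by apply/measurable_EFinP; exact: mz2.
Qed.

Let En l : (l < N)%N -> (\int[P]_w ((n l w - mu) ^+ 2)%:E = mu%:E)%E.
Proof.
move=> lN; rewrite (integral_leaf_count iX mu0 (F := fun k => (k%:R - mu) ^+ 2)).
- by rewrite integral_poisson_var// ltW.
- exact: leq_trans hN.
- by move=> k; exact: sqr_ge0.
Qed.

Let EV : (\int[P]_w (V w)%:E <= (N%:R * (33 * mu ^+ 2))%:E)%E.
Proof.
have mu00 := ltW mu0.
rewrite integral_EFin_sum; [|by move=> l w; exact: V_ge0|by move=> l; exact: mVl].
have -> : N%:R * (33 * mu ^+ 2) = \sum_(l < N) (33 * mu ^+ 2) by rewrite sumr_const card_ord mulr_natl.
rewrite -sumEFin; apply: lee_sum => l _.
have g2 w : 0 <= mu * x w l ^+ 2 by rewrite mulr_ge0 ?sqr_ge0.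
have g3 w : 0 <= 2 * (n l w - mu) ^+ 2 by rewrite mulr_ge0 ?sqr_ge0.
have c3 : 0 <= 3 * mu ^+ 2 by rewrite mulr_ge0 ?sqr_ge0.
have g1 w : 0 <= 2 * (n l w - mu) ^+ 2 + 3 * mu ^+ 2 by exact: addr_ge0.
have m1 : measurable_fun setT ((fun w => 2 * (n l w - mu) ^+ 2) : T -> RR).
  by apply: measurable_funM => //; exact: mnl.
have m2 : measurable_fun setT ((fun w => mu * x w l ^+ 2) : T -> RR).
  by apply: measurable_funM => //; exact: mxl.
have m3 : measurable_fun setT ((fun w => 2 * (n l w - mu) ^+ 2 + 3 * mu ^+ 2) : T -> RR).
  exact: measurable_funD.
rewrite (integral_EFinZ P _ (fun w => addr_ge0 (g1 w) (g2 w)) (measurable_funD m3 m2))//.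
rewrite (integral_EFinD P g1 m3 g2 m2) (integral_EFinD P g3 m1 (fun=> c3))//.
rewrite (integral_EFinZ P _ (fun w => sqr_ge0 (n l w - mu)) (mnl l))//.
rewrite (integral_EFinZ P mu00 (fun w => sqr_ge0 (x w l)) (mxl l)).
rewrite En// Ecst.
apply: (@le_trans _ _ (3%:E * (2%:E * mu%:E + (3 * mu ^+ 2)%:E + mu%:E * 6%:E)))%E.
  by apply: lee_wpmul2l => //; apply: leeD2l; apply: lee_wpmul2l => //; exact: Ex.
rewrite -!(EFinM, EFinD) lee_fin expr2; have := ler_pM ler01 mu00 mu1 (lexx mu); lra.
Qed.

Let EBY : (\int[P]_w (BY w)%:E <= (33 * mu + 16 + 2 * N%:R ^+ 4 * mu * expR (- (t ^+ 2 / 4)))%:E)%E.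
Proof.
have mu00 := ltW mu0; have lam00 := ltW lam0.
have g1 w : 0 <= N%:R / lam * V w by exact: mulr_ge0.
have g2 w : 0 <= lam * bad w by exact: mulr_ge0.
have g3 w : 0 <= 16 / lam * D w by rewrite mulr_ge0// divr_ge0.
have m1 : measurable_fun setT ((fun w => N%:R / lam * V w) : T -> RR) by exact: measurable_funM.
have m2 : measurable_fun setT ((fun w => lam * bad w) : T -> RR) by exact: measurable_funM.
have m3 : measurable_fun setT ((fun w => 16 / lam * D w) : T -> RR) by apply: measurable_funM => //; exact: mD.
have l16 : 0 <= 16 / lam by apply: divr_ge0.
rewrite (integral_EFinD P (fun w => addr_ge0 (g1 w) (g2 w)) (measurable_funD m1 m2) g3 m3).
rewrite (integral_EFinD P g1 m1 g2 m2) (integral_EFinZ P Nlam0 V0 mV).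
rewrite (integral_EFinZ P lam00 bad0 mbad) (integral_EFinZ P l16 D0 mD) ED; apply: (@le_trans _ _ ((N%:R / lam)%:E * (N%:R * (33 * mu ^+ 2))%:E
  + lam%:E * (2 ^+ h * (2 * expR (- (t ^+ 2 / 4))))%:E + (16 / lam)%:E * lam%:E))%E.
  apply: leeD2r; apply: leeD; first by apply: lee_wpmul2l; [rewrite lee_fin|exact: EV].
  by apply: lee_wpmul2l; [rewrite lee_fin|exact: Ebad].
rewrite -!(EFinM, EFinD) lee_fin divfK ?gt_eqF// NN lamE le_eqVlt; apply/orP; left; apply/eqP.
by field; rewrite !gt_eqF.
Qed.

(** The base is 2 sqrt 2 / e^2, below 1: the shift 2 h in the bound of the path sums outweighs the
    number 2^h of leaves. *)
Let small_expR : expR (- (2 * h%:R)) * (2 ^+ h * Num.sqrt 2 ^+ h) <= 1 :> R.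
Proof.
have -> : - (2 * h%:R) = - (h%:R * 2) :> R by rewrite mulrC.
rewrite expRN expRM_natl -exprMn -exprVn -exprMn exprn_ile1//.
rewrite mulrC ler_pdivrMr ?expR_gt0// mul1r.
have := expR_ge1Dx (1 : R); rewrite (_ : 2 = 1 + 1 :> R)// expRD => e2.
have := s2; have := ler_pM _ _ e2 e2; nra.
Qed.

Let mME : measurable_fun setT (ME : T -> RR).
Proof.
apply: measurable_funD; last exact: mBY.
apply: measurable_funD; last by apply: measurable_funM => //; apply: measurable_funM => //; exact: mZ.
apply: measurable_funD => //; apply: measurable_funD.
  by apply: measurable_funD => //; apply: measurable_funM => //; exact: mD.
by apply: measurable_funM => //; apply: measurable_funX; exact: mroot.
Qed.

Let EME : (\int[P]_w (ME w)%:E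
  <= (40 * mu + 23400 * m%:R + 5220 + 2 * N%:R ^+ 4 * mu * expR (- (t ^+ 2 / 4)))%:E)%E.
Proof.
set a := (2 * N%:R ^+ 2 * s)^-1 + 4 / lam; set b := expR (- (2 * h%:R) : R).
set c := 33 * mu + 16 + 2 * N%:R ^+ 4 * mu * expR (- (t ^+ 2 / 4)).
have a0 : 0 <= a.
  by rewrite addr_ge0// ?divr_ge0 ?(ltW lam0)// invr_ge0 mulr_ge0// mulr_ge0// sqr_ge0.
have b0 : 0 <= b by exact: expR_ge0.
have s20 : 0 <= s / 2 by rewrite divr_ge0.
have h0 : 0 <= h%:R :> R by exact: ler0n.
have m1 : measurable_fun setT ((fun w => a * D w) : T -> RR) by apply: measurable_funM => //; exact: mD.
have m2 : measurable_fun setT ((fun w => a * D w + s) : T -> RR) by exact: measurable_funD.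
have m30 : measurable_fun setT ((fun w => troot h (x w) ^+ 2) : T -> RR).
  by apply: measurable_funX; exact: mroot.
have m3 : measurable_fun setT ((fun w => s / 2 * troot h (x w) ^+ 2) : T -> RR).
  by apply: measurable_funM.
have m4 : measurable_fun setT ((fun w => b * Z w) : T -> RR) by apply: measurable_funM => //; exact: mZ.
have m5 : measurable_fun setT ((fun w => 5200 * (b * Z w)) : T -> RR).
  by apply: measurable_funM; [exact: measurable_cst|exact: m4].
have m6 := measurable_funD m2 m3.
have m7 := measurable_funD m6 (measurable_cst (11700 * h%:R : RR)).
have m8 := measurable_funD m7 m5.
have g1 w : 0 <= a * D w by exact: mulr_ge0.
have g2 w : 0 <= a * D w + s by exact: addr_ge0.
have g3 w : 0 <= s / 2 * troot h (x w) ^+ 2 by rewrite mulr_ge0// sqr_ge0.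
have g4 w : 0 <= b * Z w by exact: mulr_ge0.
have g5 w : 0 <= 5200 * (b * Z w) by exact: mulr_ge0 (ler0n _ 5200) (g4 w).
have g6 w : 0 <= a * D w + s + s / 2 * troot h (x w) ^+ 2 by exact: addr_ge0.
have g70 : 0 <= 11700 * h%:R :> R by exact: mulr_ge0 (ler0n _ 11700) h0.
have g7 w : 0 <= a * D w + s + s / 2 * troot h (x w) ^+ 2 + 11700 * h%:R by exact: addr_ge0.
have g8 w : 0 <= a * D w + s + s / 2 * troot h (x w) ^+ 2 + 11700 * h%:R + 5200 * (b * Z w) by exact: addr_ge0.
rewrite (integral_EFinD P g8 m8 BY0 mBY) (integral_EFinD P g7 m7 g5 m5) (integral_EFinD P g6 m6 (fun=> g70) (measurable_cst _)).
rewrite (integral_EFinD P g2 m2 g3 m3) (integral_EFinD P g1 m1 (fun=> s0) (measurable_cst _)).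
rewrite !Ecst.
rewrite (integral_EFinZ P a0 D0 mD) (integral_EFinZ P s20 _ m30); last by move=> w; exact: sqr_ge0.
rewrite (integral_EFinZ P (ler0n _ 5200) g4 m4) (integral_EFinZ P b0 Z0 mZ) ED EZ.
apply: (@le_trans _ _ (a%:E * lam%:E + s%:E + (s / 2)%:E * 6%:E + (11700 * h%:R)%:E
   + 5200%:E * (b%:E * (2 ^+ h * Num.sqrt 2 ^+ h)%:E) + c%:E)%E).
  apply: leeD; last exact: EBY.
  by apply: leeD2r; apply: leeD2r; apply: leeD2l; apply: lee_wpmul2l; [rewrite lee_fin|exact: Eroot].
rewrite -!(EFinM, EFinD) lee_fin.
have e1 : a * lam = s / 2 + 4.
  by rewrite /a lamE -ss; field; rewrite !gt_eqF.
have e2 : s <= mu by rewrite -ss expr2 ler_peMl.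
have e3 : h%:R = 2 * m%:R :> R by rewrite /h natrD; ring.
have e4 := small_expR; rewrite -/b in e4.
rewrite e1 e3 /c; exact: (expected_error_le _ _ e2 e4 mu1).
Qed.

Let ME0 w : 0 <= ME w. Proof. by have := dev_le w (leq0n N); apply: le_trans. Qed.

Let MX0 w : 0 <= MX w.
Proof. by rewrite addr_ge0// mulr_ge0// ltW. Qed.

(** [B] is of order mu + m as soon as mu is such a large multiple of [m] that the exponential beats
    N^4. *)
Lemma tree_coupling : exists ME MX : T -> RR,
  [/\ (forall w k, (k <= 2 ^ m)%N ->
        `|\sum_(j < k) ((leaf_count X (m + m) mu j w)%:R - mu - Num.sqrt mu * X (inl (j : nat)) w)| <= ME w),
      (forall w l, (l < 2 ^ m)%N -> (leaf_count X (m + m) mu l w)%:R <= MX w),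
      measurable_fun setT ME /\ (forall w, 0 <= ME w),
      measurable_fun setT MX /\ (forall w, 0 <= MX w) &
      let B := 40 * mu + 23400 * m%:R + 5220
        + 2 * (2 ^ m)%:R ^+ 4 * mu * expR (- (mu / (4 * 2400 ^+ 2))) in
      (\int[P]_w (ME w)%:E <= B%:E)%E /\ (\int[P]_w (MX w)%:E <= B%:E)%E].
Proof.
exists ME, MX; split => //; [by move=> w k; exact: dev_le|by move=> w l; exact: n_le| |].
  by split => //; apply: measurable_funD => //; exact: mBY.
have -> : mu / (4 * 2400 ^+ 2) = t ^+ 2 / 4.
  rewrite /t -ss; move: c0; move: (2400 : R) s => c z cp; field; exact: lt0r_neq0.
split; first exact: EME.
have m2 : 0 <= 2 * mu by rewrite mulr_ge0// ltW.
rewrite /MX (integral_EFinD P (fun=> m2) (measurable_cst _) BY0 mBY) Ecst.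
apply: le_trans; first by apply: leeD2l; exact: EBY.
rewrite -EFinD lee_fin.
have : 0 <= m%:R :> R by exact: ler0n.
lra.
Qed.

End tree_coupling.

(** * The functional invol and the hits *)

Section hit_rate.
Context {R : realType}.
Implicit Types theta : R.

Lemma ln_lower_bound (x : R) : 0 < x -> 1 - x^-1 <= ln x.
Proof.
move=> x0; rewrite -lerN2 -lnV ?posrE// opprB.
have : -1 < x^-1 - 1 by rewrite ltrBrDl subrr invr_gt0.
by move=> /le_ln1Dx; rewrite addrCA subrr addr0.
Qed.

Lemma ln_upper_bound (x : R) : 0 < x -> ln x <= x - 1.
Proof.
move=> x0; have : -1 < x - 1 by rewrite ltrBrDl subrr.
by move=> /le_ln1Dx; rewrite addrCA subrr addr0.
Qed.

Lemma ln_ge0_nat (k : nat) : 0 <= ln k%:R :> R.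
Proof. by case: k => [|k]; [rewrite ln0|apply: ln_ge0; rewrite ler1n]. Qed.

Lemma ln_nat_le (k l : nat) : (0 < k)%N -> (k <= l)%N -> ln k%:R <= ln l%:R :> R.
Proof. by move=> k0 kl; rewrite ler_ln ?posrE ?ltr0n ?ler_nat//; exact: leq_trans kl. Qed.

(** The Poisson mean for which at least one point occurs with probability exactly theta / (theta + j
    + 1). *)
Definition hit_rate theta (j : nat) : R := ln (1 + theta / j.+1%:R).

Definition cum_rate theta (k : nat) : R := \sum_(j < k) hit_rate theta j.

(** Telescoping majorant of the second-order errors: it equals 1 / ((j + 1) (j + 2)), and its sums
    stay below 1. *)
Let tel (j : nat) : R := j.+1%:R^-1 - j.+2%:R^-1.

Let tel_sum k : \sum_(j < k) tel j = 1 - k.+1%:R^-1.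
Proof.
elim: k => [|k IH]; first by rewrite big_ord0 invr1 subrr.
by rewrite big_ord_recr /= IH /tel; ring.
Qed.

Let tel_sum_le1 k : \sum_(j < k) tel j <= 1.
Proof. by rewrite tel_sum gerBl invr_ge0. Qed.

Let telE j : tel j = (j.+1%:R * j.+2%:R)^-1.
Proof.
rewrite /tel -[j.+2%:R]natr1; have : 0 < j.+1%:R :> R by [].
by move: (j.+1%:R : R) => z z0; field; rewrite !gt_eqF ?addr_gt0.
Qed.

Section positive_rate.
Variable theta : R.
Hypothesis theta0 : 0 < theta.

Let a0 j : 0 < theta / j.+1%:R. Proof. by rewrite divr_gt0. Qed.

Lemma hit_rate_gt0 j : 0 < hit_rate theta j.
Proof. by rewrite ln_gt0// ltrDl. Qed.

Lemma hit_rate_le j : hit_rate theta j <= theta / j.+1%:R.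
Proof. by apply: le_ln1Dx; apply: lt_trans (a0 j); rewrite ltrN10. Qed.

Lemma expRN_hit_rate j : expR (- hit_rate theta j) = 1 - fprob theta j.
Proof.
have p0 : 0 < 1 + theta / j.+1%:R by rewrite addr_gt0.
rewrite expRN lnK ?posrE// /fprob; have : 0 < j.+1%:R :> R by [].
by move: (j.+1%:R : R) => z z0; field; rewrite !gt_eqF ?addr_gt0.
Qed.

Lemma fprob_ge0 j : 0 <= fprob theta j.
Proof. by rewrite /fprob divr_ge0 ?addr_ge0// ltW. Qed.

Lemma fprob_le_hit_rate j : fprob theta j <= hit_rate theta j.
Proof.
have p0 : 0 < 1 + theta / j.+1%:R by rewrite addr_gt0.
apply: le_trans (ln_lower_bound p0); rewrite le_eqVlt; apply/orP; left; apply/eqP.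
rewrite /fprob; have : 0 < j.+1%:R :> R by [].
by move: (j.+1%:R : R) => z z0; field; rewrite !gt_eqF ?addr_gt0.
Qed.

Let rate_gap j : theta / j.+1%:R - fprob theta j <= 2 * theta ^+ 2 * tel j.
Proof.
have j0 : 0 < j.+1%:R :> R by rewrite ltr0n.
have t0 : 0 < theta + j.+1%:R by rewrite addr_gt0.
have -> : theta / j.+1%:R - fprob theta j = theta ^+ 2 / (j.+1%:R * (theta + j.+1%:R)).
  by rewrite /fprob; move: (j.+1%:R : R) j0 t0 => z z0 tz; field; rewrite !gt_eqF.
have -> : 2 * theta ^+ 2 * tel j = theta ^+ 2 * (2 * tel j) by ring.
rewrite telE ler_wpM2l ?sqr_ge0// -[j.+2%:R]natr1.
move: (j.+1%:R : R) j0 t0 (ler1n R j.+1) => z z0 tz; rewrite /= => z1.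
rewrite ler_pdivlMr ?mulr_gt0// ?addr_gt0//.
rewrite mulrC ler_pdivrMr ?mulr_gt0//.
have : 0 < theta * z by rewrite mulr_gt0.
have : 0 <= z * (z - 1) by rewrite mulr_ge0 ?subr_ge0// ltW.
nra.
Qed.

(** Rate and probability differ to second order only. The bound controls the expected surplus of
    points over hits. *)
Lemma sum_hit_rate_sub_fprob k : \sum_(j < k) (hit_rate theta j - fprob theta j) <= 2 * theta ^+ 2.
Proof.
apply: (@le_trans _ _ (\sum_(j < k) 2 * theta ^+ 2 * tel j)).
  by apply: ler_sum => j _; apply: le_trans (rate_gap j); rewrite lerD2r hit_rate_le.
by rewrite -mulr_sumr ler_piMr// mulr_ge0// sqr_ge0.
Qed.

Lemma cum_rate_bounds k :
  theta * ln k.+1%:R - 2 * theta ^+ 2 <= cum_rate theta k <= theta * ln k.+1%:R + theta.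
Proof.
have lb j : ln j.+2%:R - ln j.+1%:R <= j.+1%:R^-1 :> R.
  rewrite -ln_div ?posrE ?ltr0n//; apply: le_trans (ln_upper_bound _) _; first by rewrite divr_gt0 ?ltr0n.
  by rewrite -[j.+2%:R]natr1 mulrDl divff ?pnatr_eq0// mul1r addrAC subrr add0r.
have ub j : j.+2%:R^-1 <= ln j.+2%:R - ln j.+1%:R :> R.
  rewrite -ln_div ?posrE ?ltr0n//; apply: le_trans (ln_lower_bound _); last by rewrite divr_gt0 ?ltr0n.
  rewrite invf_div le_eqVlt; apply/orP; left; apply/eqP.
  rewrite -[j.+2%:R]natr1; have : 0 < j.+1%:R :> R by [].
  by move: (j.+1%:R : R) => z z0; field; rewrite !gt_eqF ?addr_gt0.
have main : theta * ln k.+1%:R - 2 * theta ^+ 2 * \sum_(j < k) tel j <= cum_rate theta k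
    <= theta * ln k.+1%:R + theta * \sum_(j < k) tel j.
  elim: k => [|k /andP[IH1 IH2]].
    by rewrite /cum_rate !big_ord0 ln1 !mulr0 subr0 addr0 lexx.
  rewrite /cum_rate !big_ord_recr /= -/(cum_rate theta k).
  have h1 := hit_rate_le k; have h2 := fprob_le_hit_rate k; have h3 := rate_gap k.
  have := ler_wpM2l (ltW theta0) (lb k); have := ler_wpM2l (ltW theta0) (ub k).
  have e : theta * tel k = theta / k.+1%:R - theta / k.+2%:R by rewrite /tel mulrBr.
  rewrite !(mulrDr _ (\sum_(j < k) tel j)) e mulrBr; move: h1 h2 h3 IH1 IH2.
  move: (2 * theta ^+ 2 * tel k) (2 * theta ^+ 2 * \sum_(j < k) tel j) (theta * \sum_(j < k) tel j).
  move: (theta / k.+1%:R) (theta / k.+2%:R) (hit_rate _ _) (fprob _ _) (cum_rate _ _) (theta * ln k.+1%:R) (theta * ln k.+2%:R).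
  move=> *.
  by apply/andP; split; lra.
have := tel_sum_le1 k; move/(ler_wpM2l (ltW theta0)) => t1.
have := tel_sum_le1 k => /(ler_wpM2l (mulr_ge0 (ler0n R 2) (sqr_ge0 theta))) t2.
by move: main t1 t2; rewrite !mulr1 => /andP[m1 m2] t1 t2; apply/andP; split; lra.
Qed.

Lemma cum_rateS k : cum_rate theta k.+1 = cum_rate theta k + hit_rate theta k.
Proof. by rewrite /cum_rate big_ord_recr. Qed.

Lemma cum_rate_lt k l : (k < l)%N -> cum_rate theta k < cum_rate theta l.
Proof.
elim: l => // l IH; rewrite ltnS leq_eqVlt cum_rateS => /orP[/eqP->|/IH kl].
  by rewrite ltrDl hit_rate_gt0.
by apply: lt_trans kl _; rewrite ltrDl hit_rate_gt0.
Qed.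

Lemma cum_rate_le k l : (k <= l)%N -> cum_rate theta k <= cum_rate theta l.
Proof. by rewrite leq_eqVlt => /orP[/eqP->//|/cum_rate_lt/ltW]. Qed.

End positive_rate.
End hit_rate.

Section invol_bounds.
Context {R : realType}.

Definition invol_factor (k a : nat) : R :=
  \sum_(j < a./2.+1) (a ^_ (2 * j))%:R / (((2 * k)%:R) ^+ j * (j`!)%:R).

Lemma invol_factor_ge1 k a : 1 <= invol_factor k a.
Proof.
rewrite /invol_factor big_ord_recl /= muln0 ffactn0 expr0 fact0 mul1r divr1 lerDl.
by apply: sumr_ge0 => j _; rewrite divr_ge0// mulr_ge0// exprn_ge0.
Qed.

(** As (a)_(2j) = (a)_j (a - j)_j <= (a)_j a^j, term [j] is at most C(a, j) a^j, a term of the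
    expansion of (1 + a)^a. Being this crude is affordable because there are only O(log n)
    cycles. *)
Lemma invol_factor_le k a : (0 < k)%N -> invol_factor k a <= (1 + a%:R) ^+ a.
Proof.
move=> k0; apply: (@le_trans _ _ (\sum_(j < a./2.+1) ('C(a, j) * a ^ j)%:R)).
  apply: ler_sum => j _; rewrite ler_pdivrMr; last first.
    by rewrite mulr_gt0 ?exprn_gt0 ?ltr0n ?muln_gt0 ?fact_gt0.
  have p1 : 1 <= (2 * k)%:R ^+ j :> R by rewrite exprn_ege1// ler1n muln_gt0.
  apply: (@le_trans _ _ (('C(a, j) * a ^ j)%:R * (j`!)%:R)); last first.
    by rewrite ler_wpM2l// ler_peMl.
  rewrite -natrM ler_nat mulnAC bin_ffact mul2n -addnn.
  have le_exp (x y : nat) : (x ^_ y <= x ^ y)%N.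
    elim: y x => // y IH [|x]; first by rewrite ffact0n.
    rewrite ffactnS expnS; apply: leq_mul => //; apply: leq_trans (IH x) _.
    by case: (y) => // y'; rewrite leq_exp2r.
  have ffD (x y z : nat) : (x ^_ (y + z) = x ^_ y * (x - y) ^_ z)%N.
    by elim: y x => [|y IH] [|x]; rewrite ?subn0 ?ffactn0 ?mul1n ?ffactnS ?addSn ?ffactnS ?mul0n// IH mulnA.
  rewrite ffD leq_mul// (leq_trans (le_exp _ _))//.
  by case: (nat_of_ord j) => // i; rewrite leq_exp2r// leq_subr.
have -> : (1 + a%:R) ^+ a = \sum_(j < a.+1) ('C(a, j) * a ^ j)%:R :> R.
  by rewrite -(natrD R 1 a) -natrX Pascal natr_sum; apply: eq_bigr => i _; rewrite exp1n mul1n.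
have h : (a./2.+1 <= a.+1)%N by rewrite ltnS -divn2 leq_div.
rewrite -!(big_mkord xpredT (fun j => ('C(a, j) * a ^ j)%:R)) [leRHS](big_cat_nat (n := a./2.+1))//=.
by rewrite lerDl sumr_ge0.
Qed.

Lemma ln_prod_seq (I : eqType) (s : seq I) (f : I -> R) : (forall i, i \in s -> 0 < f i) ->
  0 < \prod_(i <- s) f i /\ ln (\prod_(i <- s) f i) = \sum_(i <- s) ln (f i).
Proof.
elim: s => [|i s IH] f0; first by rewrite !big_nil ln1.
have fi : 0 < f i by apply: f0; rewrite mem_head.
have [p0 e] : 0 < \prod_(i <- s) f i /\ ln (\prod_(i <- s) f i) = \sum_(i <- s) ln (f i).
  by apply: IH => j js; apply: f0; rewrite inE js orbT.
by rewrite !big_cons mulr_gt0// lnM ?posrE// e.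
Qed.

Lemma ln_invol_bounds (m : nat) (c : nat -> nat) :
  let S := \sum_(1 <= k < m.+1) (c k)%:R * ln k%:R : R in
  S <= ln (invol R m c) <= S + \sum_(1 <= k < m.+1) (c k)%:R * ln (1 + (c k)%:R).
Proof.
set S := \sum_(_ <= _ < _) _; rewrite /=.
have -> : ln (invol R m c) = S + \sum_(1 <= k < m.+1) ln (invol_factor k (c k)).
  rewrite /invol /Bm -big_split /= [LHS](ln_prod_seq _).2 => [|k]; last first.
    rewrite mem_index_iota => /andP[k0 _]; rewrite mulr_gt0 ?exprn_gt0 ?ltr0n//.
    exact: lt_le_trans (invol_factor_ge1 k (c k)).
  rewrite /S -big_split /=; apply: eq_big_nat => k /andP[k0 _].
  rewrite lnM ?posrE ?exprn_gt0 ?ltr0n//; last exact: lt_le_trans (invol_factor_ge1 k (c k)).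
  by rewrite lnXn ?ltr0n// mulr_natl.
rewrite lerDl lerD2l; apply/andP; split.
  by apply: sumr_ge0 => k _; apply: ln_ge0; exact: invol_factor_ge1.
rewrite !big_seq; apply: ler_sum => k; rewrite mem_index_iota => /andP[k0 _].
have c0 : 0 < 1 + (c k)%:R :> R by rewrite ltr_pwDl.
rewrite mulr_natl -lnXn// ler_ln ?posrE; last 2 first.
- exact: lt_le_trans (invol_factor_ge1 k (c k)).
- by rewrite exprn_gt0.
exact: invol_factor_le.
Qed.

End invol_bounds.

Section cycles_from_hits.
Context {R : realType}.
Variables (b : nat -> bool) (J : nat) (D : R).
Hypothesis D1 : 1 <= D.

Let L : R := ln J.+1%:R.

Let L0 : 0 <= L. Proof. exact: ln_ge0_nat. Qed.

Let D0 : 0 < D. Proof. exact: lt_le_trans D1. Qed.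

Lemma feller_run2P j : (feller_run b j).2 = j.+1 \/ exists2 i, (i < j)%N & b i /\ (feller_run b j).2 = (j - i)%N.
Proof.
elim: j => [|j IH]; first by left.
rewrite feller_run2S; case bj: (b j); first by right; exists j => //; rewrite subSnn.
by case: IH => [->|[i ij [bi ->]]]; [left|right; exists i; rewrite ?subSn// ltnW].
Qed.

(** Earlier hits so close to [j] that a cycle closed at [j] may be shorter than (j + 1) / D. *)
Definition short_gaps j : R := \sum_(i < j | ((j - i)%:R * D < j.+1%:R)) (b i)%:R.

Let short_gaps_ge0 j : 0 <= short_gaps j.
Proof. by apply: sumr_ge0. Qed.

(** A cycle closed at [j] has logarithmic length within ln D of ln (j + 1) unless a short gap
    occurs, which costs at most [L]. The third term concerns cycles of length at most [m] closed at
    j >= m, which without a short gap forces j + 1 <= m D. The last term is the cycle still open at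
    [J]. *)
Lemma feller_run_log_sum m :
  `|\sum_(1 <= k < m.+1) ((feller_run b J).1 k)%:R * ln k%:R
     - \sum_(j < J) (b j)%:R * ((j < m)%N%:R * ln j.+1%:R)| <=
  ln D * \sum_(j < J) (b j)%:R + L * \sum_(j < J) (b j)%:R * short_gaps j
   + L * \sum_(j < J) (b j)%:R * ((m <= j)%N && (j.+1%:R <= m%:R * D))%:R + L.
Proof.
rewrite sum_feller_run1 big_mkcond /=.
have -> : \sum_(j < J) (if b j && ((feller_run b j).2 <= m)%N then ln (feller_run b j).2%:R else 0) =
    \sum_(j < J) (b j)%:R * (((feller_run b j).2 <= m)%N%:R * ln (feller_run b j).2%:R) :> R.
  by apply: eq_bigr => j _; case: (b j); case: (_ <= m)%N; rewrite ?mul1r ?mul0r.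
rewrite addrAC; apply: le_trans (ler_normD _ _) _; apply: lerD; last first.
  case: ifP => _; last by rewrite normr0.
  by rewrite ger0_norm ?ln_ge0_nat// ln_nat_le ?feller_run2_gt0 ?feller_run2_le.
rewrite -sumrB !mulr_sumr -!big_split /=; apply: le_trans (ler_norm_sum _ _ _) _.
apply: ler_sum => j _; rewrite -mulrBr normrM ger0_norm//.
case bj: (b j); last by rewrite !mul0r !mulr0 !addr0.
rewrite !mul1r mulr1; have l0 := feller_run2_gt0 b j; have lj := feller_run2_le b j.
have llj : ln (feller_run b j).2%:R <= ln j.+1%:R :> R by exact: ln_nat_le.
have ljL : ln j.+1%:R <= L by apply: ln_nat_le => //; rewrite ltnS; exact: ltnW.
have lD0 : 0 <= ln D by exact: ln_ge0.
have ln0' := @ln_ge0_nat R (feller_run b j).2.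
have LG0 : 0 <= L * short_gaps j by exact: mulr_ge0.
have LW0 (B : bool) : 0 <= L * B%:R by exact: mulr_ge0.
have [long|short] := leP j.+1%:R ((feller_run b j).2%:R * D); last first.
  have [lj1|[i ij [bi li]]] := feller_run2P j.
    by exfalso; move: short; rewrite lj1 ltNge ler_peMr.
  have G1 : 1 <= short_gaps j.
    rewrite /short_gaps (bigD1 (Ordinal ij)) /=; last by rewrite -li.
    by rewrite bi lerDl sumr_ge0.
  have : L <= L * short_gaps j by rewrite ler_peMr.
  have := LW0 ((m <= j)%N && (j.+1%:R <= m%:R * D)).
  move: (_ * short_gaps j) (L * _) => p q p0 q0; rewrite ler_norml.
  by case: (_ <= m)%N; case: (j < m)%N; rewrite ?mul1r ?mul0r ?subr0 ?sub0r; apply/andP; split; lra.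
have [jm|mj] := ltnP j m.
  have lm : ((feller_run b j).2 <= m)%N by exact: leq_trans jm.
  rewrite lm !mul1r /= mulr0 addr0; apply: (@le_trans _ _ (ln D)); last by rewrite lerDl.
  rewrite distrC ger0_norm ?subr_ge0// lerBlDl -lnM ?posrE ?ltr0n// ler_ln ?posrE ?ltr0n//.
  by rewrite mulr_gt0// ltr0n.
rewrite mul0r subr0; have [lm|ml] := leqP (feller_run b j).2 m; last first.
  by rewrite mul0r normr0 !addr_ge0//; exact: LW0.
have -> : j.+1%:R <= m%:R * D by apply: le_trans long _; rewrite ler_wpM2r ?ler_nat// ltW.
rewrite mul1r /= mulr1 ger0_norm//; apply: le_trans llj (le_trans ljL _).
by rewrite lerDr addr_ge0.
Qed.

Lemma sum_feller_run_cycles m : (J < m)%N -> \sum_(1 <= k < m.+1) ((feller_run b J).1 k)%:R = 1 + \sum_(j < J) (b j)%:R :> R.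
Proof.
move=> Jm; under eq_bigr do rewrite -[_%:R]mulr1.
rewrite (sum_feller_run1 b J m (fun=> 1)) (leq_trans (feller_run2_le b J) Jm) addrC big_mkcond /=; congr (_ + _).
apply: eq_bigr => j _; rewrite (_ : (_ <= m)%N = true) ?andbT; last first.
  by apply: leq_trans (feller_run2_le b j) _; exact: leq_trans (ltn_ord j) (ltnW Jm).
by case: (b j).
Qed.

(** Each count is at most the number [K] of all cycles, which is one more than the number of
    hits. *)
Lemma ln_invol_feller_run m : (m <= J.+1)%N ->
  `|ln (invol R m (feller_run b J).1) - \sum_(1 <= k < m.+1) ((feller_run b J).1 k)%:R * ln k%:R|
  <= (1 + \sum_(j < J) (b j)%:R) * ln (1 + (1 + \sum_(j < J) (b j)%:R)).
Proof.
move=> mJ; set S := \sum_(1 <= k < m.+1) _; set K := 1 + \sum_(j < J) _; have /andP[lo hi] := @ln_invol_bounds R m (feller_run b J).1.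
rewrite ger0_norm ?subr_ge0// lerBlDl; apply: le_trans hi _; rewrite lerD2l.
set c := (feller_run b J).1.
have KE : K = \sum_(1 <= k < J.+2) (c k)%:R by rewrite sum_feller_run_cycles.
have sub : \sum_(1 <= k < m.+1) (c k)%:R <= K.
  rewrite KE [leRHS](big_cat_nat (n := m.+1))//= lerDl; exact: sumr_ge0.
have le1 k : (1 <= k < m.+1)%N -> (c k)%:R <= K.
  move=> km; apply: le_trans sub; rewrite (bigD1_seq k) ?mem_index_iota ?iota_uniq//= lerDl.
  exact: sumr_ge0.
have K0 : 0 < K by rewrite ltr_pwDl// sumr_ge0.
apply: (@le_trans _ _ (\sum_(1 <= k < m.+1) (c k)%:R * ln (1 + K))).
  rewrite !big_seq; apply: ler_sum => k; rewrite mem_index_iota => /le1 kK.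
  have p1 : 0 < 1 + (c k)%:R :> R by exact: ltr_pwDl.
  have p2 : 0 < 1 + K by exact: addr_gt0.
  by rewrite ler_wpM2l// ler_ln ?posrE// lerD2l.
by rewrite -mulr_suml ler_wpM2r// ln_ge0// lerDl ltW.
Qed.

End cycles_from_hits.

(** The clipped linear function [g] never decreases, rises by 1 at each counted multiple, and takes
    values between 0 and u / mu + 1. *)
Lemma count_multiples (R : realType) (mu a u : R) (N : nat) : 0 < mu -> 0 <= u ->
  \sum_(l < N) (a <= l%:R * mu <= a + u)%R%:R <= u / mu + 1.
Proof.
move=> mu0 u0.
pose g (l : nat) : R := Num.min (Num.max (l%:R * mu - a) 0) (u + mu) / mu.
have um : 0 <= u + mu by rewrite addr_ge0// ltW.
apply: (@le_trans _ _ (g N - g 0%N)); last first.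
  have -> : u / mu + 1 = (u + mu) / mu by rewrite mulrDl divff// gt_eqF.
  rewrite lerBlDr; apply: (@le_trans _ _ ((u + mu) / mu)).
    by rewrite /g ler_wpM2r ?invr_ge0 ?(ltW mu0)// ge_min lexx orbT.
  by rewrite lerDl /g divr_ge0 ?(ltW mu0)// le_min um le_max lexx orbT.
rewrite -telescope_sumr// big_mkord; apply: ler_sum => l _.
rewrite /g -mulrBl ler_pdivlMr// -[l.+1%:R]natr1 mulrDl mul1r.
move: (l%:R * mu) => x; case: (boolP (_ <= _ <= _)) => [/andP[h1 h2]|_].
  have -> : Num.max (x + mu - a) 0 = x + mu - a by apply/max_idPl; lra.
  have -> : Num.max (x - a) 0 = x - a by apply/max_idPl; lra.
  have -> : Num.min (x + mu - a) (u + mu) = x + mu - a by apply/min_idPl; lra.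
  have -> : Num.min (x - a) (u + mu) = x - a by apply/min_idPl; lra.
  by rewrite mul1r; lra.
have m1 : Num.max (x - a) 0 <= Num.max (x + mu - a) 0.
  by rewrite ge_max !le_max lexx orbT andbT; apply/orP; left; lra.
by rewrite mul0r subr_ge0 le_min !ge_min m1 lexx orbT.
Qed.

(** * Comparison of hits with points and of marks with cells *)

Section points_to_bins.
Context {R : realType}.
Variables (theta mu : R) (J N : nat) (nn : nat -> nat) (mk : nat -> nat -> nat).
Hypotheses (theta0 : 0 < theta) (mu0 : 0 < mu) (mkJ : forall l r, (mk l r < J)%N).
Hypothesis cell : forall l r, (l < N)%N ->
  l%:R * mu < cum_rate theta (mk l r).+1 /\ cum_rate theta (mk l r) < l.+1%:R * mu.

Let hits j := has (fun l => has (fun r => mk l r == j) (iota 0 (nn l))) (iota 0 N).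
Let K : R := \sum_(j < J) (hits j)%:R.
Let S : R := \sum_(l < N) (nn l)%:R.
(** Absorbs the distance between [cum_rate] and theta ln, together with one rate, which is at most
    theta. *)
Let c : R := 2 * theta + 2 * theta ^+ 2.

(** A value hit several times is counted once among the hits and with multiplicity among the points;
    the total surplus is S - K. *)
Lemma point_sum (f : nat -> R) (B : R) : (forall j, (j < J)%N -> 0 <= f j <= B) ->
  0 <= \sum_(l < N) \sum_(r < nn l) f (mk l r) - \sum_(j < J) (hits j)%:R * f j <= B * (S - K).
Proof.
move=> fB; pose M j := \sum_(l < N) \sum_(r < nn l) (mk l r == j)%:R : R.
have E (g : nat -> R) : \sum_(l < N) \sum_(r < nn l) g (mk l r) = \sum_(j < J) M j * g j.
  transitivity (\sum_(l < N) \sum_(r < nn l) \sum_(j < J) (mk l r == j)%:R * g j).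
    apply: eq_bigr => l _; apply: eq_bigr => r _.
    rewrite (bigD1 (Ordinal (mkJ l r)))//= eqxx mul1r big1 ?addr0// => j jl.
    rewrite (_ : (mk l r == j) = false) ?mul0r//.
    by apply: contraNF jl => /eqP e; apply/eqP/val_inj.
  under eq_bigr do rewrite exchange_big /=.
  rewrite exchange_big /=; apply: eq_bigr => j _; rewrite /M mulr_suml; apply: eq_bigr => l _.
  by rewrite mulr_suml.
have SE : S = \sum_(j < J) M j.
  rewrite /S (eq_bigr (fun l : 'I_N => \sum_(r < nn l) 1)); last by move=> l _; rewrite sumr_const card_ord.
  by rewrite (E (fun=> 1)); apply: eq_bigr => j _; rewrite mulr1.
have hM j : (hits j)%:R <= M j.
  case hj: (hits j); last by rewrite /M; apply: sumr_ge0 => l _; exact: sumr_ge0.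
  move/hasP: hj => [l]; rewrite mem_iota add0n /= => lN /hasP[r]; rewrite mem_iota add0n /= => rl mj.
  rewrite /M (bigD1 (Ordinal lN))//= (bigD1 (Ordinal rl))//= mj -addrA lerDl addr_ge0//.
    exact: sumr_ge0.
  by apply: sumr_ge0 => i _; exact: sumr_ge0.
rewrite E SE /K -!sumrB mulr_sumr; apply/andP; split.
  apply: sumr_ge0 => j _; rewrite -mulrBl mulr_ge0 ?subr_ge0//.
  by have /andP[] := fB j (ltn_ord j).
apply: ler_sum => j _; rewrite -mulrBl mulrC ler_wpM2r ?subr_ge0//.
by have /andP[] := fB j (ltn_ord j).
Qed.

Lemma cell_log l r : (l < N)%N -> `|theta * ln (mk l r).+1%:R - l%:R * mu| <= mu + c.
Proof.
move=> lN; have [c1 c2] := cell r lN; move: c1 c2; rewrite cum_rateS.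
have /andP[b1 b2] := cum_rate_bounds theta0 (mk l r).
have rl : hit_rate theta (mk l r) <= theta.
  apply: le_trans (hit_rate_le theta0 _) _; rewrite ler_pdivrMr ?ltr0n// ler_peMr ?ler1n//; exact: ltW.
have t2 : 0 <= theta ^+ 2 by exact: sqr_ge0.
rewrite -[l.+1%:R]natr1 mulrDl mul1r ler_norml /c.
move: theta0 mu0 b1 b2 rl t2; move: (theta * ln _) (l%:R * mu) (cum_rate _ _) (hit_rate _ _) (theta ^+ 2).
by move=> *; apply/andP; split; lra.
Qed.

Section counting.
Variable MX : R.
Hypotheses (nMX : forall l, (l < N)%N -> (nn l)%:R <= MX) (MX0 : 0 <= MX) (cmu : 2 * c <= mu).

Let c0 : 0 <= c. Proof. by rewrite /c addr_ge0// mulr_ge0 ?sqr_ge0// ltW. Qed.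

Let count_points a u (Q : nat -> nat -> bool) : 0 <= u ->
  (forall l r, (l < N)%N -> Q l r -> a <= l%:R * mu <= a + u) ->
  \sum_(l < N) \sum_(r < nn l) (Q l r)%:R <= (u / mu + 1) * MX.
Proof.
move=> u0 HQ; apply: (@le_trans _ _ (\sum_(l < N) (a <= l%:R * mu <= a + u)%R%:R * MX)).
  apply: ler_sum => l _; case: (boolP (a <= _ <= _)) => al.
    rewrite mul1r; apply: le_trans (nMX (ltn_ord l)).
    rewrite -[X in _ <= X%:R]card_ord -sumr_const; apply: ler_sum => r _.
    by case: (Q l r).
  rewrite mul0r big1// => r _; rewrite (_ : Q l r = false)//.
  by apply: contraNF al => /(HQ _ _ (ltn_ord l)).
by rewrite -mulr_suml ler_wpM2r// count_multiples.
Qed.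

Lemma window_count (m : nat) (D : R) : (0 < m)%N -> 1 <= D -> theta * ln D <= mu ->
  \sum_(j < J) (hits j)%:R * ((m <= j)%N && (j.+1%:R <= m%:R * D))%:R <= 5 * MX.
Proof.
move=> m0 D1 Dmu; pose W (j : nat) : bool := (m <= j)%N && (j.+1%:R <= m%:R * D).
have := @point_sum (fun j => (W j)%:R) 1.
have W01 j : ((0 : R) <= (W j)%:R) && ((W j)%:R <= (1 : R)) by case: (W j); rewrite /= ?lexx ler01.
move=> /(_ (fun j _ => W01 j)) /andP[+ _]; rewrite subr_ge0 => /le_trans; apply.
have D0 : 0 < D by exact: lt_le_trans D1.
have lD : 0 <= theta * ln D by rewrite mulr_ge0 ?ln_ge0// ltW.
pose a := theta * ln m%:R - mu - c.
pose u := theta * ln D + 2 * mu + 2 * c.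
apply: le_trans (count_points (a := a) (u := u) (Q := fun l r => W (mk l r)) _ _) _.
- by rewrite /u; move: lD c0 mu0; lra.
- move=> l r lN /andP[mj jmD]; have := cell_log r lN; rewrite ler_norml.
  have : theta * ln m%:R <= theta * ln (mk l r).+1%:R.
    by rewrite ler_wpM2l ?(ltW theta0)// ln_nat_le// leqW.
  have : theta * ln (mk l r).+1%:R <= theta * ln m%:R + theta * ln D.
    rewrite -mulrDr ler_wpM2l ?(ltW theta0)// -lnM ?posrE ?ltr0n// ler_ln ?posrE ?ltr0n//.
    by rewrite mulr_gt0// ltr0n.
  rewrite /a /u; move: (theta * ln _) (l%:R * mu) (theta * ln m%:R) (theta * ln D) => p q x y.
  by move=> ? ? /andP[? ?]; apply/andP; split; lra.
(* u / mu + 1 is at most 1 + 2 + 1 + 1, as theta ln D and 2 c are each at most mu. *)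
rewrite ler_wpM2r// -lerBrDr ler_pdivrMr// /u; move: Dmu cmu; lra.
Qed.

(** Every point of cell [l] gets the weight l mu / theta in place of the logarithm of its mark. The
    three errors are the repeated marks, the rounding inside a cell, and the points that the
    cut-offs [m] and [l'] classify differently; the latter fill few cells and number at most 4
    MX. *)
Lemma bin_log_sum (L t a : R) (m l' : nat) : (l' <= N)%N ->
  (forall j, (j < J)%N -> (j < m)%N = (theta * ln j.+1%:R <= a)) ->
  (forall l, (l < N)%N -> (l < l')%N = (l.+1%:R * mu <= t)) -> `|t - a| <= c ->
  (forall j, (j < J)%N -> ln j.+1%:R <= L) -> N%:R * mu <= theta * L + c ->
  `|\sum_(j < J) (hits j)%:R * ((j < m)%N%:R * ln j.+1%:R) - \sum_(l < l') (nn l)%:R * (l%:R * mu / theta)|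
   <= L * (S - K) + (mu + c) / theta * S + 4 * (L + c / theta) * MX.
Proof.
move=> lN' Hm Hl ta HL NL.
have H1 (j : nat) : (j < J)%N -> 0 <= (j < m)%N%:R * ln (j.+1%:R : R) <= L.
  move=> jJ; have := HL _ jJ; have := @ln_ge0_nat R j.+1.
  move=> p q; case: (j < m)%N; first by rewrite mul1r p.
  by rewrite mul0r lexx (le_trans p q).
have /andP[P1 P2] := point_sum H1.
set A := \sum_(j < J) _ in P1 P2 *; set B := \sum_(l < N) _ in P1 P2.
set E := \sum_(l < l') _.
have EE : E = \sum_(l < N) \sum_(r < nn l) (l < l')%N%:R * (l%:R * mu / theta).
  rewrite /E -!(big_mkord xpredT (fun l => (nn l)%:R * (l%:R * mu / theta))).
  rewrite -(big_mkord xpredT (fun l => \sum_(r < nn l) (l < l')%N%:R * (l%:R * mu / theta))).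
  rewrite [RHS](big_cat_nat (n := l'))//= [X in _ + X]big1_seq ?addr0; last first.
    move=> l; rewrite mem_index_iota => /andP[_ /andP[ll _]].
    by rewrite big1// => r _; rewrite ltnNge ll mul0r.
  by apply: eq_big_nat => l /andP[_ ->]; rewrite sumr_const card_ord mul1r mulr_natl.
pose Q l r := ((mk l r < m)%N != (l < l')%N).
have th := ltW theta0.
have BE : `|B - E| <= (mu + c) / theta * S + (L + c / theta) * \sum_(l < N) \sum_(r < nn l) (Q l r)%:R.
  rewrite EE /B -sumrB !mulr_sumr -big_split /=; apply: le_trans (ler_norm_sum _ _ _) _.
  apply: ler_sum => l _; rewrite -sumrB; apply: le_trans (ler_norm_sum _ _ _) _.
  rewrite mulr_sumr; apply: (@le_trans _ _ (\sum_(r < nn l) ((mu + c) / theta + (L + c / theta) * (Q l r)%:R))).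
    apply: ler_sum => r _.
    have cl : `|ln (mk l r).+1%:R - l%:R * mu / theta| <= (mu + c) / theta.
      rewrite ler_pdivlMr// -[X in _ * X](ger0_norm th) -normrM mulrBl mulfVK ?gt_eqF// mulrC.
      by rewrite cell_log.
    have cl0 : 0 <= (mu + c) / theta by rewrite divr_ge0// addr_ge0// ltW.
    have x0 := @ln_ge0_nat R (mk l r).+1; have xL := HL _ (mkJ l r).
    have y0 : 0 <= l%:R * mu / theta by rewrite divr_ge0// mulr_ge0// ltW.
    have yL : l%:R * mu / theta <= L + c / theta.
      rewrite ler_pdivrMr// mulrDl mulfVK ?gt_eqF// mulrC [L * _]mulrC; apply: le_trans NL.
      by rewrite mulrC ler_wpM2r ?(ltW mu0)// ler_nat ltnW.
    have cth : 0 <= c / theta by exact: divr_ge0.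
    rewrite /Q; move: cl cl0 x0 xL y0 yL cth.
    move: (ln _) (l%:R * mu / theta) ((mu + c) / theta) (c / theta) => x y z v.
    by case: (_ < m)%N; case: (_ < l')%N => /=; rewrite ?mul1r ?mul0r ?mulr1 ?mulr0 ?subr0 ?sub0r ?normrN ?addr0 ?normr0 => // *; rewrite ger0_norm//; lra.
  by rewrite big_split /= sumr_const card_ord -[_ *+ nn l]mulr_natr.
have QB : \sum_(l < N) \sum_(r < nn l) (Q l r)%:R <= 4 * MX.
  apply: le_trans (count_points (a := a - mu - c) (u := 2 * mu + 2 * c) _ _) _.
  - by rewrite !addr_ge0 ?mulr_ge0// ltW.
  - move=> l r lN; rewrite /Q (Hm _ (mkJ l r)) (Hl _ lN) => q.
    move: ta (cell_log r lN) q; rewrite !ler_norml -[l.+1%:R]natr1 mulrDl mul1r.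
    move: (theta * _) (l%:R * mu) => x y /andP[? ?] /andP[? ?].
    case: (leP x a) => xa; case: (leP (y + mu) t) => yt //= _.
      by apply/andP; split; move: mu0 c0; lra.
    by apply/andP; split; move: mu0 c0; lra.
  rewrite ler_wpM2r// -lerBrDr ler_pdivrMr//; move: cmu; lra.
have Lc : 0 <= L + c / theta.
  rewrite -(pmulr_rge0 _ theta0) mulrDr mulrCA divff ?gt_eqF// mulr1.
  by apply: le_trans NL; rewrite mulr_ge0// ltW.
have := ler_wpM2l Lc QB; have := ler_normD (A - B) (B - E).
rewrite (_ : A - B + (B - E) = A - E); last by ring.
rewrite [`|A - B|]distrC (ger0_norm P1) mulrA [_ * 4]mulrC.
move: BE P2; move: (`|A - E|) (`|B - E|) (B - A) (L * (S - K)) ((mu + c) / theta * S) (4 * _ * MX) ((L + c / theta) * _).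
move=> *; lra.
Qed.

End counting.
End points_to_bins.

(** * Gaussian approximation of the binned sum *)

Section gaussian_bins.
Context {R : realType}.

Lemma abel_bound (a : nat -> R) (B : R) k : (forall i, (i <= k)%N -> `|\sum_(j < i) a j| <= B) ->
  `|\sum_(l < k) l%:R * a l| <= 2 * k%:R * B.
Proof.
move=> aB; have E i : \sum_(l < i) l%:R * a l = i%:R * \sum_(j < i) a j - \sum_(l < i) \sum_(j < l.+1) a j.
  elim: i => [|i IH]; first by rewrite !big_ord0 mul0r subr0.
  rewrite big_ord_recr /= IH [X in _ = _ - X]big_ord_recr /= [\sum_(j < i.+1) a j]big_ord_recr /=.
  by rewrite -[i.+1%:R]natr1; ring.
rewrite E; apply: le_trans (ler_normB _ _) _; rewrite -mulrA mulr2n mulrDl mul1r.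
apply: lerD; first by rewrite normrM ger0_norm// ler_wpM2l// aB.
apply: le_trans (ler_norm_sum _ _ _) _.
rewrite -[X in X%:R]card_ord mulr_natl -sumr_const; apply: ler_sum => l _; exact: aB.
Qed.

Lemma sum_nat_ord k : \sum_(l < k) l%:R = k%:R * (k%:R - 1) / 2 :> R.
Proof.
elim: k => [|k IH]; first by rewrite big_ord0 mul0r mul0r.
by rewrite big_ord_recr /= IH -[k.+1%:R]natr1; field.
Qed.

Variables (theta mu L c : R) (N : nat).
Hypotheses (theta0 : 0 < theta) (mu0 : 0 < mu) (L0 : 0 <= L) (N0 : (0 < N)%N).
Hypotheses (NL : `|N%:R * mu - theta * L| <= c) (cmu : 2 * c <= mu).

Let c0 : 0 <= c. Proof. exact: le_trans (normr_ge0 _) NL. Qed.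

Let NR : 0 < N%:R :> R. Proof. by rewrite ltr0n. Qed.

Lemma drift_bound (t : R) k : 0 <= t <= 1 -> k%:R <= t * N%:R < k.+1%:R ->
  `|\sum_(l < k) mu * (l%:R * mu / theta) - theta * t ^+ 2 / 2 * L ^+ 2|
   <= (3 * mu * (N%:R * mu) + c * (N%:R * mu + theta * L)) / (2 * theta).
Proof.
move=> /andP[t0 t1] /andP[k1 k2].
have -> : \sum_(l < k) mu * (l%:R * mu / theta) - theta * t ^+ 2 / 2 * L ^+ 2 =
    ((k%:R * mu) * (k%:R * mu - mu) - (t * (theta * L)) ^+ 2) / (2 * theta).
  have -> : \sum_(l < k) mu * (l%:R * mu / theta) = mu ^+ 2 / theta * \sum_(l < k) l%:R.
    by rewrite mulr_sumr; apply: eq_bigr => l _; ring.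
  by rewrite sum_nat_ord; field; rewrite gt_eqF.
rewrite normrM normfV (ger0_norm (_ : 0 <= 2 * theta)); last by rewrite mulr_ge0// ltW.
rewrite ler_wpM2r ?invr_ge0 ?mulr_ge0 ?(ltW theta0)//.
have NL' := NL; set U := N%:R * mu in NL' *; set V := theta * L in NL' *.
have U0 : 0 <= U by rewrite mulr_ge0// ltW.
have V0 : 0 <= V by rewrite mulr_ge0// ltW.
have a1 : k%:R * mu <= t * U by rewrite /U mulrA ler_wpM2r// ltW.
have a2 : t * U <= k%:R * mu + mu.
  by rewrite -[X in _ + X]mul1r -mulrDl natr1 /U mulrA ler_wpM2r// ltW.
have a0 : 0 <= k%:R * mu by rewrite mulr_ge0// ltW.
have tU : t * U <= U by rewrite ler_piMl.
have h1 : `|(k%:R * mu) * (k%:R * mu - mu) - (t * U) ^+ 2| <= 3 * mu * U.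
  move: a1 a2 a0 tU mu0 c0; clear -t0 t1; move: (k%:R * mu) (t * U) => a T a1 a2 a0 tU mu0' c0'.
  have p1 : a * a <= T * T by apply: ler_pM.
  have p2 : (T - a) * (T + a) <= mu * (2 * U) by apply: ler_pM; lra.
  have p3 : a * mu <= U * mu by rewrite ler_wpM2r; lra.
  have p4 : 0 <= a * mu by rewrite mulr_ge0; lra.
  rewrite ler_norml expr2; apply/andP; split; move: p1 p2 p3 p4; nra.
have h2 : `|(t * U) ^+ 2 - (t * V) ^+ 2| <= c * (U + V).
  have -> : (t * U) ^+ 2 - (t * V) ^+ 2 = t ^+ 2 * ((U - V) * (U + V)) by ring.
  rewrite normrM ger0_norm ?sqr_ge0// normrM (ger0_norm (addr_ge0 U0 V0)) mulrA; apply: ler_wpM2r; first exact: addr_ge0.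
  by apply: le_trans NL'; rewrite ler_piMl// exprn_ile1.
have := ler_normD ((k%:R * mu) * (k%:R * mu - mu) - (t * U) ^+ 2) ((t * U) ^+ 2 - (t * V) ^+ 2).
rewrite addrA subrK => /le_trans; apply; exact: lerD.
Qed.

Let s l : R := Num.sqrt (l.+1%:R ^+ 3 / N%:R ^+ 3 - l%:R ^+ 3 / N%:R ^+ 3).

(** Since (l + 1)^3 - l^3 = 3 (l^2 + l + 1/3), the Brownian coefficient is r a^3 q with a^2 = L / N
    and l <= q <= l + 1, while the given one is r b^3 l with b^2 = mu / theta. Rounding costs a^3,
    and since a^2 and b^2 differ by at most b^2 / (2 N), the factor l <= N does no harm. *)
Lemma coef_bound l : (l < N)%N ->
  `|Num.sqrt mu * (l%:R * mu / theta) - Num.sqrt (theta / 3 * L ^+ 3) * s l|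
    <= 6 * mu * Num.sqrt mu / theta.
Proof.
move=> lN; pose A : R := L / N%:R; pose B := mu / theta.
have A0 : 0 <= A by rewrite divr_ge0// ltW.
have B0 : 0 <= B by apply: divr_ge0; exact: ltW.
pose a := Num.sqrt A; pose b := Num.sqrt B; pose q := Num.sqrt (l%:R ^+ 2 + l%:R + 3^-1) : R.
have a0 : 0 <= a by exact: sqrtr_ge0.
have b0 : 0 <= b by exact: sqrtr_ge0.
have aa : a ^+ 2 = A by exact: sqr_sqrtr.
have bb : b ^+ 2 = B by exact: sqr_sqrtr.
have th0 := ltW theta0.
pose r := Num.sqrt theta.
have r0 : 0 < r by rewrite sqrtr_gt0.
have rr : r ^+ 2 = theta by exact: sqr_sqrtr.
have smu : Num.sqrt mu = r * b by rewrite -sqrtrM// /B mulrC divfK// gt_eqF.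
have Q0 : 0 <= l%:R ^+ 2 + l%:R + 3^-1 :> R by rewrite !addr_ge0// sqr_ge0.
have q0 : 0 <= q by exact: sqrtr_ge0.
have qq : q ^+ 2 = l%:R ^+ 2 + l%:R + 3^-1 by exact: sqr_sqrtr.
have lR : 0 <= l%:R :> R by [].
have q1 : l%:R <= q.
  by rewrite -(ler_pXn2r (n := 2))// ?nnegrE// qq -addrA lerDl addr_ge0.
have q2 : q <= l%:R + 1.
  rewrite -(ler_pXn2r (n := 2))// ?nnegrE ?addr_ge0// qq; move: (l%:R : R) lR => x x0; nra.
have sE : Num.sqrt (theta / 3 * L ^+ 3) * s l = r * (a ^+ 3 * q).
  have -> : r * (a ^+ 3 * q) = Num.sqrt ((r * (a ^+ 3 * q)) ^+ 2).
    by rewrite sqrtr_sqr ger0_norm// !mulr_ge0 ?exprn_ge0// ltW.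
  rewrite /s -sqrtrM; last by rewrite mulr_ge0 ?divr_ge0 ?exprn_ge0.
  congr Num.sqrt.
  have -> : (r * (a ^+ 3 * q)) ^+ 2 = r ^+ 2 * ((a ^+ 2) ^+ 3 * q ^+ 2) by ring.
  rewrite rr aa qq /A -[l.+1%:R]natr1; field; exact: lt0r_neq0.
have muE : mu = r ^+ 2 * b ^+ 2 by rewrite rr bb /B mulrC divfK// gt_eqF.
rewrite sE smu.
have -> : r * b * (l%:R * mu / theta) - r * (a ^+ 3 * q) = r * (b ^+ 3 * l%:R - a ^+ 3 * q).
  by rewrite muE -rr; field; rewrite gt_eqF.
have -> : 6 * mu * (r * b) / theta = r * (6 * b ^+ 3) by rewrite muE -rr; field; rewrite gt_eqF.
rewrite normrM ger0_norm ?(ltW r0)// ler_wpM2l ?(ltW r0)//.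
have AB : N%:R * `|b ^+ 2 - a ^+ 2| <= b ^+ 2 / 2.
  rewrite -[X in X * _](ger0_norm (ltW NR)) -normrM aa bb /A /B mulrBr.
  rewrite -[_ <= _](ler_pM2r theta0) -[X in _ * X <= _](ger0_norm th0) -normrM mulrBl.
  rewrite mulrA (divfK (lt0r_neq0 theta0)) [N%:R * (L / _)]mulrCA (divff (lt0r_neq0 NR)) mulr1 [L * _]mulrC.
  rewrite mulrAC (divfK (lt0r_neq0 theta0)) ler_pdivlMr//.
  by apply: le_trans cmu; rewrite [leRHS]mulrC ler_wpM2r.
have N1 : 1 <= N%:R :> R by rewrite ler1n.
have lN' : l%:R <= N%:R :> R by rewrite ler_nat ltnW.
have a2b : a ^+ 2 <= 2 * b ^+ 2.
  have : `|b ^+ 2 - a ^+ 2| <= b ^+ 2 / 2 by apply: le_trans AB; rewrite ler_peMl.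
  rewrite ler_norml => /andP[+ _]; have := sqr_ge0 b; lra.
have ab : a <= 2 * b.
  rewrite -(ler_pXn2r (n := 2))// ?nnegrE ?mulr_ge0// exprMn; have := sqr_ge0 b; lra.
have D : `|b ^+ 3 - a ^+ 3| <= `|b ^+ 2 - a ^+ 2| * (a + b).
  have [ba|ab'] := leP a b.
    have e1 : a ^+ 3 <= b ^+ 3 by rewrite lerXn2r.
    have e2 : a ^+ 2 <= b ^+ 2 by rewrite lerXn2r.
    rewrite !ger0_norm ?subr_ge0//.
    have : 0 <= a * b * (b - a) by rewrite !mulr_ge0// subr_ge0.
    nra.
  have e1 : b ^+ 3 <= a ^+ 3 by rewrite lerXn2r// ltW.
  have e2 : b ^+ 2 <= a ^+ 2 by rewrite lerXn2r// ltW.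
  rewrite ![`|b ^+ _ - _|]distrC !ger0_norm ?subr_ge0//.
  have : 0 <= a * b * (a - b) by rewrite !mulr_ge0// subr_ge0 ltW.
  nra.
have -> : b ^+ 3 * l%:R - a ^+ 3 * q = (b ^+ 3 - a ^+ 3) * l%:R - a ^+ 3 * (q - l%:R) by ring.
apply: le_trans (ler_normB _ _) _; rewrite (normrM _ l%:R) (normrM (a ^+ 3)) (ger0_norm lR) (ger0_norm (exprn_ge0 3 a0)).
have h1 : `|b ^+ 3 - a ^+ 3| * l%:R <= b ^+ 2 / 2 * (3 * b).
  apply: (@le_trans _ _ (N%:R * `|b ^+ 2 - a ^+ 2| * (a + b))).
    rewrite mulrC -mulrA; apply: ler_pM => //.
  apply: ler_pM => //; [exact: addr_ge0|lra].
have h2 : a ^+ 3 * `|q - l%:R| <= 2 * b ^+ 2 * (2 * b).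
  apply: (@le_trans _ _ (a ^+ 3)).
    rewrite ler_piMr ?exprn_ge0// ger0_norm ?subr_ge0// lerBlDl addrC //; lra.
  by rewrite exprSr ler_pM// ?sqr_ge0.
have : 0 <= b ^+ 3 by exact: exprn_ge0.
move: h1 h2; move: (`|b ^+ 3 - a ^+ 3| * l%:R) (a ^+ 3 * `|q - l%:R|) => u v; rewrite (exprSr b 2).
move: (b ^+ 2) => z *; lra.
Qed.

(** Three errors: the deterministic drift, the deviations of the counts treated by Abel summation,
    and the mismatch of the Gaussian coefficients. *)
Lemma gaussian_bins (nn x : nat -> R) (t ME : R) k : 0 <= t <= 1 -> k%:R <= t * N%:R < k.+1%:R ->
  (forall i, (i <= N)%N -> `|\sum_(j < i) (nn j - mu - Num.sqrt mu * x j)| <= ME) ->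
  `|\sum_(l < k) nn l * (l%:R * mu / theta) - theta * t ^+ 2 / 2 * L ^+ 2
     - Num.sqrt (theta / 3 * L ^+ 3) * \sum_(l < k) s l * x l|
   <= (3 * mu * (N%:R * mu) + c * (N%:R * mu + theta * L)) / (2 * theta)
      + 2 * (N%:R * mu) / theta * ME + 6 * mu * Num.sqrt mu / theta * \sum_(l < N) `|x l|.
Proof.
move=> t01 kt dev.
have kN : (k <= N)%N.
  rewrite -(ler_nat R); case/andP: kt => /le_trans + _; apply.
  by case/andP: t01 => _ t1; rewrite ler_piMl.
have th0 := ltW theta0.
have -> : \sum_(l < k) nn l * (l%:R * mu / theta) - theta * t ^+ 2 / 2 * L ^+ 2
     - Num.sqrt (theta / 3 * L ^+ 3) * \sum_(l < k) s l * x l =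
  (\sum_(l < k) mu * (l%:R * mu / theta) - theta * t ^+ 2 / 2 * L ^+ 2)
  + mu / theta * \sum_(l < k) l%:R * (nn l - mu - Num.sqrt mu * x l)
  + \sum_(l < k) (Num.sqrt mu * (l%:R * mu / theta) - Num.sqrt (theta / 3 * L ^+ 3) * s l) * x l.
  have -> : \sum_(l < k) nn l * (l%:R * mu / theta) = \sum_(l < k) mu * (l%:R * mu / theta)
    + mu / theta * \sum_(l < k) l%:R * (nn l - mu - Num.sqrt mu * x l)
    + \sum_(l < k) Num.sqrt mu * (l%:R * mu / theta) * x l.
    rewrite mulr_sumr -!big_split /=; apply: eq_bigr => l _; ring.
  rewrite [Num.sqrt (theta / 3 * L ^+ 3) * _]mulr_sumr.
  have -> : \sum_(l < k) (Num.sqrt mu * (l%:R * mu / theta) - Num.sqrt (theta / 3 * L ^+ 3) * s l) * x l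
    = \sum_(l < k) Num.sqrt mu * (l%:R * mu / theta) * x l - \sum_(l < k) Num.sqrt (theta / 3 * L ^+ 3) * (s l * x l).
    by rewrite -sumrB; apply: eq_bigr => l _; ring.
  ring.
apply: le_trans (ler_normD _ _) _; apply: lerD.
  apply: le_trans (ler_normD _ _) _; apply: lerD; first exact: drift_bound.
  rewrite normrM ger0_norm; last by apply: divr_ge0; exact: ltW.
  apply: (@le_trans _ _ (mu / theta * (2 * k%:R * ME))).
    rewrite ler_wpM2l ?divr_ge0 ?(ltW mu0)//.
    apply: (abel_bound (a := fun l => nn l - mu - Num.sqrt mu * x l)) => i ik.
    by apply: dev; exact: leq_trans kN.
  have M0 : 0 <= ME by exact: le_trans (normr_ge0 _) (dev 0%N isT).
  have -> : 2 * (N%:R * mu) / theta * ME = mu / theta * (2 * N%:R * ME) by ring.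
  rewrite ler_wpM2l ?divr_ge0 ?(ltW mu0)// ler_wpM2r// ler_wpM2l// ler_nat//.
apply: le_trans (ler_norm_sum _ _ _) _; rewrite mulr_sumr.
apply: (@le_trans _ _ (\sum_(l < k) 6 * mu * Num.sqrt mu / theta * `|x l|)).
  apply: ler_sum => l _; rewrite normrM ler_wpM2r// coef_bound//; exact: leq_trans kN.
rewrite -!(big_mkord xpredT (fun l => 6 * mu * Num.sqrt mu / theta * `|x l|)).
rewrite [leRHS](big_cat_nat (n := k))//= lerDl; apply: sumr_ge0 => l _.
by rewrite mulr_ge0// divr_ge0// mulr_ge0 ?sqrtr_ge0// mulr_ge0// ltW.
Qed.

End gaussian_bins.

(** * Moments *)

Section cell_mass.
Context {R : realType}.
Variables (theta mu : R) (N J : nat).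
Hypotheses (theta0 : 0 < theta) (mu0 : 0 < mu) (J0 : (0 < J)%N).
Hypothesis total : cum_rate theta J = N%:R * mu.

(* The part of [0, x] in the cell [l mu, (l+1) mu]: a mark in cell [l] equals [j] with
   probability proportional to its overlap with the interval of length [hit_rate j]. *)
Definition cell_part (l : nat) (x : R) : R := Num.min (Num.max (x - l%:R * mu) 0) mu.

Definition cell_mass (l j : nat) : R :=
  if (l < N)%N then
    if (j < J)%N then (cell_part l (cum_rate theta j.+1) - cell_part l (cum_rate theta j)) / mu else 0
  (* Beyond the [N] cells in use a point mass serves as default, so that every row is a probability
     mass function. *)
  else (j == 0)%:R.

Let cell_part_le l x y : x <= y -> cell_part l x <= cell_part l y.
Proof.
move=> xy; rewrite /cell_part le_min !ge_min lexx orbT andbT; apply/orP; left.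
by rewrite ge_max !le_max lexx orbT andbT lerD2r xy.
Qed.

Lemma cell_mass_ge0 l j : 0 <= cell_mass l j.
Proof.
rewrite /cell_mass; case: ifP => // _; case: ifP => // _.
by rewrite divr_ge0 ?(ltW mu0)// subr_ge0 cell_part_le// cum_rate_le.
Qed.

Lemma cell_mass_out l j : (J <= j)%N -> cell_mass l j = 0.
Proof.
move=> Jj; have jJ : (j < J)%N = false by rewrite ltnNge Jj.
rewrite /cell_mass jJ; case: ifP => // _.
by case: j Jj {jJ} => //; rewrite leqNgt J0.
Qed.

Lemma cum_rate0 : cum_rate theta 0 = 0. Proof. by rewrite /cum_rate big_ord0. Qed.

Lemma cum_rate_ge0 k : 0 <= cum_rate theta k.
Proof. by rewrite -cum_rate0 cum_rate_le. Qed.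

Lemma cell_mass_sum l : \sum_(j < J) cell_mass l j = 1.
Proof.
rewrite /cell_mass; case: (boolP (l < N)%N) => lN; last first.
  rewrite (bigD1 (Ordinal J0))//= big1 ?addr0// => i.
  by rewrite -(inj_eq val_inj) /= => /negbTE ->.
rewrite (eq_bigr (fun j : 'I_J => (cell_part l (cum_rate theta j.+1) - cell_part l (cum_rate theta j)) / mu)); last first.
  by move=> j _; rewrite ltn_ord.
rewrite -mulr_suml -(big_mkord xpredT (fun j => cell_part l (cum_rate theta j.+1) - cell_part l (cum_rate theta j))).
rewrite telescope_sumr// total cum_rate0 /cell_part.
have -> : Num.max (N%:R * mu - l%:R * mu) 0 = N%:R * mu - l%:R * mu.
  by apply/max_idPl; rewrite subr_ge0 ler_wpM2r ?(ltW mu0)// ler_nat ltnW.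
have -> : Num.min (N%:R * mu - l%:R * mu) mu = mu.
  apply/min_idPr; rewrite lerBrDl -[X in _ + X]mul1r -mulrDl natr1 ler_wpM2r ?(ltW mu0)// ler_nat//.
have -> : Num.max (0 - l%:R * mu) 0 = 0.
  by apply/max_idPr; rewrite sub0r oppr_le0 mulr_ge0// ltW.
have -> : Num.min 0 mu = 0 by apply/min_idPl; exact: ltW.
by rewrite subr0 divff// gt_eqF.
Qed.

Let cell_part_sum x k : 0 <= x -> \sum_(l < k) cell_part l x = Num.min x (k%:R * mu).
Proof.
move=> x0; elim: k => [|k IH]; first by rewrite big_ord0 mul0r; apply/esym/min_idPr.
rewrite big_ord_recr /= IH /cell_part -[k.+1%:R]natr1 mulrDl mul1r.
move: (k%:R * mu) => z; have [xz|zx] := leP x z.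
  have -> : Num.max (x - z) 0 = 0 by apply/max_idPr; rewrite subr_le0.
  have -> : Num.min 0 mu = 0 by apply/min_idPl; exact: ltW.
  by rewrite addr0; apply/esym/min_idPl; rewrite (le_trans xz)// lerDl ltW.
have -> : Num.max (x - z) 0 = x - z by apply/max_idPl; rewrite subr_ge0 ltW.
by rewrite addr_minr addrCA subrr addr0.
Qed.

(** The cells tile the interval from 0 to the total rate, so their overlaps with the interval of [j]
    add up to its length. *)
Lemma cell_mass_rate j : (j < J)%N -> \sum_(l < N) mu * cell_mass l j = hit_rate theta j.
Proof.
move=> jJ; rewrite (eq_bigr (fun l : 'I_N => cell_part l (cum_rate theta j.+1) - cell_part l (cum_rate theta j))); last first.
  by move=> l _; rewrite /cell_mass ltn_ord jJ mulrC divfK// gt_eqF.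
rewrite sumrB !cell_part_sum ?cum_rate_ge0// -total.
rewrite (min_idPl (cum_rate_le theta0 jJ)) (min_idPl (cum_rate_le theta0 (ltnW jJ))).
by rewrite cum_rateS addrAC subrr add0r.
Qed.

Lemma cell_mass_gt0 l j : (l < N)%N -> 0 < cell_mass l j ->
  l%:R * mu < cum_rate theta j.+1 /\ cum_rate theta j < l.+1%:R * mu.
Proof.
move=> lN; rewrite /cell_mass lN; case: ifP => // _; last by rewrite ltxx.
rewrite pmulr_lgt0 ?invr_gt0// subr_gt0 => lt.
split; rewrite ltNge; apply/negP => h.
  move: lt; rewrite ltNge => /negP; apply.
  rewrite {1}/cell_part (_ : Num.max _ 0 = 0); last by apply/max_idPr; rewrite subr_le0.
  by rewrite (min_idPl (ltW mu0)) /cell_part le_min le_max lexx orbT ltW.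
move: lt; rewrite ltNge => /negP; apply.
have h2 : mu <= cum_rate theta j - l%:R * mu.
  by rewrite lerBrDl -[X in _ + X]mul1r -mulrDl natr1.
rewrite {2}/cell_part (_ : Num.max _ 0 = cum_rate theta j - l%:R * mu); last first.
  by apply/max_idPl; apply: le_trans h2; exact: ltW.
by rewrite (min_idPr h2) /cell_part ge_min lexx orbT.
Qed.

End cell_mass.

Lemma count_lt (R : realType) (x : R) k : 0 <= x -> \sum_(d < k | d.+1%:R < x) 1 <= x.
Proof.
move=> x0; suff : \sum_(d < k | d.+1%:R < x) 1 <= x /\ \sum_(d < k | d.+1%:R < x) 1 <= k%:R :> R by case.
elim: k => [|k [IH1 IH2]]; first by rewrite !big_ord0.
rewrite big_mkcond big_ord_recr /= -big_mkcond /=; case: ifP => [kx|_].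
  split; last by rewrite -[k.+1%:R]natr1 lerD2r.
  by apply: le_trans (ltW kx); rewrite -[k.+1%:R]natr1 lerD2r.
by rewrite addr0; split => //; apply: le_trans IH2 _; rewrite ler_nat.
Qed.

(** With D >= 2 a short gap forces i + 1 >= (j + 1) / 2, so each probability is at most 2 theta / (j
    + 1); at most (j + 1) / D indices qualify. *)
Lemma short_gap_rate (R : realType) (theta D : R) (j : nat) : 0 < theta -> 2 <= D ->
  \sum_(i < j | (j - i)%:R * D < j.+1%:R) fprob theta i <= 2 * theta / D.
Proof.
move=> th D2; have D0 : 0 < D by apply: lt_le_trans D2.
have j0 : 0 < j.+1%:R :> R by [].
apply: (@le_trans _ _ (\sum_(i < j | (j - i)%:R * D < j.+1%:R) 2 * theta / j.+1%:R)).
  apply: ler_sum => i ij; apply: le_trans (fprob_le_hit_rate th i) _; apply: le_trans (hit_rate_le th i) _.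
  rewrite ler_pdivrMr// mulrAC ler_pdivlMr// [2 * theta]mulrC -mulrA ler_wpM2l ?(ltW th)//.
  move: ij; rewrite natrB ?(ltnW (ltn_ord i))// -[i.+1%:R]natr1 -[j.+1%:R]natr1.
  have ij : i%:R <= j%:R :> R by rewrite ler_nat ltnW.
  move=> h; have : (j%:R - i%:R) * 2 <= (j%:R - i%:R) * D by rewrite ler_wpM2l// subr_ge0.
  lra.
rewrite -[X in X <= _]mul1r -[2 * theta / j.+1%:R]mulr1 -mulr_sumr mul1r.
have cnt : \sum_(i < j | (j - i)%:R * D < j.+1%:R) 1 <= j.+1%:R / D.
  rewrite (reindex_inj rev_ord_inj) /=.
  apply: le_trans (count_lt j _); last by rewrite divr_ge0// ltW.
  rewrite le_eqVlt; apply/orP; left; apply/eqP; apply: eq_bigl => d.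
  by rewrite subKn// ltr_pdivlMr.
apply: le_trans (ler_wpM2l _ cnt) _; first by rewrite divr_ge0// mulr_ge0// ltW.
by rewrite mulrA divfK// gt_eqF.
Qed.

Lemma N01_abs_le (R : realType) : (\int[@N01 R]_z (`|z|)%:E <= 2%:E)%E.
Proof.
have mexp : measurable_fun setT (fun z : measurableTypeR R => expR (z ^+ 2 / 4) : measurableTypeR R).
  by apply: measurableT_comp => //; apply: measurable_funM => //; apply: measurable_funX.
apply: (@le_trans _ _ (\int[@N01 R]_z (expR (z ^+ 2 / 4))%:E)%E).
  apply: (@integral_EFin_le _ (measurableTypeR R) R (@N01 R) (fun z => `|z|) (fun z => expR (z ^+ 2 / 4))) => //.
  - by apply: measurableT_comp => //; exact: measurable_id.
  - move=> z; apply: le_trans (expR_ge1Dx _); rewrite -(real_normK (num_real z)).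
    have := sqr_ge0 (`|z| - 2); nra.
rewrite N01_exp_moment lee_fin -[leRHS]ger0_norm// -sqrtr_sqr ler_sqrt// expr2; lra.
Qed.

Section expectation_bound.
Context d (T : measurableType d) (R : realType) (P : probability T R).
Local Notation RR := (measurableTypeR R).
Implicit Types (f g : T -> RR) (e c : R).

(** Nonnegativity and measurability travel with the bound on the mean, so that error terms can be
    assembled from sums and multiples. *)
Definition ebound f e :=
  [/\ forall w, 0 <= f w, measurable_fun setT f & (\int[P]_w (f w)%:E <= e%:E)%E].

Lemma ebound_cst c : 0 <= c -> ebound (fun=> c) c.
Proof.
move=> c0; split => //.
by rewrite integral_cst// [X in (_ * X)%E]probability_setT mule1.
Qed.

Lemma ebound_add f g e e' : ebound f e -> ebound g e' -> ebound (fun w => f w + g w) (e + e').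
Proof.
move=> [f0 mf ef] [g0 mg eg]; split; [by move=> w; exact: addr_ge0|exact: measurable_funD|].
by rewrite (integral_EFinD P f0 mf g0 mg) EFinD; exact: leeD.
Qed.

Lemma ebound_scale c f e : 0 <= c -> ebound f e -> ebound (fun w => c * f w) (c * e).
Proof.
move=> c0 [f0 mf ef]; split; [by move=> w; exact: mulr_ge0|exact: measurable_funM|].
by rewrite (integral_EFinZ P c0 f0 mf) EFinM; apply: lee_wpmul2l; rewrite ?lee_fin.
Qed.

Lemma ebound_sum (I : Type) (s : seq I) (Q : pred I) (f : I -> T -> RR) (e : I -> R) :
  (forall i, ebound (f i) (e i)) -> ebound (fun w => \sum_(i <- s | Q i) f i w) (\sum_(i <- s | Q i) e i).
Proof.
move=> H; elim: s => [|i s IH].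
  rewrite big_nil; have -> : (fun w => \sum_(i <- [::] | Q i) f i w) = (fun=> 0) by apply/funext => w; rewrite big_nil.
  exact: ebound_cst.
rewrite big_cons; have -> : (fun w => \sum_(j <- i :: s | Q j) f j w) =
    (fun w => if Q i then f i w + \sum_(j <- s | Q j) f j w else \sum_(j <- s | Q j) f j w).
  by apply/funext => w; rewrite big_cons.
by case: (Q i) => //; exact: ebound_add.
Qed.

Lemma ebound_le f e e' : e <= e' -> ebound f e -> ebound f e'.
Proof. by move=> ee [f0 mf ef]; split => //; apply: le_trans ef _; rewrite lee_fin. Qed.

End expectation_bound.

Section coupling_moments.
Context d (T : measurableType d) (R : realType) (P : probability T R).
Local Notation RR := (measurableTypeR R).
Variables (X : nat + option (nat * nat) -> T -> RR) (h N J : nat) (theta mu : R).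
Hypotheses (iX : iid P X) (theta0 : 0 < theta) (mu0 : 0 < mu) (hN : (N <= 2 ^ h)%N) (J0 : (0 < J)%N).
Hypothesis total : cum_rate theta J = N%:R * mu.

Let nu := cell_mass theta mu N J.
Let nu0 := cell_mass_ge0 N J theta0 mu0.
Let nuJ := @cell_mass_out R theta mu N J J0.
Let nu1 := cell_mass_sum mu0 J0 total.

Definition hits (w : T) (j : nat) : bool := hit X h mu N nu j w.

Definition num_hits (w : T) : R := \sum_(j < J) (hits w j)%:R.

Definition num_points (w : T) : R := \sum_(l < N) (leaf_count X h mu l w)%:R.

Lemma cmeas_hits j : cmeas (hits^~ j).
Proof. exact: (cmeas_hit h iX mu0 N nu0 nuJ nu1). Qed.

Let pE j : (j < J)%N -> 1 - expR (- \sum_(l < N) mu * nu l j) = fprob theta j.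
Proof.
move=> jJ; rewrite (cell_mass_rate theta0 mu0 total jJ) (expRN_hit_rate theta0).
by rewrite opprB addrCA subrr addr0.
Qed.

Lemma hits_law (v : nat -> bool) : P (\big[setI/setT]_(j < J) [set w | hits w j = v j]) =
  (\prod_(j < J) (if v j then fprob theta j else 1 - fprob theta j))%:E.
Proof.
rewrite (hit_law iX mu0 hN nu0 nuJ nu1); congr (_%:E); apply: eq_bigr => j _.
by rewrite pE.
Qed.

Lemma points_cell w l r : (l < N)%N ->
  l%:R * mu < cum_rate theta (mark X nu l r w).+1 /\ cum_rate theta (mark X nu l r w) < l.+1%:R * mu.
Proof.
move=> lN; apply: (cell_mass_gt0 (J := J) mu0 lN).
by apply: quant_gt0; apply: (finite_pmf (m := J)); [exact: nu0|exact: nuJ|exact: nu1].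
Qed.

Lemma points_lt w l r : (mark X nu l r w < J)%N.
Proof. exact: mark_lt nu0 nuJ nu1 _ _ _. Qed.

Let mhits j : measurable_fun setT (fun w => (hits w j)%:R : RR).
Proof. exact: (measurable_fun_bind (cmeas_hits j) (fun v => measurable_cst (v%:R : RR))). Qed.

Let E1 j : (j < J)%N -> (\int[P]_w ((hits w j)%:R)%:E = (fprob theta j)%:E)%E.
Proof. by move=> jJ; rewrite (integral_hit iX mu0 hN nu0 nuJ nu1 jJ) pE. Qed.

Let E2 i j : (i < j)%N -> (j < J)%N ->
  (\int[P]_w ((hits w i)%:R * (hits w j)%:R)%:E = (fprob theta i * fprob theta j)%:E)%E.
Proof.
move=> ij jJ; rewrite (integral_hit2 iX mu0 hN nu0 nuJ nu1 ij jJ) /= !pE//.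
exact: ltn_trans jJ.
Qed.

Let hits0 j w : 0 <= (hits w j)%:R :> R. Proof. by []. Qed.

Let mhits2 i j : measurable_fun setT (fun w => (hits w i)%:R * (hits w j)%:R : RR).
Proof. by apply: measurable_funM; exact: mhits. Qed.

Let f0 := fprob_ge0 theta0.

Let sum_fprob_le : \sum_(j < J) fprob theta j <= N%:R * mu.
Proof. by rewrite -total; apply: ler_sum => j _; exact: fprob_le_hit_rate. Qed.

Lemma ebound_num_hits : ebound P num_hits (N%:R * mu).
Proof.
apply: ebound_le sum_fprob_le _; apply: ebound_sum => j; split => //.
by rewrite E1.
Qed.

Let E_num_hits : (\int[P]_w (num_hits w)%:E = (\sum_(j < J) fprob theta j)%:E)%E.
Proof.
rewrite /num_hits (integral_EFin_sum P _ (fun (j : 'I_J) w => hits0 j w) (fun j : 'I_J => mhits j)) -sumEFin.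
by apply: eq_bigr => j _; rewrite E1.
Qed.

Lemma ebound_num_hits_sqr : ebound P (fun w => num_hits w ^+ 2) (N%:R * mu + (N%:R * mu) ^+ 2).
Proof.
have -> : (fun w => num_hits w ^+ 2) = (fun w => \sum_(i < J) \sum_(j < J) (hits w i)%:R * (hits w j)%:R).
  by apply/funext => w; rewrite expr2 /num_hits mulr_suml; apply: eq_bigr => i _; rewrite mulr_sumr.
pose e (i j : nat) : R := fprob theta i * fprob theta j + (if i == j then fprob theta i else 0).
apply: (@ebound_le _ _ _ _ _ (\sum_(i < J) \sum_(j < J) e i j)); last first.
  apply: ebound_sum => i; apply: ebound_sum => j; split; [by move=> w; rewrite mulr_ge0|exact: mhits2|].
  rewrite /e; have [ij|ji|ij] := ltngtP i j.
  - by rewrite E2// addr0.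
  - under eq_integral do rewrite mulrC.
    by rewrite E2// addr0 mulrC.
  - rewrite (val_inj ij : i = j); apply: (@le_trans _ _ (\int[P]_w ((hits w j)%:R)%:E)%E).
      apply: (integral_EFin_le P (fun w => mulr_ge0 (hits0 j w) (hits0 j w)) (mhits2 j j) (mhits j)) => w.
      by case: (hits w j); rewrite ?mulr1 ?mulr0.
    by rewrite E1// lee_fin lerDr mulr_ge0.
have -> : \sum_(i < J) \sum_(j < J) e i j = (\sum_(i < J) fprob theta i) ^+ 2 + \sum_(i < J) fprob theta i.
  rewrite expr2 mulr_suml -big_split /=; apply: eq_bigr => i _; rewrite big_split /= mulr_sumr; congr (_ + _).
  rewrite (bigD1 i)//= eqxx big1 ?addr0// => j ji.
  by rewrite eq_sym (negbTE (ji : (j : nat) != i)).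
have s0 : 0 <= \sum_(i < J) fprob theta i by exact: sumr_ge0.
by rewrite addrC lerD// lerXn2r// nnegrE (le_trans s0).
Qed.

(** The two hits of a gap are at different places, hence independent, and [short_gap_rate] applies
    for each [j] separately. *)
Lemma ebound_short_gaps (D : R) : 2 <= D ->
  ebound P (fun w => \sum_(j < J) (hits w j)%:R * short_gaps (hits w) D j) (2 * theta / D * (N%:R * mu)).
Proof.
move=> D2; have D0 : 0 < D by exact: lt_le_trans D2.
apply: (@ebound_le _ _ _ _ _ (\sum_(j < J) 2 * theta / D * fprob theta j)).
  by rewrite -mulr_sumr ler_wpM2l// divr_ge0 ?(ltW D0)// mulr_ge0// ltW.
apply: ebound_sum => j; apply: (@ebound_le _ _ _ _ _ (\sum_(i < j | (j - i)%:R * D < j.+1%:R) fprob theta i * fprob theta j)).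
  by rewrite -mulr_suml ler_wpM2r// short_gap_rate.
have -> : (fun w => (hits w j)%:R * short_gaps (hits w) D j) =
    (fun w => \sum_(i < j | (j - i)%:R * D < j.+1%:R) (hits w i)%:R * (hits w j)%:R).
  apply/funext => w; rewrite /short_gaps mulr_sumr; apply: eq_bigr => i _; exact: mulrC.
apply: ebound_sum => i.
by split; [move=> w; rewrite mulr_ge0|exact: mhits2|rewrite E2].
Qed.

Let mleaf l : measurable_fun setT (fun w => (leaf_count X h mu l w)%:R : RR).
Proof.
exact: (measurable_fun_bind (cmeas_leaf_count h iX mu0 l) (fun k => measurable_cst (k%:R : RR))).
Qed.

Let E_num_points : (\int[P]_w (num_points w)%:E = (N%:R * mu)%:E)%E.
Proof.
rewrite /num_points (integral_EFin_sum P _ (fun (l : 'I_N) w => ler0n _ _) (fun l : 'I_N => mleaf l)).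
rewrite (eq_bigr (fun=> mu%:E)); last first.
  move=> l _; rewrite (integral_leaf_count iX mu0 (F := fun k => k%:R))//; last exact: leq_trans hN.
  by rewrite integral_poisson_id// ltW.
by rewrite sumEFin sumr_const card_ord mulr_natl.
Qed.

Let mpoints : measurable_fun setT (num_points : T -> RR).
Proof. by apply: measurable_sum => l; exact: mleaf. Qed.

Lemma ebound_num_points : ebound P num_points (N%:R * mu).
Proof. by split; [move=> w; exact: sumr_ge0|exact: mpoints|rewrite E_num_points]. Qed.

(** The points have mean the sum of the rates, the hits the sum of the probabilities. The integral
    of the difference is found by adding the finite mean of the hits to it. *)
Lemma ebound_double_hits : ebound P (fun w => num_points w - num_hits w) (2 * theta ^+ 2).
Proof.
have mh : measurable_fun setT (num_hits : T -> RR) by apply: measurable_sum => j; exact: mhits.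
have g0 w : 0 <= num_points w - num_hits w.
  have /andP[/le_trans H1 H2] := @point_sum R J N (fun l => leaf_count X h mu l w) _ (points_lt w) (fun=> 0) 1 (fun j _ => introT andP (conj (lexx 0) ler01)).
  by move: (H1 _ H2); rewrite mul1r.
have md : measurable_fun setT ((fun w => num_points w - num_hits w) : T -> RR) by exact: measurable_funB.
split => //.
have K0 w : 0 <= num_hits w by exact: sumr_ge0.
have E : (\int[P]_w (num_points w - num_hits w)%:E + (\sum_(j < J) fprob theta j)%:E = (N%:R * mu)%:E)%E.
  rewrite -E_num_hits -(integral_EFinD P g0 md K0 mh) -E_num_points.
  by apply: eq_integral => w _; rewrite subrK.
rewrite -(leeD2rE _ _ (x := (\sum_(j < J) fprob theta j)%:E))// E -EFinD lee_fin -lerBlDr -total.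
by rewrite -sumrB; exact: sum_hit_rate_sub_fprob.
Qed.

Lemma ebound_abs_leaves : ebound P (fun w => \sum_(l < N) `|X (inl (l : nat)) w|) (2 * N%:R).
Proof.
have -> : 2 * N%:R = \sum_(l < N) 2 :> R by rewrite sumr_const card_ord mulr_natr.
have mX k : measurable_fun setT (X k) by exact: indep_measurable iX k.
apply: ebound_sum => l; split => //; first by apply: measurableT_comp => //; exact: mX.
apply: le_trans (@N01_abs_le R); rewrite le_eqVlt; apply/orP; left; apply/eqP.
apply: (indep_integral (inl (l : nat)) iX (f := fun z => (`|z|)%:E)); last by move=> z; rewrite lee_fin.
have mabs : measurable_fun setT (fun z : RR => `|z| : RR) by apply: measurableT_comp => //; exact: measurable_id.
exact/measurable_EFinP.
Qed.

End coupling_moments.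

(** * The supremum and the coupling error *)

Section sup_dev_measurable.
Context {R : realType}.

Lemma within_cvg_seq (A : set R) (f : R -> R) (u : nat -> R) (a : R) :
  {within A, continuous f} -> (forall n, A (u n)) -> A a -> u @ \oo --> a -> (f \o u) @ \oo --> f a.
Proof.
move=> /subspace_continuousP fA uA Aa ua; apply: cvg_trans (fA a Aa).
move=> U /= fU; have : \forall n \near \oo, A (u n) -> U (f (u n)) by exact: ua fU.
by apply: filterS => n; apply; exact: uA.
Qed.

Definition unit_dyadic (k : nat) : R :=
  if unpickle k is Some (i, j) then Num.min (i%:R / 2 ^+ j) 1 else 0.

Lemma unit_dyadic_itv k : 0 <= unit_dyadic k <= 1.
Proof.
rewrite /unit_dyadic; case: (unpickle k) => [[i j]|]; last by rewrite lexx ler01.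
by rewrite ge_min lexx orbT andbT le_min ler01 andbT divr_ge0// exprn_ge0.
Qed.

Lemma unit_dyadicE i j : exists k, unit_dyadic k = Num.min (i%:R / 2 ^+ j) 1.
Proof. by exists (pickle (i, j)); rewrite /unit_dyadic pickleK. Qed.

Variables (theta : R) (n : nat).
Hypothesis n2 : (2 <= n)%N.

Let L : R := ln n%:R.

Let L0 : 0 < L. Proof. by rewrite ln_gt0// ltr1n. Qed.

Let dev c (Wp : R -> R) t := `|Wn theta n c t - Wp (t ^+ 3)|.

(** Dyadic approximation from the right, because the integer part of n^t is right-continuous in [t];
    the minimum keeps it in [0, 1]. *)
Let right_approx (t : R) j : R := Num.min ((Num.truncn (t * 2 ^+ j)).+1%:R / 2 ^+ j) 1.

Let right_approx_bounds (t : R) j : 0 <= t <= 1 -> t <= right_approx t j <= t + 2^-1 ^+ j.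
Proof.
move=> /andP[t0 t1]; have p0 : 0 < 2 ^+ j :> R by exact: exprn_gt0.
have t20 : 0 <= t * 2 ^+ j by rewrite mulr_ge0// ltW.
have /andP[a b] := truncn_itv t20.
rewrite /right_approx le_min t1 andbT ler_pdivlMr// (ltW b) /= ge_min; apply/orP; left.
by rewrite ler_pdivrMr// mulrDl exprVn mulVf ?gt_eqF// -natr1 lerD2r.
Qed.

Let right_approx_itv (t : R) j : 0 <= t <= 1 -> 0 <= right_approx t j <= 1.
Proof.
move=> t01; have /andP[a _] := right_approx_bounds j t01.
rewrite (le_trans _ a); last by case/andP: t01.
by rewrite ge_min lexx orbT.
Qed.

Let right_approx_cvg (t : R) : 0 <= t <= 1 -> right_approx t @ \oo --> t.
Proof.
move=> t01; have b j := right_approx_bounds j t01.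
apply: (@squeeze_cvgr _ _ _ _ (cst t) (fun j => t + 2^-1 ^+ j)).
- by apply: nearW => j; exact: b.
- exact: cvg_cst.
- rewrite -[X in _ --> X]addr0; apply: cvgD; first exact: cvg_cst.
  by apply: cvg_expr; rewrite ger0_norm// invf_lt1// ltr1n.
Qed.

Let trunc_right (t : R) : 0 <= t -> exists2 q, t < q &
  forall x, t <= x -> x < q -> Num.truncn (n%:R `^ x) = Num.truncn (n%:R `^ t).
Proof.
move=> t0; set k := Num.truncn (n%:R `^ t).
have n0 : 0 < n%:R :> R by rewrite ltr0n; exact: leq_trans n2.
have n1 : 1 <= n%:R :> R by rewrite ler1n; exact: leq_trans n2.
have /andP[a b] := truncn_itv (powR_ge0 n%:R t); rewrite -/k in a b.
exists (ln k.+1%:R / L); first by rewrite ltr_pdivlMr// -ln_powR ltr_ln ?posrE//; exact: powR_gt0.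
move=> x tx; rewrite ltr_pdivlMr// -ln_powR ltr_ln ?posrE//; last exact: powR_gt0.
move=> xk.
by apply: truncn_def; rewrite xk andbT (le_trans a)// ler_powR.
Qed.

Let dev_cvg c (Wp : R -> R) (t : R) : {within `[0, +oo[, continuous Wp} -> 0 <= t <= 1 ->
  (dev c Wp \o right_approx t) @ \oo --> dev c Wp t.
Proof.
move=> cW t01; have /andP[t0 t1] := t01.
have xt := right_approx_cvg t01.
have [q tq trq] := trunc_right t0.
have ev : \forall j \near \oo, right_approx t j < q.
  by apply: (cvgr_lt t) => //; exact: xt.
have x2 : (fun j => right_approx t j ^+ 2) @ \oo --> t ^+ 2.
  by rewrite expr2; under eq_fun do rewrite expr2; exact: cvgM.
have x3 : (fun j => right_approx t j ^+ 3) @ \oo --> t ^+ 3.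
  by rewrite exprS; under eq_fun do rewrite exprS; exact: cvgM.
have cv3 : (Wp \o (fun j => right_approx t j ^+ 3)) @ \oo --> Wp (t ^+ 3).
  apply: (within_cvg_seq cW) => //=.
  - by move=> j; rewrite in_itv /= andbT exprn_ge0//; case/andP: (right_approx_itv j t01).
  - by rewrite in_itv /= andbT exprn_ge0.
set m := Num.truncn (n%:R `^ t) in trq.
have main : (fun j => `|(ln (invol R m c) - theta * right_approx t j ^+ 2 / 2 * L ^+ 2)
     / Num.sqrt (theta / 3 * L ^+ 3) - Wp (right_approx t j ^+ 3)|) @ \oo --> dev c Wp t.
  apply: cvg_norm; apply: cvgB; last exact: cv3.
  apply: cvgM; last exact: cvg_cst.
  apply: cvgB; first exact: cvg_cst.
  apply: cvgM; last exact: cvg_cst.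
  apply: cvgM; last exact: cvg_cst.
  by apply: cvgM; first exact: cvg_cst.
apply: cvg_trans main; apply: near_eq_cvg; near=> j.
rewrite /dev /Wn /= trq//; last by near: j.
by case/andP: (right_approx_bounds j t01).
Unshelve. all: by end_near.
Qed.

(** The deviation is right-continuous in [t], so the supremum is already reached along dyadic
    times. *)
Lemma sup_devE c (Wp : R -> R) : {within `[0, +oo[, continuous Wp} ->
  sup_dev theta n c Wp = esups (fun k => (dev c Wp (unit_dyadic k))%:E) 0.
Proof.
move=> cW; apply/eqP; rewrite eq_le; apply/andP; split; apply/ereal_supP => y.
  move=> [t /=]; rewrite in_itv /= => t01 <-.
  apply: (@cvge_to_le _ \oo _ R (fun j => (dev c Wp (right_approx t j))%:E)).
    by apply: cvg_EFin; [exact: nearW|exact: dev_cvg].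
  apply: nearW => j; apply: le_ereal_sup_tmp.
  have [k kE] := unit_dyadicE (Num.truncn (t * 2 ^+ j)).+1 j.
  exists (dev c Wp (right_approx t j))%:E => //; exists k => //.
  by rewrite kE.
move=> [k _ <-]; apply: le_ereal_sup_tmp; exists (dev c Wp (unit_dyadic k))%:E => //.
by exists (unit_dyadic k) => //=; rewrite in_itv /= unit_dyadic_itv.
Qed.

(** The counts depend on [w] through a variable with countably many values; for each of these the
    supremum is a countable one of measurable functions. *)
Lemma measurable_sup_dev d (T : measurableType d) (I : countType) (H : T -> I) (g : I -> nat -> nat)
    (W : R -> T -> R) : cmeas H ->
  (forall t, 0 <= t -> measurable_fun setT (W t : T -> measurableTypeR R)) ->
  (forall w, {within `[0, +oo[, continuous (fun t => W t w)}) ->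
  measurable_fun setT (fun w => sup_dev theta n (g (H w)) (fun s => W s w)).
Proof.
move=> cH mW cW.
apply: (measurable_fun_bind (f := H) (g := fun i w => sup_dev theta n (g i) (fun s => W s w)) cH) => i.
under eq_fun do rewrite sup_devE//.
apply: measurable_fun_esups => k; apply/measurable_EFinP; apply: measurableT_comp => //.
apply: measurable_funB => //; apply: mW; rewrite exprn_ge0//.
by case/andP: (unit_dyadic_itv k).
Qed.

End sup_dev_measurable.

(** * Pathwise error of the coupling and its expectation *)

Section coupling_error.
Context d (T : measurableType d) (R : realType) (P : probability T R).
Local Notation RR := (measurableTypeR R).
Variables (X : nat + option (nat * nat) -> T -> RR) (m J : nat) (theta mu : R).
Variables (W : R -> T -> R) (Osc : T -> \bar R).
Let N := (2 ^ m)%N.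
Let L : R := ln J.+1%:R.
Let c : R := 2 * theta + 2 * theta ^+ 2.
Hypotheses (iX : iid P X) (theta0 : 0 < theta) (J0 : (0 < J)%N) (mu_ge : 2400 <= Num.sqrt mu).
Hypotheses (total : cum_rate theta J = N%:R * mu) (L2 : 2 <= L) (cmu : 2 * c <= mu) (thL : theta * ln L <= mu).
Hypothesis W_grid : forall k w, (k <= N)%N -> W (k%:R ^+ 3 / N%:R ^+ 3) w =
  \sum_(l < k) Num.sqrt (l.+1%:R ^+ 3 / N%:R ^+ 3 - l%:R ^+ 3 / N%:R ^+ 3) * X (inl (l : nat)) w.
Hypothesis W_osc : forall s t w, 0 <= s <= 1 -> 0 <= t <= 1 -> `|s - t| <= 4 / N%:R ->
  (`|W s w - W t w|%:E <= Osc w)%E.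

Let mu0 : 0 < mu.
Proof. by rewrite -sqrtr_gt0; apply: lt_le_trans mu_ge; rewrite ltr0n. Qed.

Let N0 : (0 < N)%N. Proof. by rewrite expn_gt0. Qed.

Let NR : 0 < N%:R :> R. Proof. by rewrite ltr0n. Qed.

Let hN : (N <= 2 ^ (m + m))%N. Proof. by rewrite leq_exp2l// leq_addr. Qed.

Let L0 : 0 < L. Proof. exact: lt_le_trans L2. Qed.

Let th2 : 0 <= theta ^+ 2. Proof. exact: sqr_ge0. Qed.

Let c0 : 0 <= c. Proof. by rewrite addr_ge0// mulr_ge0// ltW. Qed.

Let NL : `|N%:R * mu - theta * L| <= c.
Proof.
have /andP[h1 h2] := cum_rate_bounds theta0 J; move: h1 h2; rewrite -/L total ler_norml /c.
by move: theta0 th2 => *; apply/andP; split; lra.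
Qed.

Let b w := hits X (m + m) N J theta mu w.
Let K := num_hits X (m + m) N J theta mu.
Let S := num_points X (m + m) N mu.
Let sigma := Num.sqrt (theta / 3 * L ^+ 3).
Let drift := (3 * mu * (N%:R * mu) + c * (N%:R * mu + theta * L)) / (2 * theta).
Let B := 40 * mu + 23400 * m%:R + 5220 + 2 * N%:R ^+ 4 * mu * expR (- (mu / (4 * 2400 ^+ 2))).

(** The cubes differ by at most 3 / N; 4 / N is the dyadic scale 2^-(m - 2) of the oscillation
    bound. *)
Let abs_sub_cube_le (t : R) (k : nat) : 0 <= t <= 1 -> k%:R <= t * N%:R < k.+1%:R ->
  `|k%:R ^+ 3 / N%:R ^+ 3 - t ^+ 3| <= 4 / N%:R /\
  (0 : R) <= (k%:R ^+ 3 / N%:R ^+ 3 : R) <= (1 : R).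
Proof.
move=> /andP[t0 t1] /andP[k1 k2]; pose s : R := k%:R / N%:R.
have s0 : 0 <= s by rewrite divr_ge0// ltW.
have st : s <= t by rewrite ler_pdivrMr.
have ts : t <= s + N%:R^-1.
  by rewrite /s -[X in _ + X]mul1r -mulrDl natr1 ler_pdivlMr// ltW.
have -> : k%:R ^+ 3 / N%:R ^+ 3 = s ^+ 3 by rewrite /s exprMn exprVn.
have N10 : 0 <= N%:R^-1 :> R by rewrite invr_ge0 ltW.
have s3 : s ^+ 3 <= t ^+ 3 by rewrite lerXn2r// nnegrE.
split; last by rewrite exprn_ge0// (le_trans s3)// exprn_ile1.
rewrite distrC ger0_norm ?subr_ge0//.
have -> : t ^+ 3 - s ^+ 3 = (t - s) * (t * t + t * s + s * s) by ring.
rewrite mulrC; apply: ler_pM; rewrite ?subr_ge0 ?addr_ge0 ?mulr_ge0//; last by rewrite lerBlDl.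
have s1 := le_trans st t1.
have := ler_pM t0 t0 t1 t1; have := ler_pM t0 s0 t1 s1; have := ler_pM s0 s0 s1 s1; lra.
Qed.

(** The four lines of the bound belong to the four comparisons [b1] to [b4]: invol with a sum of
    logarithms of cycle lengths, this with hits, hits with cells, cells with normals. The cut-off D
    of the short gaps is [L]: rounding then costs ln L per hit, and the short gaps L * 2 theta / L
    per hit. *)
Theorem coupling_error : exists2 F : T -> RR,
  ebound P F
    (ln L + ln L * (N%:R * mu) + L^-1 * (2 + 3 * (N%:R * mu) + (N%:R * mu + (N%:R * mu) ^+ 2))
     + (ln L * (N%:R * mu) + L * (2 * theta / L * (N%:R * mu)) + L * (5 * B) + L)
     + (L * (2 * theta ^+ 2) + (mu + c) / theta * (N%:R * mu) + 4 * (L + c / theta) * B)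
     + (drift + 2 * (N%:R * mu) / theta * B + 6 * mu * Num.sqrt mu / theta * (2 * N%:R))) &
  forall w t, 0 <= t <= 1 ->
    (`|ln (invol R (Num.truncn (J.+1%:R `^ t)) (feller_run (b w) J).1) - theta * t ^+ 2 / 2 * L ^+ 2
       - sigma * W (t ^+ 3) w|%:E <= (F w)%:E + sigma%:E * Osc w)%E.
Proof.
have [ME [MX [hE hX [mE E0] [mX X0] [EE EX]]]] := tree_coupling m iX mu_ge.
pose G w := \sum_(j < J) (b w j)%:R * short_gaps (b w) L j.
pose A w := \sum_(l < N) `|X (inl (l : nat)) w|.
exists (fun w => ln L + ln L * K w + L^-1 * (2 + 3 * K w + K w ^+ 2)
  + (ln L * K w + L * G w + L * (5 * MX w) + L)
  + (L * (S w - K w) + (mu + c) / theta * S w + 4 * (L + c / theta) * MX w)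
  + (drift + 2 * (N%:R * mu) / theta * ME w + 6 * mu * Num.sqrt mu / theta * A w)).
  have eK : ebound P K (N%:R * mu) by exact: ebound_num_hits.
  have eK2 : ebound P (fun w => K w ^+ 2) (N%:R * mu + (N%:R * mu) ^+ 2) by exact: ebound_num_hits_sqr.
  have eG : ebound P G (2 * theta / L * (N%:R * mu)) by exact: ebound_short_gaps.
  have eS : ebound P S (N%:R * mu) by exact: ebound_num_points.
  have eSK : ebound P (fun w => S w - K w) (2 * theta ^+ 2) by exact: ebound_double_hits.
  have eA : ebound P A (2 * N%:R) by exact: (ebound_abs_leaves N iX).
  have eE : ebound P ME B by split.
  have eX : ebound P MX B by split.
  have lL : 0 <= ln L by apply: ln_ge0; apply: le_trans L2; rewrite ler1n.
  have L0' := ltW L0; have mu00 := ltW mu0; have th0 := ltW theta0; have N00 := ltW NR.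
  have s0 := sqrtr_ge0 mu.
  have ct : 0 <= c / theta by exact: divr_ge0.
  have mct : 0 <= (mu + c) / theta by rewrite divr_ge0// addr_ge0.
  have Nth : 0 <= 2 * (N%:R * mu) / theta by rewrite divr_ge0// mulr_ge0// mulr_ge0.
  have mut : 0 <= 6 * mu * Num.sqrt mu / theta by rewrite divr_ge0// mulr_ge0// mulr_ge0.
  have d0 : 0 <= drift.
    by rewrite /drift divr_ge0 ?addr_ge0 ?mulr_ge0// addr_ge0// mulr_ge0.
  apply: ebound_add; last first.
    apply: ebound_add; last exact: ebound_scale.
    by apply: ebound_add; [exact: ebound_cst|exact: ebound_scale].
  apply: ebound_add; last first.
    apply: ebound_add; last by apply: ebound_scale => //; rewrite mulr_ge0// addr_ge0.
    by apply: ebound_add; exact: ebound_scale.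
  apply: ebound_add; last first.
    apply: ebound_add; last exact: ebound_cst.
    apply: ebound_add; last by apply: ebound_scale => //; exact: ebound_scale.
    by apply: ebound_add; exact: ebound_scale.
  apply: ebound_add.
    by apply: ebound_add; [exact: ebound_cst|exact: ebound_scale].
  apply: ebound_scale; first by rewrite invr_ge0.
  apply: ebound_add => //; apply: ebound_add; first exact: ebound_cst.
  exact: ebound_scale.
move=> w t t01; have /andP[t0 t1] := t01.
set M := Num.truncn _; pose k := Num.truncn (t * N%:R).
have n0 : 0 < J.+1%:R :> R by [].
have n1 : 1 <= J.+1%:R :> R by rewrite ler1n.
have pt : 1 <= J.+1%:R `^ t by have := ler_powR n1 t0; rewrite powRr0.
have M0 : (0 < M)%N by rewrite truncn_gt0.
have MJ : (M <= J.+1)%N.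
  have := truncn_itv (powR_ge0 J.+1%:R t) => /andP[h _].
  rewrite -(ler_nat R); apply: le_trans h _; rewrite -[leRHS]powRr1 ?(ltW n0)// ler_powR//.
have kt : k%:R <= t * N%:R < k.+1%:R by apply: truncn_itv; rewrite mulr_ge0// ltW.
have kN : (k <= N)%N.
  by rewrite -(ler_nat R); case/andP: kt => /le_trans + _; apply; rewrite ler_piMl// ltW.
have L1 : 1 <= L by apply: le_trans L2; rewrite ler1n.
pose S1 := \sum_(1 <= i < M.+1) ((feller_run (b w) J).1 i)%:R * ln i%:R : R.
pose A1 := \sum_(j < J) (b w j)%:R * ((j < M)%N%:R * ln j.+1%:R) : R.
pose E1 := \sum_(l < k) (leaf_count X (m + m) mu l w)%:R * (l%:R * mu / theta) : R.
pose Z1 := \sum_(l < k) Num.sqrt (l.+1%:R ^+ 3 / N%:R ^+ 3 - l%:R ^+ 3 / N%:R ^+ 3) * X (inl (l : nat)) w : R.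
have K0 : 0 <= K w by exact: sumr_ge0.
have b1 : `|ln (invol R M (feller_run (b w) J).1) - S1| <= ln L + ln L * K w + L^-1 * (2 + 3 * K w + K w ^+ 2).
  apply: le_trans (ln_invol_feller_run (b w) MJ) _.
  have -> : \sum_(j < J) (b w j)%:R = K w by [].
  have p1 : 0 < 1 + (1 + K w) by rewrite addr_gt0// ltr_pwDl.
  (* A linear bound on ln at scale [L] makes the estimate quadratic in the number of hits, whose
     first two moments are known. *)
  have lnb : ln (1 + (1 + K w)) <= ln L + L^-1 * (1 + (1 + K w)).
    have q0 : 0 < (1 + (1 + K w)) / L by rewrite divr_gt0.
    have := ln_upper_bound q0; rewrite ln_div ?posrE// [_ / L]mulrC lerBlDl => /le_trans; apply.
    by rewrite lerD2l gerBl.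
  have := ler_wpM2l (addr_ge0 ler01 K0) lnb.
  by have -> : (1 + K w) * (ln L + L^-1 * (1 + (1 + K w))) = ln L + ln L * K w + L^-1 * (2 + 3 * K w + K w ^+ 2) by ring.
have nX l : (l < N)%N -> (leaf_count X (m + m) mu l w)%:R <= MX w by exact: hX.
have mlt := points_lt (N := N) X theta0 mu0 J0 total w.
have mcell l r := @points_cell _ _ _ X N J theta mu theta0 mu0 J0 total w l r.
have b2 : `|S1 - A1| <= ln L * K w + L * G w + L * (5 * MX w) + L.
  apply: le_trans (feller_run_log_sum (b w) J L1 M) _.
  rewrite lerD2r lerD2l ler_wpM2l ?(ltW L0)//.
  exact: (window_count theta0 mu0 mlt mcell nX (X0 w) cmu M0 L1 thL).
have b3 : `|A1 - E1| <= L * (S w - K w) + (mu + c) / theta * S w + 4 * (L + c / theta) * MX w.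
  apply: (bin_log_sum theta0 mu0 mlt mcell nX (X0 w) cmu (L := L) (t := t * (N%:R * mu)) (a := t * (theta * L)) (m := M) (l' := k)) => //.
  - move=> j jJ; rewrite /M truncn_gt_nat mulrCA ler_pM2l// -ln_powR ler_ln ?posrE// powR_gt0.
  - by move=> l lN; rewrite /k truncn_gt_nat mulrA ler_pM2r.
  - rewrite -mulrBr normrM ger0_norm//; apply: le_trans NL; rewrite ler_piMl//.
  - by move=> j jJ; rewrite ln_nat_le// ltnS ltnW.
  - by move: NL; rewrite ler_norml => /andP[_]; rewrite lerBlDl.
have b4 : `|E1 - theta * t ^+ 2 / 2 * L ^+ 2 - sigma * Z1|
    <= drift + 2 * (N%:R * mu) / theta * ME w + 6 * mu * Num.sqrt mu / theta * A w.
  apply: (gaussian_bins theta0 mu0 (ltW L0) N0 NL cmu (nn := fun l => (leaf_count X (m + m) mu l w)%:R)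
    (x := fun l => X (inl l) w) t01 kt) => i iN.
  exact: hE.
have sg0 : 0 <= sigma by exact: sqrtr_ge0.
have b5 : ((sigma * `|Z1 - W (t ^+ 3) w|)%:E <= sigma%:E * Osc w)%E.
  rewrite EFinM lee_wpmul2l ?lee_fin// /Z1 -W_grid//.
  have [h1 h2] := abs_sub_cube_le t01 kt.
  by apply: W_osc => //; rewrite exprn_ge0// exprn_ile1.
apply: (@le_trans _ _ ((ln L + ln L * K w + L^-1 * (2 + 3 * K w + K w ^+ 2)
  + (ln L * K w + L * G w + L * (5 * MX w) + L)
  + (L * (S w - K w) + (mu + c) / theta * S w + 4 * (L + c / theta) * MX w)
  + (drift + 2 * (N%:R * mu) / theta * ME w + 6 * mu * Num.sqrt mu / theta * A w))%:E
  + (sigma * `|Z1 - W (t ^+ 3) w|)%:E)%E); last by rewrite leeD2l.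
rewrite -EFinD lee_fin -[X in X * `|Z1 - _|](ger0_norm sg0) -normrM.
have -> : ln (invol R M (feller_run (b w) J).1) - theta * t ^+ 2 / 2 * L ^+ 2 - sigma * W (t ^+ 3) w =
  (ln (invol R M (feller_run (b w) J).1) - S1) + (S1 - A1) + (A1 - E1)
   + (E1 - theta * t ^+ 2 / 2 * L ^+ 2 - sigma * Z1) + sigma * (Z1 - W (t ^+ 3) w) by ring.
apply: le_trans (ler_normD _ _) _; rewrite lerD2r.
apply: le_trans (ler_normD _ _) _; apply: lerD => //.
apply: le_trans (ler_normD _ _) _; apply: lerD => //.
by apply: le_trans (ler_normD _ _) _; apply: lerD.
Qed.

End coupling_error.

(** * Choice of the parameters *)

Lemma BM_increments_iid d (T : measurableType d) (R : realType) (P : probability T R)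
    (W : R -> T -> R) (ts : nat -> R) : standard_BM P W -> ts 0%N = 0 -> (forall i, ts i < ts i.+1) ->
  iid P (fun l w => (W (ts l.+1) w - W (ts l) w) / Num.sqrt (ts l.+1 - ts l) : measurableTypeR R).
Proof.
move=> [mW _ _ incr] ts0 tslt; set X := fun l w => _.
have tsge0 i : 0 <= ts i by elim: i => [|i IH]; [rewrite ts0|exact: le_trans IH (ltW (tslt i))].
have s0 i : 0 < Num.sqrt (ts i.+1 - ts i) by rewrite sqrtr_gt0 subr_gt0.
apply: indep_cofinal => [l|s].
  by apply: measurable_funM => //; apply: measurable_funB; exact: mW.
have [k sk] : exists k, {subset s <= iota 0 k}.
  by exists (\max_(i <- s) i).+1 => i si; rewrite mem_iota add0n ltnS; exact: leq_bigmax_seq.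
exists (iota 0 k); split; [exact: iota_uniq|exact: sk|].
move=> B mB; pose B' i : set R := (fun x => x / Num.sqrt (ts i.+1 - ts i)) @^-1` B i.
have mB' i : measurable (B' i : set (measurableTypeR R)).
  rewrite -[X in measurable X]setTI.
  have : measurable_fun setT (fun x : measurableTypeR R => x / Num.sqrt (ts i.+1 - ts i) : measurableTypeR R).
    by apply: measurable_funM => //; exact: measurable_id.
  by move=> /(_ measurableT _ (mB i)).
have -> : \big[setI/setT]_(i <- iota 0 k) X i @^-1` B i =
    \bigcap_(i in [set i | (i < k)%N]) [set w | B' i (W (ts i.+1) w - W (ts i) w)].
  rewrite -bigcap_seq; apply/seteqP; split => w H i /=.
    by move=> ik; apply: H => /=; rewrite mem_iota add0n.
  by rewrite mem_iota add0n /= => ik; exact: H.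
have -> : iota 0 k = index_iota 0 k by rewrite /index_iota subn0.
rewrite incr// big_mkord; apply: eq_bigr => i _.
rewrite (normal_prob_scale (s0 i) (mB' i)); congr (N01 _); apply/seteqP.
by split => x; rewrite /B' /= mulrAC divff ?mul1r// gt_eqF.
Qed.

(** The first [N] leaves use the first [N] increments, those inside [0, 1]. All later increments are
    shared by parity: even offsets for the other leaves, odd ones for the total and the marks. *)
Definition leaf_source (N : nat) (i : nat + option (nat * nat)) : nat :=
  match i with
  | inl l => if (l < N)%N then l else (N + (l - N).*2)%N
  | inr o => (N + (pickle o).*2.+1)%N
  end.

Lemma leaf_source_inj N : injective (leaf_source N).
Proof.
case=> [l|o] [l'|o'] /=.
- by case: ltnP => h; case: ltnP => h' e; congr inl; move: e h h'; clear; lia.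
- by case: ltnP => h e; exfalso; move: e h; move: (pickle o') => p; clear; lia.
- by case: ltnP => h e; exfalso; move: e h; move: (pickle o) => p; clear; lia.
- by move=> e; congr inr; apply: (pcan_inj pickleK); move: e; move: (pickle o) (pickle o') => p q; clear; lia.
Qed.

Lemma dyadic_floor (R : realType) (x : R) : 1 <= x -> exists m, (2 ^ m)%:R <= x < 2 * (2 ^ m)%:R.
Proof.
move=> x1; have x0 : 0 <= x by exact: le_trans x1.
have t0 : (0 < Num.truncn x)%N by rewrite truncn_gt0.
have /andP[a b] := trunc_log_bounds (p := 2) isT t0.
have /andP[c e] := truncn_itv x0.
exists (trunc_log 2 (Num.truncn x)); apply/andP; split; first by apply: le_trans c; rewrite ler_nat.
by apply: lt_le_trans e _; rewrite -natrM ler_nat -expnS.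
Qed.

Section error_size.
Context {R : realType}.
Variables (theta c a kap bb L h mu Lam B Nr drift : R).
Hypotheses (theta0 : 0 < theta) (c0 : 0 <= c) (a0 : 0 <= a) (L1 : 1 <= L) (h1 : 1 <= h).
Hypotheses (mu1 : 1 <= mu) (muh : mu <= kap * h) (Lam0 : 0 <= Lam) (LamL : Lam <= a * L).
Hypotheses (B0 : 0 <= B) (Bh : B <= bb * h) (NLam : Nr * mu = Lam).

Let LH := L * h.

Let L0 : 0 <= L. Proof. exact: le_trans L1. Qed.
Let h0 : 0 <= h. Proof. exact: le_trans h1. Qed.
Let mu0 : 0 <= mu. Proof. exact: le_trans mu1. Qed.
Let L_LH : L <= LH. Proof. by rewrite /LH ler_peMr. Qed.
Let h_LH : h <= LH. Proof. by rewrite /LH ler_peMl. Qed.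
Let one_LH : 1 <= LH. Proof. exact: le_trans L_LH. Qed.
Let LH0 : 0 <= LH. Proof. exact: mulr_ge0. Qed.

Let hLam : h * Lam <= a * LH.
Proof. 
apply: le_trans (ler_wpM2l h0 LamL) _; rewrite le_eqVlt; apply/orP; left; apply/eqP.
by rewrite /LH; ring.
 Qed.

Let Lam_LH : Lam <= a * LH.
Proof. by apply: le_trans LamL _; rewrite ler_wpM2l. Qed.

Let muLam : mu * Lam <= a * kap * LH.
Proof.
apply: le_trans (ler_pM mu0 Lam0 muh LamL) _; rewrite le_eqVlt; apply/orP; left; apply/eqP.
by rewrite /LH; ring.
Qed.

Let LB : L * B <= bb * LH.
Proof.
apply: le_trans (ler_wpM2l L0 Bh) _; rewrite le_eqVlt; apply/orP; left; apply/eqP.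
by rewrite /LH; ring.
Qed.

Let B_LH : B <= bb * LH.
Proof. by apply: le_trans LB; rewrite ler_peMl. Qed.

Let LamB : Lam * B <= a * bb * LH.
Proof.
apply: le_trans (ler_pM Lam0 B0 LamL Bh) _; rewrite le_eqVlt; apply/orP; left; apply/eqP.
by rewrite /LH; ring.
Qed.

Let term1 : h + h * Lam + L^-1 * (2 + 3 * Lam + (Lam + Lam ^+ 2)) <= (3 + 5 * a + a ^+ 2) * LH.
Proof.
have L00 : 0 < L by exact: lt_le_trans L1.
have i1 : L^-1 * (2 + 3 * Lam + (Lam + Lam ^+ 2)) <= 2 + 4 * a + a ^+ 2 * L.
  rewrite mulrC ler_pdivrMr//.
  have p1 : Lam ^+ 2 <= a ^+ 2 * L * L.
    by rewrite -mulrA -(expr2 L) -exprMn lerXn2r// nnegrE mulr_ge0.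
  have -> : (2 + 4 * a + a ^+ 2 * L) * L = 2 * L + 4 * (a * L) + a ^+ 2 * L * L by ring.
  by move: p1 LamL L1; move: (a * L) (Lam ^+ 2) (a ^+ 2 * L * L) => *; lra.
have p2 : a ^+ 2 * L <= a ^+ 2 * LH by rewrite ler_wpM2l// sqr_ge0.
have p3 : a <= a * LH by rewrite ler_peMr.
have -> : (3 + 5 * a + a ^+ 2) * LH = 3 * LH + 5 * (a * LH) + a ^+ 2 * LH by ring.
move: i1 p2 p3 hLam h_LH one_LH; move: (L^-1 * _) (a ^+ 2 * L) (a ^+ 2 * LH) (a * LH) (h * Lam) => *; lra.
Qed.

Let term2 : h * Lam + L * (2 * theta / L * Lam) + L * (5 * B) + L <= (a + 2 * theta * a + 5 * bb + 1) * LH.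
Proof.
have L00 : 0 < L by exact: lt_le_trans L1.
have -> : L * (2 * theta / L * Lam) = 2 * theta * Lam by field; rewrite gt_eqF.
have p1 : 2 * theta * Lam <= 2 * theta * (a * LH) by rewrite ler_wpM2l// mulr_ge0// ltW.
have -> : (a + 2 * theta * a + 5 * bb + 1) * LH = a * LH + 2 * theta * (a * LH) + 5 * (bb * LH) + LH by ring.
have -> : L * (5 * B) = 5 * (L * B) by ring.
move: p1 hLam LB L_LH; move: (2 * theta * Lam) (2 * theta * (a * LH)) (h * Lam) (a * LH) (L * B) (bb * LH) => *.
lra.
Qed.

Let term3 : L * (2 * theta ^+ 2) + (mu + c) / theta * Lam + 4 * (L + c / theta) * B
  <= (2 * theta ^+ 2 + (a * kap + c * a) / theta + 4 * bb + 4 * (c / theta) * bb) * LH.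
Proof.
have p1 : L * (2 * theta ^+ 2) <= 2 * theta ^+ 2 * LH.
  by rewrite mulrC ler_wpM2l// mulr_ge0// sqr_ge0.
have p2 : (mu + c) / theta * Lam <= (a * kap + c * a) / theta * LH.
  rewrite mulrAC [leRHS]mulrAC ler_wpM2r ?invr_ge0 ?(ltW theta0)// !mulrDl.
  by apply: lerD => //; rewrite -mulrA ler_wpM2l.
have p3 : c / theta * B <= c / theta * (bb * LH) by rewrite ler_wpM2l// divr_ge0// ltW.
have -> : 4 * (L + c / theta) * B = 4 * (L * B) + 4 * (c / theta * B) by ring.
have -> : (2 * theta ^+ 2 + (a * kap + c * a) / theta + 4 * bb + 4 * (c / theta) * bb) * LH =
  2 * theta ^+ 2 * LH + (a * kap + c * a) / theta * LH + 4 * (bb * LH) + 4 * (c / theta * (bb * LH)) by ring.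
rewrite [leLHS]addrA; apply: lerD; last by rewrite ler_wpM2l.
by apply: lerD; [exact: lerD|rewrite ler_wpM2l].
Qed.

Let term4 : (3 * mu * Lam + c * (Lam + theta * L)) / (2 * theta) + 2 * Lam / theta * B
    + 6 * mu * Num.sqrt mu / theta * (2 * Nr)
  <= ((3 * (a * kap) + c * (a + theta)) / (2 * theta) + 2 * (a * bb) / theta + 12 * (a * kap) / theta) * LH.
Proof.
have th := ltW theta0.
have p1 : (3 * mu * Lam + c * (Lam + theta * L)) / (2 * theta) <= (3 * (a * kap) + c * (a + theta)) / (2 * theta) * LH.
  rewrite [leRHS]mulrAC; apply: ler_wpM2r; first by rewrite invr_ge0 mulr_ge0.
  have -> : (3 * (a * kap) + c * (a + theta)) * LH = 3 * (a * kap * LH) + c * (a * LH + theta * LH) by ring.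
  apply: lerD; first by rewrite -mulrA ler_wpM2l.
  by rewrite ler_wpM2l//; apply: lerD => //; rewrite ler_wpM2l.
have p2 : 2 * Lam / theta * B <= 2 * (a * bb) / theta * LH.
  rewrite mulrAC [leRHS]mulrAC ler_wpM2r ?invr_ge0// -!mulrA ler_wpM2l// mulrA; exact: LamB.
have p3 : 6 * mu * Num.sqrt mu / theta * (2 * Nr) <= 12 * (a * kap) / theta * LH.
  have -> : 6 * mu * Num.sqrt mu / theta * (2 * Nr) = 12 * (Num.sqrt mu * Lam) / theta.
    by rewrite -NLam; ring.
  have smu : Num.sqrt mu <= mu.
    by rewrite -[leRHS]ger0_norm// -sqrtr_sqr ler_sqrt ?sqr_ge0// expr2 ler_peMr.
  rewrite [leRHS]mulrAC ler_wpM2r ?invr_ge0// -mulrA ler_wpM2l//.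
  by apply: le_trans muLam; rewrite ler_wpM2r.
rewrite [leRHS]mulrDl [X in _ <= X + _]mulrDl; apply: lerD; last exact: p3.
by apply: lerD; [exact: p1|exact: p2].
Qed.

Definition error_const : R :=
  (3 + 5 * a + a ^+ 2) + (a + 2 * theta * a + 5 * bb + 1)
  + (2 * theta ^+ 2 + (a * kap + c * a) / theta + 4 * bb + 4 * (c / theta) * bb)
  + ((3 * (a * kap) + c * (a + theta)) / (2 * theta) + 2 * (a * bb) / theta + 12 * (a * kap) / theta).

(** [h] stands for ln L. [Lam] is O(L), while [mu] and [B] are O(h), so the mixed products are O(L
    h); the square of [Lam] comes divided by [L], and sqrt mu * Nr is at most [Lam]. *)
Lemma error_size :
  h + h * Lam + L^-1 * (2 + 3 * Lam + (Lam + Lam ^+ 2))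
  + (h * Lam + L * (2 * theta / L * Lam) + L * (5 * B) + L)
  + (L * (2 * theta ^+ 2) + (mu + c) / theta * Lam + 4 * (L + c / theta) * B)
  + ((3 * mu * Lam + c * (Lam + theta * L)) / (2 * theta) + 2 * Lam / theta * B
     + 6 * mu * Num.sqrt mu / theta * (2 * Nr)) <= error_const * (L * h).
Proof.
rewrite /error_const -/LH; rewrite [_ * LH]mulrDl [X in _ <= X + _]mulrDl [X in _ <= X + _ + _]mulrDl.
apply: lerD; last exact: term4.
apply: lerD; last exact: term3.
by apply: lerD; [exact: term1|exact: term2].
Qed.

End error_size.

Lemma feller_run_ext (b b' : nat -> bool) n : (forall j, (j < n)%N -> b j = b' j) -> feller_run b n = feller_run b' n.
Proof.
elim: n => //= n IH H; rewrite IH; last by move=> j jn; apply: H; exact: ltnW.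
by rewrite (H n (ltnSn n)).
Qed.

Section assembly.
Context {R : realType}.
Variables (theta : R).
Hypothesis theta0 : 0 < theta.
Local Notation RR := (measurableTypeR R).

(* The increments of [W] on [0, 1] drive the leaves of the tree; its increments beyond
   time 1 supply the remaining independent normals. *)
Theorem coupled_space (J m : nat) (mu : R) :
  let N := (2 ^ m)%N in let L : R := ln J.+1%:R in let c := 2 * theta + 2 * theta ^+ 2 in
  let Lam := N%:R * mu in
  let B := 40 * mu + 23400 * m%:R + 5220 + 2 * N%:R ^+ 4 * mu * expR (- (mu / (4 * 2400 ^+ 2))) in
  (0 < J)%N -> (1 < m)%N -> 2400 <= Num.sqrt mu -> cum_rate theta J = N%:R * mu -> 2 <= L ->
  2 * c <= mu -> theta * ln L <= mu ->
  exists (C : RR -> nat -> nat) (W : R -> RR -> R),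
    [/\ ESF_cycle_counts_law U01 theta J.+1 C, standard_BM U01 W,
      measurable_fun [set: RR] (fun w => sup_dev theta J.+1 (C w) (fun s => W s w)) &
      (\int[U01]_w sup_dev theta J.+1 (C w) (fun s => W s w) <=
       ((ln L + ln L * Lam + L^-1 * (2 + 3 * Lam + (Lam + Lam ^+ 2))
         + (ln L * Lam + L * (2 * theta / L * Lam) + L * (5 * B) + L)
         + (L * (2 * theta ^+ 2) + (mu + c) / theta * Lam + 4 * (L + c / theta) * B)
         + ((3 * mu * Lam + c * (Lam + theta * L)) / (2 * theta) + 2 * Lam / theta * B
            + 6 * mu * Num.sqrt mu / theta * (2 * N%:R))) / Num.sqrt (theta / 3 * L ^+ 3)
        + 288 * ((Num.sqrt 2)^-1 ^+ (m - 2) * Num.sqrt (m - 2).+1%:R))%:E)%E].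
Proof.
move=> N L c Lam B J0 m2 mu_ge total L2 cmu thL.
have [W [Osc [BM mO W_osc EO]]] := exists_BM_modulus R.
have NR : 0 < N%:R :> R by rewrite ltr0n expn_gt0.
pose ts (i : nat) : R := i%:R ^+ 3 / N%:R ^+ 3.
have ts0 : ts 0%N = 0 by rewrite /ts expr0n mul0r.
have tslt i : ts i < ts i.+1.
  rewrite /ts ltr_pM2r ?invr_gt0 ?exprn_gt0// ltrXn2r// ltr_nat//.
pose G (l : nat) (w : RR) : RR := (W (ts l.+1) w - W (ts l) w) / Num.sqrt (ts l.+1 - ts l).
have iG : iid U01 G by exact: BM_increments_iid BM ts0 tslt.
pose X (i : nat + option (nat * nat)) : RR -> RR := G (leaf_source N i).
have iX : iid U01 X by exact: (indep_reindex (@leaf_source_inj N) iG).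
have W_grid k w : (k <= N)%N -> W (k%:R ^+ 3 / N%:R ^+ 3) w =
    \sum_(l < k) Num.sqrt (l.+1%:R ^+ 3 / N%:R ^+ 3 - l%:R ^+ 3 / N%:R ^+ 3) * X (inl (l : nat)) w.
  move=> kN; have [_ W0 _ _] := BM.
  transitivity (\sum_(l < k) (W (ts l.+1) w - W (ts l) w)).
    rewrite -(big_mkord xpredT (fun l => W (ts l.+1) w - W (ts l) w)) telescope_sumr// ts0 W0 subr0//.
  apply: eq_bigr => l _; rewrite /X /= (leq_trans (ltn_ord l) kN) /G mulrC divfK//.
  by rewrite gt_eqF// sqrtr_gt0 subr_gt0 tslt.
have osc s t w : 0 <= s <= 1 -> 0 <= t <= 1 -> `|s - t| <= 4 / N%:R -> (`|W s w - W t w|%:E <= Osc (m - 2)%N w)%E.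
  move=> s01 t01 st; apply: W_osc => //; apply: le_trans st _; rewrite /N natrX exprVn.
  rewrite -{1}(subnK m2) exprD ler_pdivrMr ?mulr_gt0 ?exprn_gt0// mulKf ?gt_eqF ?exprn_gt0//.
  by rewrite -[2 ^+ 2]natrX ler_nat.
have [F [F0 mF EF] path] := coupling_error iX theta0 J0 mu_ge total L2 cmu thL W_grid osc.
have mu0 : 0 < mu by rewrite -sqrtr_gt0; apply: lt_le_trans mu_ge; rewrite ltr0n.
have hN : (N <= 2 ^ (m + m))%N by rewrite leq_exp2l// leq_addr.
pose b := hits X (m + m) N J theta mu.
have cb j : cmeas (b^~ j) by exact: (cmeas_hits (m + m) iX theta0 mu0 J0 total j).
exists (fun w => (feller_run (b w) J).1), W.
have [mW _ cW _] := BM.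
have J1 : (2 <= J.+1)%N by [].
(* The run sees only the first [J] hits, a sequence of booleans: a countable type, as
   [measurable_sup_dev] requires. *)
have feller_runE w : (feller_run (b w) J).1 = (feller_run (nth false (mkseq (b w) J)) J).1.
  by congr (_.1); apply: feller_run_ext => j jJ; rewrite nth_mkseq.
have ms : measurable_fun [set: RR] (fun w => sup_dev theta J.+1 (feller_run (b w) J).1 (fun s => W s w)).
  under eq_fun do rewrite feller_runE.
  exact: (measurable_sup_dev theta J1 (fun s => (feller_run (nth false s) J).1) (cmeas_mkseq (f := fun j w => b w j) J cb) mW cW).
split => //.
  apply: (feller_run_ESF (b := fun j w => b w j)) => // v.
  exact: (hits_law iX theta0 mu0 hN J0 total v).
have L0 : 0 < L by exact: lt_le_trans L2.
pose sg := Num.sqrt (theta / 3 * L ^+ 3).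
have sg0 : 0 < sg by rewrite sqrtr_gt0 mulr_gt0 ?divr_gt0 ?exprn_gt0.
have [mOk Ok0] := mO (m - 2)%N.
have F0' w : (0 <= (F w / sg)%:E)%E by rewrite lee_fin divr_ge0// ltW.
have sup_le w : (sup_dev theta J.+1 (feller_run (b w) J).1 (fun s => W s w) <= (F w / sg)%:E + Osc (m - 2)%N w)%E.
  apply/ereal_supP => y [t /=]; rewrite in_itv /= => t01 <-.
  have H := path w t t01.
  have := lee_wpmul2l (_ : (0 <= (sg^-1)%:E)%E) H; rewrite lee_fin invr_ge0 => /(_ (ltW sg0)).
  rewrite -EFinM ge0_muleDr; last 2 first.
  - by rewrite lee_fin.
  - by apply: mule_ge0 => //; rewrite lee_fin ltW.
  rewrite muleA -!EFinM mulVf ?gt_eqF// mul1e [sg^-1 * F w]mulrC; apply: le_trans.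
  rewrite lee_fin -[X in X * _](ger0_norm (_ : 0 <= sg^-1)) ?invr_ge0 ?(ltW sg0)// -normrM mulrC mulrBl.
  by rewrite [sg * _ / sg]mulrAC divff ?gt_eqF// mul1r.
apply: (@le_trans _ _ (\int[U01]_w ((F w / sg)%:E + Osc (m - 2)%N w))%E).
  apply: integral_le => //.
  - move=> w; apply: le_ereal_sup_tmp; exists (`|Wn theta J.+1 (feller_run (b w) J).1 0 - W (0 ^+ 3) w|)%:E => //.
    by exists 0 => //=; rewrite in_itv /= lexx ler01.
  - by apply: emeasurable_funD => //; apply/measurable_EFinP; exact: measurable_funM.
rewrite ge0_integralD//; last by apply/measurable_EFinP; exact: measurable_funM.
rewrite EFinD; apply: leeD; last exact: EO.
under eq_integral do rewrite mulrC.
rewrite integral_EFinZ// ?invr_ge0 ?(ltW sg0)// mulrC EFinM.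
by apply: lee_wpmul2l; rewrite ?lee_fin ?invr_ge0 ?(ltW sg0).
Qed.

End assembly.

Section parameters.
Context {R : realType}.

Lemma ln_le_2sqrt (x : R) : 0 < x -> ln x <= 2 * Num.sqrt x.
Proof.
move=> x0; have s0 : 0 < Num.sqrt x by rewrite sqrtr_gt0.
have -> : ln x = 2 * ln (Num.sqrt x) by rewrite -[in LHS](sqr_sqrtr (ltW x0)) lnXn// mulr_natl.
rewrite ler_wpM2l//; by apply: le_trans (ln_upper_bound s0) _; rewrite gerBl.
Qed.

Lemma half_le_ln2 : 2^-1 <= ln 2 :> R.
Proof. by apply: le_trans (ln_lower_bound _); lra. Qed.

Lemma dyadic_exponent_le (a L : R) m : 0 < a -> 1 <= ln L -> 0 < L -> (2 ^ m)%:R <= a * L ->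
  m%:R <= (2 * a + 2) * ln L.
Proof.
move=> a0 h1 L0 mL.
have h : m%:R * ln 2 <= a + ln L :> R.
  rewrite mulr_natl -lnXn// -natrX; apply: (@le_trans _ _ (ln (a * L))).
    by rewrite ler_ln ?posrE ?mulr_gt0// ltr0n expn_gt0.
  rewrite lnM ?posrE// lerD2r; apply: le_trans (ln_upper_bound a0) _; by rewrite gerBl.
have h2 : m%:R * 2^-1 <= m%:R * ln 2 :> R by rewrite ler_wpM2l// half_le_ln2.
have h3 : a <= a * ln L by rewrite ler_peMr// ltW.
have -> : (2 * a + 2) * ln L = 2 * (a * ln L) + 2 * ln L by ring.
lra.
Qed.

(** The lower bound 16 D^2 ln L on mu is what turns the exponential into L^-4, which cancels the
    fourth power of 2^m <= a L. *)
Lemma fluctuation_size (D a kap L mu : R) m : 0 < D -> 0 < a -> 0 < L -> 1 <= ln L ->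
  16 * D ^+ 2 * ln L <= mu -> mu <= kap * ln L -> (2 ^ m)%:R <= a * L ->
  40 * mu + 23400 * m%:R + 5220 + 2 * (2 ^ m)%:R ^+ 4 * mu * expR (- (mu / (4 * D ^+ 2)))
    <= (40 * kap + 23400 * (2 * a + 2) + 5220 + 2 * a ^+ 4 * kap) * ln L.
Proof.
move=> D0 a0 L0 h1 Dmu muk mL; have mle := dyadic_exponent_le a0 h1 L0 mL.
have D2 : 0 < D ^+ 2 by exact: exprn_gt0.
have mu0 : 0 <= mu by apply: le_trans Dmu; apply: mulr_ge0; [rewrite mulr_ge0// ltW|exact: le_trans h1].
have e1 : expR (- (mu / (4 * D ^+ 2))) <= L ^- 4.
  have -> : L ^- 4 = expR (- (4 * ln L)) by rewrite expRN mulr_natl -lnXn// lnK// posrE exprn_gt0.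
  rewrite ler_expR lerN2 ler_pdivlMr ?mulr_gt0//; apply: le_trans Dmu.
  by rewrite le_eqVlt; apply/orP; left; apply/eqP; ring.
have e2 : 2 * (2 ^ m)%:R ^+ 4 * mu * expR (- (mu / (4 * D ^+ 2))) <= 2 * a ^+ 4 * (kap * ln L).
  have p : (2 ^ m)%:R ^+ 4 * expR (- (mu / (4 * D ^+ 2))) <= a ^+ 4.
    have -> : a ^+ 4 = (a * L) ^+ 4 * L ^- 4 by field; rewrite gt_eqF.
    apply: ler_pM => //.
    by rewrite lerXn2r// nnegrE// mulr_ge0// ltW.
  have -> : 2 * (2 ^ m)%:R ^+ 4 * mu * expR (- (mu / (4 * D ^+ 2)))
    = 2 * ((2 ^ m)%:R ^+ 4 * expR (- (mu / (4 * D ^+ 2))) * mu) by ring.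
  rewrite -[leRHS]mulrA ler_wpM2l//; apply: ler_pM => //; by rewrite mulr_ge0 ?exprn_ge0 ?expR_ge0.
have -> : (40 * kap + 23400 * (2 * a + 2) + 5220 + 2 * a ^+ 4 * kap) * ln L =
  40 * (kap * ln L) + 23400 * ((2 * a + 2) * ln L) + 5220 * ln L + 2 * a ^+ 4 * (kap * ln L) by ring.
lra.
Qed.

(** The oscillation of W at scale 1 / N has order sqrt (m / N). As N is at least of order L / ln L
    and m is O(ln L), this is ln L / sqrt L, the target rate itself. *)
Lemma oscillation_size (theta a kap L mu : R) m : 0 < theta -> 0 < a -> 0 < kap -> 0 < L -> 1 <= ln L -> (1 < m)%N ->
  0 < mu -> mu <= kap * ln L -> (2 ^ m)%:R <= a * L -> theta * L <= 2 * ((2 ^ m)%:R * mu) ->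
  288 * ((Num.sqrt 2)^-1 ^+ (m - 2) * Num.sqrt (m - 2).+1%:R)
    <= 576 * Num.sqrt (2 * kap * (2 * a + 2) / theta) * (ln L / Num.sqrt L).
Proof.
move=> th a0 k0 L0 h1 m2 mu0 muk mL thL; have mle := dyadic_exponent_le a0 h1 L0 mL.
have h0 : 0 < ln L by exact: lt_le_trans h1.
have N0 : 0 < (2 ^ m)%:R :> R by rewrite ltr0n expn_gt0.
have s20 : 0 < Num.sqrt 2 :> R by rewrite sqrtr_gt0.
have ss : Num.sqrt 2 * Num.sqrt 2 = 2 :> R by rewrite -expr2 sqr_sqrtr.
have E1 : (Num.sqrt 2)^-1 ^+ (m - 2) = 2 * Num.sqrt ((2 ^ m)%:R^-1) :> R.
  have -> : Num.sqrt ((2 ^ m)%:R^-1) = (Num.sqrt 2)^-1 ^+ m :> R.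
    by rewrite natrX sqrtrV ?exprn_ge0// -{1}(sqr_sqrtr (ler0n R 2)) -exprM mulnC exprM sqrtr_sqr ger0_norm ?exprn_ge0 ?sqrtr_ge0// exprVn.
  rewrite -{2}(subnK m2) exprD mulrCA expr2 -invfM ss divff ?mulr1//.
have E2 : Num.sqrt (m - 2).+1%:R <= Num.sqrt m%:R :> R.
  by rewrite ler_sqrt// ler_nat -subSn// subSS leq_subr.
rewrite E1.
apply: (@le_trans _ _ (576 * (Num.sqrt ((2 ^ m)%:R^-1) * Num.sqrt m%:R))).
  have := ler_wpM2l (sqrtr_ge0 ((2 ^ m)%:R^-1 : R)) E2.
  by rewrite -mulrA; move: (Num.sqrt ((2 ^ m)%:R^-1)) => s; move: (s * _) (s * _) => *; lra.
rewrite -mulrA; apply: ler_wpM2l; first exact: ler0n.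
rewrite -sqrtrM ?invr_ge0//.
have -> : ln L / Num.sqrt L = Num.sqrt (ln L ^+ 2 / L).
  by rewrite sqrtrM ?sqr_ge0// sqrtr_sqr ger0_norm ?(ltW h0)// sqrtrV// ltW.
have c0 : 0 <= 2 * kap * (2 * a + 2) / theta.
  by apply: divr_ge0; [rewrite mulr_ge0 ?addr_ge0 ?mulr_ge0// ltW|exact: ltW].
rewrite -sqrtrM// ler_sqrt; last first.
  by apply: mulr_ge0 => //; rewrite divr_ge0 ?sqr_ge0// ltW.
rewrite mulrC ler_pdivrMr//.
apply: le_trans mle _.
have p1 : theta * L <= 2 * ((2 ^ m)%:R * (kap * ln L)).
  by apply: le_trans thL _; rewrite ler_wpM2l// ler_wpM2l// ltW.
have -> : 2 * kap * (2 * a + 2) / theta * (ln L ^+ 2 / L) * (2 ^ m)%:R =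
  (2 * a + 2) * ln L * (2 * ((2 ^ m)%:R * (kap * ln L)) / (theta * L)).
  by field; rewrite !gt_eqF.
rewrite ler_peMr ?mulr_ge0 ?addr_ge0 ?mulr_ge0 ?(ltW h0) ?(ltW a0)//.
by rewrite ler_pdivlMr ?mulr_gt0// mul1r.
Qed.

End parameters.

Theorem theorem5p1 (R : realType) (theta : R) : 0 < theta ->
  exists K : R, exists N : nat, forall n : nat, (N <= n)%N ->
  exists (d : measure_display) (T : measurableType d) (P : probability T R)
         (C : T -> nat -> nat) (W : R -> T -> R),
    [/\ ESF_cycle_counts_law P theta n C,
        standard_BM P W,
        measurable_fun [set: T] (fun w : T => sup_dev theta n (C w) (fun s => W s w)) &
        (\int[P]_w sup_dev theta n (C w) (fun s => W s w)
           <= (K * (ln (ln n%:R) / Num.sqrt (ln n%:R)))%:E)%E].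
Proof.
(* A variable in place of the numeral keeps the powers of 2400 symbolic. *)
move=> theta0; have [D DE] : exists D : R, D = 2400 by exists 2400.
have D1 : 1 <= D by rewrite DE ler1n.
have D0 : 0 < D by exact: lt_le_trans D1.
pose c := 2 * theta + 2 * theta ^+ 2; have th0 := ltW theta0.
have t2 : 0 <= theta ^+ 2 by exact: sqr_ge0.
have c0 : 0 <= c by rewrite addr_ge0// mulr_ge0.
have thc : theta <= c by rewrite /c; move: theta0 t2; lra.
have th2c : 2 * theta ^+ 2 <= c by rewrite /c; move: theta0; lra.
(* The cell mean will be at least K0 ln L. The three bounds serve the cancellation in
   [fluctuation_size] and the conditions theta ln L <= mu and 2 c <= mu. *)
have [K0 [K0D K0t K0c]] : exists K0, [/\ 16 * D ^+ 2 <= K0, theta <= K0 & 2 * c <= K0].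
  have D2 : 0 <= 16 * D ^+ 2 by rewrite mulr_ge0// sqr_ge0.
  by exists (16 * D ^+ 2 + theta + 2 * c); split; move: D2 c0 th0; lra.
have D16 : D ^+ 2 <= 16 * D ^+ 2 by rewrite ler_peMl ?sqr_ge0// ler1n.
have K01 : 1 <= K0 by apply: le_trans K0D; apply: le_trans D16; exact: exprn_ege1.
have K00 : 0 < K0 by exact: lt_le_trans K01.
pose a := theta + c; have a0 : 0 < a by rewrite ltr_pwDl.
pose kap := 2 * K0; have kap0 : 0 < kap by rewrite mulr_gt0.
pose bb := 40 * kap + 23400 * (2 * a + 2) + 5220 + 2 * a ^+ 4 * kap.
(* With ln L <= 2 sqrt L, the condition sqrt L >= q yields 4 K0 ln L + c <= theta L. Then the total
   rate is at least 4 K0 ln L, which ensures m > 1. *)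
pose q := (8 * K0 + c) / theta; have q0 : 0 <= q by rewrite divr_ge0// addr_ge0// mulr_ge0// ltW.
exists (error_const theta c a kap bb / Num.sqrt (theta / 3)
  + 576 * Num.sqrt (2 * kap * (2 * a + 2) / theta)).
exists (Num.truncn (expR (q ^+ 2 + expR 1 + 2))).+1 => -[//|J] NJ.
set L := ln J.+1%:R.
have LA : q ^+ 2 + expR 1 + 2 <= L.
  rewrite -[leLHS]expRK ler_ln ?posrE ?expR_gt0 ?ltr0n//.
  have /andP[_ /ltW h] := truncn_itv (expR_ge0 (q ^+ 2 + expR 1 + 2)).
  by apply: le_trans h _; rewrite ler_nat.
have q2 : 0 <= q ^+ 2 by exact: sqr_ge0.
have e0 := expR_ge0 (1 : R).
have L2 : 2 <= L by apply: le_trans LA; rewrite lerDr addr_ge0.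
have L1 : 1 <= L by apply: le_trans L2; rewrite ler1n.
have L0 : 0 < L by exact: lt_le_trans L1.
have eL : expR 1 <= L by apply: le_trans LA; rewrite addrAC lerDr addr_ge0.
have qL : q ^+ 2 <= L by apply: le_trans LA; rewrite -addrA lerDl addr_ge0.
have h1 : 1 <= ln L by rewrite -[leLHS]expRK ler_ln ?posrE ?expR_gt0.
have h0 : 0 < ln L by exact: lt_le_trans h1.
have J0 : (0 < J)%N.
  by case: (J) @L L2 {LA L1 L0 h1 h0 NJ eL qL} => // L; rewrite /L ln1 lern0.
pose s := Num.sqrt L; have s1 : 1 <= s by rewrite -[leLHS]sqrtr1 ler_sqrt ?(ltW L0).
have ss : s ^+ 2 = L by rewrite sqr_sqrtr// ltW.
have qs : q <= s by rewrite -[leLHS]ger0_norm// -sqrtr_sqr ler_sqrt ?(ltW L0).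
have hs : ln L <= 2 * s by exact: ln_le_2sqrt.
have s0 : 0 <= s by exact: le_trans s1.
have thL : 4 * K0 * (2 * s) + c <= theta * L.
  have : theta * q * s <= theta * L.
    by rewrite -mulrA -ss expr2 ler_wpM2l// ler_wpM2r.
  rewrite /q mulrCA divff ?gt_eqF// mulr1; apply: le_trans.
  have -> : 4 * K0 * (2 * s) = 8 * K0 * s by ring.
  by rewrite [leRHS]mulrDl lerD2l ler_peMr.
have thLh : 4 * (K0 * ln L) + c <= theta * L.
  by apply: le_trans thL; rewrite lerD2r mulrA ler_wpM2l// mulr_ge0// ltW.
set Lam := cum_rate theta J.
have /andP[Lam1 Lam2] := cum_rate_bounds theta0 J; rewrite -/Lam -/L in Lam1 Lam2.
have KL : 4 * (K0 * ln L) <= Lam by apply: le_trans Lam1; rewrite lerBrDr; apply: le_trans thLh; rewrite lerD2l.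
have KL0 : 0 < K0 * ln L by exact: mulr_gt0.
have Lam0 : 0 < Lam by apply: lt_le_trans KL; rewrite mulr_gt0.
have LamL : Lam <= a * L.
  apply: le_trans Lam2 _; rewrite /a mulrDl lerD2l; apply: le_trans thc _; exact: ler_peMr.
have K0L : K0 * ln L <= Lam by apply: le_trans KL; rewrite ler_peMl ?(ltW KL0)// ler1n.
have thLam : theta * L <= 2 * Lam.
  rewrite mulrDl mul1r -lerBlDl; apply: le_trans K0L.
  apply: (@le_trans _ _ K0); last by rewrite ler_peMr// ltW.
  apply: (@le_trans _ _ c); last by apply: le_trans K0c; rewrite ler_peMl// ler1n.
  by rewrite lerBlDl -lerBlDr; apply: le_trans Lam1; rewrite lerD2l lerN2.
(* Rounding the number of cells down to a power of two keeps their mean between K0 ln L and twice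
   that. *)
have [m /andP[m1 m2]] : exists m, (2 ^ m)%:R <= Lam / (K0 * ln L) < 2 * (2 ^ m)%:R.
  apply: dyadic_floor; rewrite ler_pdivlMr// mul1r; apply: le_trans KL; rewrite ler_peMl// ?ltW//.
  by rewrite ltr1n.
have N0 : 0 < (2 ^ m)%:R :> R by rewrite ltr0n expn_gt0.
have m_gt1 : (1 < m)%N.
  have : 4 < 2 * (2 ^ m)%:R :> R by apply: le_lt_trans m2; rewrite ler_pdivlMr.
  by rewrite ltNge; case: m {m1 m2 N0} => [|[|m]]//; rewrite -natrM ler_nat.
pose mu := Lam / (2 ^ m)%:R.
have total : Lam = (2 ^ m)%:R * mu by rewrite /mu mulrC divfK// gt_eqF.
have mu1 : K0 * ln L <= mu.
  by move: m1; rewrite /mu !ler_pdivlMr// mulrC.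
have mu2 : mu <= kap * ln L.
  move: m2; rewrite /mu ltr_pdivrMr// => /ltW; rewrite ler_pdivrMr// => /le_trans; apply.
  by rewrite le_eqVlt; apply/orP; left; apply/eqP; rewrite /kap; ring.
have K0h : K0 <= K0 * ln L by rewrite ler_peMr// ltW.
have mu_ge1 : 1 <= mu by apply: le_trans mu1; exact: le_trans K0h.
have mu0 : 0 < mu by exact: lt_le_trans mu_ge1.
have mu_D : D <= Num.sqrt mu.
  rewrite -[leLHS]ger0_norm ?(ltW D0)// -sqrtr_sqr ler_sqrt ?(ltW mu0)//.
  by apply: le_trans D16 _; apply: le_trans K0D _; exact: le_trans mu1.
have cmu : 2 * c <= mu by apply: le_trans K0c _; exact: le_trans mu1.
have thmu : theta * ln L <= mu by apply: le_trans mu1; rewrite ler_wpM2r// ltW.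
have NL : (2 ^ m)%:R <= a * L.
  apply: le_trans m1 _; rewrite ler_pdivrMr//; apply: le_trans LamL _.
  rewrite ler_peMr ?mulr_ge0 ?(ltW a0) ?(ltW L0)//; exact: le_trans K0h.
have mu_2400 : 2400 <= Num.sqrt mu by rewrite -DE.
have [C [W [law BM ms EE]]] := coupled_space theta0 J0 m_gt1 mu_2400 total L2 cmu thmu.
exists _, (measurableTypeR R), U01, C, W; split => //.
apply: le_trans EE _; rewrite lee_fin -/L [leRHS]mulrDl; apply: lerD; last first.
  apply: (oscillation_size theta0 a0 kap0 L0 h1 m_gt1 mu0 mu2 NL).
  by rewrite -total.
have Dmu : 16 * D ^+ 2 * ln L <= mu.
  by apply: le_trans mu1; rewrite ler_wpM2r// ltW.
have B1 := fluctuation_size D0 a0 L0 h1 Dmu mu2 NL; rewrite -/bb DE in B1.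
set B := _ + _ * expR _ in B1; rewrite -/B.
have B0 : 0 <= B.
  rewrite /B; apply: addr_ge0; last first.
    apply: mulr_ge0; last exact: expR_ge0.
    apply: mulr_ge0; last exact: ltW.
    by apply: mulr_ge0; [exact: ler0n|apply: exprn_ge0; exact: ler0n].
  apply: addr_ge0; last exact: ler0n.
  by apply: addr_ge0; apply: mulr_ge0; rewrite ?ler0n ?(ltW mu0).
have ES := error_size theta0 c0 (ltW a0) L1 h1 mu_ge1 mu2 (ltW Lam0) LamL B0 B1 (esym total).
rewrite total in ES.
have sg : Num.sqrt (theta / 3 * L ^+ 3) = Num.sqrt (theta / 3) * (L * s).
  rewrite sqrtrM ?divr_ge0//; congr (_ * _).
  by rewrite exprSr sqrtrM ?sqr_ge0// sqrtr_sqr ger0_norm// ltW.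
have t3 : 0 < Num.sqrt (theta / 3) by rewrite sqrtr_gt0 divr_gt0.
have sgt0 : 0 < s by exact: lt_le_trans s1.
rewrite sg ler_pdivrMr ?mulr_gt0//; apply: le_trans ES _.
rewrite le_eqVlt; apply/orP; left; apply/eqP; rewrite -/s.
by field; rewrite !gt_eqF.
Qed.
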